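(* Let $\ell\geq 5$ be prime and fix $\delta\in\{0,-1\}$. Let $S$ be the set of primes $Q\geq 5$, $Q\neq \ell$, for which there exists an integer $\beta$ with $\left(\frac{1-24\beta}{\ell}\right)=\delta$ such that $$p(\ell Q n+\beta)\equiv 0 \pmod{\ell}\quad\text{for all integers } n.$$ Then at least one of the following holds: (1) $S$ has density zero (i.e. $\#\{Q\in S: Q\leq X\}/\#\{Q\text{ prime}: Q\leq X\}\to 0$ as $X\to\infty$); (2) $\#\left\{ n\leq X \,:\, \left(\frac{-n}{\ell}\right)=\delta,\ p\left(\frac{n+1}{24}\right)\not\equiv 0 \pmod{\ell}\right\} \ll \sqrt{X}\log X$.
   Context: $p(n)$ denotes the partition function, with the conventions $p(0)=1$ and $p(x)=0$ whenever $x$ is not a nonnegative integer. $\left(\frac{\cdot}{\ell}\right)$ is the Legendre symbol. The implied constant in $\ll$ may depend on $\ell$ and $\delta$. *)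

(* Defs.v *)
From mathcomp Require Import all_boot all_algebra.
From Stdlib Require Import Reals ClassicalEpsilon.
Set Implicit Arguments. Unset Strict Implicit. Unset Printing Implicit Defensive.
Import GRing.Theory Num.Theory.
(* Stdlib Reals grabs the keys %ring and %Z; give MathComp's scopes fresh keys. *)
Delimit Scope ring_scope with ring.
Delimit Scope int_scope with int.

Fixpoint all_seqs (m : nat) (vals : seq nat) : seq (seq nat) :=
  match m with
  | 0 => [:: [::]]
  | m'.+1 => [::] :: [seq x :: s | x <- vals, s <- all_seqs m' vals]
  end.

Definition is_partition (n : nat) (s : seq nat) : bool :=
  [&& sorted geq s, all (fun x => 0 < x) s & sumn s == n].

(* p(n): the number of partitions of n (every partition of n has length <= n
   and parts in 1..n, so it occurs exactly once in all_seqs n (iota 1 n)). *)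
Definition partition_fn (n : nat) : nat :=
  count (is_partition n) (all_seqs n (iota 1 n)).

Definition pZ (x : int) : nat :=
  match x with Posz n => partition_fn n | Negz _ => 0 end.

Definition p_div24 (n : nat) : nat :=
  if 24 %| n.+1 then partition_fn (n.+1 %/ 24) else 0.

Definition legendre (a : int) (l : nat) : int :=
  if (Posz l %| a)%int then 0%ring
  else if [exists x : 'I_l, (Posz l %| (Posz x * Posz x - a)%ring)%int] then 1%ring else (-1)%ring.

Definition in_S (l : nat) (delta : int) (Q : nat) : Prop :=
  [/\ prime Q, 5 <= Q, Q <> l &
   exists beta : int, legendre (1 - 24 * beta)%ring l = delta /\
     forall n : int, l %| pZ (Posz l * (Posz Q) * n + beta)%ring].

Definition decP (P : Prop) : bool :=
  if excluded_middle_informative P then true else false.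

Definition count_S (l : nat) (delta : int) (X : nat) : nat :=
  count (fun Q => decP (in_S l delta Q)) (iota 0 X.+1).

Definition prime_pi (X : nat) : nat := count prime (iota 0 X.+1).

Definition count_np (l : nat) (delta : int) (X : nat) : nat :=
  count (fun n => (legendre (- (Posz n))%ring l == delta) && ~~ (l %| p_div24 n))
        (iota 1 X).

(* Main.v *)
(** Let [a(n) = p((n+1)/24)] if [(-n/l) = delta] and [a(n) = 0] otherwise, modulo [l].

    In [F_l[[X]]] the generating series of [p((n+1)/24)] is [1/eta].  Up to theta operators,
    [sum a(n) X^n] is a projection of [1/eta], and Ramanujan-type derivative formulas, made
    polynomial modulo [l] by the Legendre polynomial congruence [sum_i C(N,i)^2 th2^4i th3^4(N-i) = 1]
    with [N = (l-1)/2], rewrite it as [eta^11] times a polynomial in [th2^4] and [th4^4].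
    Hence [a(n)] counts, with a weight periodic modulo [12], the vectors of norm [n] of a
    positive definite integral lattice of odd rank.

    Summing over the [m]-neighbours of that lattice, whose Gram matrices range over finitely many
    classes because their determinant is fixed, relates [a(m^2 n)], [(n/m) a(n)] and finitely many theta
    series independent of [m].  So there is a map [tau] with finite range such that [tau n1 = tau n2],
    [a(n1) <> 0] and [a(m^2 n1) = a(m^2 n2)] force [(n1/m) = (n2/m)], for primes [m] not dividing
    [l n1 n2].

    If the support of [a] meets finitely many square classes, (2) holds.  Otherwise it contains
    arbitrarily many [n_1, ..., n_R] that are independent modulo squares and [l], with equal [tau]
    and equal residue modulo [l].  If [a] vanishes on a residue class [t] modulo [l Q], then a prime
    [m] given by Dirichlet's theorem moves [m^2 n_i] into that class while [(n_i/m) <> (n_j/m)],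
    contradicting the previous paragraph unless nearly all of the [(n_i/Q)] coincide.  For all but
    finitely many [Q] in [S] the sum of the [(n_i/Q)] is thus of size about [R], whereas
    its second moment over the primes [Q <= X] is [O(R pi(X))] by Selberg's sieve; since [R] is arbitrary,
    [S] has density zero. *)

From HB Require structures.
From mathcomp Require all_boot all_order all_algebra all_fingroup all_solvable all_field.
From mathcomp Require boolp classical_sets functions cardinality fsbigop finmap.
From mathcomp Require reals exp Rstruct.
From mathcomp Require zify ring lra.
Require Defs.
From Stdlib Require Reals Lra.

Set Implicit Arguments. Unset Strict Implicit. Unset Printing Implicit Defensive.

(** * Formal power series: ring structure, Euler derivative, substitution of X^2 for X *)

Module FormalSeries.
Import structures.
Import all_boot all_order all_algebra.
Import boolp classical_sets functions cardinality fsbigop.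
Import zify ring lra.
Import Order.TTheory GRing.Theory Num.Theory.
Local Open Scope ring_scope.

(** The two values of [delta] are those that avoid the pole. The leading term of 1/eta is X^(-1), of
    index -1 and symbol (1/l) = 1, so it survives only in the projection for the symbol 1. For 0 and
    -1 the projected series vanishes at the three cusps, where th2, th3 or th4 is zero, and can be
    divided by (th2 th3 th4)^4 = 16 eta^12.

    Odd rank makes the symbol (n/m) appear: a vector of norm n has an orthogonal complement of even
    rank whose discriminant involves n, and the number of isotropic lines in it modulo m depends on
    the quadratic character of that discriminant.

    The lattice depends on l only and its neighbours share its determinant, so the number of values
    of [tau] is independent of m and Q. This uniformity lets one fixed family n_1, ..., n_R serve
    every Q in S.

    Dirichlet's theorem is proved over the reals: the values L(1, chi) are replaced by one linear
    operator on mean-zero functions of the units, and its injectivity is reduced to the case of a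
    real character. *)

Definition series (F : comNzRingType) : Type := nat -> F.

Section SeriesRing.
Variable F : comNzRingType.
Local Notation S := (series F).
Implicit Types f g h : S.

HB.instance Definition _ := gen_eqMixin (series F).
HB.instance Definition _ := gen_choiceMixin (series F).

Definition s0 : S := fun=> 0.
Definition s1 : S := fun n => (n == 0)%:R.
Definition sadd f g : S := fun n => f n + g n.
Definition sopp f : S := fun n => - f n.
Definition smul f g : S := fun n => \sum_(i < n.+1) f i * g (n - i)%N.
Definition trunc n f : {poly F} := \poly_(i < n.+1) f i.

(** Reading coefficients off truncated polynomials lets the ring axioms be inherited from
    [{poly F}]. *)
Lemma smulE f g n k : (k <= n)%N -> smul f g k = (trunc n f * trunc n g)`_k.
Proof.
move=> kn; rewrite coefM; apply: eq_bigr => i _; rewrite !coef_poly.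
have := ltn_ord i; rewrite ltnS => ik.
by rewrite !ltnS (leq_trans ik kn) (leq_trans (leq_subr _ _) kn).
Qed.

Lemma coef_trunc n f k : (k <= n)%N -> (trunc n f)`_k = f k.
Proof. by move=> kn; rewrite coef_poly ltnS kn. Qed.

Lemma coefM_eq (p p' q q' : {poly F}) n :
  (forall k, (k <= n)%N -> p`_k = p'`_k) -> (forall k, (k <= n)%N -> q`_k = q'`_k) ->
  (p * q)`_n = (p' * q')`_n.
Proof.
move=> e e'; rewrite !coefM; apply: eq_bigr => i _.
by rewrite e ?e' ?leq_subr // -ltnS ltn_ord.
Qed.

Lemma saddA : associative sadd.
Proof. by move=> f g h; apply/funext => n; rewrite /sadd addrA. Qed.
Lemma saddC : commutative sadd.
Proof. by move=> f g; apply/funext => n; rewrite /sadd addrC. Qed.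
Lemma sadd0 : left_id s0 sadd.
Proof. by move=> f; apply/funext => n; rewrite /sadd add0r. Qed.
Lemma saddN : left_inverse s0 sopp sadd.
Proof. by move=> f; apply/funext => n; rewrite /sadd /sopp addNr. Qed.
Lemma smulA : associative smul.
Proof.
move=> f g h; apply/funext => n; rewrite !(smulE _ _ (leqnn n)).
rewrite (@coefM_eq _ (trunc n f) _ (trunc n g * trunc n h)) //.
  rewrite mulrA; apply/esym/coefM_eq => // k kn.
  by rewrite coef_trunc // (smulE _ _ kn).
by move=> k kn; rewrite coef_trunc // (smulE _ _ kn).
Qed.
Lemma smulC : commutative smul.
Proof. by move=> f g; apply/funext => n; rewrite !(smulE _ _ (leqnn n)) mulrC. Qed.
Lemma smul1 : left_id s1 smul.
Proof.
move=> f; apply/funext => n; rewrite /smul big_ord_recl /= /s1 eqxx mul1r subn0.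
by rewrite big1 ?addr0 // => i _; rewrite /= mul0r.
Qed.
Lemma smulDl : left_distributive smul sadd.
Proof.
move=> f g h; apply/funext => n; rewrite /smul /sadd -big_split /=.
by apply: eq_bigr => i _; rewrite mulrDl.
Qed.
Lemma s1_neq0 : s1 != s0.
Proof.
by apply/eqP => /(congr1 (fun f : S => f 0%N)); rewrite /s1 /s0 /= => /eqP; rewrite oner_eq0.
Qed.

HB.instance Definition _ := GRing.isZmodule.Build (series F) saddA saddC sadd0 saddN.
HB.instance Definition _ := GRing.Zmodule_isComNzRing.Build (series F)
  smulA smulC smul1 smulDl s1_neq0.

Lemma addsE f g n : (f + g) n = f n + g n. Proof. by []. Qed.
Lemma mulsE f g n : (f * g) n = \sum_(i < n.+1) f i * g (n - i)%N. Proof. by []. Qed.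
Lemma subsE f g n : (f - g) n = f n - g n. Proof. by []. Qed.
Lemma zeroE n : (0 : S) n = 0. Proof. by []. Qed.
Lemma oneE n : (1 : S) n = (n == 0)%:R. Proof. by []. Qed.
Lemma sumsE (I : Type) (r : seq I) (P : pred I) (H : I -> S) n :
  (\sum_(i <- r | P i) H i) n = \sum_(i <- r | P i) H i n.
Proof. by elim/big_rec2: _ => // i y1 y2 _ <-; rewrite addsE. Qed.
Lemma natsE k n : (k%:R : S) n = if n == 0%N then k%:R else 0.
Proof.
elim: k => [|k IH]; first by case: eqP.
by rewrite -natr1 addsE IH oneE; case: eqP => _; rewrite ?natr1 ?addr0.
Qed.

Definition sC (c : F) : S := fun n => if n == 0%N then c else 0.
Lemma sCE c f n : (sC c * f) n = c * f n.
Proof.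
rewrite mulsE big_ord_recl /= /sC eqxx subn0 big1 ?addr0 // => i _.
by rewrite /= mul0r.
Qed.
Lemma sC_is_additive : zmod_morphism sC.
Proof. by move=> x y; apply/funext => n; rewrite subsE /sC; case: eqP; rewrite ?subr0. Qed.
Lemma sC_is_multiplicative : monoid_morphism sC.
Proof.
split; first by apply/funext => n; rewrite oneE /sC; case: eqP.
move=> x y; apply/funext => n; rewrite sCE /sC; case: eqP; by rewrite ?mulr0.
Qed.
HB.instance Definition _ := GRing.isZmodMorphism.Build F (series F) sC sC_is_additive.
HB.instance Definition _ := GRing.isMonoidMorphism.Build F (series F) sC sC_is_multiplicative.

(** The Euler derivative X d/dX. *)
Definition vt f : S := fun n => n%:R * f n.
Lemma vtE f n : vt f n = n%:R * f n. Proof. by []. Qed.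
Lemma vt_is_additive : zmod_morphism vt.
Proof. by move=> x y; apply/funext => n; rewrite subsE !vtE subsE mulrBr. Qed.
HB.instance Definition _ := GRing.isZmodMorphism.Build (series F) (series F) vt vt_is_additive.
Lemma vtM f g : vt (f * g) = vt f * g + f * vt g.
Proof.
apply/funext => n; rewrite addsE vtE !mulsE mulr_sumr -big_split /=.
apply: eq_bigr => i _; rewrite !vtE.
have {1}-> : n = (i + (n - i))%N by rewrite subnKC // -ltnS ltn_ord.
rewrite natrD; ring.
Qed.
Lemma vt1 : vt 1 = 0.
Proof. by apply/funext => n; rewrite vtE oneE; case: n => [|n]; rewrite ?mul0r ?mulr0. Qed.
Lemma vt_nat k : vt k%:R = 0.
Proof. by rewrite raddfMn /= vt1 mul0rn. Qed.
Lemma vtZ c f : vt (sC c * f) = sC c * vt f.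
Proof. by apply/funext => n; rewrite !(vtE, sCE); ring. Qed.
Lemma vtX f k : vt (f ^+ k) = k%:R * f ^+ k.-1 * vt f.
Proof.
elim: k => [|k IH]; first by rewrite expr0 vt1 !mul0r.
rewrite exprS vtM IH; case: k {IH} => [|k] /=; first by rewrite !expr0; ring.
by rewrite exprS -[k.+2%:R]natr1; ring.
Qed.

(** The substitution of X^2 for X; on theta and eta series it replaces tau by 2 tau. *)
Definition sV f : S := fun n => if odd n then 0 else f n./2.
Lemma sVE f n : sV f n = if odd n then 0 else f n./2. Proof. by []. Qed.
Lemma sV_is_additive : zmod_morphism sV.
Proof. by move=> x y; apply/funext => n; rewrite subsE !sVE; case: odd; rewrite ?subrr. Qed.
Lemma big_even_double (G : nat -> F) k : (forall i, odd i -> G i = 0) ->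
  \sum_(0 <= i < k.*2.+1) G i = \sum_(0 <= i < k.+1) G i.*2.
Proof.
move=> G0; elim: k => [|k IH]; first by rewrite !big_nat1.
rewrite doubleS big_nat_recr //= big_nat_recr //= IH G0 /= ?odd_double // addr0.
by rewrite [RHS]big_nat_recr //= doubleS.
Qed.
Lemma sV_is_multiplicative : monoid_morphism sV.
Proof.
split; first by apply/funext => -[|[|n]]; rewrite sVE !oneE //=; case: odd.
move=> f g; apply/funext => n; rewrite sVE [RHS]mulsE.
case: ifP => on.
  rewrite big1 // => i _; rewrite !sVE.
  case oi: (odd i); first by rewrite mul0r.
  case oj: (odd (n - i)); first by rewrite mulr0.
  by have := ltn_ord i; lia.
have -> : n = (n./2).*2 by lia.
move: (n./2) => k; rewrite doubleK mulsE.
rewrite -(big_mkord xpredT (fun i => f i * g (k - i)%N)).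
rewrite -(big_mkord xpredT (fun i => sV f i * sV g (k.*2 - i)%N)).
rewrite big_even_double; last by move=> i oi; rewrite sVE oi mul0r.
apply: eq_bigr => i _; rewrite !sVE -doubleB !odd_double !doubleK //.
Qed.
HB.instance Definition _ := GRing.isZmodMorphism.Build (series F) (series F) sV sV_is_additive.
HB.instance Definition _ := GRing.isMonoidMorphism.Build (series F) (series F) sV sV_is_multiplicative.
Lemma vtV f : vt (sV f) = 2%:R * sV (vt f).
Proof.
rewrite mulr_natl mulr2n; apply/funext => n; rewrite addsE !(sVE, vtE).
case: ifP => on; first by rewrite mulr0 addr0.
by have {1}-> : n = (n./2 + n./2)%N by [lia]; rewrite natrD; ring.
Qed.
End SeriesRing.
End FormalSeries.

(** * Orders of vanishing, and generating series of weighted counts *)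

Module WeightedSeries.
Import structures.
Import all_boot all_order all_algebra.
Import boolp classical_sets functions cardinality fsbigop.
Import finmap.
Import zify ring lra.
Import FormalSeries.
Import Order.TTheory GRing.Theory Num.Theory.
Local Open Scope classical_set_scope.
Local Open Scope ring_scope.

Section Order.
Variable F : fieldType.
Implicit Types f g : series F.

Definition ord_ge f k := forall i, (i < k)%N -> f i = 0.

Lemma ord_geM f g k m : ord_ge f k -> ord_ge g m -> ord_ge (f * g) (k + m).
Proof.
move=> fk gm n nkm; rewrite mulsE big1 // => i _.
have := ltn_ord i => ?; case: (ltnP i k) => ik; first by rewrite fk // mul0r.
by rewrite gm ?mulr0 //; lia.
Qed.

Lemma coefM_ord f g k m : ord_ge f k -> ord_ge g m -> (f * g) (k + m)%N = f k * g m.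
Proof.
move=> fk gm; rewrite mulsE.
have kP : (k < (k + m).+1)%N by lia.
rewrite (bigD1 (Ordinal kP)) //= big1 ?addr0; first by congr (_ * g _); lia.
move=> i /eqP nik; have := ltn_ord i => ?.
have {}nik : nat_of_ord i <> k by move=> e; apply: nik; apply: val_inj.
case: (ltnP i k) => ik; first by rewrite fk // mul0r.
by rewrite gm ?mulr0 //; lia.
Qed.

(** Induction on n: once g vanishes below n, coefficient k + n of the product is f k * g n. *)
Lemma mul_ser_eq0 f g k : ord_ge f k -> f k != 0 -> f * g = 0 -> g = 0.
Proof.
move=> fk fk0 fg; apply/funext => n; elim/ltn_ind: n => n IH.
have := coefM_ord fk (m := n) IH; rewrite fg zeroE => /esym/eqP.
by rewrite mulf_eq0 (negPf fk0) /= => /eqP.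
Qed.

Lemma mul_ser_inj f g h k : ord_ge f k -> f k != 0 -> f * g = f * h -> g = h.
Proof.
move=> fk fk0 /eqP; rewrite -subr_eq0 -mulrBr => /eqP /(mul_ser_eq0 fk fk0) /eqP.
by rewrite subr_eq0 => /eqP.
Qed.

(** Coefficient n is 0 for odd n and equals coefficient n/2 for even n; the descent ends at 0. This
    is how a series is recognised as a constant without any theory of modular forms. *)
Lemma sV_const f : sV f = f -> f = sC (f 0%N).
Proof.
move=> Vf; apply/funext => n; elim/ltn_ind: n => n IH.
rewrite /sC; case: eqP => [->//|n0]; rewrite -Vf sVE; case: ifP => // on.
by rewrite IH /sC ?ifF //; lia.
Qed.
End Order.

Section WeightedSeries.
Variable F : comNzRingType.

(** Finite fibres make the coefficients of [ws] genuine sums: [\sum_(t \in A)] is 0 by convention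
    when infinitely many terms are nonzero. *)
Definition finfib (T : choiceType) (q : T -> nat) := forall n, finite_set [set t | q t = n].
Definition ws (T : choiceType) (q : T -> nat) (psi : T -> F) : series F :=
  fun n => \sum_(t \in [set t | q t = n]) psi t.

Lemma finfib_le (T : choiceType) (q : T -> nat) n : finfib q -> finite_set [set t | (q t <= n)%N].
Proof.
move=> fq; have -> : [set t | (q t <= n)%N] = \bigcup_(k in `I_n.+1) [set t | q t = k].
  apply/seteqP; split => [t /= h|t [k /= kn qk]] /=; last by rewrite qk -ltnS.
  by exists (q t) => //=; rewrite ltnS.
exact: bigcup_finite.
Qed.

Lemma mem_finfib_le (T : choiceType) (q : T -> nat) n t : finfib q ->
  (t \in fset_set [set t | (q t <= n)%N]) = (q t <= n)%N.
Proof.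
move=> fq; rewrite in_fset_set; last exact: finfib_le.
by apply/idP/idP => [/set_mem|/mem_set].
Qed.

Lemma wsE (T : choiceType) (q : T -> nat) psi n k : finfib q -> (k <= n)%N ->
  ws q psi k = \sum_(t <- fset_set [set t | (q t <= n)%N] | q t == k) psi t.
Proof.
move=> fq kn; rewrite bigfs //.
  by apply: eq_fsbigl; apply/seteqP; split => t /= /eqP.
by move=> t /eqP qt; rewrite mem_finfib_le // qt kn.
Qed.

Lemma finfib_pair (T T' : choiceType) (q : T -> nat) (q' : T' -> nat) :
  finfib q -> finfib q' -> finfib (fun p : T * T' => (q p.1 + q' p.2)%N).
Proof.
move=> fq fq' n; apply: (@sub_finite_set _ _ ([set t | (q t <= n)%N] `*` [set t | (q' t <= n)%N])).
  by move=> [t t'] /= <-; split; rewrite /= ?leq_addr ?leq_addl.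
by apply: finite_setX; exact: finfib_le.
Qed.

Lemma ws_mul (T T' : choiceType) (q : T -> nat) (q' : T' -> nat) psi psi' :
  finfib q -> finfib q' ->
  ws q psi * ws q' psi' = ws (fun p : T * T' => (q p.1 + q' p.2)%N) (fun p => psi p.1 * psi' p.2).
Proof.
move=> fq fq'; apply/funext => n; rewrite mulsE.
pose A := fset_set [set t | (q t <= n)%N]; pose A' := fset_set [set t | (q' t <= n)%N].
transitivity (\sum_(t <- A) \sum_(t' <- A' | (q t + q' t')%N == n) psi t * psi' t').
  transitivity (\sum_(i < n.+1) \sum_(t <- A | q t == i) \sum_(t' <- A' | (q t + q' t')%N == n) psi t * psi' t').
    apply: eq_bigr => i _; rewrite (wsE _ fq (n := n)); last by rewrite -ltnS.
    rewrite (wsE _ fq' (n := n)) ?leq_subr // big_distrl /=; apply: eq_bigr => t /eqP qt.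
    rewrite big_distrr /=; apply: eq_bigl => t'; rewrite qt.
    by have := ltn_ord i => ?; apply/eqP/eqP; lia.
  rewrite (exchange_big_dep xpredT) //= big_seq [RHS]big_seq; apply: eq_bigr => t.
  rewrite mem_finfib_le // => qt; have qtP : (q t < n.+1)%N by [].
  rewrite (big_pred1 (Ordinal qtP)) //= => i; rewrite /= -val_eqE /=; apply/eqP/eqP => ->//.
rewrite /ws -[RHS](@eq_fsbigl _ _ _ _ _ [set` [pred p : T * T' | (q p.1 + q' p.2)%N == n]]); last first.
  by apply/seteqP; split => p /= /eqP.
rewrite -(@bigfs _ _ _ _ [seq (t, t') | t <- A, t' <- A']).
- by rewrite [RHS]big_mkcond [RHS]big_allpairs; apply: eq_bigr => t _; rewrite -big_mkcond.
- by rewrite allpairs_uniq ?fset_uniq //= => -[? ?] [? ?] _ _ [-> ->].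
- move=> [t t'] /= /eqP qn; rewrite allpairs_f //=.
  by rewrite mem_finfib_le // -qn leq_addr.
  by rewrite mem_finfib_le // -qn leq_addl.
Qed.

(** Only the support of [psi'] has to be reached by [h]; this admits changes of variables such as (u
    + v, u - v), whose image is the pairs of equal parity. *)
Lemma ws_reindex (T T' : choiceType) (h : T -> T') (q : T -> nat) (q' : T' -> nat) psi psi' :
  injective h -> (forall t, q' (h t) = q t) -> (forall t, psi' (h t) = psi t) ->
  (forall t', psi' t' != 0 -> exists t, h t = t') -> ws q' psi' = ws q psi.
Proof.
move=> hI hq hpsi hS; apply/funext => n; rewrite /ws.
rewrite -(@fsbig_widen _ _ _ _ (h @` [set t | q t = n])).
- rewrite fsbig_image; last by move=> x y _ _; apply: hI.
  by apply: eq_fsbigr => t _; rewrite hpsi.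
- by move=> _ [t /= <- <-]; rewrite /= hq.
- move=> t' [/= qt nt] /=; apply/eqP/negP => /negP /hS [t ht]; apply: nt.
  by exists t => //=; rewrite -hq ht.
Qed.

Lemma sV_ws (T : choiceType) (q : T -> nat) psi : sV (ws q psi) = ws (fun t => (q t).*2) psi.
Proof.
apply/funext => n; rewrite sVE /ws; case: ifP => on.
  by rewrite fsbig1 // => t /= qt; move: on; rewrite -qt odd_double.
by apply: eq_fsbigl; apply/seteqP; split => t /= qt; lia.
Qed.

Lemma wsD (T : choiceType) (q : T -> nat) psi psi' : finfib q ->
  ws q psi + ws q psi' = ws q (fun t => psi t + psi' t).
Proof. by move=> fq; apply/funext => n; rewrite addsE /ws fsbig_split. Qed.

Lemma wsZ (T : choiceType) (q : T -> nat) c psi : finfib q ->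
  sC c * ws q psi = ws q (fun t => c * psi t).
Proof. by move=> fq; apply/funext => n; rewrite sCE /ws fsbig_distrr. Qed.

Lemma eq_ws (T : choiceType) (q : T -> nat) psi psi' : psi =1 psi' -> ws q psi = ws q psi'.
Proof. by move=> /funext ->. Qed.

End WeightedSeries.
End WeightedSeries.

(** * Jacobi theta series, their duplication formulas and a Wronskian *)

Module ThetaFunctions.
Import structures.
Import all_boot all_order all_algebra.
Import boolp classical_sets functions cardinality fsbigop.
Import finmap.
Import zify ring lra.
Import FormalSeries WeightedSeries.
Import Order.TTheory GRing.Theory Num.Theory.
Local Open Scope classical_set_scope.
Local Open Scope ring_scope.

Lemma sqr_absz (x : int) : ((`|x| ^ 2)%N : int) = x ^+ 2.
Proof. by rewrite -abszX gez0_abs // sqr_ge0. Qed.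

Lemma finite_absz_le n : finite_set [set x : int | (`|x| <= n)%N].
Proof.
apply: (@sub_finite_set _ _ ((fun k : nat => k%:Z - n%:Z) @` `I_(n.*2.+1))); last first.
  exact/finite_image/finite_II.
move=> x /= xn; exists (absz (x + n%:Z)); [by rewrite /=; lia|lia].
Qed.

Definition tq (k : nat) (x : int) : nat := (k * `|x| ^ 2)%N.

Arguments tq : simpl never.

Lemma tqE k x : (tq k x : int) = k%:Z * x ^+ 2.
Proof. by rewrite /tq (PoszM k) sqr_absz. Qed.

Lemma finfib_tq k : (0 < k)%N -> finfib (tq k).
Proof.
move=> k0 n; apply: sub_finite_set (finite_absz_le n) => x /= <-.
rewrite /tq; nia.
Qed.

Ltac wcase := repeat (case: ifP => /eqP ?).

Section Theta.
Variable F : fieldType.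

(** With nome q = X^12, [th2], [th3], [th4] are Jacobi's theta constants: 3 x^2 = 12 (x/2)^2, so odd
    x gives half-integral squares, even x = 2n gives n^2, and [w4] adds the sign (-1)^n. The factor
    3 puts them on the scale of eta, where X^24 = q^2. *)
Definition w2 (x : int) : F := if (x %% 2)%Z == 1 then 1 else 0.
Definition w3 (x : int) : F := if (x %% 2)%Z == 0 then 1 else 0.
Definition w4 (x : int) : F := if (x %% 4)%Z == 0 then 1 else if (x %% 4)%Z == 2 then -1 else 0.
Definition th2 : series F := ws (tq 3) w2.
Definition th3 : series F := ws (tq 3) w3.
Definition th4 : series F := ws (tq 3) w4.

Definition pq (p : int * int) : nat := ((tq 3 p.1).*2 + (tq 3 p.2).*2)%N.

Lemma finfib_tq2 : finfib (fun x => (tq 3 x).*2).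
Proof.
move=> n; apply: sub_finite_set (finite_absz_le n) => x /= <-.
rewrite /tq; nia.
Qed.

Lemma finfib_pq : finfib pq.
Proof. exact: (finfib_pair finfib_tq2 finfib_tq2). Qed.

Lemma mulVV (phi psi : int -> F) :
  sV (ws (tq 3) phi) * sV (ws (tq 3) psi) = ws pq (fun p => phi p.1 * psi p.2).
Proof. by rewrite !sV_ws ws_mul //; exact: finfib_tq2. Qed.

(** The change of variables x = u + v, y = u - v turns x^2 + y^2 into 2 (u^2 + v^2) and reaches
    exactly the pairs of equal parity. *)
Lemma mul_parity (phi psi : int -> F) :
  (forall x y, phi x * psi y != 0 -> (x %% 2)%Z = (y %% 2)%Z) ->
  ws (tq 3) phi * ws (tq 3) psi = ws pq (fun p => phi (p.1 + p.2) * psi (p.1 - p.2)).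
Proof.
move=> par; rewrite ws_mul; try exact: finfib_tq.
apply: (@ws_reindex _ _ _ (fun p : int * int => (p.1 + p.2, p.1 - p.2))).
- by move=> [x y] [x' y'] /= [? ?]; congr (_, _); lia.
- move=> [u v]; rewrite /pq /=; apply/eqP; rewrite -eqz_nat; apply/eqP.
  by rewrite -!addnn !PoszD !sqr_absz; ring.
- by move=> [u v].
- move=> [x y] /= /par xy; exists ((x + y) %/ 2, (x - y) %/ 2)%Z => /=.
  by congr (_, _); lia.
Qed.

Lemma th3_sq : th3 ^+ 2 = sV th3 ^+ 2 + sV th2 ^+ 2.
Proof.
rewrite !expr2 !mulVV wsD; last exact: finfib_pq.
rewrite mul_parity; last by move=> x y; rewrite /w3; wcase; rewrite ?mulr0 ?mul0r ?eqxx // => _; lia.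
apply: eq_ws => -[u v] /=; rewrite /w2 /w3.
by wcase; rewrite ?(mulr0, mul0r, mulr1, addr0, add0r) //; lia.
Qed.

Lemma th4_sq : th4 ^+ 2 = sV th3 ^+ 2 - sV th2 ^+ 2.
Proof.
have -> : sV th3 ^+ 2 - sV th2 ^+ 2 = sV th3 ^+ 2 + sC (-1) * sV th2 ^+ 2.
  by rewrite rmorphN rmorph1 mulN1r.
rewrite !expr2 !mulVV wsZ; last exact: finfib_pq.
rewrite wsD; last exact: finfib_pq.
rewrite mul_parity; last by move=> x y; rewrite /w4; wcase; rewrite ?(mulr0, mul0r) ?eqxx // => _; lia.
apply: eq_ws => -[u v] /=; rewrite /w2 /w3 /w4.
by wcase; rewrite ?(mulrN1,mulN1r, opprK, oppr0, mulr0, mul0r, mulr1, addr0, add0r) //; lia.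
Qed.

Lemma th2_sq : th2 ^+ 2 = 2%:R * (sV th2 * sV th3).
Proof.
rewrite mulr_natl mulr2n expr2 {2}[sV th2 * _]mulrC !mulVV wsD; last exact: finfib_pq.
rewrite mul_parity; last by move=> x y; rewrite /w2; wcase; rewrite ?mulr0 ?mul0r ?eqxx // => _; lia.
apply: eq_ws => -[u v] /=; rewrite /w2 /w3.
by wcase; rewrite ?(mulr0, mul0r, mulr1, addr0, add0r) //; lia.
Qed.

Lemma ws_tq0 k (phi : int -> F) : (0 < k)%N -> ws (tq k) phi 0%N = phi 0.
Proof.
move=> k0; rewrite /ws (_ : [set t | tq k t = 0%N] = [set 0]) ?fsbig_set1 //.
by apply/seteqP; split => x /=; rewrite /tq; [nia|move=> ->; rewrite muln0].
Qed.

Lemma th3_0 : th3 0%N = 1. Proof. by rewrite /th3 ws_tq0. Qed.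
Lemma th4_0 : th4 0%N = 1. Proof. by rewrite /th4 ws_tq0. Qed.
Lemma th2_ord : ord_ge th2 3.
Proof.
move=> n n3; rewrite /th2 /ws fsbig1 // => x /=; rewrite /tq /w2 => xn.
by case: eqP => // ?; nia.
Qed.
Lemma th2_3 : th2 3%N = 2%:R.
Proof.
rewrite /th2 /ws (_ : [set t | tq 3 t = 3%N] = [set 1] `|` [set -1]).
  rewrite fsbigU0 ?fsbig_set1 //; last by move=> x /= [-> ].
by apply/seteqP; split => x /=; rewrite /tq; [|by case=> ->]; move=> h; have : x = 1 \/ x = -1 by nia.
Qed.

Hypothesis F2 : (2%:R : F) != 0.

Lemma th3_inj f g : th3 * f = th3 * g -> f = g.
Proof. by apply: (@mul_ser_inj _ _ _ _ 0) => //; rewrite th3_0 oner_eq0. Qed.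

Lemma th_quartic : th3 ^+ 4 = th2 ^+ 4 + th4 ^+ 4.
Proof.
rewrite !(exprM _ 2 2) th3_sq th4_sq th2_sq; ring.
Qed.

(** The squares of both sides agree by the duplication formulas. The sum of the two sides has
    constant term 2, so it can be cancelled from the difference of squares. *)
Lemma th34 : th3 * th4 = sV th4 ^+ 2.
Proof.
have sq : (th3 * th4) ^+ 2 = (sV th4 ^+ 2) ^+ 2.
  rewrite exprMn th3_sq th4_sq -exprM -[RHS]rmorphXn.
  have -> : th4 ^+ 4 = th3 ^+ 4 - th2 ^+ 4 by rewrite th_quartic; ring.
  by rewrite rmorphB /= !rmorphXn /=; ring.
apply/eqP; rewrite -subr_eq0; apply/eqP.
apply: (@mul_ser_eq0 _ (th3 * th4 + sV th4 ^+ 2) _ 0) => //.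
  rewrite addsE expr2 (@coefM_ord _ _ _ 0 0) // (@coefM_ord _ _ _ 0 0) //.
  by rewrite sVE /= th3_0 th4_0 !mulr1.
by rewrite mulrC -subr_sqr sq subrr.
Qed.

(** By duplication the Wronskian w satisfies th2 th3 w = 2 th4^2 w(X^2), and so does the right-hand
    side. A difference of order n >= 4 would have order n + 3 on the left and at least 2n > n + 3 on
    the right, so it suffices to compare the coefficients up to 3. *)
Lemma wronskian_th : vt th2 * th3 - th2 * vt th3 = 3%:R * (th2 * th3 * th4 ^+ 4).
Proof.
set w := LHS; pose d := w - 3%:R * (th2 * th3 * th4 ^+ 4).
have wV : th2 * th3 * w = 2%:R * (th4 ^+ 2 * sV w).
  have e2 : 2%:R * (th2 * vt th2) = vt (th2 ^+ 2) by rewrite vtX /=; ring.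
  have e3 : 2%:R * (th3 * vt th3) = vt (th3 ^+ 2) by rewrite vtX /=; ring.
  apply: (@mul_ser_inj _ 2%:R _ _ 0) => //.
  have -> : 2%:R * (th2 * th3 * w) = th3 ^+ 2 * (2%:R * (th2 * vt th2)) - th2 ^+ 2 * (2%:R * (th3 * vt th3)).
    by rewrite /w; ring.
  rewrite e2 e3 th3_sq th2_sq th4_sq raddfD /= !vtX /= !vtM !vtV vt_nat.
  by rewrite /w rmorphB /= !rmorphM /=; ring.
have d_eq : th2 * th3 * d = 2%:R * (th4 ^+ 2 * sV d).
  have -> : sV d = sV w - 3%:R * (sV th2 * sV th3 * sV th4 ^+ 4).
    by rewrite /d; move: w {wV d} => w; rewrite rmorphB /= rmorphM /= rmorphM /= rmorphXn /= rmorphM /= rmorph_nat.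
  rewrite /d mulrBr wV.
  suff -> : th2 * th3 * (3%:R * (th2 * th3 * th4 ^+ 4)) =
     2%:R * (th4 ^+ 2 * (3%:R * (sV th2 * sV th3 * sV th4 ^+ 4))) by ring.
  have -> : sV th4 ^+ 4 = (th3 * th4) ^+ 2 by rewrite th34 -exprM.
  have := th2_sq => e.
  have -> : 2%:R * (th4 ^+ 2 * (3%:R * (sV th2 * sV th3 * (th3 * th4) ^+ 2))) =
     3%:R * th4 ^+ 2 * (th3 * th4) ^+ 2 * (2%:R * (sV th2 * sV th3)) by ring.
  by rewrite -e; ring.
suff d0 : d = 0 by apply/eqP; rewrite -subr_eq0 -/d d0.
have th23 : ord_ge (th2 * th3) 3 by apply: (@ord_geM _ _ _ 3 0) => //; exact: th2_ord.
have th23_3 : (th2 * th3) 3%N = 2%:R.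
  by rewrite (@coefM_ord _ _ _ 3 0) //; [rewrite th2_3 th3_0 mulr1|exact: th2_ord].
have vt2 : ord_ge (vt th2) 3 by move=> i i3; rewrite vtE th2_ord // mulr0.
have d3 : ord_ge d 4.
  have o1 : ord_ge (vt th2 * th3) 3 by apply: (@ord_geM _ _ _ 3 0).
  have o2 : ord_ge (th2 * vt th3) 3 by apply: (@ord_geM _ _ _ 3 0) => //; exact: th2_ord.
  have o3 : ord_ge (th2 * th3 * th4 ^+ 4) 3 by apply: (@ord_geM _ _ _ 3 0).
  have o3E : (th2 * th3 * th4 ^+ 4) 3%N = 2%:R.
    rewrite (@coefM_ord _ _ _ 3 0) // th23_3 !exprS expr0 mulr1 !(@coefM_ord _ _ _ 0 0) //.
    by rewrite th4_0 !mulr1.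
  have nE (g : series F) i : (3%:R * g) i = 3%:R * g i by rewrite -sCE; congr (_ i); rewrite rmorph_nat.
  move=> i; rewrite ltnS leq_eqVlt => /orP [/eqP -> |i3].
    rewrite /d subsE nE o3E /w subsE (@coefM_ord _ _ _ 3 0) // (@coefM_ord _ _ _ 3 0) //; last exact: th2_ord.
    by rewrite !vtE th2_3 th3_0 mul0r mulr0 mulr1 subr0 subrr.
  by rewrite /d subsE nE o3 // /w subsE o1 // o2 // subrr mulr0 subrr.
apply/funext => n; elim/ltn_ind: n => n IH.
case: (ltnP n 4) => [/d3 //|n4].
have oV : ord_ge (sV d) n.*2.
  move=> i ni; rewrite sVE; case: ifP => // oi; apply: IH; lia.
have := coefM_ord th23 (m := n) IH; rewrite d_eq th23_3 => /esym.
have oR : ord_ge (2%:R * (th4 ^+ 2 * sV d)) n.*2.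
  by apply: (@ord_geM _ _ _ 0) => //; apply: (@ord_geM _ _ _ 0).
by rewrite oR; [move=> /eqP; rewrite mulf_eq0 (negPf F2) /= => /eqP|lia].
Qed.
End Theta.
End ThetaFunctions.

(** * Finite forms of the Euler and Gauss identities, and a recursion for partitions *)

Module FiniteProducts.
Import structures.
Import all_boot all_order all_algebra.
Import zify ring lra.
Import Defs.
Import Order.TTheory GRing.Theory Num.Theory.
Local Open Scope ring_scope.

Section FiniteIdentities.
Variables (R : comNzRingType) (q : R).

Definition qprod s n : R := \prod_(s.+1 <= k < n.+1) (1 - q ^+ k).

Lemma qprod_recr s n : (s <= n)%N -> qprod s n.+1 = qprod s n * (1 - q ^+ n.+1).
Proof. by move=> sn; rewrite /qprod big_nat_recr. Qed.
Lemma qprod_recl s n : (s < n)%N -> qprod s n = (1 - q ^+ s.+1) * qprod s.+1 n.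
Proof. by move=> sn; rewrite /qprod big_ltn. Qed.
Lemma qprod_id n : qprod n n = 1.
Proof. by rewrite /qprod big_geq. Qed.

Definition pent (k : nat) := ((k * (3 * k + 1)) %/ 2)%N.
Definition pent' (k : nat) := ((k * (3 * k - 1)) %/ 2)%N.

Lemma dbl_bin2 n : (2 * 'C(n.+1, 2) = n.+1 * n)%N.
Proof. by rewrite mulnC -[2%N]/(2`!) bin_ffact ffactnS ffactn1. Qed.
Lemma dbl_pent k : (2 * pent k = k * (3 * k + 1))%N.
Proof.
rewrite /pent mulnC divnK // dvdn2 oddM oddD oddM /=; by case: odd.
Qed.
Lemma dbl_pent' k : (2 * pent' k = k * (3 * k - 1))%N.
Proof.
case: k => [|k] //; have -> : (3 * k.+1 - 1 = 3 * k + 2)%N by lia.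
have -> : pent' k.+1 = (k.+1 * (3 * k + 2) %/ 2)%N by rewrite /pent'; congr (_ * _ %/ 2)%N; lia.
rewrite mulnC divnK // dvdn2 oddM oddD oddM /=; by case: odd.
Qed.

(** Shanks' finite form of Euler's pentagonal number theorem *)
Definition euler_sum n : R := \sum_(0 <= s < n.+1) (-1) ^+ s * qprod s n * q ^+ (s * n + 'C(s.+1, 2)).
Lemma euler_shanks n :
  euler_sum n = 1 + \sum_(1 <= k < n.+1) (-1) ^+ k * (q ^+ pent' k + q ^+ pent k).
Proof.
elim: n => [|n IH].
  by rewrite /euler_sum big_nat1 big_geq // qprod_id bin_small // !expr0 !mulr1 addr0.
rewrite big_nat_recr //= addrA -IH; apply/eqP; rewrite [X in _ == X]addrC -subr_eq; apply/eqP.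
pose u s := (-1) ^+ s * qprod s n * q ^+ (s * n + 'C(s.+1, 2)).
(* For s < n the term [g s] cancels the term s + 1 of the sum of u s (1 - q^s). Only [g n] and the
   last summand survive; they are the two new pentagonal terms. *)
pose g s := - u s * q ^+ (n.+1 + s).
have eS : euler_sum n.+1 = \sum_(0 <= s < n.+1) u s * q ^+ s * (1 - q ^+ n.+1)
     + (-1) ^+ n.+1 * q ^+ (n.+1 * n.+1 + 'C(n.+2, 2)).
  rewrite /euler_sum big_nat_recr //= qprod_id mulr1; congr (_ + _).
  apply: eq_big_nat => s sn; rewrite qprod_recr; last by lia.
  rewrite /u mulnS -addnA exprD; ring.
rewrite eS /euler_sum -/u addrAC -sumrB.
have gu s : (s <= n)%N -> g s = if s == n then (-1) ^+ n.+1 * q ^+ (pent' n.+1) else u s.+1 * (1 - q ^+ s.+1).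
  move=> sn; rewrite /g /u; case: eqP => [->|/eqP sn'].
    rewrite qprod_id mulr1 exprS mulN1r -!mulNr -mulrA -exprD; congr (_ * q ^+ _).
    by have := dbl_pent' n.+1; have := dbl_bin2 n; nia.
  rewrite (qprod_recl (s := s)); last by lia.
  rewrite [(-1) ^+ s.+1]exprS; set Q := qprod _ _.
  have -> : q ^+ (s.+1 * n + 'C(s.+2, 2)) = q ^+ (s * n + 'C(s.+1, 2)) * q ^+ (n.+1 + s).
    rewrite -exprD; congr (q ^+ _); rewrite [X in (_ + X)%N]binS bin1; lia.
  ring.
have -> : \sum_(0 <= s < n.+1) (u s * q ^+ s * (1 - q ^+ n.+1) - u s) =
   \sum_(0 <= s < n.+1) g s - \sum_(0 <= s < n.+1) u s * (1 - q ^+ s).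
  rewrite -sumrB; apply: eq_bigr => s _; rewrite /g exprD; ring.
rewrite big_nat_recr //= gu // eqxx [X in _ - X]big_nat_recl //= expr0 subrr mulr0 add0r.
have -> : \sum_(0 <= i < n) g i = \sum_(0 <= i < n) u i.+1 * (1 - q ^+ i.+1).
  by apply: eq_big_nat => s sn; rewrite gu; [rewrite ifF //|]; lia.
have -> : (n.+1 * n.+1 + 'C(n.+2, 2) = pent n.+1)%N.
  by have := dbl_pent n.+1; have := dbl_bin2 n.+1; nia.
ring.
Qed.

(** Shanks' finite form of Gauss's theorem on triangular numbers *)
Definition oprod n : R := \prod_(0 <= k < n) (1 - q ^+ k.*2.+1).
Definition eprod s n : R := \prod_(s.+1 <= k < n.+1) (1 - q ^+ k.*2).
Definition gauss_sum n : R := \sum_(0 <= s < n) eprod s n * oprod s * q ^+ (s * n.*2.+1).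
Lemma gauss_shanks n :
  oprod n * \sum_(1 <= s < n.*2.+1) q ^+ 'C(s, 2) = gauss_sum n.
Proof.
elim: n => [|n IH]; first by rewrite /gauss_sum !big_geq // mulr0.
pose t s := eprod s n * oprod s * q ^+ (s * n.*2.+1).
have oS m : oprod m.+1 = oprod m * (1 - q ^+ m.*2.+1) by rewrite /oprod big_nat_recr.
have enn : eprod n n = 1 by rewrite /eprod big_geq.
have tn : t n = oprod n * q ^+ (n * n.*2.+1) by rewrite /t enn mul1r.
have eG : gauss_sum n.+1 = \sum_(0 <= s < n.+1) t s * (q ^+ s.*2 * (1 - q ^+ n.*2.+2)).
  apply: eq_big_nat => s sn; rewrite /t /eprod big_nat_recr /=; last by lia.
  have -> : (s * n.+1.*2.+1 = s * n.*2.+1 + s.*2)%N by lia.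
  rewrite exprD doubleS; ring.
have tS s : (s < n)%N -> t s * (q ^+ n.*2.+1 * (1 - q ^+ s.*2.+1)) = t s.+1 * (1 - q ^+ s.+1.*2).
  move=> sn; rewrite /t /eprod big_ltn /=; last by lia.
  rewrite oS mulSn exprD; ring.
(* By [tS] the term s of the first family is the term s + 1 of the second, so only the term s = n of
   the first is left. *)
have tele : \sum_(0 <= s < n.+1) (t s * (q ^+ n.*2.+1 * (1 - q ^+ s.*2.+1)) - t s * (1 - q ^+ s.*2)) =
    t n * (q ^+ n.*2.+1 * (1 - q ^+ n.*2.+1)).
  rewrite sumrB big_nat_recr //= [X in _ - X]big_nat_recl //= expr0 subrr mulr0 add0r.
  have -> : \sum_(0 <= i < n) t i * (q ^+ n.*2.+1 * (1 - q ^+ i.*2.+1)) = \sum_(0 <= i < n) t i.+1 * (1 - q ^+ i.+1.*2).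
    by apply: eq_big_nat => s sn; rewrite tS //; lia.
  ring.
have -> : gauss_sum n.+1 = (1 - q ^+ n.*2.+1) * (gauss_sum n + t n) + t n * (q ^+ n.*2.+1 * (1 - q ^+ n.*2.+1)).
  rewrite -tele eG /gauss_sum -/t.
  have -> : \sum_(0 <= s < n) eprod s n * oprod s * q ^+ (s * n.*2.+1) + t n = \sum_(0 <= s < n.+1) t s.
    by rewrite [RHS]big_nat_recr.
  rewrite mulr_sumr -big_split /=; apply: eq_bigr => s _; rewrite !exprS; ring.
rewrite -IH oS tn doubleS big_nat_recr //= big_nat_recr //=.
have -> : 'C(n.*2.+1, 2) = (n * n.*2.+1)%N by have := dbl_bin2 n.*2; nia.
have -> : 'C(n.*2.+2, 2) = (n * n.*2.+1 + n.*2.+1)%N by have := dbl_bin2 n.*2.+1; nia.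
rewrite exprD; ring.
Qed.
End FiniteIdentities.

Section Partitions.
Local Open Scope nat_scope.

(** Partitions into parts at most k, in the encoding of the statement. The length bound m and the
    alphabet 1..v are separate parameters because the recursion changes them at different rates;
    [pcnt_stable] removes the dependence on both. *)
Definition pcnt m v k n := count (fun s => [&& path geq k s, all (fun x => 0 < x) s & sumn s == n]) (all_seqs m (iota 1 v)).

Lemma pcntS m v k n : pcnt m.+1 v k n = (n == 0) + \sum_(1 <= x < v.+1 | (x <= k) && (x <= n)) pcnt m v x (n - x).
Proof.
rewrite /pcnt /= eq_sym; congr (_ + _).
rewrite /allpairs_dep count_flatten -map_comp sumnE big_map /index_iota subSS subn0.
rewrite [RHS]big_mkcond [RHS]big_seq big_seq; apply: eq_bigr => x.
rewrite mem_iota => xP /=; rewrite count_map.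
case: ifP => [/andP [xk xn]|h].
  apply: eq_count => s /=.
  by have -> : 0 < x by [lia]; rewrite /geq /= xk /= -(eqn_add2l x (sumn s)) subnKC.
rewrite (eq_count (a2 := pred0)) ?count_pred0 // => s /=.
by apply/negP => /andP [/andP [h1 _] /andP[_ /eqP h2]]; move: h1; rewrite /geq /=; lia.
Qed.

Lemma pcnt_stable m v k n : n <= m -> n <= v -> pcnt m v k n = pcnt n n k n.
Proof.
elim/ltn_ind: n m k v => n IH m k v nm nv.
case: m nm => [|m] nm.
  have -> : n = 0 by lia. by rewrite /pcnt /=.
case: n IH nm nv => [|n] IH nm nv.
  rewrite pcntS big_nat_cond big_pred0 //; by move=> x; lia.
rewrite !pcntS /=; congr (_ + _).
rewrite (big_cat_nat (n := n.+2)) //=.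
rewrite [X in _ + X = _]big1_seq ?addn0; last by move=> x; rewrite mem_index_iota; lia.
rewrite big_seq_cond [RHS]big_seq_cond; apply: eq_bigr => x; rewrite mem_index_iota => h.
by rewrite IH ?[in RHS]IH //; lia.
Qed.

Definition ppart k n := pcnt n n k n.

Lemma ppartE k n : ppart k n = (n == 0) + \sum_(1 <= x < n.+1 | (x <= k)) ppart x (n - x).
Proof.
rewrite /ppart; case: n => [|n]; first by rewrite big_geq // addn0 /pcnt.
rewrite pcntS /=; congr (_ + _).
rewrite big_seq_cond [RHS]big_seq_cond; apply: eq_big => [x|x]; rewrite mem_index_iota; first by lia.
by move=> h; rewrite pcnt_stable //; lia.
Qed.

Lemma ppart0 n : ppart 0 n = (n == 0).
Proof. by rewrite ppartE big_nat_cond big1 ?addn0 // => x; lia. Qed.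

(** Either k + 1 is not a part, or one copy of it can be removed. For generating series this is the
    factor 1 - q^(k+1) of Euler's product. *)
Lemma ppartS k n : ppart k.+1 n = ppart k n + (if k < n then ppart k.+1 (n - k.+1) else 0).
Proof.
rewrite ppartE [X in _ = X + _]ppartE -addnA; congr (_ + _).
case: ifP => kn; last first.
  rewrite addn0 big_nat_cond [RHS]big_nat_cond; apply: eq_bigl => x; lia.
rewrite [LHS]big_mkcond (bigD1_seq k.+1) ?iota_uniq ?mem_index_iota //= leqnn addnC; congr (_ + _).
rewrite big_mkcond [RHS]big_mkcond; apply: eq_bigr => x _.
by case: eqP => [->|/eqP]; [rewrite ltnn|rewrite /= leq_eqVlt => /negPf -> /=; rewrite ltnS].
Qed.

Lemma ppart_stable k n : n <= k -> ppart k n = partition_fn n.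
Proof.
move=> nk; rewrite /ppart /partition_fn /pcnt; apply: eq_in_count => s.
case: s => [|x s] //= _; rewrite /is_partition /=.
case: (boolP (_ == n)) => [/eqP xs|]; last by rewrite !andbF.
by rewrite /geq /=; have -> : x <= k by lia.
Qed.
End Partitions.
End FiniteProducts.

(** * The eta series, the partition series and eta quotients *)

Module EtaFunction.
Import structures.
Import all_boot all_order all_algebra.
Import boolp classical_sets functions cardinality fsbigop.
Import finmap.
Import zify ring lra.
Import Defs.
Import FormalSeries WeightedSeries ThetaFunctions FiniteProducts.
Import Order.TTheory GRing.Theory Num.Theory.
Local Open Scope classical_set_scope.
Local Open Scope ring_scope.

Section Eta.
Variable F : fieldType.
Implicit Types f g h : series F.

(** Congruence modulo X^N, which takes the place of convergence for infinite products. *)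
Definition eqm N f g := forall i, (i < N)%N -> f i = g i.
Lemma eqm_refl N f : eqm N f f. Proof. by []. Qed.
Lemma eqm_sym N f g : eqm N f g -> eqm N g f. Proof. by move=> h i /h. Qed.
Lemma eqm_trans N f g h : eqm N f g -> eqm N g h -> eqm N f h.
Proof. by move=> h1 h2 i iN; rewrite h1 ?h2. Qed.
Lemma eqmM N f f' g g' : eqm N f f' -> eqm N g g' -> eqm N (f * g) (f' * g').
Proof.
move=> h h' i iN; rewrite !mulsE; apply: eq_bigr => j _.
by have := ltn_ord j => ?; rewrite h ?h' //; lia.
Qed.
Lemma eqmD N f f' g g' : eqm N f f' -> eqm N g g' -> eqm N (f + g) (f' + g').
Proof. by move=> h h' i iN; rewrite !addsE h ?h'. Qed.
Lemma eqm_le N M f g : (M <= N)%N -> eqm N f g -> eqm M f g.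
Proof. by move=> MN h i iM; apply: h; exact: leq_trans MN. Qed.
Lemma eqmV N f g : eqm N f g -> eqm N (sV f) (sV g).
Proof. by move=> h i iN; rewrite !sVE; case: ifP => // _; apply: h; lia. Qed.
Lemma eqm_eq f g : (forall N, eqm N f g) -> f = g.
Proof. by move=> h; apply/funext => n; apply: (h n.+1). Qed.

Definition sX k : series F := fun n => (n == k)%:R.
Lemma sXM k f n : (sX k * f) n = if (k <= n)%N then f (n - k)%N else 0.
Proof.
rewrite mulsE; case: leqP => kn.
  have kP : (k < n.+1)%N by [].
  rewrite (bigD1 (Ordinal kP)) //= /sX eqxx mul1r big1 ?addr0 // => i /eqP ik.
  by case: eqP => [e|_]; rewrite ?mul0r //; case: ik; apply: val_inj.
rewrite big1 // => i _; rewrite /sX; case: eqP => [e|_]; rewrite ?mul0r //.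
by have := ltn_ord i; lia.
Qed.
Lemma sXD i j : sX i * sX j = sX (i + j)%N.
Proof.
apply/funext => n; rewrite sXM /sX; case: leqP => h; last by rewrite (_ : _ == _ = false) //; lia.
by congr (_%:R); lia.
Qed.
Lemma sXX k n : sX k ^+ n = sX (n * k)%N.
Proof. by elim: n => [|n IH]; rewrite ?expr0 ?mul0n // exprS IH sXD mulSn. Qed.
Lemma sV_sX k : sV (sX k) = sX (k.*2).
Proof. by apply/funext => n; rewrite sVE /sX; case: ifP => h; [rewrite (_ : _ == _ = false) //; lia|congr (_%:R); lia]. Qed.

Lemma ws_delta k (y : int) (c : F) : ws (tq k) (fun x => if x == y then c else 0) = sC c * sX (tq k y).
Proof.
apply/funext => n; rewrite sCE /ws /sX; case: eqP => [->|h].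
  rewrite mulr1 -(@fsbig_widen _ _ _ _ [set y]) ?fsbig_set1 ?eqxx //.
    by move=> x /= ->.
  by move=> x [_ /= h]; rewrite /=; case: eqP.
rewrite mulr0 fsbig1 // => x /= xn; case: eqP => // xy; case: h; by rewrite -xn xy.
Qed.

(** The support is x = 6k + 1 with sign (-1)^k, and (6k + 1)^2 = 1 + 24 k(3k + 1)/2: the series is
    the pentagonal expansion of X prod (1 - X^(24 k)). *)
Definition weta (x : int) : F := if (x %% 12)%Z == 1 then 1 else if (x %% 12)%Z == 7 then -1 else 0.
Definition eta : series F := ws (tq 1) weta.
Definition q24 : series F := sX 24.

Lemma eta_eqm K : eqm (24 * K.+1) eta (sX 1 * qprod q24 0 K).
Proof.
(* The bound keeps x = 6j + 1 with |j| <= k, which are the terms of the finite identity. *)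
pose wK k (x : int) := if (absz x <= 6 * k + 1)%N then weta x else 0.
have wKE : ws (tq 1) (wK K) = sX 1 * (1 + \sum_(1 <= k < K.+1) (-1) ^+ k * (q24 ^+ pent' k + q24 ^+ pent k)).
  elim: K => [|K IH].
    rewrite big_geq // addr0 mulr1 -[RHS]mul1r -(rmorph1 (@sC F)) -(ws_delta 1 1 1).
    apply: eq_ws => x; rewrite /wK /weta; wcase => //; lia.
  rewrite big_nat_recr //= addrA mulrDr -IH.
  pose d1 (x : int) : F := if x == (6 * K + 7)%:Z then (-1) ^+ K.+1 else 0.
  pose d2 (x : int) : F := if x == - (6 * K + 5)%:Z then (-1) ^+ K.+1 else 0.
  have -> : ws (tq 1) (wK K.+1) = ws (tq 1) (wK K) + ws (tq 1) d1 + ws (tq 1) d2.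
    rewrite !wsD; try exact: finfib_tq.
    apply: eq_ws => x; rewrite /wK /d1 /d2 /weta -!(signr_odd _ K.+1) /=.
    case oK : (odd K) => /=; rewrite ?expr0 ?expr1; wcase => //; rewrite ?(addr0, add0r) //; lia.
  rewrite !ws_delta -addrA; congr (_ + _); rewrite rmorphXn rmorphN rmorph1 /=.
  rewrite mulrCA -mulrDr; congr (_ * _); rewrite mulrDr addrC !sXX !sXD.
  have e1 : tq 1 (6 * K + 7)%:Z = (1 + pent K.+1 * 24)%N by have := dbl_pent K.+1; rewrite /tq; nia.
  have e2 : tq 1 (- (6 * K + 5)%:Z) = (1 + pent' K.+1 * 24)%N by have := dbl_pent' K.+1; rewrite /tq; nia.
  by rewrite e1 e2.
have h1 : eqm (24 * K.+1) eta (ws (tq 1) (wK K)).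
  move=> i iN; apply: eq_fsbigr => x /set_mem /= xi; rewrite /wK; case: leqP => // h.
  by move: xi; rewrite /tq /weta; wcase => // xi; exfalso; nia.
(* In Shanks' sum only s = 0, the product itself, lies within the precision: the terms s >= 1 start
   at exponent 1 + 24 (s K + C(s+1, 2)), beyond 24 (K + 1). *)
apply: (eqm_trans h1); rewrite wKE -euler_shanks /euler_sum big_ltn // mulrDr.
rewrite expr0 mul1r mul0n bin_small // expr0 mulr1 -[X in eqm _ _ X]addr0.
apply: eqmD => //; rewrite mulr_sumr => i iN; rewrite sumsE big_nat big1 // => s sP.
rewrite [_ * q24 ^+ _]mulrC mulrA sXX sXD sXM; case: leqP => // h.
have h3 : (0 < 'C(s.+1, 2))%N by rewrite bin_gt0; lia.
have h2 : (K <= s * K)%N by rewrite leq_pmull //; lia.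
lia.
Qed.

Lemma th2_eqm K : (0 < K)%N -> eqm (24 * K.+1) (th2 F) (2%:R * (sX 3 * \sum_(1 <= s < K.*2.+1) q24 ^+ 'C(s, 2))).
Proof.
pose wK k (x : int) : F := if (absz x < k.*2)%N then w2 F x else 0.
have wKE k : ws (tq 3) (wK k) = 2%:R * (sX 3 * \sum_(1 <= s < k.+1) q24 ^+ 'C(s, 2)).
  elim: k => [|k IH].
    rewrite big_geq // !mulr0; apply/funext => n; rewrite /ws fsbig1 //.
  rewrite big_nat_recr //= !mulrDr -IH.
  pose d1 (x : int) : F := if x == k.*2.+1%:Z then 1 else 0.
  pose d2 (x : int) : F := if x == - k.*2.+1%:Z then 1 else 0.
  have -> : ws (tq 3) (wK k.+1) = ws (tq 3) (wK k) + ws (tq 3) d1 + ws (tq 3) d2.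
    rewrite !wsD; try exact: finfib_tq.
    apply: eq_ws => x; rewrite /wK /d1 /d2 /w2.
    wcase => //; rewrite ?(addr0, add0r) //; lia.
  rewrite !ws_delta -addrA; congr (_ + _); rewrite rmorph1 !mul1r sXX sXD.
  have e1 : tq 3 k.*2.+1%:Z = (3 + 'C(k.+1, 2) * 24)%N by have := dbl_bin2 k; rewrite /tq; nia.
  have e2 : tq 3 (- k.*2.+1%:Z) = (3 + 'C(k.+1, 2) * 24)%N by have := dbl_bin2 k; rewrite /tq; nia.
  by rewrite ?e1 ?e2 mulr_natl mulr2n.
move=> K0; rewrite -wKE => i iN; apply: eq_fsbigr => x /set_mem /= xi; rewrite /wK; case: leqP => // h.
by move: xi; rewrite /tq; nia.
Qed.

(** Gauss's product for the series of triangular numbers, once the odd and even factors of the eta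
    product are separated. The eta product is cut at 2K so that each group has K factors. *)
Lemma eta_th2 : th2 F * eta = 2%:R * sV eta ^+ 2.
Proof.
apply: eqm_eq => K0; pose K := K0.+1; apply: (@eqm_le (24 * K.+1)); first by lia.
have hE := @eqm_le (24 * K.*2.+1) (24 * K.+1) _ _ _ (eta_eqm (K := K.*2)).
have hEK := eta_eqm (K := K).
have qE : qprod q24 0 K.*2 = oprod q24 K * eprod q24 0 K.
  elim: (K) => [|k IH]; first by rewrite /qprod /oprod /eprod !big_geq // mulr1.
  have -> : oprod q24 k.+1 = oprod q24 k * (1 - q24 ^+ k.*2.+1) by rewrite /oprod big_nat_recr.
  have -> : eprod q24 0 k.+1 = eprod q24 0 k * (1 - q24 ^+ k.*2.+2) by rewrite /eprod big_nat_recr.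
  by rewrite doubleS !qprod_recr // IH; ring.
have hV : eqm (24 * K.+1) (sV eta) (sX 2 * eprod q24 0 K).
  apply: eqm_trans (eqmV hEK) _; rewrite rmorphM /= sV_sX /qprod /eprod rmorph_prod /=.
  set L := \prod_(_ <= _ < _) _; set L' := \prod_(_ <= _ < _) _.
  suff -> : L = L' by [].
  apply: eq_bigr => k _; rewrite rmorphB rmorph1 rmorphXn /= sV_sX !sXX; congr (_ - sX _); lia.
apply: eqm_trans (eqmM (th2_eqm (K := K) isT) (hE _)) _; first by lia.
apply: eqm_sym; apply: eqm_trans (eqmM (@eqm_refl _ 2%:R) (eqmM hV hV)) _; apply: eqm_sym.
rewrite qE.
set T := \sum_(1 <= s < _) _.
have -> : 2%:R * (sX 3 * T) * (sX 1 * (oprod q24 K * eprod q24 0 K)) =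
  2%:R * (sX 3 * sX 1 * (eprod q24 0 K * (oprod q24 K * T))) by ring.
have -> : 2%:R * (sX 2 * eprod q24 0 K * (sX 2 * eprod q24 0 K)) =
  2%:R * (sX 2 * sX 2 * (eprod q24 0 K * eprod q24 0 K)) by ring.
rewrite !sXD /=; do 3!apply: eqmM => //.
rewrite gauss_shanks /gauss_sum.
rewrite big_ltn //= mul0n expr0 mulr1 /oprod big_geq // mulr1 -/(oprod _ _) -[X in eqm _ _ X]addr0.
apply: eqmD => // i iN; rewrite sumsE big_nat big1 // => s sP.
rewrite mulrC sXX sXM; case: leqP => // h.
have h2 : (K.*2.+1 <= s * K.*2.+1)%N by rewrite leq_pmull //; lia.
lia.
Qed.

(** This is X / eta: the shift by one avoids the negative exponent and puts p((m + 1)/24) at index m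
    + 1. *)
Definition pser : series F := fun n => if (24 %| n)%N then (partition_fn (n %/ 24))%:R else 0.

Lemma eta_pser : eta * pser = sX 1.
Proof.
pose G k : series F := fun n => if (24 %| n)%N then (ppart k (n %/ 24))%:R else 0.
have G0 : G 0%N = 1.
  apply/funext => n; rewrite /G oneE ppart0; case: ifP => h; first by congr (_%:R); lia.
  by rewrite (_ : (n == 0)%N = false) //; lia.
have GS k : (1 - q24 ^+ k.+1) * G k.+1 = G k.
  rewrite mulrBl mul1r; apply/funext => n; rewrite subsE sXX sXM /G ppartS.
  have D : (k.+1 * 24 <= n)%N -> (24 %| n - k.+1 * 24)%N = (24 %| n)%N.
    by move=> kn; rewrite dvdn_subl // dvdn_mull.
  case: ifP => h; last by case: (leqP (k.+1 * 24) n) => h'; rewrite ?D // ?h subr0.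
  case: (leqP (k.+1 * 24) n) => h'.
    rewrite D // ?h ifT; last by lia.
    have -> : ((n - k.+1 * 24) %/ 24 = n %/ 24 - k.+1)%N by lia.
    by rewrite natrD addrK.
  by rewrite ifF ?addn0 ?subr0 //; lia.
have EG k : qprod q24 0 k * G k = 1.
  elim: k => [|k IH]; first by rewrite qprod_id mul1r.
  by rewrite qprod_recr // -mulrA GS.
apply: eqm_eq => K; apply: (@eqm_le (24 * K.+1)); first by lia.
have hG : eqm (24 * K.+1) pser (G K).
  by move=> i iN; rewrite /pser /G; case: ifP => // h; rewrite ppart_stable //; lia.
by apply: eqm_trans (eqmM (eta_eqm (K := K)) hG) _; rewrite -mulrA EG mulr1.
Qed.

Lemma eta_ord : ord_ge eta 1.
Proof. by move=> [|//] _; rewrite /eta ws_tq0. Qed.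
Lemma eta_1 : eta 1%N = 1.
Proof. by rewrite (eta_eqm (K := 0)) // qprod_id mulr1. Qed.

Lemma eta_inj f g : eta * f = eta * g -> f = g.
Proof. by apply: (mul_ser_inj eta_ord); rewrite eta_1 oner_eq0. Qed.

Hypothesis F2 : (2%:R : F) != 0.

Lemma nat_ser_inj k f g : (k%:R : F) != 0 -> k%:R * f = k%:R * g -> f = g.
Proof. by move=> k0; apply: (@mul_ser_inj _ _ _ _ 0) => //; rewrite natsE. Qed.

Lemma ord_geX f k n : ord_ge f k -> ord_ge (f ^+ n) (n * k).
Proof.
move=> fk; elim: n => [|n IH] //; rewrite exprS mulSn; exact: ord_geM.
Qed.
Lemma coefX_ord f k n : ord_ge f k -> (f ^+ n) (n * k)%N = f k ^+ n.
Proof.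
move=> fk; elim: n => [|n IH]; first by rewrite !expr0 oneE.
by rewrite exprS mulSn coefM_ord ?IH ?exprS //; exact: ord_geX.
Qed.
Lemma ord_geV f k : ord_ge f k -> ord_ge (sV f) k.*2.
Proof. by move=> fk i ik; rewrite sVE; case: ifP => // oi; apply: fk; lia. Qed.

(** Both u = V(th4 eta) and eta^2 solve u V(eta)^4 = V(u)^2 eta^2, with V the substitution [sV]. If
    their difference had order n >= 3, the two sides of [dE] would have order n + 8 and at least 2n
    + 6 > n + 8; so agreement below X^3 forces equality. *)
Lemma V_th4_eta : sV (th4 F) * sV eta = eta ^+ 2.
Proof.
have V1 : sV (th2 F) * sV eta = 2%:R * sV (sV eta) ^+ 2.
  by rewrite -rmorphM eta_th2 rmorphM rmorph_nat rmorphXn.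
have I3 : sV (sV eta) ^+ 2 * sV (th3 F) * eta ^+ 2 = sV eta ^+ 5.
  apply: (@nat_ser_inj 4); first by rewrite (natrM _ 2 2) mulf_neq0.
  have -> : 4%:R * (sV (sV eta) ^+ 2 * sV (th3 F) * eta ^+ 2) =
     2%:R * (2%:R * sV (sV eta) ^+ 2) * (sV (th3 F) * eta ^+ 2) by ring.
  rewrite -V1.
  have -> : 2%:R * (sV (th2 F) * sV eta) * (sV (th3 F) * eta ^+ 2) =
    (2%:R * (sV (th2 F) * sV (th3 F))) * eta ^+ 2 * sV eta by ring.
  by rewrite -th2_sq -exprMn eta_th2; ring.
have V34 : sV (th3 F) * sV (th4 F) = sV (sV (th4 F)) ^+ 2.
  by rewrite -rmorphM th34 // rmorphXn.
set u := sV (th4 F) * sV eta.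
have uE : u * sV eta ^+ 4 = sV u ^+ 2 * eta ^+ 2.
  have -> : sV u ^+ 2 = sV (sV (th4 F)) ^+ 2 * sV (sV eta) ^+ 2 by rewrite /u rmorphM exprMn.
  rewrite -V34 /u.
  have -> : sV (th3 F) * sV (th4 F) * sV (sV eta) ^+ 2 * eta ^+ 2 =
     sV (th4 F) * (sV (sV eta) ^+ 2 * sV (th3 F) * eta ^+ 2) by ring.
  rewrite I3; ring.
pose d := u - eta ^+ 2.
have dE : d * sV eta ^+ 4 = eta ^+ 2 * (sV d * (2%:R * sV eta ^+ 2 + sV d)).
  have uE' : u = eta ^+ 2 + d by rewrite /d; ring.
  have VuE : sV u = sV eta ^+ 2 + sV d by rewrite uE' rmorphD rmorphXn.
  have := uE; rewrite VuE {1}uE' => /eqP; rewrite -subr_eq0 => /eqP h.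
  apply/eqP; rewrite -subr_eq0; apply/eqP; rewrite -[RHS]h; ring.
suff d0 : d = 0 by apply/eqP; rewrite -subr_eq0 -/d d0.
have oV : ord_ge (sV eta) 2 := ord_geV eta_ord.
have V2 : sV eta 2%N = 1 by rewrite sVE /= eta_1.
have oV4 : ord_ge (sV eta ^+ 4) 8 := ord_geX (n := 4) oV.
have V48 : (sV eta ^+ 4) 8%N = 1 by rewrite (coefX_ord 4 oV) V2 expr1n.
have od : ord_ge d 3.
  have o1 : ord_ge u 2 by apply: (@ord_geM _ _ _ 0).
  have o2 : ord_ge (eta ^+ 2) 2 := ord_geX (n := 2) eta_ord.
  move=> i; rewrite ltnS leq_eqVlt => /orP [/eqP -> |i2]; last by rewrite /d subsE o1 // o2 // subrr.
  rewrite /d subsE (coefX_ord 2 eta_ord) eta_1 /u (@coefM_ord _ _ _ 0 2) // V2 sVE /= th4_0.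
  by rewrite mulr1 expr1n subrr.
apply/funext => n; elim/ltn_ind: n => n IH.
case: (ltnP n 3) => [/od //|n3].
have oVd : ord_ge (sV d) n.*2 := ord_geV IH.
have := coefM_ord IH oV4; rewrite dE V48 mulr1 => <-.
have oR : ord_ge (2%:R * sV eta ^+ 2 + sV d) 4.
  move=> i i4; rewrite addsE oVd; last by lia.
  by rewrite addr0 (@ord_geM _ _ _ 0 4) //; apply: (ord_geX (n := 2) oV).
have o2 : ord_ge (eta ^+ 2) 2 := ord_geX (n := 2) eta_ord.
by rewrite (ord_geM o2 (ord_geM oVd oR)) //; lia.
Qed.

Lemma eta_cube : 2%:R * eta ^+ 3 = th2 F * th3 F * th4 F.
Proof.
apply: eta_inj.
have -> : eta * (2%:R * eta ^+ 3) = 2%:R * (eta ^+ 2) ^+ 2 by ring.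
rewrite -V_th4_eta exprMn -th34 //.
have -> : 2%:R * (th3 F * th4 F * sV eta ^+ 2) = th3 F * th4 F * (2%:R * sV eta ^+ 2) by ring.
rewrite -eta_th2; ring.
Qed.

Lemma eta_12 : 16%:R * eta ^+ 12 = th2 F ^+ 4 * th4 F ^+ 4 * th3 F ^+ 4.
Proof.
have -> : 16%:R * eta ^+ 12 = (2%:R * eta ^+ 3) ^+ 4 by ring.
by rewrite eta_cube; ring.
Qed.
End Eta.
End EtaFunction.

(** * Binomial congruences modulo l and a Landen transformation *)

Module LegendrePolynomial.
Import structures.
Import all_boot all_order all_algebra.
Import boolp classical_sets functions cardinality fsbigop.
Import finmap finfield.
Import zify ring lra.
Import Defs.
Import FormalSeries WeightedSeries ThetaFunctions FiniteProducts EtaFunction.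
Import Order.TTheory GRing.Theory Num.Theory.
Local Open Scope ring_scope.

Section PolyTop.
Variable R : comNzRingType.
Implicit Types p q : {poly R}.

Lemma coefM_top p q m n : (size p <= m.+1)%N -> (size q <= n.+1)%N ->
  (p * q)`_(m + n) = p`_m * q`_n.
Proof.
move=> pm qn; rewrite coefM.
have mP : (m < (m + n).+1)%N by lia.
rewrite (bigD1 (Ordinal mP)) //= big1 ?addr0; first by congr (_ * q`_ _); lia.
move=> i /eqP nim; have := ltn_ord i => ?.
have {}nim : nat_of_ord i <> m by move=> e; apply: nim; apply: val_inj.
case: (ltnP m i) => im; first by rewrite nth_default ?mul0r //; apply: leq_trans pm _.
by rewrite [q`_ _]nth_default ?mulr0 //; apply: leq_trans qn _; lia.
Qed.

Lemma size_mul_leqS p q m n : (size p <= m.+1)%N -> (size q <= n.+1)%N -> (size (p * q)%R <= (m + n).+1)%N.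
Proof. by move=> pm qn; apply: leq_trans (size_polyMleq _ _) _; move: pm qn; set a := size p; set b := size q; lia. Qed.

Lemma coef_linX (u v : R) n i :
  ((u%:P + v%:P * 'X) ^+ n)`_i = u ^+ (n - i) * v ^+ i *+ 'C(n, i).
Proof.
rewrite exprDn coef_sum; case: (leqP i n) => ni.
  have iP : (i < n.+1)%N by [].
  rewrite (bigD1 (Ordinal iP)) //= big1 ?addr0.
    by rewrite coefMn exprMn -!rmorphXn /= mulrA -rmorphM coefCM coefXn eqxx mulr1.
  move=> j /eqP ij; rewrite coefMn exprMn -!rmorphXn /= mulrA -rmorphM coefCM coefXn.
  case: eqP => [e|_]; last by rewrite mulr0 mul0rn.
  by case: ij; apply: val_inj.
rewrite bin_small // mulr0n big1 // => j _.
rewrite coefMn exprMn -!rmorphXn /= mulrA -rmorphM coefCM coefXn.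
by case: eqP => [e|_]; [have := ltn_ord j; lia|rewrite mulr0 mul0rn].
Qed.
End PolyTop.

Section Modl.
Variables (l : nat).
Hypotheses (l_pr : prime l) (l_ge5 : (5 <= l)%N).
Local Notation F := 'F_l.
Local Notation N := (l./2).

Lemma lE : l = (N.*2.+1)%N.
Proof.
have : odd l by case: (even_prime l_pr) => [l2|//]; move: l_ge5; rewrite l2.
lia.
Qed.

Lemma natF_eq0 k : ((k%:R : F) == 0) = (l %| k)%N.
Proof. by rewrite -(dvdn_pcharf (pchar_Fp l_pr)). Qed.

Lemma natF_neq0 k : (0 < k < l)%N -> (k%:R : F) != 0.
Proof. by move=> kP; rewrite natF_eq0 gtnNdvd //; lia. Qed.

Lemma F2 : (2%:R : F) != 0. Proof. by apply: natF_neq0; lia. Qed.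
Lemma F3 : (3%:R : F) != 0. Proof. by apply: natF_neq0; lia. Qed.

Lemma twoN : (2%:R : F) * N%:R = -1.
Proof.
have : ((N.*2.+1)%:R : F) = 0 by apply/eqP; rewrite natF_eq0 -lE.
by rewrite -natr1 -muln2 mulnC natrM => /eqP; rewrite addr_eq0 => /eqP.
Qed.

(** As 2N = -1 in F, C(N, i) is the binomial coefficient of -1/2, that is (-1/4)^i C(2i, i); the
    induction compares ratios of consecutive terms. *)
Lemma bin_half i : (i <= N)%N -> (4%:R : F) ^+ i * 'C(N, i)%:R = (-1) ^+ i * 'C(i.*2, i)%:R.
Proof.
elim: i => [|i IH] iN; first by rewrite !bin0 !expr0.
have IHi := IH (ltnW iN).
have i0 : (i.+1%:R : F) != 0 by apply: natF_neq0; have := lE; lia.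
apply: (mulfI i0).
have e1 : (i.+1%:R : F) * 'C(N, i.+1)%:R = (N%:R - i%:R) * 'C(N, i)%:R.
  rewrite -natrM mul_bin_left natrM natrB //; exact: ltnW.
have e2 : (i.+1%:R : F) * 'C(i.+1.*2, i.+1)%:R = 2%:R * (i.*2.+1)%:R * 'C(i.*2, i)%:R.
  rewrite -!natrM; congr (_%:R).
  have h1 : ((i.*2.+1) * 'C(i.*2, i) = i.+1 * 'C(i.*2.+1, i.+1))%N := mul_bin_diag i.*2.+1 i.
  have h5 : ('C(i.*2.+1, i) = 'C(i.*2.+1, i.+1))%N by rewrite -bin_sub; [congr 'C(_, _); lia|lia].
  rewrite doubleS binS h5; nia.
rewrite !exprS.
have -> : (i.+1%:R : F) * (4%:R * 4%:R ^+ i * 'C(N, i.+1)%:R) = 4%:R * 4%:R ^+ i * (i.+1%:R * 'C(N, i.+1)%:R) by ring.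
have -> : (i.+1%:R : F) * (-1 * (-1) ^+ i * 'C(i.+1.*2, i.+1)%:R) = - (-1) ^+ i * (i.+1%:R * 'C(i.+1.*2, i.+1)%:R) by ring.
rewrite e1 e2.
have -> : 4%:R * 4%:R ^+ i * ((N%:R - i%:R) * 'C(N, i)%:R) = 2%:R * (2%:R * N%:R - 2%:R * i%:R) * (4%:R ^+ i * 'C(N, i)%:R) :> F by ring.
rewrite IHi twoN -[i.*2.+1%:R]natr1 -muln2 natrM; ring.
Qed.

Lemma four_expN : (4%:R : F) ^+ N = 1.
Proof.
have -> : (4%:R : F) ^+ N = 2%:R ^+ (N.*2) by rewrite -mul2n exprM -(natrX _ 2 2).
apply: (mulfI F2); rewrite -exprS -lE mulr1.
by have := expf_card (2%:R : F); rewrite card_Fp.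
Qed.

Lemma bin_lN : ('C(N.*2, N)%:R : F) = (-1) ^+ N.
Proof.
have := bin_half (leqnn N); rewrite four_expN mul1r binn => h.
have -> : 'C(N.*2, N)%:R = (-1) ^+ N * ((-1) ^+ N * 'C(N.*2, N)%:R) :> F by rewrite mulrA -expr2 sqrr_sign mul1r.
by rewrite -h mulr1.
Qed.

Definition Csq i : nat := ('C(N, i) ^ 2)%N.

Lemma CsqE (R : pzSemiRingType) i : ((Csq i)%:R : R) = 'C(N, i)%:R * 'C(N, i)%:R.
Proof. by rewrite -natrM mulnn. Qed.

(** Both sides are the coefficient of T^N in ((t + s T)(s + t T))^N. For the left side the product
    is rewritten as (s + t)^2 T + s t (1 - T)^2, and [bin_half] turns the central coefficient of (1
    - T)^(2i) into 4^i C(N, i). *)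
Lemma landen_poly (s t : series F) :
  \sum_(i < N.+1) (Csq i)%:R * (4%:R * (s * t)) ^+ i * ((s + t) ^+ 2) ^+ (N - i) =
  \sum_(i < N.+1) (Csq i)%:R * (s ^+ 2) ^+ i * (t ^+ 2) ^+ (N - i).
Proof.
pose P : {poly series F} := ((t%:P + s%:P * 'X) * (s%:P + t%:P * 'X)) ^+ N.
transitivity (P`_N).
  have -> : P = \sum_(i < N.+1) (((s + t) ^+ 2)%:P * 'X) ^+ (N - i) * ((s * t)%:P * (1%:P + (-1)%:P * 'X) ^+ 2) ^+ i *+ 'C(N, i).
    rewrite -exprDn; congr (_ ^+ _); rewrite !rmorphXn !rmorphD !rmorphM rmorphN /=; ring.
  rewrite coef_sum; apply: eq_bigr => i _; have := ltn_ord i; rewrite ltnS => iN.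
  set u := (s + t) ^+ 2; set w := s * t; set L := 1%:P + _ * _.
  have -> : (u%:P * 'X) ^+ (N - i) * (w%:P * L ^+ 2) ^+ i =
     (u ^+ (N - i))%:P * ('X^(N - i) * ((w ^+ i)%:P * L ^+ (2 * i))).
    by rewrite exprMn [(w%:P * _) ^+ i]exprMn exprM !rmorphXn /= mulrA.
  rewrite coefMn coefCM coefXnM ltnNge leq_subr /= subKn // coefCM coef_linX expr1n mul1r.
  have -> : (2 * i = i.*2)%N by rewrite mul2n.
  have h : ((Csq i)%:R : series F) * 4%:R ^+ i = ('C(N, i)%:R) * ((-1) ^+ i * 'C(i.*2, i)%:R).
    have := congr1 (@sC F) (bin_half iN); rewrite !rmorphM !rmorphXn rmorphN rmorph1 !rmorph_nat /= => <-.
    ring.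
  rewrite [(4%:R * _) ^+ i]exprMn -[(_ * _) *+ _]mulr_natl -[(-1) ^+ i *+ _]mulr_natl.
  have -> : (Csq i)%:R * (4%:R ^+ i * w ^+ i) * u ^+ (N - i) = ((Csq i)%:R * 4%:R ^+ i) * (w ^+ i * u ^+ (N - i)) by ring.
  rewrite h; ring.
rewrite /P exprMn coefM; apply: eq_bigr => i _; have := ltn_ord i; rewrite ltnS => iN.
rewrite !coef_linX subKn // bin_sub // CsqE -[t ^+ _ * s ^+ _ *+ _]mulr_natl -[s ^+ _ * t ^+ _ *+ _]mulr_natl.
rewrite -[s ^+ 2 ^+ _]exprM -[t ^+ 2 ^+ _]exprM !mul2n -!addnn !exprD; ring.
Qed.

End Modl.
End LegendrePolynomial.

(** * Derivation formulas modulo l for theta and eta *)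

Module ThetaDerivatives.
Import structures.
Import all_boot all_order all_algebra.
Import boolp classical_sets functions cardinality fsbigop.
Import finmap finfield.
Import zify ring lra.
Import Defs.
Import FormalSeries WeightedSeries ThetaFunctions FiniteProducts EtaFunction LegendrePolynomial.
Import Order.TTheory GRing.Theory Num.Theory.
Local Open Scope ring_scope.

Section Modl2.
Variables (l : nat).
Hypotheses (l_pr : prime l) (l_ge5 : (5 <= l)%N).
Local Notation F := 'F_l.
Local Notation N := (l./2).
Local Notation F2 := (F2 l_pr l_ge5).
Local Notation F3 := (F3 l_pr l_ge5).
Local Notation twoN := (twoN l_pr l_ge5).
Local Notation Csq := (Csq l).
Local Notation landen_poly := (landen_poly l_pr l_ge5).

Lemma c0M (f g : series F) : (f * g) 0%N = f 0%N * g 0%N.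
Proof. exact: (@coefM_ord _ _ _ 0 0). Qed.
Lemma c0X (f : series F) n : (f ^+ n) 0%N = f 0%N ^+ n.
Proof. by elim: n => [|n IH]; rewrite ?expr0 // !exprS c0M IH. Qed.

Local Notation th2 := (th2 F).
Local Notation th3 := (th3 F).
Local Notation th4 := (th4 F).
Local Notation eta := (eta F).
Local Notation a := (th2 ^+ 4).
Local Notation b := (th4 ^+ 4).
Local Notation c := (th3 ^+ 4).
Local Notation pser := (pser F).

(** Up to sign the Hasse invariant of the Legendre family, of weight l - 1; [calB] is its partial
    derivative in th2^4. *)
Definition calA : series F := \sum_(i < N.+1) (Csq i)%:R * a ^+ i * c ^+ (N - i).
Definition calB : series F := \sum_(i < N.+1) (i * Csq i)%:R * a ^+ i.-1 * c ^+ (N - i).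

(** Duplication gives a = 4 s t and c = (s + t)^2, while [sV] sends a and c to s^2 and t^2. So
    [landen_poly] says that [calA] is fixed by [sV], and its constant term is 1. *)
Lemma calA_eq1 : calA = 1.
Proof.
have VA : sV calA = calA.
  pose s := sV th2 ^+ 2; pose t := sV th3 ^+ 2.
  have aE : a = 4%:R * (s * t) by rewrite (exprM _ 2 2) th2_sq /s /t; ring.
  have cE : c = (s + t) ^+ 2 by rewrite (exprM _ 2 2) th3_sq addrC.
  have h : calA = \sum_(i < N.+1) (Csq i)%:R * (4%:R * (s * t)) ^+ i * ((s + t) ^+ 2) ^+ (N - i).
    by rewrite /calA aE cE.
  rewrite landen_poly in h; rewrite {2}h /calA rmorph_sum; apply: eq_bigr => i _ /=.
  have eM (f g h' : series F) : sV (f * g * h') = sV f * sV g * sV h' by rewrite !rmorphM.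
  have eX (f : series F) n : sV (f ^+ n) = sV f ^+ n by rewrite rmorphXn.
  rewrite eM rmorph_nat !eX.
  by rewrite /s /t -!(exprM _ 2 2).
rewrite (sV_const VA) -(rmorph1 (@sC F)); congr sC.
rewrite /calA sumsE big_ord_recl big1 ?addr0 => [|i _].
  by rewrite !c0M natsE eqxx !c0X /= expr0 mulr1 th3_0 !expr1n mulr1 /Csq bin0.
by rewrite !c0M !c0X (@th2_ord F 0%N) // expr0n /= expr0n /= mulr0 mul0r.
Qed.

(** The logarithmic derivative of th3, quasimodular of weight 2 in characteristic 0, becomes modulo
    l this form of weight l + 1. *)
Definition pi3 : series F := 6%:R * a * b * calB.

Lemma pow_pred (x : series F) k : k%:R * x ^+ k.-1 * x = k%:R * x ^+ k.
Proof. by case: k => [|k]; rewrite ?mul0r //= -mulrA -exprSr. Qed.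

Lemma quartic : c = a + b. Proof. exact: th_quartic. Qed.

(** Differentiating [calA] = 1 and eliminating vt th2 by the Wronskian leaves a linear equation for
    vt th3, whose coefficient is 4N = -2. *)
Lemma vt_th3 : vt th3 = pi3 * th3.
Proof.
have W := wronskian_th F2; set u := vt th3.
have h2 : th3 * vt th2 = th2 * u + 3%:R * (th2 * th3 * b) by rewrite -W -/u; ring.
have ha : th3 * vt a = 4%:R * a * (u + 3%:R * b * th3).
  rewrite vtX /=.
  have -> : th3 * (4%:R * th2 ^+ 3 * vt th2) = 4%:R * th2 ^+ 3 * (th3 * vt th2) by ring.
  rewrite h2; ring.
have hc : th3 * vt c = 4%:R * c * u by rewrite vtX /= -/u; ring.
have := congr1 (fun f => th3 * vt f) calA_eq1.
rewrite vt1 mulr0 /calA raddf_sum /= mulr_sumr.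
have -> : \sum_(i < N.+1) th3 * vt ((Csq i)%:R * a ^+ i * c ^+ (N - i)) =
   4%:R * N%:R * u * calA + 12%:R * a * b * th3 * calB.
  rewrite /calA /calB !mulr_sumr -big_split; apply: eq_bigr => i _ /=.
  rewrite !vtM vt_nat (vtX a i) (vtX c (N - i)%N); have := ltn_ord i; rewrite ltnS => iN.
  set A1 := a ^+ i.-1; set C1 := c ^+ (N - i).-1.
  have eA := pow_pred a i; have eC := pow_pred c (N - i).
  transitivity ((Csq i)%:R * (i%:R * A1 * (th3 * vt a)) * c ^+ (N - i) + (Csq i)%:R * a ^+ i * ((N - i)%:R * C1 * (th3 * vt c))).
    by ring.
  rewrite ha hc.
  have -> : i%:R * A1 * (4%:R * a * (u + 3%:R * b * th3)) = 4%:R * u * (i%:R * a ^+ i) + 12%:R * b * th3 * a * (i%:R * A1).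
    by rewrite -eA -/A1; ring.
  have -> : (N - i)%:R * C1 * (4%:R * c * u) = 4%:R * u * ((N - i)%:R * c ^+ (N - i)).
    by rewrite -eC -/C1; ring.
  rewrite natrB // natrM; ring.
rewrite calA_eq1 mulr1 => h.
have N4 : 4%:R * N%:R = - 2%:R :> series F.
  have := congr1 (@sC F) twoN; rewrite rmorphM !rmorph_nat rmorphN rmorph1 => e.
  have -> : 4%:R * N%:R = 2%:R * (2%:R * N%:R) :> series F by ring.
  rewrite e; ring.
apply: (@nat_ser_inj _ 2); first exact: F2.
move/eqP: h; rewrite N4 addrC mulNr subr_eq0 => /eqP <-.
rewrite /pi3; ring.
Qed.

Lemma vt_th2 : vt th2 = th2 * (pi3 + 3%:R * b).
Proof.
apply: th3_inj; have := wronskian_th F2; rewrite vt_th3 => /eqP.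
rewrite subr_eq => /eqP; rewrite mulrC => ->; ring.
Qed.

Lemma vt_a : vt a = 4%:R * a * (pi3 + 3%:R * b).
Proof. rewrite vtX vt_th2 /=; ring. Qed.

Lemma vt_b : vt b = 4%:R * b * (pi3 - 3%:R * a).
Proof.
have -> : b = c - a by rewrite quartic; ring.
rewrite raddfB /= vt_a vtX vt_th3 /= quartic.
have -> : 4%:R * th3 ^+ 3 * (pi3 * th3) = 4%:R * pi3 * c by ring.
rewrite quartic; ring.
Qed.

Lemma vt_eta : vt eta = eta * (pi3 + b - a).
Proof.
have e12 := eta_12 F2.
have F192 : (192%:R : F) != 0 by rewrite (natrM _ 64 3) (natrX _ 2 6) mulf_neq0 ?expf_neq0 ?F2 ?F3.
have : vt (16%:R * eta ^+ 12) = vt (a * b * c) by rewrite e12.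
have -> : vt (a * b * c) = 12%:R * (a * b * c) * (pi3 + b - a).
  by rewrite (vtM (a * b) c) (vtM a b) vt_a vt_b (vtX th3) vt_th3 /=; ring.
rewrite -e12 vtM vt_nat vtX /= => h.
apply: (nat_ser_inj F192); apply: (@mul_ser_inj _ (eta ^+ 11) _ _ 11).
- exact: (ord_geX (n := 11) (@eta_ord F)).
- by rewrite (coefX_ord 11 (@eta_ord F)) eta_1 expr1n oner_eq0.
- transitivity (0 * eta ^+ 12 + 16%:R * (12%:R * eta ^+ 11 * vt eta)); first by ring.
  rewrite h; ring.
Qed.

(** As [pser] is X / eta, subtracting [pser * H] removes the contribution of X: vt - 1 acts here as
    vt acts on H / eta. *)
Lemma vt_pser (H : series F) : vt (pser * H) - pser * H = pser * (vt H - (pi3 + b - a) * H).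
Proof.
have e := eta_pser F.
have vX : vt (sX F 1) = sX F 1.
  by apply/funext => n; rewrite vtE /sX; case: eqP => [->|_]; rewrite ?mulr1 ?mulr0.
have h : vt pser = pser - (pi3 + b - a) * pser.
  apply: (@eta_inj F); have := congr1 (@vt F) e; rewrite vX -e vtM vt_eta => h.
  have -> : eta * vt pser = eta * (pi3 + b - a) * pser + eta * vt pser - eta * (pi3 + b - a) * pser by ring.
  rewrite h; ring.
rewrite vtM h; ring.
Qed.

(** The geometric series in 1 - f, cut at k = n for coefficient n because (1 - f)^k has order at
    least k when f has constant term 1. *)
Definition sinv (f : series F) : series F := fun n => (\sum_(k < n.+1) (1 - f) ^+ k) n.
Lemma sinvE (f : series F) : f 0%N = 1 -> f * sinv f = 1.
Proof.
move=> f0; apply: eqm_eq => n.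
have o1 : ord_ge (1 - f) 1 by move=> [|//] _; rewrite subsE f0 oneE subrr.
have oX k : ord_ge ((1 - f) ^+ k) k by have := ord_geX (n := k) o1; rewrite muln1.
have hS : eqm n (sinv f) (\sum_(k < n.+1) (1 - f) ^+ k).
  move=> i iN; rewrite /sinv -!(big_mkord xpredT (fun k => (1 - f) ^+ k)).
  rewrite [in RHS](big_cat_nat (n := i.+1)) //=; last by lia.
  rewrite addsE [X in _ = _ + X](_ : _ = 0) ?addr0 // sumsE big_nat big1 // => k kP; apply: oX; lia.
apply: eqm_trans (eqmM (@eqm_refl _ n f) hS) _.
have -> : f * \sum_(k < n.+1) (1 - f) ^+ k = 1 - (1 - f) ^+ n.+1.
  have := subrX1 (1 - f) n.+1; have -> : 1 - f - 1 = - f by ring.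
  rewrite mulNr => /eqP; rewrite -eqr_opp opprK opprB => /eqP <- //.
by move=> i iN; rewrite subsE oX ?subr0 //; lia.
Qed.

Definition binv := sinv b.
Lemma b_binv : b * binv = 1.
Proof. by apply: sinvE; rewrite c0X th4_0 expr1n. Qed.
(** For the modular function lambda = a / c this is lambda / (1 - lambda). Forms of degree d in a
    and b are b^d times a polynomial of degree at most d in it; the zeros of a, c and b correspond
    to [xr] = 0, -1 and infinity. *)
Definition xr : series F := a * binv.
Lemma b_xr : b * xr = a. Proof. by rewrite /xr mulrCA b_binv mulr1. Qed.

Definition ev (h : {poly F}) : series F := (map_poly (@sC F) h).[xr].
Lemma evD h g : ev (h + g) = ev h + ev g. Proof. by rewrite /ev rmorphD hornerD. Qed.
Lemma evN h : ev (- h) = - ev h. Proof. by rewrite /ev rmorphN hornerN. Qed.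
Lemma evB h g : ev (h - g) = ev h - ev g. Proof. by rewrite evD evN. Qed.
Lemma evM h g : ev (h * g) = ev h * ev g. Proof. by rewrite /ev rmorphM hornerM. Qed.
Lemma evC k : ev k%:P = sC k. Proof. by rewrite /ev map_polyC hornerC. Qed.
Lemma evX : ev 'X = xr. Proof. by rewrite /ev map_polyX hornerX. Qed.
Lemma ev1 : ev 1 = 1. Proof. by rewrite -[1]/(1%:P) evC rmorph1. Qed.
Lemma evXn h n : ev (h ^+ n) = ev h ^+ n.
Proof. by elim: n => [|n IH]; rewrite ?expr0 ?ev1 // !exprS evM IH. Qed.
Lemma ev_sum (I : Type) (r : seq I) (P : pred I) (H : I -> {poly F}) :
  ev (\sum_(i <- r | P i) H i) = \sum_(i <- r | P i) ev (H i).
Proof.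
apply: (big_morph ev evD); by rewrite -[0]/(0%:P) evC rmorph0.
Qed.
Lemma ev_nat k : ev k%:R = k%:R.
Proof. by rewrite -polyC_natr evC rmorph_nat. Qed.

Lemma vt_xr : vt xr = 12%:R * b * (xr + xr ^+ 2).
Proof.
apply: (@mul_ser_inj _ b _ _ 0) => //; first by rewrite c0X th4_0 expr1n oner_eq0.
have := congr1 (@vt F) b_xr; rewrite vtM vt_b vt_a -b_xr => h.
transitivity (4%:R * b * (pi3 - 3%:R * (b * xr)) * xr + b * vt xr - 4%:R * b * (pi3 - 3%:R * (b * xr)) * xr); first by ring.
rewrite h; ring.
Qed.

Lemma vt_ev h : vt (ev h) = 12%:R * b * ev ('X * (1 + 'X) * h^`()).
Proof.
elim/poly_ind: h => [|h k IH].
  by rewrite deriv0 mulr0 -[0]/(0%:P) evC rmorph0 raddf0 mulr0.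
rewrite derivD derivM derivX derivC addr0 mulr1 evD evC raddfD /= evM evX vtM IH vt_xr.
have -> : vt (sC k) = 0 by rewrite -[sC k]mulr1 vtZ vt1 mulr0.
rewrite !(evM, evD, evX, ev1); ring.
Qed.
End Modl2.
End ThetaDerivatives.

(** * The projections of 1/eta as eta^11 times a form in th2^4 and th4^4 *)

Module PartitionTheta.
Import structures.
Import all_boot all_order all_algebra.
Import boolp classical_sets functions cardinality fsbigop.
Import finmap finfield.
Import zify ring lra.
Import Defs.
Import FormalSeries WeightedSeries ThetaFunctions FiniteProducts EtaFunction LegendrePolynomial ThetaDerivatives.
Import Order.TTheory GRing.Theory Num.Theory.
Local Open Scope ring_scope.

Section Modl3.
Variables (l : nat).
Hypotheses (l_pr : prime l) (l_ge5 : (5 <= l)%N).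
Local Notation F := 'F_l.
Local Notation N := (l./2).
Local Notation F2 := (F2 l_pr l_ge5).
Local Notation twoN := (twoN l_pr l_ge5).
Local Notation Csq := (Csq l).
Local Notation th2 := (th2 F).
Local Notation th3 := (th3 F).
Local Notation th4 := (th4 F).
Local Notation eta := (eta F).
Local Notation a := (th2 ^+ 4).
Local Notation b := (th4 ^+ 4).
Local Notation c := (th3 ^+ 4).
Local Notation pser := (pser F).
Local Notation pi3 := (pi3 l).
Local Notation xr := (xr l).
Local Notation b_xr := (b_xr l_pr l_ge5).

(** As polynomials in [xr], [calA] is b^N [alpha] and a [calB] is b^N [betaX]; hence [alpha] takes
    the value b^(-N) at [xr]. *)
Definition alpha : {poly F} := \sum_(i < N.+1) (Csq i)%:R * 'X^i * (1 + 'X) ^+ (N - i).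
Definition betaX : {poly F} := \sum_(i < N.+1) (i * Csq i)%:R * 'X^i * (1 + 'X) ^+ (N - i).

Lemma c_xr : b * (1 + xr) = c.
Proof. by rewrite mulrDr mulr1 b_xr addrC quartic. Qed.

Lemma ac_xr i : (i <= N)%N -> a ^+ i * c ^+ (N - i) = b ^+ N * ev ('X^i * (1 + 'X) ^+ (N - i)).
Proof.
move=> iN; rewrite evM !evXn evD ev1 evX -c_xr -b_xr [(b * xr) ^+ i]exprMn [(b * (1 + xr)) ^+ _]exprMn.
have -> : b ^+ N = b ^+ i * b ^+ (N - i) by rewrite -exprD subnKC.
ring.
Qed.

Lemma alpha_ev : b ^+ N * ev alpha = 1.
Proof.
rewrite -(calA_eq1 l_pr l_ge5) /calA /alpha ev_sum mulr_sumr; apply: eq_bigr => i _.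
have := ltn_ord i; rewrite ltnS => iN.
rewrite -!mulrA [in RHS]ac_xr // evM ev_nat; ring.
Qed.

Lemma pi3_ev : pi3 = 6%:R * b ^+ N.+1 * ev betaX.
Proof.
rewrite /pi3 [b ^+ N.+1]exprS.
have -> : 6%:R * a * b * calB l = 6%:R * (a * b * calB l) by ring.
suff -> : a * b * calB l = b * (b ^+ N * ev betaX) by ring.
rewrite mulrAC mulrC; congr (_ * _).
rewrite /calB /betaX ev_sum !mulr_sumr; apply: eq_bigr => i _.
have := ltn_ord i; rewrite ltnS => iN.
have -> : a * ((i * Csq i)%:R * a ^+ i.-1 * c ^+ (N - i)) = (Csq i)%:R * (i%:R * a ^+ i.-1 * a) * c ^+ (N - i).
  by rewrite natrM; ring.
rewrite pow_pred -!mulrA [in LHS]ac_xr // [in RHS]evM ev_nat natrM; ring.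
Qed.

(** The effect of vt - 1 on pser b^d h(xr), read on h. Inserting b^N alpha = 1 in the second summand
    brings both to the common factor b^(d + N + 1). *)
Definition Dop d (h : {poly F}) : {poly F} :=
  ((4 * d)%:R - 1) * 6%:R * betaX * h +
  alpha * (12%:R * ('X * (1 + 'X) * h^`()) - (12 * d)%:R * 'X * h - (1 - 'X) * h).

Definition vts (f : series F) := vt f - f.

Lemma vts_step d h : vts (pser * (b ^+ d * ev h)) = pser * (b ^+ (d + N.+1) * ev (Dop d h)).
Proof.
rewrite /vts (vt_pser l_pr l_ge5); congr (_ * _).
rewrite (vtM (b ^+ d)) (vtX b) (vt_ev l_pr l_ge5) (vt_b l_pr l_ge5).
set e' := ev ('X * _ * _).
have -> : d%:R * b ^+ d.-1 * (4%:R * b * (pi3 - 3%:R * a)) * ev h = 4%:R * (d%:R * b ^+ d.-1 * b) * (pi3 - 3%:R * a) * ev h by ring.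
rewrite pow_pred /Dop !(evD, evN, evM, evX, ev1, ev_nat) -!/e'.
have A1 := alpha_ev.
rewrite pi3_ev exprD -b_xr.
have -> : 4%:R * (d%:R * b ^+ d) * (6%:R * b ^+ N.+1 * ev betaX - 3%:R * (b * xr)) * ev h +
  b ^+ d * (12%:R * b * e') - (6%:R * b ^+ N.+1 * ev betaX + b - b * xr) * (b ^+ d * ev h) =
  b ^+ d * (b ^+ N.+1 * ((4%:R * d%:R - 1) * 6%:R * ev betaX * ev h)
   + b * (12%:R * e' - 12%:R * d%:R * xr * ev h - (1 - xr) * ev h) * (b ^+ N * ev alpha)) by rewrite A1; ring.
have E' : e' = xr * (1 + xr) * ev h^`() by rewrite /e' !(evM, evD, evX, ev1).
rewrite E' [b ^+ N.+1]exprS ?natrM; ring.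
Qed.

Fixpoint hseq j : {poly F} := if j is j'.+1 then Dop (j' * N.+1) (hseq j') else 1.

Lemma iter_vts j : iter j vts pser = pser * (b ^+ (j * N.+1) * ev (hseq j)).
Proof.
elim: j => [|j IH]; first by rewrite /= expr0 ev1 !mulr1.
by rewrite iterS IH vts_step mulSn addnC.
Qed.

Lemma iter_vtsE j (f : series F) n : iter j vts f n = (n%:R - 1) ^+ j * f n.
Proof.
elim: j => [|j IH]; first by rewrite expr0 mul1r.
by rewrite iterS /vts subsE vtE IH exprS; ring.
Qed.

Lemma size_linX n : (size ((1 + 'X : {poly F}) ^+ n)%R <= n.+1)%N.
Proof.
apply: leq_trans (size_poly_exp_leq _ _) _.
by rewrite addrC size_XaddC /= mul1n.
Qed.

Lemma size_term i k : (i <= N)%N -> (size (k%:R * 'X^i * (1 + 'X) ^+ (N - i) : {poly F})%R <= N.+1)%N.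
Proof.
move=> iN; have -> : N.+1 = ((0 + i) + (N - i)).+1 by rewrite add0n subnKC.
apply: size_mul_leqS (size_linX _); apply: size_mul_leqS; last by rewrite size_polyXn.
by rewrite -polyC_natr size_polyC; case: eqP.
Qed.

Lemma size_alpha : (size alpha <= N.+1)%N.
Proof.
apply: leq_trans (size_sum _ _ _) _; apply/bigmax_leqP => i _.
by apply: size_term; rewrite -ltnS.
Qed.
Lemma size_betaX : (size betaX <= N.+1)%N.
Proof.
apply: leq_trans (size_sum _ _ _) _; apply/bigmax_leqP => i _.
by apply: size_term; rewrite -ltnS.
Qed.

Lemma alpha_top : alpha`_N = (-1) ^+ N.
Proof.
rewrite coef_sum -(bin_lN l_pr l_ge5) -addnn -binomial.Vandermonde natr_sum.
apply: eq_bigr => i _; have := ltn_ord i; rewrite ltnS => iN.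
have E : ((0 + i) + (N - i))%N = N by rewrite add0n subnKC.
rewrite -[X in _`_X]E.
rewrite coefM_top ?size_linX //; last first.
  by apply: size_mul_leqS; rewrite ?size_polyXn // -polyC_natr size_polyC; case: eqP.
rewrite coefM_top ?size_polyXn //; last by rewrite -polyC_natr size_polyC; case: eqP.
rewrite coefXn eqxx -polyC_natr coefC eqxx mulr1.
have -> : ((1 + 'X : {poly F}) ^+ (N - i))`_(N - i) = 1.
  by have := coef_linX (1 : F) 1 (N - i) (N - i); rewrite polyC1 mul1r binn !expr1n mulr1 mulr1n => <-.
by rewrite mulr1 CsqE natrM bin_sub.
Qed.

Lemma hnat k (x : F) : (k%:R : {poly F}).[x] = k%:R.
Proof. by rewrite -polyC_natr hornerC. Qed.

Lemma hone (x : F) : (1 : {poly F}).[x] = 1.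
Proof. exact: hornerC. Qed.

Lemma alpha_0 : alpha.[0] = 1.
Proof.
rewrite horner_sum big_ord_recl big1 ?addr0 => [|i _].
  by rewrite !hornerE /= !expr1n mulr1 /Csq bin0 -polyC_natr hornerC.
by rewrite !hornerE /= expr0n /= mulr0 mul0r.
Qed.

Lemma sum_m1 (k : nat -> nat) :
  (\sum_(i < N.+1) (k i)%:R * 'X^i * (1 + 'X) ^+ (N - i) : {poly F}).[-1] = (k N)%:R * (-1) ^+ N.
Proof.
rewrite horner_sum big_ord_recr big1 ?add0r => [|i _] /=.
  by rewrite subnn expr0 mulr1 hornerM hornerXn hnat add0r.
rewrite hornerM horner_exp hornerD hornerX hone subrr expr0n.
by rewrite subn_eq0 leqNgt ltn_ord /= mulr0.
Qed.
Lemma alpha_m1 : alpha.[-1] = (-1) ^+ N.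
Proof. by rewrite sum_m1 /Csq binn mul1r. Qed.
Lemma betaX_m1 : betaX.[-1] = N%:R * (-1) ^+ N.
Proof. by rewrite (sum_m1 (fun i => i * Csq i)%N) /Csq binn muln1. Qed.
Lemma betaX_0 : betaX.[0] = 0.
Proof.
rewrite horner_sum big1 // => -[[|i] iP] _ /=; first by rewrite mul0n !mul0r horner0.
by rewrite !hornerE /= expr0n /= mulr0 mul0r.
Qed.

Lemma Dop_0 d h : (Dop d h).[0] = - h.[0].
Proof.
rewrite /Dop !(hornerD, hornerM, hornerN, hornerX, hone, hnat, alpha_0, betaX_0); ring.
Qed.

Lemma Dop_m1 d h : (Dop d h).[-1] = (-1) ^+ N * h.[-1].
Proof.
rewrite /Dop !(hornerD, hornerM, hornerN, hornerX, hone, hnat, alpha_m1, betaX_m1).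
rewrite !natrM /=.
have -> : (4%:R * d%:R - 1) * 6%:R * (N%:R * (-1) ^+ N) * h.[-1] = (4%:R * d%:R - 1) * 3%:R * (2%:R * N%:R) * (-1) ^+ N * h.[-1] :> F by ring.
rewrite twoN; ring.
Qed.

Lemma size_Dop d (h : {poly F}) : (size h <= d.+1)%N -> (size (Dop d h) <= (d + N.+1).+1)%N /\
  (Dop d h)`_(d + N.+1) = (-1) ^+ N * h`_d.
Proof.
move=> sh.
pose g : {poly F} := 12%:R * ('X * (1 + 'X) * h^`()) - (12 * d)%:R * 'X * h - (1 - 'X) * h.
have gE : g = (12%:R *: h^`() + 1 *: h - (12 * d)%:R *: h) * 'X + 12%:R *: h^`() * 'X^2 - h.
  by rewrite /g -!mul_polyC !polyC_natr; ring.
have sh' : (size h^`() <= d)%N.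
  by apply: leq_trans (size_poly _ _) _; rewrite -subn1 leq_subLR add1n.
have cg k : g`_k.+1 = 12%:R * (h`_k.+1 * k.+1%:R) + h`_k - (12 * d)%:R * h`_k + (if k is k'.+1 then 12%:R * (h`_k * k%:R) else 0) - h`_k.+1.
  rewrite gE !(coefD, coefN, coefMX, coefMXn, coefZ) /= coef_deriv mul1r mulr_natr.
  by case: k => [|k]; rewrite //= subn2 /= ?coefZ ?coef_deriv ?mulr_natr //.
have sg : (size g <= d.+2)%N.
  apply/leq_sizeP => -[//|k] dk; rewrite cg.
  have h0 j : (d < j)%N -> h`_j = 0 by move=> ?; rewrite nth_default //; apply: leq_trans sh _.
  rewrite !h0 //; last by lia.
  by case: k dk => [|k] dk; rewrite ?mul0r ?mulr0 ?addr0 ?subr0 ?addr0.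
have gtop : g`_d.+1 = h`_d.
  rewrite cg nth_default; last exact: sh.
  rewrite mul0r mulr0 natrM; case: (d) => [|d']; ring.
have sA := size_alpha; have sB := size_betaX.
have s1 : (size (((4 * d)%:R - 1) * 6%:R * betaX * h)%R <= d + N.+1)%N.
  have -> : ((4 * d)%:R - 1) * 6%:R * betaX * h = (((4 * d)%:R - 1) * 6%:R) *: (betaX * h) :> {poly F}.
    by rewrite -mul_polyC rmorphM rmorphB rmorph1 /= !polyC_natr -!mulrA.
  apply: leq_trans (size_scale_leq _ _) _.
  by apply: leq_trans (size_mul_leqS sB sh) _; rewrite addnC addnS.
have s2 : (size (alpha * g)%R <= (N + d.+1).+1)%N := size_mul_leqS sA sg.
have e : (d + N.+1 = N + d.+1)%N by lia.
split.
  rewrite /Dop -/g; apply: leq_trans (size_polyD _ _) _; rewrite geq_max.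
  by rewrite (leq_trans s1) //= (leq_trans s2) // e.
by rewrite /Dop -/g coefD nth_default // add0r e coefM_top // alpha_top gtop.
Qed.

(** The top coefficient and the values at 0 and -1 describe the three cusps. [Dop] multiplies each
    of them by a sign, so they are known although the polynomials are not. *)
Lemma hseq_props j : [/\ (size (hseq j) <= (j * N.+1).+1)%N,
  (hseq j)`_(j * N.+1) = (-1) ^+ (N * j), (hseq j).[0] = (-1) ^+ j &
  (hseq j).[-1] = (-1) ^+ (N * j)].
Proof.
elim: j => [|j [IH1 IH2 IH3 IH4]].
  by rewrite /= muln0 !expr0 coefC size_poly1 !hone.
have [s1 s2] := size_Dop IH1.
have -> : (j.+1 * N.+1 = j * N.+1 + N.+1)%N by rewrite mulSn addnC.
rewrite /=; split => //; first by rewrite s2 IH2 -exprD mulnS.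
  by rewrite Dop_0 IH3 exprS mulN1r.
by rewrite Dop_m1 IH4 -exprD mulnS.
Qed.

Lemma alphaX_props j : [/\ (size (alpha ^+ j)%R <= (j * N).+1)%N,
  (alpha ^+ j)`_(j * N) = (-1) ^+ (N * j), (alpha ^+ j).[0] = 1 &
  (alpha ^+ j).[-1] = (-1) ^+ (N * j)].
Proof.
rewrite !horner_exp alpha_0 alpha_m1 expr1n -exprM; split => //.
  elim: j => [|j IH]; first by rewrite expr0 size_poly1.
  by rewrite exprS mulSn; apply: size_mul_leqS => //; exact: size_alpha.
elim: j => [|j IH]; first by rewrite muln0 !expr0 coefC.
rewrite exprS mulSn coefM_top ?IH ?alpha_top ?mulnS ?exprD //; first exact: size_alpha.
elim: (j) => [|j' IH']; first by rewrite expr0 size_poly1.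
by rewrite exprS mulSn; apply: size_mul_leqS => //; exact: size_alpha.
Qed.

(** Both projections involve 2N derivations, each raising the degree by N + 1. *)
Definition deg := (2 * N * N.+1)%N.
Lemma N_ge2 : (2 <= N)%N. Proof. by have := lE l_pr l_ge5; lia. Qed.

(* [eta^11] times a form in [a = th2^4] and [b = th4^4]; the factor [16 eta^12 = a b c] absorbed the pole of [1/eta]. *)
Definition theta_comb (h : {poly F}) : series F :=
  16%:R * eta ^+ 11 * \sum_(i < (deg - 3).+1) sC h`_i * a ^+ i * b ^+ (deg - 3 - i).

(** The three conditions make b^deg H(xr) divisible by b, a and c, hence by a b c = 16 eta^12; and
    eta^12 [pser] is X eta^11. *)
Lemma theta_factor (H : {poly F}) : (size H <= deg.+1)%N -> H`_deg = 0 -> H.[0] = 0 -> H.[-1] = 0 ->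
  exists h, pser * (b ^+ deg * ev H) = sX F 1 * theta_comb h.
Proof.
move=> sH Hd H0 H1.
have d3 : (3 <= deg)%N by have := N_ge2; rewrite /deg; nia.
have [q Hq] : exists q, H = q * 'X by exists (H %/ 'X); rewrite divpK // -['X]subr0 -polyC0 dvdp_XsubCl; apply/rootP.
have [h qh] : exists h, q = h * (1 + 'X).
  exists (q %/ (1 + 'X)); rewrite divpK //.
  have -> : (1 + 'X : {poly F}) = 'X - (-1)%:P by rewrite rmorphN opprK addrC.
  rewrite dvdp_XsubCl; apply/rootP; move: H1; rewrite Hq hornerM hornerX => /eqP.
  by rewrite mulf_eq0 oppr_eq0 oner_eq0 orbF => /eqP.
exists h.
have sh : (size h <= (deg - 3).+1)%N.
  have sH' : (size H <= deg)%N.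
    apply/leq_sizeP => j; rewrite leq_eqVlt => /orP [/eqP <- //|dj].
    by rewrite nth_default //; apply: leq_trans sH _.
  have [->|h0] := eqVneq h 0; first by rewrite size_poly0.
  move: sH'; rewrite Hq qh size_mulX ?mulf_neq0 // ?monic_neq0 //; last first.
    by rewrite addrC -[1]/(1%:P) -(opprK 1%:P) -polyCN monicXsubC.
  by rewrite -[1]/(1%:P) addrC -(opprK 1%:P) -polyCN size_Mmonic ?monicXsubC // size_XsubC; lia.
have evh : b ^+ (deg - 3) * ev h = \sum_(i < (deg - 3).+1) sC h`_i * a ^+ i * b ^+ (deg - 3 - i).
  rewrite /ev (horner_coef_wide _ (n := (deg - 3).+1)); last by apply: leq_trans (size_poly _ _) _.
  rewrite mulr_sumr; apply: eq_bigr => i _; have := ltn_ord i; rewrite ltnS => iN.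
  rewrite coef_map /= -b_xr [(b * xr) ^+ i]exprMn.
  have -> : b ^+ (deg - 3) = b ^+ i * b ^+ (deg - 3 - i) by rewrite -exprD subnKC.
  ring.
rewrite /theta_comb -evh Hq qh !evM evD ev1 evX.
have -> : b ^+ deg = b ^+ (deg - 3) * b ^+ 3 by rewrite -exprD subnK.
transitivity (pser * ((b * xr) * b * (b * (1 + xr))) * (b ^+ (deg - 3) * ev h)); first by ring.
rewrite b_xr c_xr -(eta_12 F2) -(eta_pser F); ring.
Qed.

(** The factor 1 - m^(l-1) is the indicator of l | m. The series itself, written with 1 = (b^N
    alpha)^(2N+2), and its 2N-th derivative have the same degree and the same three cusp values. *)
Lemma theta_rep0 : exists h, forall m, (1 - (m%:R : F) ^+ l.-1) * (p_div24 m)%:R = theta_comb h m.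
Proof.
have dE : deg = (N.*2 * N.+1)%N by rewrite /deg mul2n.
pose H := alpha ^+ (N.*2.+2) - hseq N.*2.
have [a1 a2 a3 a4] := alphaX_props N.*2.+2; have [h1 h2 h3 h4] := hseq_props N.*2.
have eN : (N.*2.+2 * N = deg)%N by rewrite /deg; lia.
rewrite eN in a1 a2; rewrite -dE in h1 h2.
have sgn : (-1) ^+ (N * N.*2.+2) = 1 :> F by rewrite -signr_odd oddM /= odd_double andbF.
have sgn' : (-1) ^+ (N * N.*2) = 1 :> F by rewrite -signr_odd oddM odd_double andbF.
have [||||h hE] := @theta_factor H.
- by apply: leq_trans (size_polyD _ _) _; rewrite size_polyN geq_max a1 h1.
- by rewrite coefB a2 h2 sgn sgn' subrr.
- by rewrite hornerD hornerN a3 h3 -signr_odd odd_double subrr.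
- by rewrite hornerD hornerN a4 h4 sgn sgn' subrr.
exists h => m; have := congr1 (fun f : series F => f m.+1) hE.
rewrite sXM /= subSS subn0 => <-.
have -> : pser * (b ^+ deg * ev H) = pser - iter N.*2 vts pser.
  rewrite iter_vts -dE /H evB evXn mulrBr mulrBr -[deg in X in X - _]eN mulnC exprM -exprMn.
  by rewrite alpha_ev expr1n mulr1.
rewrite subsE iter_vtsE -[m.+1%:R]natr1 addrK.
have -> : l.-1 = N.*2 by have := lE l_pr l_ge5; lia.
have -> : pser m.+1 = (p_div24 m)%:R by rewrite /pser /p_div24; case: ifP.
ring.
Qed.

(** By Euler's criterion the factor is the indicator of (-m/l) = -1. The factor alpha^(N+1) brings
    the N-th derivative to degree [deg]. At 0 the two terms cancel; with a plus sign, as for the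
    symbol 1, the value 1 would remain, which is the pole of 1/eta. *)
Lemma theta_rep1 : exists h, forall m,
  2%:R^-1 * ((m%:R : F) ^+ l.-1 - (- m%:R) ^+ N) * (p_div24 m)%:R = theta_comb h m.
Proof.
have dE : deg = (N.*2 * N.+1)%N by rewrite /deg mul2n.
pose H := (2%:R^-1)%:P * (hseq N.*2 - (-1) ^+ N * alpha ^+ N.+1 * hseq N).
have [a1 a2 a3 a4] := alphaX_props N.+1; have [h1 h2 h3 h4] := hseq_props N.*2.
have [g1 g2 g3 g4] := hseq_props N.
have eN : (N.+1 * N + N * N.+1 = deg)%N by rewrite /deg; lia.
rewrite -dE in h1 h2.
have sgn' : (-1) ^+ (N * N.*2) = 1 :> F by rewrite -signr_odd oddM odd_double andbF.
have sgn1 : (-1) ^+ (N * N.+1) = 1 :> F by rewrite -signr_odd oddM /= andbN.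
have sgn2 : (-1) ^+ (N * N) = (-1) ^+ N :> F by rewrite -signr_odd oddM andbb signr_odd.
have sgnN : (-1) ^+ N * (-1) ^+ N = 1 :> F by rewrite -expr2 sqrr_sign.
have signP : ((-1) ^+ N : {poly F}) = ((-1) ^+ N)%:P by rewrite rmorphXn rmorphN rmorph1.
have sg : (size (alpha ^+ N.+1 * hseq N)%R <= deg.+1)%N by rewrite -eN; exact: size_mul_leqS.
have tg : (alpha ^+ N.+1 * hseq N)`_deg = (-1) ^+ N by rewrite -eN coefM_top // a2 g2 sgn1 mul1r sgn2.
have [||||h hE] := @theta_factor H.
- rewrite /H mul_polyC; apply: leq_trans (size_scale_leq _ _) _.
  apply: leq_trans (size_polyD _ _) _; rewrite size_polyN geq_max h1 /= -mulrA signP mul_polyC.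
  exact: leq_trans (size_scale_leq _ _) _.
- by rewrite coefCM coefB h2 sgn' -mulrA signP coefCM tg sgnN subrr mulr0.
- by rewrite hornerM hornerC hornerD hornerN !hornerM signP !hornerC h3 a3 g3 -signr_odd odd_double mulr1 sgnN subrr mulr0.
- by rewrite hornerM hornerC hornerD hornerN !hornerM signP !hornerC h4 a4 g4 sgn' sgn1 mulr1 sgn2 sgnN subrr mulr0.
exists h => m; have := congr1 (fun f : series F => f m.+1) hE.
rewrite sXM /= subSS subn0 => <-.
have -> : pser * (b ^+ deg * ev H) = sC (2%:R^-1) * (iter N.*2 vts pser - sC ((-1) ^+ N) * iter N vts pser).
  rewrite !iter_vts -dE /H evM evC evB -mulrA !evM evXn signP evC.
  have -> : b ^+ deg * (sC 2%:R^-1 * (ev (hseq N.*2) - sC ((-1) ^+ N) * (ev alpha ^+ N.+1 * ev (hseq N)))) =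
    sC 2%:R^-1 * (b ^+ deg * ev (hseq N.*2) - sC ((-1) ^+ N) * (b ^+ deg * ev alpha ^+ N.+1 * ev (hseq N))) by ring.
  have -> : b ^+ deg * ev alpha ^+ N.+1 = b ^+ (N * N.+1).
    have e1 : b ^+ (N.+1 * N) = (b ^+ N) ^+ N.+1 by rewrite -(exprM b N N.+1) [(N.+1 * N)%N]mulnC.
    by rewrite -eN exprD e1 mulrAC -[_ ^+ N.+1 * _ ^+ N.+1]exprMn alpha_ev expr1n mul1r.
  ring.
rewrite sCE subsE sCE !iter_vtsE -[m.+1%:R]natr1 addrK.
have -> : l.-1 = N.*2 by have := lE l_pr l_ge5; lia.
have -> : pser m.+1 = (p_div24 m)%:R by rewrite /pser /p_div24; case: ifP.
rewrite [(- m%:R) ^+ N]exprNn; ring.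
Qed.
End Modl3.
End PartitionTheta.

(** * Theta products as weighted sums over a diagonal lattice *)

Module LatticeSums.
Import structures.
Import all_boot all_order all_algebra all_fingroup all_solvable all_field.
Import boolp classical_sets functions cardinality fsbigop.
Import finmap.
Import zify ring lra.
Import Defs.
Import FormalSeries WeightedSeries ThetaFunctions EtaFunction LegendrePolynomial ThetaDerivatives PartitionTheta.
Import Order.TTheory GRing.Theory Num.Theory.
Local Open Scope classical_set_scope.
Local Open Scope ring_scope.

Definition Qf r (k : 'I_r -> nat) (v : 'rV[int]_r) : nat := (\sum_j tq (k j) (v ord0 j))%N.

Definition vcons r (p : int * 'rV[int]_r) : 'rV[int]_r.+1 :=
  \row_j (if unlift ord0 j is Some j' then p.2 ord0 j' else p.1).
Lemma vcons0 r (p : int * 'rV[int]_r) : vcons p ord0 ord0 = p.1.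
Proof. by rewrite mxE unlift_none. Qed.
Lemma vconsS r (p : int * 'rV[int]_r) j : vcons p ord0 (lift ord0 j) = p.2 ord0 j.
Proof. by rewrite mxE liftK. Qed.
Lemma vcons_inj r : injective (@vcons r).
Proof.
move=> [x v] [y w] /rowP h; congr (_, _); first by have := h ord0; rewrite !vcons0.
by apply/rowP => j; have := h (lift ord0 j); rewrite !vconsS.
Qed.
Lemma vcons_surj r (v : 'rV[int]_r.+1) : exists p, vcons p = v.
Proof.
exists (v ord0 ord0, \row_j v ord0 (lift ord0 j)); apply/rowP => j.
by case: (unliftP ord0 j) => [j'|] ->; rewrite ?vconsS ?vcons0 ?mxE.
Qed.
Lemma Qf_vcons r (k : 'I_r.+1 -> nat) p :
  Qf k (vcons p) = (tq (k ord0) p.1 + Qf (fun j => k (lift ord0 j)) p.2)%N.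
Proof. by rewrite /Qf big_ord_recl vcons0; congr addn; apply: eq_bigr => j _; rewrite vconsS. Qed.

Lemma finfib_Qf r (k : 'I_r -> nat) : (forall j, 0 < k j)%N -> finfib (Qf k).
Proof.
elim: r k => [|r IH] k k0 n.
  by apply: (@sub_finite_set _ _ [set 0]); [move=> v _ /=; apply/rowP => -[]|exact: finite_set1].
have fp := finfib_pair (finfib_tq (k0 ord0)) (IH (fun j => k (lift ord0 j)) (fun j => k0 _)).
apply: (@sub_finite_set _ _ (@vcons r @` [set p | (tq (k ord0) p.1 + Qf (fun j => k (lift ord0 j)) p.2)%N = n])); last exact/finite_image/fp.
by move=> v /= vn; have [p pv] := vcons_surj v; exists p => //=; rewrite -Qf_vcons pv.
Qed.

Section Prod.
Variable F : comNzRingType.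
Lemma prod_ws r (k : 'I_r -> nat) (psi : 'I_r -> int -> F) : (forall j, 0 < k j)%N ->
  \prod_j ws (tq (k j)) (psi j) = ws (Qf k) (fun v => \prod_j psi j (v ord0 j)).
Proof.
elim: r k psi => [|r IH] k psi k0.
  rewrite big_ord0; apply/funext => n; rewrite oneE /ws.
  case: (eqVneq n 0%N) => [->|n0].
    rewrite (_ : [set t | Qf k t = 0%N] = [set 0]) ?fsbig_set1 ?big_ord0 //.
    by apply/seteqP; split => v _ /=; [apply/rowP => -[]|rewrite /Qf big_ord0].
  by rewrite fsbig1 // => v /=; rewrite /Qf big_ord0 => h; rewrite -h eqxx in n0.
rewrite big_ord_recl IH // ws_mul; [|exact: finfib_tq|exact: finfib_Qf].
symmetry; apply: (ws_reindex (@vcons_inj r)) => [p|p|v _]; last exact: vcons_surj.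
  exact: Qf_vcons.
by rewrite big_ord_recl vcons0; congr (_ * _); apply: eq_bigr => j _; rewrite vconsS.
Qed.

Lemma ws_sum (T : choiceType) (q : T -> nat) n (psi : nat -> T -> F) : finfib q ->
  \sum_(i < n) ws q (psi i) = ws q (fun t => \sum_(i < n) psi i t).
Proof.
move=> fq; elim: n => [|n IH].
  rewrite big_ord0; apply/funext => m; rewrite zeroE /ws fsbig1 // => t _.
  by rewrite big_ord0.
by rewrite big_ord_recr /= IH wsD //; apply: eq_ws => t; rewrite big_ord_recr.
Qed.
End Prod.

Definition chi12 (F : fieldType) (x : int) : F :=
  if ((x %% 12)%Z == 1) || ((x %% 12)%Z == 11) then 1 else
  if ((x %% 12)%Z == 5) || ((x %% 12)%Z == 7) then -1 else 0.

(** Symmetrising under x -> -x doubles eta, but replaces [weta] by the character [chi12]; its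
    multiplicativity is what gives Psi (m v) = +-Psi v. *)
Lemma eta_chi12 (F : fieldType) : 2%:R * eta F = ws (tq 1) (@chi12 F).
Proof.
have e : eta F = ws (tq 1) (fun x => weta F (- x)).
  apply: (ws_reindex (h := fun x : int => - x)); [exact: oppr_inj| | |].
  - by move=> x; rewrite /tq abszN.
  - by [].
  - by move=> x _; exists (- x); rewrite opprK.
rewrite mulr_natl mulr2n {2}e /eta wsD; last exact: finfib_tq.
apply: eq_ws => x; rewrite /weta /chi12.
do ![case: eqP => /= ?]; rewrite ?(addr0, add0r) //; lia.
Qed.

Lemma mod12_cases (x : int) : exists y, [/\ (x %% 12)%Z = Posz y, (y < 12)%N, (x %% 2)%Z = Posz (y %% 2) & (x %% 4)%Z = Posz (y %% 4)].
Proof. by exists (absz (x %% 12)%Z); split; lia. Qed.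

Section Rep.
Variable l : nat.
Hypotheses (l_pr : prime l) (l_ge5 : (5 <= l)%N).
Local Notation F := 'F_l.

Lemma chi12_mod (x y : int) : (x = y %[mod 12])%Z -> chi12 F x = chi12 F y.
Proof. by rewrite /chi12 => ->. Qed.
Lemma w2_mod (x y : int) : (x = y %[mod 12])%Z -> w2 F x = w2 F y.
Proof. by rewrite /w2 => h; have -> : (x %% 2 = y %% 2)%Z by lia. Qed.
Lemma w4_mod (x y : int) : (x = y %[mod 12])%Z -> w4 F x = w4 F y.
Proof. by rewrite /w4 => h; have -> : (x %% 4 = y %% 4)%Z by lia. Qed.

Lemma coprime6 m : prime m -> (5 <= m)%N -> ((m %% 12)%N == 1) || ((m %% 12)%N == 11) || ((m %% 12)%N == 5) || ((m %% 12)%N == 7).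
Proof.
move=> pm m5; have h2 : ~~ (2 %| m)%N by rewrite dvdn_prime2 //; lia.
have h3 : ~~ (3 %| m)%N by rewrite dvdn_prime2 //; lia.
lia.
Qed.

Lemma chi12_mul m (x : int) : prime m -> (5 <= m)%N -> chi12 F (m%:Z * x) = chi12 F m%:Z * chi12 F x.
Proof.
move=> pm m5; have := coprime6 pm m5.
have [y [xy y12 _ _]] := mod12_cases x.
have -> : chi12 F (m%:Z * x) = chi12 F (((m %% 12) * y)%N%:Z).
  by apply: chi12_mod; rewrite -modzMml -modzMmr xy modz_nat PoszM.
have -> : chi12 F x = chi12 F y by apply: chi12_mod; lia.
have -> : chi12 F m%:Z = chi12 F (m %% 12)%N by apply: chi12_mod; lia.
do ![case/orP] => /eqP ->; move: y y12 {xy} => [|[|[|[|[|[|[|[|[|[|[|[|//]]]]]]]]]]]] _; rewrite /chi12 /=; ring.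
Qed.

Lemma chi12_sgn m : prime m -> (5 <= m)%N -> chi12 F m%:Z = 1 \/ chi12 F m%:Z = -1.
Proof. by move=> pm m5; have := coprime6 pm m5; rewrite /chi12 modz_nat !eqz_nat; do ![case/orP] => /eqP ->; [left|left|right|right]. Qed.

Lemma w2_mul m (x : int) : prime m -> (5 <= m)%N -> w2 F (m%:Z * x) = w2 F x.
Proof.
move=> pm m5; rewrite /w2; have := coprime6 pm m5 => h.
suff -> : (m%:Z * x %% 2 = x %% 2)%Z by [].
have [k ->] : exists k, m = (k * 2 + 1)%N by exists (m %/ 2)%N; lia.
have -> : (k * 2 + 1)%N%:Z * x = (k%:Z * x) * 2 + x by rewrite PoszD PoszM; ring.
by rewrite modzMDl.
Qed.
Lemma w4_mul m (x : int) : prime m -> (5 <= m)%N -> w4 F (m%:Z * x) = w4 F x.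
Proof.
move=> pm m5; rewrite /w4; have := coprime6 pm m5 => h.
have [k ->] : exists k, m = (k * 2 + 1)%N by exists (m %/ 2)%N; lia.
have -> : (k * 2 + 1)%N%:Z * x = (k%:Z * x) * 2 + x by rewrite PoszD PoszM; ring.
set z := k%:Z * x.
have zx : (x %% 2)%Z = 0 -> (z %% 2)%Z = 0.
  by move=> x0; rewrite /z -modzMmr x0 mulr0 mod0z.
have [[e1|e1]|x1] : ((x %% 4)%Z = 1 \/ (x %% 4)%Z = 3) \/ (x %% 2)%Z = 0 by lia.
- do ![case: eqP => /= ?] => //; exfalso; lia.
- do ![case: eqP => /= ?] => //; exfalso; lia.
- by have -> : ((z * 2 + x) %% 4 = x %% 4)%Z by have := zx x1; lia.
Qed.

(** Eleven coordinates carry eta^11 and 4 (deg - 3) carry the products of th2^4 and th4^4. All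
    monomials live on one lattice and differ only in their weights. Scaling by m multiplies each
    weight by chi12(m)^11 = chi12(m). *)
Lemma lattice_rep (h : {poly F}) : exists r (k : 'I_r -> nat) (Psi : 'rV[int]_r -> F),
  [/\ odd r, (2 < r)%N, forall j, k j = 1%N \/ k j = 3%N &
   [/\ forall v w : 'rV[int]_r, (forall j, (v ord0 j = w ord0 j %[mod 12])%Z) -> Psi v = Psi w,
    forall m, prime m -> (5 <= m)%N -> exists2 s : F, (s = 1 \/ s = -1) & forall v, Psi (m%:Z *: v) = s * Psi v &
    forall n, theta_comb h n = ws (Qf k) Psi n]].
Proof.
pose D := (deg l - 3)%N; pose r := (11 + 4 * D)%N.
pose k (j : nat) := if (j < 11)%N then 1%N else 3%N.
pose psi i (j : nat) : int -> F := if (j < 11)%N then @chi12 F else if (j < 11 + 4 * i)%N then @w2 F else @w4 F.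
have r11 : (11 <= r)%N := leq_addr _ _.
have k0 (j : nat) : (0 < k j)%N by rewrite /k; case: ifP.
(* The factor 2^(-11) compensates for 2 eta in place of eta. *)
pose Psi (v : 'rV[int]_r) : F := \sum_(i < D.+1) 16%:R * 2%:R^-1 ^+ 11 * h`_i * \prod_(j < r) psi i j (v ord0 j).
exists r, (fun j => k j), Psi; split.
- by rewrite /r oddD oddM.
- by rewrite /r; lia.
- by move=> j; rewrite /k; case: ifP; [left|right].
split.
- move=> v w vw; apply: eq_bigr => i _; congr (_ * _); apply: eq_bigr => j _.
  by rewrite /psi; case: ifP => _; [|case: ifP => _]; [apply: chi12_mod|apply: w2_mod|apply: w4_mod].
- move=> m pm m5; exists (chi12 F m%:Z); first exact: chi12_sgn.
  move=> v; rewrite /Psi mulr_sumr; apply: eq_bigr => i _.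
  rewrite [RHS]mulrCA; congr (_ * _).
  have c11 : \prod_(j < r) (if (j < 11)%N then chi12 F m%:Z else 1) = chi12 F m%:Z.
    rewrite -(big_mkord xpredT (fun j => if (j < 11)%N then chi12 F m%:Z else 1)) (big_cat_nat (n := 11)) //=.
    rewrite [X in _ * X]big_nat [X in _ * X]big1 ?mulr1 => [|j /andP [h1 _]]; last by rewrite ltnNge h1.
    rewrite big_nat (eq_bigr (fun=> chi12 F m%:Z)) => [|j /andP [_ ->] //].
    rewrite -big_nat prodr_const_nat subn0.
    by case: (chi12_sgn pm m5) => ->; rewrite ?expr1n // -signr_odd.
  rewrite -[in RHS]c11 -big_split /=; apply: eq_bigr => j _; rewrite mxE /psi.
  by case: ifP => _; [rewrite chi12_mul|case: ifP => _; rewrite ?w2_mul ?w4_mul ?mul1r].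
- move=> n.
  have e : theta_comb h = \sum_(i < D.+1) ws (Qf (fun j : 'I_r => k j)) (fun v => 16%:R * 2%:R^-1 ^+ 11 * h`_i * \prod_(j < r) psi i j (v ord0 j)).
    rewrite /theta_comb mulr_sumr; apply: eq_bigr => i _.
    rewrite -wsZ; last exact: finfib_Qf.
    rewrite -(prod_ws (k := fun j : 'I_r => k j) (fun j => psi i j)) //.
    rewrite -(big_mkord xpredT (fun j => ws (tq (k j)) (psi i j))) (big_cat_nat (n := 11)) //=.
    rewrite (big_cat_nat (m := 11) (n := 11 + 4 * i)) /=; [|lia|by rewrite /r leq_add2l leq_mul2l /=; have := ltn_ord i; lia].
    have iD := ltn_ord i.
    rewrite (eq_big_nat _ _ (F2 := fun=> 2%:R * eta F)); last by move=> j /andP [_ jj]; rewrite /k /psi jj eta_chi12.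
    rewrite [X in _ = _ * (_ * (X * _))](eq_big_nat _ _ (F2 := fun=> th2 F)); last first.
      move=> j /andP [j1 j2]; rewrite /k /psi j2.
      by have -> : (j < 11)%N = false by apply/negbTE; rewrite -leqNgt.
    rewrite [X in _ = _ * (_ * (_ * X))](eq_big_nat _ _ (F2 := fun=> th4 F)); last first.
      move=> j /andP [j1 j2]; rewrite /k /psi.
      have -> : (j < 11)%N = false by apply/negbTE; rewrite -leqNgt (leq_trans _ j1) ?leq_addr.
      by rewrite ltnNge j1.
    rewrite !prodr_const_nat subn0 addKn.
    have -> : (r - (11 + 4 * i) = 4 * (D - i))%N by rewrite /r; lia.
    rewrite -/D !exprM [(2%:R * _) ^+ 11]exprMn.
    have -> : sC (16%:R * 2%:R^-1 ^+ 11 * h`_i) = 16%:R * sC (2%:R^-1 : F) ^+ 11 * sC h`_i.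
      by rewrite (rmorphM (@sC F) (16%:R * 2%:R^-1 ^+ 11)) (rmorphM (@sC F) 16%:R) (rmorphXn (@sC F)) (rmorph_nat (@sC F)).
    have half : sC (2%:R^-1 : F) ^+ 11 * 2%:R ^+ 11 = 1.
      by rewrite -exprMn -[X in _ * X](rmorph_nat (@sC F)) -(rmorphM (@sC F) 2%:R^-1) /= mulVf ?F2 // rmorph1 expr1n.
    set A := eta F ^+ 11; set B := (th2 F ^+ 4) ^+ i; set C := (th4 F ^+ 4) ^+ _; set c := sC h`_i.
    have -> : 16%:R * sC 2%:R^-1 ^+ 11 * c * (2%:R ^+ 11 * A * (B * C)) = (sC (2%:R^-1 : F) ^+ 11 * 2%:R ^+ 11) * (16%:R * A * (c * B * C)) by ring.
    by rewrite half mul1r.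
  rewrite e (ws_sum _ (fun i (v : 'rV[int]_r) => 16%:R * 2%:R^-1 ^+ 11 * h`_i * \prod_(j < r) psi i j (v ord0 j))) //.
  exact: finfib_Qf.
Qed.
End Rep.
End LatticeSums.

(** * The Legendre symbol and quadratic Gauss sums *)

Module LegendreSymbol.
Import structures.
Import all_boot all_order all_algebra all_fingroup all_solvable all_field.
Import zify ring lra.
Import Order.TTheory GRing.Theory Num.Theory.
Local Open Scope ring_scope.

Section Legendre.
Variable p : nat.
Hypotheses (p_pr : prime p) (p_odd : odd p).
Local Notation Fp := 'F_p.

Definition leg (a : Fp) : int :=
  if a == 0 then 0 else if [exists x : Fp, x ^+ 2 == a] then 1 else -1.

Lemma p_half : p = (p./2).*2.+1.
Proof. by have := odd_double_half p; rewrite p_odd. Qed.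
Lemma p_gt2 : (2 < p)%N.
Proof. by have := prime_gt1 p_pr; case: (p) p_odd => [|[|[|]]]. Qed.
Lemma pnat_eq0 k : ((k%:R : Fp) == 0) = (p %| k)%N.
Proof. by rewrite -(dvdn_pcharf (pchar_Fp p_pr)). Qed.
Lemma two_neq0 : (2%:R : Fp) != 0.
Proof. by rewrite pnat_eq0 gtnNdvd // p_gt2. Qed.
Lemma Fp_fermat (a : Fp) : a != 0 -> a ^+ p.-1 = 1.
Proof.
move=> a0; apply: (mulfI a0); rewrite -exprS prednK ?prime_gt0 // mulr1.
by have := expf_card a; rewrite card_Fp.
Qed.

Lemma Fp_prim_root : exists z : Fp, p.-1.-primitive_root z.
Proof.
have p1 : (0 < p.-1)%N by have := p_gt2; lia.
have /hasP [z _ zP] : has p.-1.-primitive_root [seq x <- enum Fp | x != 0].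
  apply: has_prim_root => //.
  - by apply/allP => x; rewrite mem_filter => /andP [x0 _]; rewrite unity_rootE Fp_fermat.
  - by rewrite filter_uniq // enum_uniq.
  - rewrite size_filter -(leq_add2r 1) addn1 prednK ?prime_gt0 //.
    have e := count_predC (fun x : Fp => x != 0) (enum Fp); rewrite -cardE card_Fp // in e.
    have c1 : (count (predC (fun x : Fp => x != 0%R)) (enum Fp) <= 1)%N.
      rewrite (eq_count (a2 := pred1 0)); last by move=> x /=; rewrite negbK.
      by rewrite count_uniq_mem ?enum_uniq // leq_b1.
    by move: e c1; set A := count _ _; set B := count _ _; lia.
by exists z.
Qed.

Lemma euler_criterion a : (leg a)%:~R = a ^+ p./2 :> Fp.
Proof.
rewrite /leg; have h0 : (0 < p./2)%N by have := p_half; have := p_gt2; lia.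
case: eqP => [->|/eqP a0]; first by rewrite expr0n; case: (p./2) h0.
have pE : p.-1 = (p./2).*2 by rewrite {1}p_half.
case: ifP => [/existsP [x /eqP xa]|/negbT nsq].
  rewrite -xa -exprM mul2n -pE Fp_fermat //.
  by apply: contraNneq a0 => x0; rewrite -xa x0 expr0n.
have [z zP] := Fp_prim_root.
have [i ai] := prim_rootP zP (Fp_fermat a0).
have io : odd i.
  apply: contraR nsq => ie; apply/existsP; exists (z ^+ (i./2)).
  by rewrite -exprM muln2 ai; apply/eqP; congr (_ ^+ _); have := odd_double_half i; rewrite (negPf ie).
have zh : z ^+ p./2 = -1.
  have : (z ^+ p./2) ^+ 2 == 1 by rewrite -exprM muln2 -pE (prim_expr_order zP).
  rewrite sqrf_eq1 => /orP [h|/eqP //].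
  have := prim_order_dvd zP p./2; rewrite h => dv; have := dvdn_leq h0 dv; rewrite pE; lia.
by rewrite ai -exprM mulnC exprM zh -signr_odd io.
Qed.

Lemma leg_vals a : a != 0 -> leg a = 1 \/ leg a = -1.
Proof. by move=> a0; rewrite /leg (negPf a0); case: ifP; [left|right]. Qed.
Lemma leg_leg a : a != 0 -> leg a * leg a = 1.
Proof. by move=> /leg_vals [] ->. Qed.
Lemma leg0 : leg 0 = 0. Proof. by rewrite /leg eqxx. Qed.
Lemma leg_eq0 a : (leg a == 0) = (a == 0).
Proof. by rewrite /leg; case: (eqVneq a 0) => // _; case: ifP. Qed.

Lemma pint_eq0 (z : int) : ((z%:~R : Fp) == 0) = (p %| absz z)%N.
Proof. by case: z => n; rewrite ?NegzE ?mulrNz ?oppr_eq0 -pmulrn pnat_eq0 ?abszN. Qed.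
(** Identities between symbols are verified in F_p, where 0, 1 and -1 stay distinct because p >
    2. *)
Lemma int3_inj (x y : int) : (absz x <= 1)%N -> (absz y <= 1)%N -> x%:~R = y%:~R :> Fp -> x = y.
Proof.
move=> x1 y1 /eqP; rewrite -subr_eq0 -rmorphB /= pint_eq0 => /dvdnP [[|k] hk]; first by lia.
have := p_gt2; nia.
Qed.
Lemma leg_abs a : (absz (leg a) <= 1)%N.
Proof. by rewrite /leg; do 2?case: ifP. Qed.
Lemma legM a b : leg (a * b) = leg a * leg b.
Proof.
apply: int3_inj; first exact: leg_abs.
  by rewrite abszM; have := leg_abs a; have := leg_abs b; case: (absz (leg a)) => [|[|]] //; case: (absz (leg b)) => [|[|]].
by rewrite rmorphM /= !euler_criterion exprMn.
Qed.
Lemma leg1 : leg 1 = 1.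
Proof. by apply: int3_inj => //; [exact: leg_abs|rewrite euler_criterion expr1n]. Qed.
Lemma leg_sqr a : a != 0 -> leg (a ^+ 2) = 1.
Proof. by move=> a0; rewrite expr2 legM; case: (leg_vals a0) => ->. Qed.
Lemma leg_m1 : leg (-1) = (-1) ^+ p./2.
Proof.
apply: int3_inj; [exact: leg_abs|by rewrite abszX exp1n|].
by rewrite euler_criterion rmorphXn rmorphN1.
Qed.
Lemma ex_nonres : exists a : Fp, leg a = -1.
Proof.
have [z zP] := Fp_prim_root.
have p1 : (0 < p.-1)%N by have := p_gt2; lia.
have h0 : (0 < p./2)%N by have := p_half; have := p_gt2; lia.
exists z; apply: int3_inj => //; first exact: leg_abs.
rewrite euler_criterion rmorphN1.
have pE : p.-1 = (p./2).*2 by rewrite {1}p_half.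
have : (z ^+ p./2) ^+ 2 == 1 by rewrite -exprM muln2 -pE (prim_expr_order zP).
rewrite sqrf_eq1 => /orP [h|/eqP //].
have := prim_order_dvd zP p./2; rewrite h => dv; have := dvdn_leq h0 dv; rewrite pE; lia.
Qed.

Section Gauss.
Variables (K : fieldType) (zeta : K).
Hypotheses (zetap : zeta ^+ p = 1) (zeta1 : zeta != 1).

(** The additive character attached to a p-th root of unity of a general field K: the same sums are
    used in a finite field for reciprocity and in [algC] for counting. *)
Definition psi (a : Fp) : K := zeta ^+ a.
Lemma zeta_mod n : zeta ^+ (n %% p) = zeta ^+ n.
Proof. by rewrite {2}(divn_eq n p) exprD mulnC exprM zetap expr1n mul1r. Qed.
Lemma psi_nat n : psi n%:R = zeta ^+ n.
Proof. by rewrite /psi val_Fp_nat // zeta_mod. Qed.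
Lemma psiD a b : psi (a + b) = psi a * psi b.
Proof. by rewrite -[a]natr_Zp -[b]natr_Zp -natrD !psi_nat exprD. Qed.
Lemma psi0 : psi 0 = 1. Proof. by rewrite /psi expr0. Qed.
Lemma psi_sumM (I : finType) (f : I -> Fp) : psi (\sum_i f i) = \prod_i psi (f i).
Proof. exact: (big_morph psi psiD psi0). Qed.

Lemma sum_psi : \sum_a psi a = 0.
Proof.
have h : zeta * (\sum_a psi a) = \sum_a psi a.
  rewrite mulr_sumr [RHS](reindex_inj (addrI (1 : Fp))) /=; apply: eq_bigr => a _.
  by rewrite psiD -[1]/(1%:R) psi_nat expr1.
apply/eqP; move/eqP: h; rewrite -subr_eq0 -{2}[\sum_a _]mul1r -mulrBl mulf_eq0 subr_eq0.
by rewrite (negPf zeta1).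
Qed.
Lemma sum_psiM b : \sum_a psi (a * b) = if b == 0 then p%:R else 0.
Proof.
case: eqP => [->|/eqP b0].
  rewrite (eq_bigr (fun=> 1)); last by move=> a _; rewrite mulr0 psi0.
  by rewrite sumr_const card_Fp.
by rewrite -[RHS]sum_psi [RHS](reindex_inj (mulIf b0)).
Qed.

Definition gsum (a : Fp) : K := \sum_x psi (a * x ^+ 2).
Definition gauss := gsum 1.

Lemma card_sqrt a : (#|[set x : Fp | x ^+ 2 == a]|)%:Z = 1 + leg a.
Proof.
rewrite /leg; case: eqP => [->|/eqP a0].
  rewrite (_ : [set x : Fp | _] = [set 0]) ?cards1 //.
  by apply/setP => x; rewrite !inE sqrf_eq0.
case: ifP => [/existsP [x /eqP xa]|/negbT nsq].
  have x0 : x != 0 by apply: contraNneq a0 => x0; rewrite -xa x0 expr0n.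
  rewrite (_ : [set x : Fp | _] = [set x; - x]).
    rewrite cards2 (_ : x != - x) //; apply: contraNneq x0 => h.
    have : x * 2%:R == 0 by rewrite mulr_natr mulr2n {1}h addNr.
    by rewrite mulf_eq0 (negPf two_neq0) orbF.
  by apply/setP => y; rewrite !inE -xa eqf_sqr.
rewrite (_ : [set x : Fp | _] = set0) ?cards0 //.
by apply/setP => x; rewrite !inE; apply/negP => h; case/negP: nsq; apply/existsP; exists x.
Qed.

Lemma gsum_leg a : a != 0 -> gsum a = \sum_x (leg x)%:~R * psi (a * x).
Proof.
move=> a0.
have -> : gsum a = \sum_y (1 + leg y)%:~R * psi (a * y).
  rewrite /gsum (partition_big (fun x : Fp => x ^+ 2) xpredT) //=; apply: eq_bigr => y _.
  rewrite (eq_bigr (fun=> psi (a * y))); last by move=> x /eqP ->.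
  by rewrite sumr_const -card_sqrt pmulrn mulr_natl; congr (_ *+ _); apply: eq_card => x; rewrite !inE.
rewrite (eq_bigr (fun y => psi (a * y) + (leg y)%:~R * psi (a * y))); last first.
  by move=> y _; rewrite rmorphD /= mulrDl mul1r.
rewrite big_split /= (eq_bigr (fun y => psi (y * a))); last by move=> y _; rewrite mulrC.
by rewrite sum_psiM (negPf a0) add0r.
Qed.

Lemma gsumE a : a != 0 -> gsum a = (leg a)%:~R * gauss.
Proof.
move=> a0; rewrite gsum_leg // /gauss gsum_leg ?oner_eq0 // [in RHS](reindex_inj (mulIf a0)) mulr_sumr.
apply: eq_bigr => x _; rewrite legM rmorphM /= mul1r [a * x]mulrC.
have -> : (leg a)%:~R * ((leg x)%:~R * (leg a)%:~R * psi (x * a)) = ((leg a) * leg a)%:~R * ((leg x)%:~R * psi (x * a)) :> K.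
  by rewrite rmorphM /=; ring.
by rewrite leg_leg // mul1r.
Qed.

(** With u = x - y one has x^2 - y^2 = u (u + 2y), so gauss * gsum (-1) becomes the sum of psi (u v)
    over all pairs, which is p. *)
Lemma gauss_sq : gauss ^+ 2 = (leg (-1))%:~R * p%:R.
Proof.
have m1 : (-1 : Fp) != 0 by rewrite oppr_eq0 oner_eq0.
have h : gauss * gsum (-1) = p%:R.
  rewrite /gauss /gsum big_distrlr /=.
  transitivity (\sum_(u : Fp) \sum_(v : Fp) psi (u * v)); last first.
    rewrite exchange_big /= (bigD1 0) //= sum_psiM eqxx big1 ?addr0 // => v v0.
    by rewrite sum_psiM (negPf v0).
  rewrite [RHS](eq_bigr (fun u => \sum_(y : Fp) psi (u * (u + 2%:R * y)))); last first.
    move=> u _; have inj : injective (fun y : Fp => u + 2%:R * y).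
      by move=> y y' /addrI /(mulfI two_neq0).
    by rewrite [LHS](reindex_inj inj).
  rewrite exchange_big [RHS]exchange_big /=; apply: eq_bigr => y _.
  rewrite [LHS](reindex_inj (addIr y)) /=; apply: eq_bigr => u _.
  by rewrite -psiD; congr psi; ring.
move: h; rewrite gsumE // => h.
have -> : gauss ^+ 2 = (leg (-1) * leg (-1))%:~R * gauss ^+ 2.
  by rewrite leg_leg // mul1r.
rewrite -h rmorphM /=; ring.
Qed.

Lemma gsum_lin a b : a != 0 -> \sum_x psi (a * x ^+ 2 + b * x) = psi (- (b ^+ 2 / (4%:R * a))) * (leg a)%:~R * gauss.
Proof.
move=> a0; have t0 := two_neq0.
rewrite (reindex_inj (addrI (- (b / (2%:R * a))))) /= -mulrA -gsumE // mulr_sumr.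
apply: eq_bigr => x _; rewrite -psiD; congr psi.
by field; rewrite a0 t0 (natrM _ 2 2) mulf_neq0.
Qed.
End Gauss.
End Legendre.
End LegendreSymbol.

(** * Quadratic reciprocity, and isotropic vectors orthogonal to a given vector *)

Module QuadraticReciprocity.
Import structures.
Import all_boot all_order all_algebra all_fingroup all_solvable all_field.
Import zify ring lra.
Import LegendreSymbol.
Import Order.TTheory GRing.Theory Num.Theory.
Local Open Scope ring_scope.

Lemma finField_prim_root (L : finFieldType) : exists z : L, #|L|.-1.-primitive_root z.
Proof.
have L1 : (1 < #|L|)%N := finNzRing_gt1 L.
have p1 : (0 < #|L|.-1)%N by lia.
have /hasP [z _ zP] : has #|L|.-1.-primitive_root [seq x <- enum L | x != 0].
  apply: has_prim_root => //.
  - apply/allP => x; rewrite mem_filter => /andP [x0 _]; rewrite unity_rootE; apply/eqP/(mulfI x0).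
    by rewrite -exprS prednK ?expf_card ?mulr1 //; lia.
  - by rewrite filter_uniq // enum_uniq.
  - rewrite size_filter.
    have e := count_predC (fun x : L => x != 0) (enum L); rewrite -cardE in e.
    have c1 : (count (predC (fun x : L => x != 0%R)) (enum L) <= 1)%N.
      rewrite (eq_count (a2 := pred1 0)); last by move=> x /=; rewrite negbK.
      by rewrite count_uniq_mem ?enum_uniq // leq_b1.
    by rewrite -e -subn1 leq_subLR [(1 + _)%N]addnC leq_add2l.
by exists z.
Qed.

Section QR.
Variables p q : nat.
Hypotheses (p_pr : prime p) (p_odd : odd p) (q_pr : prime q) (q_odd : odd q) (pq : p != q).

(** The field with q^(p-1) elements contains a primitive p-th root of unity. Its Frobenius
    multiplies the Gauss sum g by (q/p), while g^q = g (g^2)^((q-1)/2) is evaluated by [gauss_sq]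
    and Euler's criterion. *)
Lemma quadratic_reciprocity :
  leg (q%:R : 'F_p) = (-1) ^+ (p./2 * q./2) * leg (p%:R : 'F_q).
Proof.
have p1 : (0 < p.-1)%N by have := prime_gt1 p_pr; lia.
have [L qL cL] := PrimePowerField q_pr p1.
have [z zP] := finField_prim_root L; rewrite cL in zP.
have cop : coprime q p by rewrite prime_coprime // dvdn_prime2 // eq_sym.
have dvp : (p %| (q ^ p.-1).-1)%N.
  have := Euler_exp_totient cop; rewrite totient_prime // => /eqP.
  by rewrite eqn_mod_dvd ?subn1 // expn_gt0 prime_gt0.
have zetaP : p.-primitive_root (z ^+ ((q ^ p.-1).-1 %/ p)) by exact: dvdn_prim_root.
set zeta := z ^+ _ in zetaP.
have z1 : zeta ^+ p = 1 := prim_expr_order zetaP.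
have z2 : zeta != 1.
  by have := prim_order_dvd zetaP 1; rewrite expr1 dvdn1 => <-; have := prime_gt1 p_pr; lia.
have qz (a : int) : (q %| absz a)%N -> a%:~R = 0 :> L.
  have h n : (q %| n)%N -> n%:R = 0 :> L by rewrite (dvdn_pcharf qL) => /eqP.
  by case: a => n /h; rewrite ?NegzE ?mulrNz ?pmulrn => ->; rewrite ?oppr0.
have zq (a : int) : a%:~R = 0 :> L -> (q %| absz a)%N.
  by case: a => n; rewrite ?NegzE ?mulrNz -?pmulrn => /eqP; rewrite ?oppr_eq0 ?abszN (dvdn_pcharf qL).
pose g := gauss p zeta.
have g2 : g ^+ 2 = (leg (-1 : 'F_p))%:~R * p%:R by exact: (gauss_sq p_pr p_odd z1 z2).
have m1 : (-1 : 'F_p) != 0 by rewrite oppr_eq0 oner_eq0.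
have g0 : g != 0.
  have h2 : g ^+ 2 != 0; last by apply: contraNneq h2 => ->; rewrite expr0n.
  rewrite g2 mulf_eq0 negb_or; apply/andP; split.
    by case: (leg_vals m1) => ->; rewrite ?mulrN1z ?oppr_eq0 oner_eq0.
  by rewrite -(dvdn_pcharf qL) dvdn_prime2 // eq_sym.
have qF0 : (q%:R : 'F_p) != 0 by rewrite (pnat_eq0 p_pr) dvdn_prime2.
have gq : g ^+ q = (leg (q%:R : 'F_p))%:~R * g.
  rewrite -(gsumE p_pr p_odd z1 z2) // (gsum_leg p_pr p_odd z1 z2) //.
  rewrite /g /gauss (gsum_leg p_pr p_odd z1 z2) ?oner_eq0 // -(pFrobenius_autE qL) rmorph_sum.
  apply: eq_bigr => x _; rewrite rmorphM /= !pFrobenius_autE mul1r; congr (_ * _).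
    have := leg_abs x; case: (leg x) => [[|[|]]|[|]] // _; rewrite ?expr1n //.
      by rewrite expr0n; case: (q) q_pr.
    by rewrite NegzE mulrNz -signr_odd q_odd.
  by rewrite /psi -[x]natr_Zp -natrM !val_Fp_nat // !(zeta_mod z1) -exprM mulnC.
have key : ((leg (-1 : 'F_p))%:~R * p%:R) ^+ q./2 = (leg (q%:R : 'F_p))%:~R :> L.
  apply: (mulIf g0); rewrite -gq {2}(p_half q_odd) exprSr -mul2n exprM g2 //.
have eul : (p%:R : L) ^+ q./2 = (leg (p%:R : 'F_q))%:~R.
  apply/eqP; rewrite -subr_eq0 -natrX pmulrn -rmorphB /=; apply/eqP/qz.
  by rewrite -(pint_eq0 q_pr) rmorphB /= (euler_criterion q_pr q_odd) -pmulrn natrX subrr.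
move: key; rewrite exprMn eul -rmorphXn -rmorphM /= => /eqP; rewrite -subr_eq0 -rmorphB /= => /eqP /zq.
rewrite (leg_m1 p_pr p_odd) -exprM => h.
have l1 := leg_abs (q%:R : 'F_p); have l2 := leg_abs (p%:R : 'F_q).
have q3 := p_gt2 q_pr q_odd.
apply/eqP; rewrite eq_sym -subr_eq0 -absz_eq0; apply/negPn/negP => ne.
have := dvdn_leq _ h; rewrite lt0n.
rewrite ne => /(_ isT).
have : (absz ((-1) ^+ (p./2 * q./2)%N * leg (p%:R : 'F_q))%R <= 1)%N by rewrite abszM abszX exp1n mul1n.
move: l1 q3; move: ((-1) ^+ _ * _) (leg (q%:R : 'F_p)) => s t; clear; lia.
Qed.
End QR.

Section IsoCount.
Variables (p r : nat) (p_pr : prime p) (p_odd : odd p) (r_odd : odd r).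
Local Notation Fp := 'F_p.
Variable k : 'I_r -> Fp.
Hypothesis k0 : forall j, k j != 0.
Local Notation V := {ffun 'I_r -> Fp}.

Definition fq (x : V) : Fp := \sum_j k j * x j ^+ 2.
Definition fb (x y : V) : Fp := \sum_j k j * x j * y j.
Definition isoc (w : V) := #|[set x : V | (fq x == 0) && (fb x w == 0)]|.

(** The two conditions are detected by additive characters with parameters s and t. For s = 0 only t
    = 0 contributes, giving p^r. For s <> 0 the r coordinates and the sum over t yield r + 1 Gauss
    sums; as r + 1 is even, s drops out and only powers of gauss^2 occur. *)
Lemma isoc_eq w : fq w != 0 ->
  (p ^ 2 * isoc w)%:Z = (p ^ r)%:Z + (p.-1)%:Z * leg (- fq w * \prod_j k j) * (leg (-1 : Fp) * p%:Z) ^+ r.+1./2.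
Proof.
move=> w0.
have [zeta zP] := C_prim_root_exists (prime_gt0 p_pr).
have z1 : zeta ^+ p = 1 := prim_expr_order zP.
have z2 : zeta != 1.
  by have := prim_order_dvd zP 1; rewrite expr1 dvdn1 => <-; have := prime_gt1 p_pr; lia.
apply: (@intr_inj algC); rewrite intrD.
rewrite [(_ * _ ^+ _)%:~R]intrM [(_ * leg _)%:~R]intrM.
rewrite [((leg (-1) * _) ^+ _)%:~R](rmorphXn (intmul 1)) /= [(leg (-1) * _)%:~R]intrM -!pmulrn.
have pp : \sum_(s : Fp) \sum_(t : Fp) \sum_(x : V) psi zeta (s * fq x + t * fb x w) = (p ^ 2 * isoc w)%:R.
  rewrite (eq_bigr (fun s => \sum_(x : V) \sum_(t : Fp) psi zeta (s * fq x + t * fb x w))); last by move=> s _; rewrite exchange_big.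
  rewrite exchange_big /= natrM natrX expr2 /isoc -sum1_card natr_sum [in RHS]big_mkcond [in RHS]mulr_sumr /=.
  apply: eq_bigr => x _; rewrite inE.
  rewrite (eq_bigr (fun s => psi zeta (s * fq x) * \sum_t psi zeta (t * fb x w))); last first.
    by move=> s _; rewrite [RHS]mulr_sumr; apply: eq_bigr => t _; rewrite (psiD p_pr z1).
  rewrite -mulr_suml !(sum_psiM p_pr z1 z2).
  by case: (fq x == 0); case: (fb x w == 0); rewrite /= ?mulr1 ?mulr0 ?mul0r.
have prodE s t : \sum_(x : V) psi zeta (s * fq x + t * fb x w) = \prod_j \sum_(y : Fp) psi zeta (s * k j * y ^+ 2 + t * k j * w j * y).
  rewrite bigA_distr_bigA /=; apply: eq_bigr => x _.
  rewrite -(psi_sumM p_pr z1); congr psi; rewrite /fq /fb !mulr_sumr -big_split; apply: eq_bigr => j _ /=; ring.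
rewrite -pp (bigD1 0) //=; congr (_ + _).
  rewrite (bigD1 0) //= [X in _ + X]big1 ?addr0 => [|t t0].
    have E0 x : psi zeta ((0 : Fp) * fq x + (0 : Fp) * fb x w) = 1 by rewrite !mul0r addr0 psi0.
    rewrite (eq_bigr (fun=> 1)); last by move=> x _; exact: E0.
    by rewrite sumr_const card_ffun card_Fp // card_ord.
  rewrite prodE.
  have [j wj] : exists j, w j != 0.
    apply/existsP; apply: contraR w0; rewrite negb_exists => /forallP h; apply/eqP.
    by rewrite /fq big1 // => j _; move/negPn/eqP: (h j) => ->; rewrite expr0n mulr0.
  apply/eqP; rewrite prodf_seq_eq0; apply/hasP; exists j; rewrite ?mem_index_enum //=.
  rewrite (eq_bigr (fun y => psi zeta (y * (t * k j * w j)))); last by move=> y _; congr psi; ring.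
  by rewrite (sum_psiM p_pr z1 z2) !mulf_eq0 (negPf t0) (negPf (k0 j)) (negPf wj).
have fourP : (4%:R : Fp) != 0 by rewrite (natrM _ 2 2) mulf_neq0 ?two_neq0.
have inner s : s != 0 -> \sum_(t : Fp) \sum_(x : V) psi zeta (s * fq x + t * fb x w) =
   (leg (- fq w * \prod_j k j))%:~R * gauss p zeta ^+ r.+1.
  move=> s0.
  rewrite (eq_bigr (fun t => psi zeta (- (fq w / (4%:R * s)) * t ^+ 2) * ((leg (s ^+ r * \prod_j k j))%:~R * gauss p zeta ^+ r))); last first.
    move=> t _; rewrite prodE.
    rewrite (eq_bigr (fun j => psi zeta (- (t ^+ 2 * k j * w j ^+ 2 / (4%:R * s))) * ((leg (s * k j))%:~R * gauss p zeta))); last first.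
      move=> j _; rewrite (gsum_lin p_pr p_odd z1 z2) ?mulf_neq0 // -mulrA; congr (psi zeta (- _) * _).
      by field; rewrite s0 k0 fourP.
    rewrite !big_split /= -(psi_sumM p_pr z1) prodr_const card_ord; congr (psi _ _ * (_ * _)).
      by rewrite /fq mulr_suml -sumrN mulr_suml; apply: eq_bigr => j _; ring.
    have -> : s ^+ r * \prod_j k j = \prod_j (s * k j) by rewrite big_split /= prodr_const card_ord.
    by rewrite (big_morph _ (legM p_pr p_odd) (leg1 p_pr p_odd)) rmorph_prod.
  rewrite -mulr_suml -[X in X * _]/(gsum zeta (- (fq w / (4%:R * s)))).
  rewrite (gsumE p_pr p_odd z1 z2); last by rewrite oppr_eq0 mulf_neq0 // invr_eq0 mulf_neq0.
  rewrite [in RHS]exprS.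
  have -> : leg (- (fq w / (4%:R * s))) = leg (- fq w * s).
    have -> : - fq w * s = (2%:R * s) ^+ 2 * (- (fq w / (4%:R * s))) by field; rewrite s0 fourP.
    rewrite [RHS](legM p_pr p_odd) (leg_sqr p_pr p_odd) ?mul1r //.
    by rewrite mulf_neq0 ?two_neq0.
  have -> : (leg (- fq w * s))%:~R * gauss p zeta * ((leg (s ^+ r * \prod_j k j))%:~R * gauss p zeta ^+ r) =
     (leg (- fq w * s) * leg (s ^+ r * \prod_j k j))%:~R * (gauss p zeta * gauss p zeta ^+ r) :> algC by rewrite rmorphM /=; ring.
  congr (_%:~R * _); rewrite -(legM p_pr p_odd).
  have -> : - fq w * s * (s ^+ r * \prod_j k j) = (s ^+ r.+1./2) ^+ 2 * (- fq w * \prod_j k j).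
    rewrite -exprM muln2 (_ : r.+1./2.*2 = r.+1); last by have := r_odd; lia.
    by rewrite exprS; ring.
  by rewrite (legM p_pr p_odd) (leg_sqr p_pr p_odd) ?mul1r // expf_neq0.
rewrite (eq_bigr (fun=> (leg (- fq w * \prod_j k j))%:~R * gauss p zeta ^+ r.+1)); last by move=> s; exact: inner.
rewrite sumr_const -mulr_natl -mulrA; congr (_%:R * (_ * _)).
  by rewrite cardC1 card_Fp.
rewrite -(gauss_sq p_pr p_odd z1 z2) -exprM mul2n; congr (_ ^+ _); have := r_odd; lia.
Qed.
End IsoCount.
End QuadraticReciprocity.

(** * Hermite reduction of positive definite integral forms *)

Module Reduction.
Import structures.
Import all_boot all_order all_algebra.
Import boolp perm.
Import zify ring lra.
Import Order.TTheory GRing.Theory Num.Theory.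
Local Open Scope ring_scope.

Definition qf n (A : 'M[int]_n) (v : 'rV[int]_n) : int := (v *m A *m v^T) ord0 ord0.
Definition pdef n (A : 'M[int]_n) := A^T = A /\ forall v, v != 0 -> 0 < qf A v.

Lemma qf_conj n (A U : 'M[int]_n) v : qf (U *m A *m U^T) v = qf A (v *m U).
Proof. by rewrite /qf trmx_mul !mulmxA. Qed.

Lemma qf_row n (A U : 'M[int]_n) i : (U *m A *m U^T) i i = qf A (row i U).
Proof.
rewrite /qf -row_mul tr_row !mxE; apply: eq_bigr => j _.
by rewrite !mxE.
Qed.

Lemma pdef_conj n (A U : 'M[int]_n) : U \in unitmx -> pdef A -> pdef (U *m A *m U^T).
Proof.
move=> Uu [sA pA]; split; first by rewrite !trmx_mul trmxK sA mulmxA.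
move=> v v0; rewrite qf_conj; apply: pA; apply: contra v0 => /eqP h.
by apply/eqP; rewrite -[v](mulmxK Uu) h mul0mx.
Qed.

Lemma det_conj n (A U : 'M[int]_n) : U \in unitmx -> \det (U *m A *m U^T) = \det A.
Proof.
move=> Uu; rewrite !det_mulmx det_tr mulrC mulrA.
have : \det U \is a GRing.unit by rewrite -unitmxE.
by rewrite qualifE /= => /orP [] /eqP ->; rewrite ?mulrNN ?mul1r.
Qed.

Lemma unit_row0 n (U : 'M[int]_n.+1) i : U \in unitmx -> exists2 U', U' \in unitmx & row ord0 U' = row i U.
Proof.
move=> Uu; exists (xrow ord0 i U); first by rewrite xrowE unitmx_mul unitmx_perm.
by apply/rowP => j; rewrite !mxE tpermL.
Qed.

Lemma near_mult (m s : int) : 0 < m -> exists t, 2 * `|m * t + s| <= m.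
Proof.
move=> m0; have h := divz_eq s m; have h1 := modz_ge0 s (lt0r_neq0 m0); have h2 := ltz_pmod s m0.
case: (leP (2 * (s %% m)%Z) m) => h3.
  exists (- (s %/ m)%Z); rewrite {2}h; set q := (s %/ m)%Z; set e := (s %% m)%Z in h1 h2 h3 *.
  by rewrite (_ : m * - q + _ = e); [rewrite ger0_norm|ring].
exists (- (s %/ m)%Z - 1); rewrite {2}h; set q := (s %/ m)%Z; set e := (s %% m)%Z in h1 h2 h3 *.
by rewrite (_ : m * _ + _ = e - m); [rewrite ler0_norm; lia|ring].
Qed.

Lemma PoszX (a k : nat) : (a ^ k)%N%:Z = a%:Z ^+ k.
Proof. by elim: k => // k IH; rewrite expnS PoszM IH exprS. Qed.

Section Block.
Variable n : nat.
Implicit Types A : 'M[int]_(1 + n).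
(** The Schur complement of the corner entry, multiplied by that entry to stay integral. *)
Definition sch A : 'M[int]_n := A ord0 ord0 *: drsubmx A - (ursubmx A)^T *m ursubmx A.

Lemma ulE A : ulsubmx A = (A ord0 ord0)%:M.
Proof. by rewrite [LHS]mx11_scalar !mxE; congr ((A _ _)%:M); apply/val_inj. Qed.
Lemma symE A : A^T = A -> A = block_mx (A ord0 ord0)%:M (ursubmx A) (ursubmx A)^T (drsubmx A).
Proof. by move=> sA; rewrite -{1}[A]submxK ulE trmx_ursub sA. Qed.

Lemma sch_sym A : A^T = A -> (sch A)^T = sch A.
Proof.
move=> sA; rewrite /sch linearB /= linearZ /= trmx_mul trmxK.
by rewrite trmx_drsub sA.
Qed.

Lemma pdef00 A : pdef A -> 0 < A ord0 ord0.
Proof.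
move=> [_ pA]; have := pA (row ord0 1%:M); rewrite -qf_row mul1mx trmx1 mulmx1; apply.
by apply/negP => /eqP /rowP /(_ ord0); rewrite !mxE.
Qed.

Lemma sch_pdef A : pdef A -> pdef (sch A).
Proof.
move=> pdA; have m0 := pdef00 pdA; have [sA pA] := pdA.
split; first exact: sch_sym.
move=> u u0; set m := A ord0 ord0 in m0 *; set w := ursubmx A; set B := drsubmx A.
pose c := (u *m w^T) ord0 ord0.
have cE : u *m w^T = c%:M by rewrite [LHS]mx11_scalar.
have cE' : w *m u^T = c%:M by rewrite -[LHS]trmxK trmx_mul trmxK cE tr_scalar_mx.
have v0 : row_mx (- c)%:M (m *: u) != 0.
  apply: contra u0 => /eqP /(congr1 rsubmx); rewrite row_mxKr linear0 => /eqP.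
  by rewrite scalemx_eq0 (gt_eqF m0).
have := pA _ v0; rewrite /qf {1}(symE sA) -/m -/w -/B mul_row_block tr_row_mx mul_row_col tr_scalar_mx.
have -> : ((- c)%:M *m m%:M + m *: u *m w^T) = 0.
  by rewrite -scalemxAl cE -!scalar_mxM scale_scalar_mx -raddfD /= (_ : _ + _ = 0) ?raddf0 //; ring.
rewrite mul0mx add0r linearZ /= -scalemxAr mulmxDl -!scalemxAl mul_scalar_mx -scalemxAl cE' => h.
have -> : u *m sch A *m u^T = m *: (u *m B *m u^T) - (c ^+ 2)%:M.
  rewrite /sch -/m -/w -/B mulmxBr mulmxBl -scalemxAr -scalemxAl !mulmxA cE -mulmxA cE' -scalar_mxM expr2.
  by [].
move: h; rewrite !mxE /= mulr1n pmulr_rgt0 // expr2.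
by rewrite addrC mulNr mulr1n.
Qed.

Lemma sch_det A : A^T = A -> A ord0 ord0 ^+ n * \det A = A ord0 ord0 * \det (sch A).
Proof.
move=> sA; set m := A ord0 ord0; set w := ursubmx A; set B := drsubmx A.
have : block_mx (1%:M : 'M_1) 0 (- w^T) m%:M *m A = block_mx m%:M w 0 (sch A).
  rewrite {1}(symE sA) -/m -/w -/B mulmx_block !mul1mx !mul0mx !addr0 mul_mx_scalar mul_scalar_mx scalerN addNr.
  by rewrite mulNmx mul_scalar_mx addrC.
move/(congr1 determinant); rewrite det_mulmx det_lblock det_ublock !det_scalar expr1n mul1r expr1.
by [].
Qed.

Lemma blk_unit (t : 'cV[int]_n) (U : 'M[int]_n) : U \in unitmx -> block_mx (1%:M : 'M_1) 0 t U \in unitmx.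
Proof. by rewrite !unitmxE det_lblock det1 mul1r. Qed.

Lemma conj_blk A (t : 'cV[int]_n) (U : 'M[int]_n) : A^T = A ->
  let T := block_mx (1%:M : 'M_1) 0 t U in let A2 := T *m A *m T^T in
  [/\ A2 ord0 ord0 = A ord0 ord0, ursubmx A2 = A ord0 ord0 *: t^T + ursubmx A *m U^T &
      sch A2 = U *m sch A *m U^T].
Proof.
move=> sA T A2; set m := A ord0 ord0; set w := ursubmx A; set B := drsubmx A.
have A2E : A2 = block_mx m%:M (m *: t^T + w *m U^T) (m *: t + U *m w^T) ((m *: t + U *m w^T) *m t^T + (t *m w + U *m B) *m U^T).
  rewrite /A2 /T {1}(symE sA) -/m -/w -/B mulmx_block tr_block_mx trmx1 trmx0 !mul1mx !mul0mx !addr0.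
  by rewrite mulmx_block !mulmx1 !mulmx0 !addr0 mul_scalar_mx mul_mx_scalar.
clearbody A2; have e1 : A2 ord0 ord0 = m.
  have -> : A2 ord0 ord0 = (ulsubmx A2) ord0 ord0 by rewrite !mxE; congr (A2 _ _); apply/val_inj.
  by rewrite A2E block_mxKul mxE mulr1n.
have e2 : ursubmx A2 = m *: t^T + w *m U^T by rewrite A2E block_mxKur.
split=> //; rewrite /sch e1 e2 -/m -/w -/B A2E block_mxKdr.
have -> : (m *: t^T + w *m U^T)^T = m *: t + U *m w^T by rewrite linearD /= linearZ /= trmx_mul !trmxK.
rewrite mulmxBr mulmxBl !mulmxDl !mulmxDr !scalerDr -!scalemxAl -!scalemxAr !mulmxA.
set a := t *m t^T; set b := U *m w^T *m t^T; set c := t *m w *m U^T; set d := U *m B *m U^T; set e := U *m w^T *m w *m U^T.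
by rewrite -scalemxAl -/d opprD opprD addrACA; apply/matrixP => i j; rewrite !mxE; ring.
Qed.
End Block.

(** Let m be the least corner entry of all equivalent forms. After reducing the Schur complement by
    induction and translating so that |x| <= m/2, the second diagonal entry y is again a possible
    corner, so y >= m and the corner s = m y - x^2 of the complement is at least 3 m^2 / 4. The
    bound on s then gives the factor 4^(n+1). *)
Lemma hermite n : exists C : nat, forall A : 'M[int]_n.+1, pdef A ->
  exists2 U, U \in unitmx & (U *m A *m U^T) ord0 ord0 ^+ n.+1 <= C%:Z * \det A.
Proof.
elim: n => [|n [C IH]].
  exists 1%N => A pA; exists 1%:M; first exact: unitmx1.
  by rewrite mul1mx trmx1 mulmx1 expr1 mul1r [A]mx11_scalar det_scalar mxE expr1.
exists (4 ^ n.+1 * C)%N => A pA.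
pose P (m : nat) := `[< exists2 U, U \in unitmx & (U *m A *m U^T) ord0 ord0 = m%:Z >].
have exP : exists m, P m.
  exists (absz (A ord0 ord0)); apply/asboolP; exists 1%:M; first exact: unitmx1.
  by rewrite mul1mx trmx1 mulmx1 gez0_abs // ltW // (pdef00 (n := n.+1)).
case: (ex_minnP exP) => m /asboolP [U Uu Um] mmin; exists U => //.
pose A1 : 'M[int]_(1 + n.+1) := U *m A *m U^T.
have pA1 : pdef A1 by exact: pdef_conj.
have [U' U'u hU'] := IH _ (sch_pdef pA1).
have m0 : 0 < m%:Z by rewrite -Um -/A1; exact: pdef00.
have [t ht] := near_mult ((ursubmx A1 *m U'^T) ord0 ord0) m0.
have [e1 e2 e3] := conj_blk (const_mx t) U' pA1.1.
move: e1 e2 e3; set T := block_mx _ _ _ _; set A2 := T *m A1 *m T^T => e1 e2 e3.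
have Tu : T \in unitmx by exact: blk_unit.
have s2 : A2^T = A2 by exact: (pdef_conj Tu pA1).1.
rewrite -e3 in hU'; set s := sch A2 ord0 ord0 in hU'.
pose x := ursubmx A2 ord0 ord0; pose y := drsubmx A2 ord0 ord0.
have sE : s = m%:Z * y - x ^+ 2.
  rewrite /s /sch e1 -[A1 _ _]/((U *m A *m U^T) ord0 ord0) Um /x /y expr2; clearbody A2; by rewrite !mxE big_ord1 !mxE.
have xb : 2 * `|x| <= m%:Z.
  rewrite /x e2 -[A1 ord0 ord0]/((U *m A *m U^T) ord0 ord0) Um mxE; move: ht; congr (2 * `| _ + _| <= _).
  by rewrite !mxE.
have yb : m%:Z <= y.
  have yr : y = qf A (row (lift ord0 ord0) (T *m U)).
    have dr (M : 'M[int]_(1 + n.+1)) : drsubmx M ord0 ord0 = M (lift ord0 ord0) (lift ord0 ord0).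
      by rewrite !mxE; congr (M _ _); apply/val_inj.
    rewrite -qf_row trmx_mul !mulmxA /y dr.
    by rewrite /A2 /A1 !mulmxA.
  have TUu : T *m U \in unitmx by rewrite unitmx_mul Tu Uu.
  have [W Wu Wr] := unit_row0 (lift ord0 ord0) TUu.
  have y0 : 0 <= y.
    rewrite yr -qf_row; have := pdef_conj TUu pA => -[_ /(_ (row (lift ord0 ord0) 1%:M))].
    rewrite -qf_row mul1mx trmx1 mulmx1 => h; apply/ltW/h.
    by apply/negP => /eqP /rowP /(_ (lift ord0 ord0)); rewrite !mxE eqxx.
  rewrite -[y]gez0_abs // lez_nat; apply: mmin; apply/asboolP; exists W => //.
  by rewrite gez0_abs // qf_row Wr.
have sb : 3 * m%:Z ^+ 2 <= 4 * s by rewrite sE; nia.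
rewrite Um; have d1 := sch_det pA1.1.
have d2 : \det (sch A2) = \det (sch A1) by rewrite e3 det_conj.
have d3 : \det A1 = \det A by rewrite det_conj.
have d4 : A1 ord0 ord0 = m%:Z by exact: Um.
rewrite d4 d3 exprS -mulrA in d1; have {}d1 := mulfI (lt0r_neq0 m0) d1.
rewrite e3 det_conj // in d2.
have pw : (3 * m%:Z ^+ 2) ^+ n.+1 <= (4 * s) ^+ n.+1 by apply: lerXn2r; rewrite ?nnegrE; nia.
have hs : s ^+ n.+1 <= C%:Z * (m%:Z ^+ n * \det A).
  by rewrite d1; move: hU'; rewrite /s e3.
have mn0 : 0 < m%:Z ^+ n by exact: exprn_gt0.
rewrite -(ler_pM2l mn0).
have -> : m%:Z ^+ n * m%:Z ^+ n.+2 = (m%:Z ^+ 2) ^+ n.+1 by rewrite -exprD -exprM; congr (_ ^+ _); lia.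
have step : (m%:Z ^+ 2) ^+ n.+1 <= (3 * m%:Z ^+ 2) ^+ n.+1 by apply: lerXn2r; rewrite ?nnegrE; nia.
apply: (le_trans step); apply: (le_trans pw); rewrite exprMn.
have -> : m%:Z ^+ n * ((4 ^ n.+1 * C)%N%:Z * \det A) = 4 ^+ n.+1 * (C%:Z * (m%:Z ^+ n * \det A)).
  by rewrite PoszM PoszX; ring.
by rewrite ler_pM2l // exprn_gt0.
Qed.

Lemma bounded_gram n (D : nat) : exists K : nat, forall A : 'M[int]_n, pdef A -> \det A <= D%:Z ->
  exists2 U, U \in unitmx & forall i j, (absz ((U *m A *m U^T) i j) <= K)%N.
Proof.
elim: n D => [|n IH] D.
  by exists 0%N => A _ _; exists 1%:M; [exact: unitmx1|case].
have [C hC] := hermite n; set M := (C * D)%N.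
have [K hK] := IH (M ^ n * D)%N.
(* M bounds the corner m, and M^n D the determinant of the Schur complement, whose entries K bounds.
   In m d = sch + x y the product x y is at most M^2, and dividing by m >= 1 only helps. *)
exists (M + K + M ^ 2)%N => A pA dA.
have [U Uu Ub] := hC A pA.
pose A1 : 'M[int]_(1 + n) := U *m A *m U^T.
have pA1 : pdef A1 by exact: pdef_conj.
have m0 := pdef00 pA1; pose m := A1 ord0 ord0; rewrite -/m in m0.
have mM : m <= M%:Z.
  apply: (@le_trans _ _ (m ^+ n.+1)).
    by rewrite exprS ler_peMr ?(ltW m0) // exprn_ege1.
  by apply: (le_trans Ub); rewrite /M PoszM ler_wpM2l.
have d1 := sch_det pA1.1; rewrite -/m det_conj // in d1.
have dS : \det (sch A1) <= (M ^ n * D)%N%:Z.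
  have M0 : m ^+ n <= M%:Z ^+ n by apply: lerXn2r; rewrite ?nnegrE ?(ltW m0) // (le_trans (ltW m0)).
  have dm : \det (sch A1) <= m * \det (sch A1).
    have [s0|s0] := leP 0 (\det (sch A1)); first by rewrite ler_peMl.
    exfalso.
    have : 0 < C%:Z * \det A by apply: lt_le_trans Ub; exact: exprn_gt0.
    have mn : 0 < m ^+ n by exact: exprn_gt0.
    move=> h; have dA0 : 0 < \det A by nia.
    have : 0 < m ^+ n * \det A by rewrite mulr_gt0.
    by rewrite d1 pmulr_rgt0 // ltNge (ltW s0).
  apply: (le_trans dm); rewrite -d1 PoszM PoszX.
  have mn : 0 <= m ^+ n by rewrite exprn_ge0 // ltW.
  have Mn : (0 : int) <= M%:Z ^+ n by exact: exprn_ge0.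
  apply: (@le_trans _ _ (m ^+ n * D%:Z)); first by rewrite ler_wpM2l.
  by rewrite ler_wpM2r.
have [U' U'u hU'] := hK _ (sch_pdef pA1) dS.
have /choice [t ht] : forall j, exists t, 2 * `|m * t + (ursubmx A1 *m U'^T) ord0 j| <= m.
  by move=> j; exact: near_mult.
have [e1 e2 e3] := conj_blk (\col_j t j) U' pA1.1.
move: e1 e2 e3; set T := block_mx _ _ _ _; set A2 := T *m A1 *m T^T => e1 e2 e3.
have Tu : T \in unitmx by exact: blk_unit.
have s2 : A2^T = A2 by exact: (pdef_conj Tu pA1).1.
exists (T *m U); first by rewrite unitmx_mul Tu Uu.
have -> : T *m U *m A *m (T *m U)^T = A2 by rewrite trmx_mul /A2 /A1 !mulmxA.
have ub j : 2 * `|ursubmx A2 ord0 j| <= m.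
  by rewrite e2 -/m; move: (ht j); rewrite !mxE.
have db i j : (absz (drsubmx A2 i j) <= K + M ^ 2)%N.
  have schE (Z : 'M[int]_(1 + n)) : sch Z i j = Z ord0 ord0 * drsubmx Z i j - ursubmx Z ord0 i * ursubmx Z ord0 j.
    by rewrite !mxE big_ord1 !mxE.
  have := hU' i j; rewrite -e3 schE e1 -/m.
  move: (ub i) (ub j); set x := ursubmx A2 ord0 i; set y := ursubmx A2 ord0 j; set d := drsubmx A2 i j.
  move=> xb yb h; have xy : `|x * y| <= m ^+ 2 by rewrite normrM; nia.
  have mb : m ^+ 2 <= (M ^ 2)%N%:Z by rewrite PoszX; apply: lerXn2r; rewrite ?nnegrE ?(ltW m0) // (le_trans (ltW m0)).
  have : `|d| <= `|m * d| by rewrite normrM ler_peMl // ger0_norm ?(ltW m0).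
  move: h xy mb; move: (m * d) (x * y) (m ^+ 2) (M ^ 2)%N => a b c e; lia.
suff h (i j : 'I_(1 + n)) : (absz (A2 i j) <= M + K + M ^ 2)%N by move=> i j; exact: h.
rewrite (symE s2) e1 -/m.
case: (@split_ordP 1 n i) => i' ->; case: (@split_ordP 1 n j) => j' ->.
- by rewrite block_mxEul !ord1 mxE mulr1n; lia.
- have -> : i' = ord0 by rewrite [i']ord1.
  by rewrite block_mxEur; have := ub j'; move: (ursubmx A2 ord0 j') => x; lia.
- have -> : j' = ord0 by rewrite [j']ord1.
  by rewrite block_mxEdl mxE; have := ub i'; move: (ursubmx A2 ord0 i') => x; lia.
- by rewrite block_mxEdr; apply: leq_trans (db i' j') _; rewrite -addnA leq_addl.
Qed.
End Reduction.

(** * The neighbours of a diagonal lattice at a prime m *)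

Module Neighbours.
Import structures.
Import all_boot all_order all_algebra all_fingroup all_solvable all_field.
Import boolp classical_sets functions cardinality fsbigop.
Import finmap.
Import zify ring lra.
Import FormalSeries WeightedSeries ThetaFunctions LatticeSums LegendreSymbol QuadraticReciprocity Reduction.
Import Order.TTheory GRing.Theory Num.Theory.
Local Open Scope classical_set_scope.
Local Open Scope ring_scope.

Section Bil.
Variables (r : nat) (k : 'I_r -> nat).
Hypothesis k13 : forall j, k j = 1%N \/ k j = 3%N.
Implicit Types u v w x y : 'rV[int]_r.

Lemma k_gt0 j : (0 < k j)%N. Proof. by case: (k13 j) => ->. Qed.

Definition bil u v : int := \sum_j (k j)%:Z * u ord0 j * v ord0 j.
Definition Dg : 'M[int]_r := diag_mx (\row_j (k j)%:Z).

Lemma bilC u v : bil u v = bil v u.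
Proof. by apply: eq_bigr => j _; ring. Qed.
Lemma bil_lin u v w (a b : int) : bil w (a *: u + b *: v) = a * bil w u + b * bil w v.
Proof. by rewrite /bil !mulr_sumr -big_split; apply: eq_bigr => j _; rewrite !mxE /=; ring. Qed.
Lemma bilE u v : bil u v = (u *m Dg *m v^T) ord0 ord0.
Proof.
rewrite mxE; apply: eq_bigr => j _; rewrite mul_mx_diag !mxE; ring.
Qed.
Lemma bil_Qf v : bil v v = (Qf k v)%:Z.
Proof.
rewrite /Qf /bil (big_morph Posz PoszD (erefl _)); apply: eq_bigr => j _.
by rewrite tqE; ring.
Qed.
Lemma bil_gt0 v : v != 0 -> 0 < bil v v.
Proof.
move=> v0; have [j vj] : exists j, v ord0 j != 0.
  apply/existsP; apply: contraR v0; rewrite negb_exists => /forallP h; apply/eqP/rowP => j.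
  by rewrite mxE; apply/eqP/negPn/h.
rewrite /bil (bigD1 j) //=; have kj := k_gt0 j.
have h1 : 0 < (k j)%:Z * v ord0 j * v ord0 j by rewrite -mulrA mulr_gt0 // lt0r mulf_neq0 //= -expr2 sqr_ge0.
apply: ltr_pwDl => //; apply: sumr_ge0 => a _; rewrite -mulrA mulr_ge0 // -expr2; exact: sqr_ge0.
Qed.

Section Nbr.
Variable m : nat.
Hypotheses (m_pr : prime m) (m_ge5 : (5 <= m)%N).
Local Notation Fm := 'F_m.
Definition vb v : {ffun 'I_r -> Fm} := [ffun j => (v ord0 j)%:~R].
Definition kb (j : 'I_r) : Fm := (k j)%:R.
Local Notation fb := (fb kb).
Local Notation fq := (fq kb).

Lemma m_odd : odd m.
Proof. by case: (even_prime m_pr) => // h; move: m_ge5; rewrite h. Qed.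
Lemma kb0 j : kb j != 0.
Proof. by rewrite /kb (pnat_eq0 m_pr) gtnNdvd ?k_gt0 //; case: (k13 j) => ->; lia. Qed.
Lemma zF (z : int) : ((z%:~R : Fm) == 0) = (m%:Z %| z)%Z.
Proof. by rewrite (pint_eq0 m_pr) dvdzE. Qed.
Lemma bil_fb u v : (bil u v)%:~R = fb (vb u) (vb v).
Proof.
rewrite /bil rmorph_sum /= /QuadraticReciprocity.fb; apply: eq_bigr => j _; rewrite !ffunE !rmorphM /=.
by rewrite -pmulrn.
Qed.
Lemma m0z : m%:Z != 0. Proof. by have := prime_gt0 m_pr; case: (m). Qed.
Lemma m2z : (m ^ 2)%N%:Z != 0. Proof. by rewrite PoszX expf_neq0 ?m0z. Qed.

(** The vectors v such that v / m lies in the Kneser m-neighbour attached to the line of x. The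
    scaling by m keeps all vectors integral and multiplies norms by m^2. *)
Definition inM x v := (exists s y, v = s *: x + m%:Z *: y) /\ ((m ^ 2)%N%:Z %| bil x v)%Z.

Lemma dvd_m2 (z : int) : ((m ^ 2)%N%:Z %| m%:Z * z)%Z = (m%:Z %| z)%Z.
Proof. by rewrite !dvdzE abszM expnS expn1 dvdn_pmul2l // prime_gt0. Qed.

Lemma inM_perp x s y : ((m ^ 2)%N%:Z %| bil x x)%Z ->
  ((m ^ 2)%N%:Z %| bil x (s *: x + m%:Z *: y))%Z = (m%:Z %| bil x y)%Z.
Proof. by move=> xx; rewrite bil_lin rpredDl ?dvd_m2 // dvdz_mull. Qed.

Lemma inM_bil x u v : ((m ^ 2)%N%:Z %| bil x x)%Z -> inM x u -> inM x v -> ((m ^ 2)%N%:Z %| bil u v)%Z.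
Proof.
move=> xx [[s [y ->]] hu] [[s' [y' ->]] hv].
rewrite inM_perp // in hu; rewrite bilC bil_lin rpredD //.
  by rewrite dvdz_mull // bilC.
rewrite dvd_m2 bilC bil_lin rpredD //; first by rewrite dvdz_mull // bilC.
by rewrite dvdz_mulr.
Qed.

(* [i] and [j] are the first and the last index at which [x] is nonzero. *)
Definition lifted (i j : 'I_r) x (xb : {ffun 'I_r -> Fm}) :=
  [/\ vb x = xb, x ord0 i = 1, (forall a : 'I_r, a < i -> x ord0 a = 0)%N /\ (forall a : 'I_r, j < a -> x ord0 a = 0)%N,
   (i < j)%N /\ xb j != 0 & ((m ^ 2)%N%:Z %| bil x x)%Z].

Definition normalized (xb : {ffun 'I_r -> Fm}) :=
  [exists i, (xb i == 1) && [forall a : 'I_r, (a < i)%N ==> (xb a == 0)]].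

(** Hensel lifting: adding m t e_j changes bil x x by 2 m t k_j x_j modulo m^2, and t is solved for.
    The index j differs from i because a vector with one nonzero coordinate is not isotropic; taking
    it last keeps the zero pattern used by [Pm]. *)
Lemma lift_ex xb : normalized xb -> fq xb = 0 -> exists i j x, lifted i j x xb.
Proof.
move=> /existsP [i /andP [/eqP xi /forallP xlt]] q0.
have xi0 : xb i != 0 by rewrite xi oner_eq0.
case: (@arg_maxnP _ i (fun a => xb a != 0) (fun a : 'I_r => a : nat) xi0) => j xj jmax.
have {}jmax a : xb a != 0 -> (a <= j)%N := jmax a.
have ij : (i < j)%N.
  rewrite ltn_neqAle (jmax i xi0) andbT; apply/negP => /eqP /val_inj ij.
  move/eqP: q0; rewrite /QuadraticReciprocity.fq (bigD1 i) //= big1 ?addr0 => [|a ai].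
    by rewrite xi expr1n mulr1 (negPf (kb0 i)).
  suff -> : xb a = 0 by rewrite expr0n mulr0.
  apply/eqP/negPn/negP => xa; case: (ltngtP a i) => h.
  - by have := xlt a; rewrite h (negPf xa).
  - by have := jmax a xa; rewrite -ij; lia.
  - by move/val_inj: h => h; rewrite h eqxx in ai.
have rep (c : Fm) : ((val c)%:Z)%:~R = c by rewrite -pmulrn natr_Zp.
pose x0 : 'rV[int]_r := \row_a (val (xb a))%:Z.
have vx0 : vb x0 = xb by apply/ffunP => a; rewrite ffunE mxE rep.
have mQ : (m%:Z %| bil x0 x0)%Z.
  rewrite -zF bil_fb vx0 -q0; apply/eqP; apply: eq_bigr => a _; ring.
have [q qE] := dvdzP mQ.
pose ej : 'rV[int]_r := delta_mx ord0 j.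
have bj v : bil v ej = (k j)%:Z * v ord0 j.
  rewrite /bil (bigD1 j) //= big1 ?addr0 => [|a aj]; first by rewrite mxE !eqxx mulr1.
  by rewrite mxE eqxx (negPf aj) mulr0.
have two := two_neq0 m_pr m_odd.
pose t : Fm := - q%:~R / (2%:R * kb j * xb j).
pose x := x0 + (m%:Z * (val t)%:Z) *: ej.
have xE a : x ord0 a = x0 ord0 a + (if a == j then m%:Z * (val t)%:Z else 0).
  by rewrite !mxE eqxx /=; case: eqP; rewrite ?mulr1 ?mulr0.
exists i, j, x; split => //.
- apply/ffunP => a; rewrite ffunE xE rmorphD /= -[in RHS]vx0 ffunE; case: eqP => _; rewrite ?addr0 //.
  have -> : (m%:Z * (val t)%:Z)%:~R = 0 :> Fm by apply/eqP; rewrite zF dvdz_mulr.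
  by rewrite addr0.
- rewrite xE (negbTE (_ : i != j)) ?addr0; last by rewrite neq_ltn ij.
  have v1 : (1 : Fm) = 1%N :> nat by rewrite -[1]/(1%:R) val_Fp_nat // modn_small // prime_gt1.
  by rewrite mxE xi [val _]v1.
- split=> a; rewrite xE mxE.
    move=> ai; have /eqP -> : xb a == 0 by have := xlt a; rewrite ai.
    by rewrite (negbTE (_ : a != j)) // neq_ltn (ltn_trans ai ij).
  move=> ja; have /eqP -> : xb a == 0.
    by apply/negPn/negP => xa; have := jmax a xa; rewrite leqNgt ja.
  by rewrite (negbTE (_ : a != j)) // neq_ltn ja orbT.
set T := (val t)%:Z in x xE *; set xj0 := (val (xb j))%:Z.
have xs : x = 1 *: x0 + (m%:Z * T) *: ej by rewrite scale1r.
have -> : bil x x = bil x0 x0 + 2 * (m%:Z * T) * bil x0 ej + (m%:Z * T) ^+ 2 * bil ej ej.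
  rewrite {2}xs bil_lin ![bil x _]bilC xs !bil_lin [bil ej x0]bilC; ring.
rewrite !bj !mxE !eqxx qE -/xj0.
have -> : q * m%:Z + 2 * (m%:Z * T) * ((k j)%:Z * xj0) + (m%:Z * T) ^+ 2 * ((k j)%:Z * 1) =
  m%:Z * (q + 2 * T * (k j)%:Z * xj0 + m%:Z * (T ^+ 2 * (k j)%:Z)) by ring.
rewrite dvd_m2 rpredDr ?dvdz_mulr // -zF rmorphD !rmorphM /= /T /xj0 !rep -[(k j)%:~R]pmulrn -/(kb j) /t.
by apply/eqP; field; rewrite two kb0 xj.
Qed.

Section Basis.
Variables (i j : 'I_r) (x : 'rV[int]_r) (xb : {ffun 'I_r -> Fm}).
Hypothesis lx : lifted i j x xb.
Let vx : vb x = xb. Proof. by case: lx. Qed.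
Let xi : x ord0 i = 1. Proof. by case: lx. Qed.
Let xlt (a : 'I_r) : (a < i)%N -> x ord0 a = 0. Proof. by case: lx => _ _ [h _] _ _; exact: h. Qed.
Let xgt (a : 'I_r) : (j < a)%N -> x ord0 a = 0. Proof. by case: lx => _ _ [_ h] _ _; exact: h. Qed.
Let ij : (i < j)%N. Proof. by case: lx => _ _ _ []. Qed.
Let xj : xb j != 0. Proof. by case: lx => _ _ _ []. Qed.
Let xx : ((m ^ 2)%N%:Z %| bil x x)%Z. Proof. by case: lx. Qed.
Let nij : i != j. Proof. by rewrite neq_ltn ij. Qed.
Let nji : j != i. Proof. by rewrite eq_sym. Qed.

(** Chosen so that e_a - al(a) e_j is orthogonal to x modulo m. *)
Definition al (a : 'I_r) : int := (val (kb a * xb a / (kb j * xb j)))%:Z.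
Lemma alE a : kb j * xb j * (al a)%:~R = kb a * xb a.
Proof. by rewrite /al -pmulrn natr_Zp; field; rewrite kb0 xj. Qed.
Lemma al0 (a : 'I_r) : (j < a)%N -> al a = 0.
Proof. by move=> /xgt h; rewrite /al -vx ffunE h mulr0 mul0r. Qed.

(** The rows are a basis of the scaled neighbour: x, m^2 e_j, and m (e_a - al(a) e_j) for the other
    a. The matrix is upper triangular since i and j are the first and last nonzero positions of x,
    and its determinant can be read off the diagonal. *)
Definition Pm : 'M[int]_r := \matrix_(a, b)
  (if a == i then x ord0 b else if a == j then (m ^ 2)%N%:Z * (b == j)%:R
   else m%:Z * (b == a)%:R - m%:Z * al a * (b == j)%:R).

Definition yv (w : 'rV[int]_r) : 'rV[int]_r := \row_b
  (if b == i then 0 else if b == j then m%:Z * w ord0 j - \sum_(a | (a != i) && (a != j)) al a * w ord0 a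
   else w ord0 b).

Lemma mulP w : w *m Pm = w ord0 i *: x + m%:Z *: yv w.
Proof.
apply/rowP => b; rewrite mxE (bigD1 i) //= (bigD1 j) //= !mxE eqxx (negPf nji) eqxx; congr (_ + _).
rewrite (eq_bigr (fun a => m%:Z * (w ord0 a * (b == a)%:R) - (m%:Z * (b == j)%:R) * (al a * w ord0 a))); last first.
  by move=> a /andP [ai aj]; rewrite mxE (negPf ai) (negPf aj); ring.
rewrite sumrB -!mulr_sumr.
have -> : \sum_(a | (a != i) && (a != j)) w ord0 a * (b == a)%:R = if (b == i) || (b == j) then 0 else w ord0 b.
  case: ifP => [bij|/negbT]; last rewrite negb_or => bij.
    rewrite big1 // => a /andP [ai aj]; case: eqP => [ba|]; rewrite ?mulr0 //.
    by move: bij; rewrite ba (negPf ai) (negPf aj).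
  rewrite (bigD1 b) //= eqxx mulr1 big1 ?addr0 // => a /andP [_ ab].
  by rewrite eq_sym (negPf ab) mulr0.
case: (eqVneq b i) => [bi|bi] /=; first by rewrite bi (negPf nij) /=; ring.
case: (eqVneq b j) => [bj|bj] /=; first by rewrite expnS expn1 PoszM /=; ring.
ring.
Qed.

Lemma bil_yv w : (m%:Z %| bil x (yv w))%Z.
Proof.
rewrite -zF bil_fb vx /QuadraticReciprocity.fb (bigD1 i) //= (bigD1 j) //= !ffunE !mxE !eqxx (negPf nji) mulr0 add0r.
rewrite rmorphB rmorphM /= -[(m%:Z)%:~R]pmulrn (_ : m%:R = 0 :> Fm); last by apply/eqP; rewrite (pnat_eq0 m_pr).
rewrite mul0r sub0r rmorph_sum /= mulrN mulr_sumr addrC -sumrB; apply/eqP/big1 => a /andP [ai aj].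
by rewrite !ffunE !mxE (negPf ai) (negPf aj) rmorphM /= mulrA alE subrr.
Qed.

Lemma inM_P w : inM x (w *m Pm).
Proof. by rewrite mulP; split; [exists (w ord0 i), (yv w)|rewrite inM_perp // bil_yv]. Qed.

Lemma inM_surj v : inM x v -> exists w, v = w *m Pm.
Proof.
move=> [[s [y vE]] hv].
pose s' := s + m%:Z * y ord0 i; pose y' := y - y ord0 i *: x.
have vE' : v = s' *: x + m%:Z *: y'.
  by rewrite vE /s' /y'; apply/rowP => b; rewrite !mxE; ring.
have y'i : y' ord0 i = 0 by rewrite !mxE xi mulr1 subrr.
move: hv; rewrite vE' inM_perp // -zF bil_fb vx /QuadraticReciprocity.fb (bigD1 i) //= (bigD1 j) //= !ffunE y'i mulr0 add0r => h.
have : (m%:Z %| y' ord0 j + \sum_(a | (a != i) && (a != j)) al a * y' ord0 a)%Z.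
  rewrite -zF; have kx : kb j * xb j != 0 by rewrite mulf_neq0 ?kb0.
  suff : kb j * xb j * (y' ord0 j + \sum_(a | (a != i) && (a != j)) al a * y' ord0 a)%:~R == 0.
    by rewrite mulf_eq0 (negPf kx).
  rewrite rmorphD rmorph_sum /= mulrDr mulr_sumr; apply/eqP; rewrite -[RHS](eqP h); congr (_ + _).
  by apply: eq_bigr => a _; rewrite rmorphM /= mulrA alE !ffunE.
move=> /dvdzP [c hc].
pose w : 'rV[int]_r := \row_b (if b == i then s' else if b == j then c else y' ord0 b).
exists w; rewrite mulP; congr (_ *: _ + _ *: _); first by rewrite mxE eqxx.
apply/rowP => b; rewrite [RHS]mxE; case: (eqVneq b i) => [->//|bi]; case: (eqVneq b j) => [->|bj]; last first.
  by rewrite [RHS]mxE (negPf bi) (negPf bj).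
rewrite [w _ _]mxE (negPf nji) eqxx (eq_bigr (fun a => al a * y' ord0 a)); last first.
  by move=> a /andP [ai aj]; rewrite mxE (negPf ai) (negPf aj).
by rewrite mulrC -hc addrK.
Qed.

Lemma det_Pm : \det Pm = m%:Z ^+ r.
Proof.
have tr : is_trig_mx Pm^T.
  apply/is_trig_mxP => a b ab; rewrite !mxE.
  case: eqP => [bi|_]; first by apply: xlt; rewrite -bi.
  have nab : a != b by rewrite neq_ltn ab.
  case: (eqVneq b j) => [bj|_]; first by rewrite -bj (negPf nab) mulr0.
  rewrite (negPf nab) mulr0 sub0r; case: (eqVneq a j) => [aj|_]; last by rewrite mulr0 oppr0.
  by rewrite al0 ?mulr0 ?mul0r ?oppr0 // -aj.
rewrite -det_tr det_trig // (bigD1 i) //= (bigD1 j) //= !mxE !eqxx (negPf nji) ?eqxx xi.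
have -> : m%:Z ^+ r = \prod_(a : 'I_r) m%:Z by rewrite prodr_const card_ord.
rewrite [in RHS](bigD1 i) //= [in RHS](bigD1 j) //= expnS expn1 PoszM mul1r mulr1 mulrA; congr (_ * _).
by apply: eq_bigr => a /andP [ai aj]; rewrite !mxE (negPf ai) (negPf aj) eqxx mulr1 mulr0 subr0.
Qed.

Definition Gm : 'M[int]_r := map_mx (fun z => (z %/ (m ^ 2)%N%:Z)%Z) (Pm *m Dg *m Pm^T).

Lemma GmE : (m ^ 2)%N%:Z *: Gm = Pm *m Dg *m Pm^T.
Proof.
apply/matrixP => a b; rewrite !mxE mulrC divzK //.
have -> : \sum_j0 (Pm *m Dg) a j0 * Pm^T j0 b = (Pm *m Dg *m Pm^T) a b by rewrite [RHS]mxE.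
have -> : (Pm *m Dg *m Pm^T) a b = bil (row a Pm) (row b Pm).
  by rewrite bilE -row_mul tr_row !mxE; apply: eq_bigr => c _; rewrite !mxE.
by apply: (inM_bil xx); rewrite rowE; exact: inM_P.
Qed.

Lemma qf_Gm w : (m ^ 2)%N%:Z * qf Gm w = (Qf k (w *m Pm))%:Z.
Proof.
rewrite -bil_Qf bilE trmx_mul !mulmxA -[w *m Pm *m Dg *m Pm^T]mulmxA -[w *m Pm *m _]mulmxA [Pm *m (_ *m _)]mulmxA -GmE.
by rewrite -scalemxAr -scalemxAl [RHS]mxE.
Qed.

Lemma mulP_inj w w' : w *m Pm = w' *m Pm -> w = w'.
Proof.
move=> /(congr1 (mulmx^~ (\adj Pm))); rewrite -!mulmxA mul_mx_adj !mul_mx_scalar det_Pm => /rowP h.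
apply/rowP => a; have := h a; rewrite !mxE; apply: mulfI; exact: (expf_neq0 _ m0z).
Qed.

Lemma Gm_pdef : pdef Gm.
Proof.
split.
  have : (m ^ 2)%N%:Z *: Gm^T = (m ^ 2)%N%:Z *: Gm.
    by rewrite -linearZ /= GmE !trmx_mul trmxK tr_diag_mx mulmxA.
  by move/matrixP => h; apply/matrixP => a b; have := h a b; rewrite !mxE => /(mulfI m2z).
move=> v v0; have : 0 < (m ^ 2)%N%:Z * qf Gm v.
  rewrite qf_Gm -bil_Qf; apply: bil_gt0; apply: contra v0 => /eqP h; apply/eqP.
  by apply: mulP_inj; rewrite h mul0mx.
by rewrite pmulr_rgt0 // lt0r m2z.
Qed.

(** The square of det Pm = m^r cancels the division by m^2, so the neighbour has the determinant of
    the original lattice, a product of entries at most 3. This bound is the same for all m. *)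
Lemma Gm_det : \det Gm <= (3 ^ r)%N%:Z.
Proof.
have := congr1 determinant GmE; rewrite detZ !det_mulmx det_tr det_Pm det_diag.
have -> : (m ^ 2)%N%:Z ^+ r = m%:Z ^+ r * m%:Z ^+ r by rewrite PoszX -exprM mulnC exprM expr2.
rewrite -mulrA mulrCA [in RHS]mulrC -mulrA [in RHS]mulrC => h.
have {}h : \det Gm = \prod_a (\row_a (k a)%:Z) ord0 a :> int.
  apply: (mulfI (expf_neq0 r m0z)); apply: (mulfI (expf_neq0 r m0z)).
  by rewrite -[LHS]/(_ * (_ * _)) h; ring.
rewrite h; have -> : (3 ^ r)%N%:Z = \prod_(a : 'I_r) 3 by rewrite prodr_const card_ord PoszX.
by apply: ler_prod => a _; rewrite mxE; case: (k13 a) => ->.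
Qed.
End Basis.
End Nbr.
End Bil.
End Neighbours.

(** * The sum over neighbours and its consequence for Legendre symbols *)

Module HeckeRelation.
Import structures.
Import all_boot all_order all_algebra all_fingroup all_solvable all_field.
Import boolp classical_sets functions cardinality fsbigop.
Import finmap.
Import zify ring lra.
Import FormalSeries WeightedSeries ThetaFunctions LatticeSums LegendreSymbol QuadraticReciprocity Reduction Neighbours.
Import Order.TTheory GRing.Theory Num.Theory.
Local Open Scope ring_scope.

Definition thetaA (F : comNzRingType) r (A : 'M[int]_r) (G : 'rV[int]_r -> F) (n : nat) : F :=
  \sum_(w \in [set w | qf A w = n%:Z]%classic) G w.
Definition per12 (F : comNzRingType) r (G : 'rV[int]_r -> F) :=
  forall v w : 'rV[int]_r, (forall j, (v ord0 j = w ord0 j %[mod 12])%Z) -> G v = G w.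

(** Bounded Gram matrices and weights of period 12 with values in a finite ring are finite in
    number, so one map can record all their coefficients at n at once. *)
Lemma finite_types (F : finComNzRingType) r K : exists (Y : finType) (tau : nat -> Y), forall n1 n2, tau n1 = tau n2 ->
  forall (A : 'M[int]_r) (G : 'rV[int]_r -> F), (forall i j, (absz (A i j) <= K)%N) -> per12 G ->
  thetaA A G n1 = thetaA A G n2.
Proof.
pose code : Type := ({ffun 'I_r * 'I_r -> 'I_(K.*2.+1)} * {ffun {ffun 'I_r -> 'I_12} -> F})%type.
pose Ac (c : code) : 'M[int]_r := \matrix_(i, j) (Posz (c.1 (i, j)) - K%:Z).
pose red (w : 'rV[int]_r) : {ffun 'I_r -> 'I_12} := [ffun j => inord (absz (w ord0 j %% 12)%Z)].
exists {ffun code -> F}, (fun n => [ffun c : code => thetaA (Ac c) (fun w => c.2 (red w)) n]).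
move=> n1 n2 /ffunP h A G Ab Gp.
pose c : code := ([ffun p => inord (absz (A p.1 p.2 + K%:Z))], [ffun v : {ffun 'I_r -> 'I_12} => G (\row_j Posz (v j))]).
have AE : Ac c = A.
  by apply/matrixP => i j; rewrite !mxE ffunE inordK /=; have := Ab i j; lia.
have GE : (fun w => c.2 (red w)) = G.
  apply/funext => w; rewrite /= ffunE; apply: Gp => j; rewrite mxE ffunE inordK; lia.
by have := h c; rewrite !ffunE AE GE.
Qed.

Section Hecke.
Variables (r : nat) (k : 'I_r -> nat) (l : nat).
Hypothesis k13 : forall j, k j = 1%N \/ k j = 3%N.
Hypotheses (r_odd : odd r) (l_pr : prime l) (l_odd : odd l).
Local Notation F := 'F_l.
Variable Psi : 'rV[int]_r -> F.
Hypothesis Psi_per : per12 Psi.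
Hypothesis Psi_sgn : forall m, prime m -> (5 <= m)%N -> exists2 s : F, (s = 1 \/ s = -1) & forall v, Psi (m%:Z *: v) = s * Psi v.
Local Notation acoef := (ws (Qf k) Psi).

Section Prime.
Variables (m : nat) (K : nat).
Hypotheses (m_pr : prime m) (m_ge5 : (5 <= m)%N).
Hypothesis hK : forall A : 'M[int]_r, pdef A -> \det A <= (3 ^ r)%N%:Z ->
  exists2 U, U \in unitmx & forall i j, (absz ((U *m A *m U^T) i j) <= K)%N.
Local Notation Fm := 'F_m.
Local Notation V := {ffun 'I_r -> Fm}.
Local Notation kb := (kb k m).
Local Notation vb := (vb m).

Definition sc (s : Fm) (x : V) : V := [ffun j => s * x j].

Lemma norm_ex (y : V) : y != 0 -> exists s x, [/\ s != 0, normalized x & y = sc s x].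
Proof.
move=> y0; have [i0 yi0] : exists i, y i != 0.
  apply/existsP; apply: contraR y0; rewrite negb_exists => /forallP h; apply/eqP/ffunP => j.
  by rewrite ffunE; apply/eqP/negPn/h.
case: (@arg_minnP _ i0 (fun a => y a != 0) (fun a : 'I_r => a : nat) yi0) => i yi imin.
exists (y i), [ffun j => y j / y i]; split => //.
  apply/existsP; exists i; rewrite ffunE divff ?eqxx //=; apply/forallP => a; apply/implyP => ai.
  rewrite ffunE; have -> : y a = 0 by apply/eqP/negPn/negP => ya; have := imin a ya; lia.
  by rewrite mul0r.
by apply/ffunP => j; rewrite !ffunE mulrC divfK.
Qed.

Lemma norm_uniq s s' (x x' : V) : s != 0 -> s' != 0 -> normalized x -> normalized x' ->
  sc s x = sc s' x' -> s = s' /\ x = x'.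
Proof.
move=> s0 s'0 /existsP [i /andP [/eqP xi /forallP xlt]] /existsP [i' /andP [/eqP xi' /forallP xlt']] /ffunP h.
have hh a : s * x a = s' * x' a by have := h a; rewrite !ffunE.
have ii : i = i'.
  apply/val_inj; case: (ltngtP i i') => // [lt|gt].
    have := hh i; rewrite xi mulr1; have /implyP /(_ lt) /eqP -> := xlt' i; rewrite mulr0 => e.
    by rewrite e eqxx in s0.
  have := hh i'; rewrite xi' mulr1; have /implyP /(_ gt) /eqP -> := xlt i'; rewrite mulr0 => e.
  by rewrite -e eqxx in s'0.
have ss : s = s' by have := hh i; rewrite xi ii xi' !mulr1.
by split=> //; apply/ffunP => a; apply: (mulfI s0); rewrite hh ss.
Qed.

(** Normalisation selects one generator of each isotropic line, hence one index per neighbour. *)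
Definition X : {set V} := [set x | normalized x && (fq kb x == 0)].
Definition nu (w : V) := #|[set x in X | fb kb x w == 0]|.

Lemma fq_sc s x : fq kb (sc s x) = s ^+ 2 * fq kb x.
Proof. by rewrite /fq mulr_sumr; apply: eq_bigr => j _; rewrite ffunE; ring. Qed.
Lemma fb_sc s x w : fb kb (sc s x) w = s * fb kb x w.
Proof. by rewrite /fb mulr_sumr; apply: eq_bigr => j _; rewrite ffunE; ring. Qed.

Lemma norm_n0 (x : V) : normalized x -> x != 0.
Proof.
move=> /existsP [i /andP [/eqP xi _]]; apply/eqP => x0.
by move/eqP: xi; rewrite x0 ffunE eq_sym oner_eq0.
Qed.

(** Each line has m - 1 nonzero vectors; the extra one is the zero vector. *)
Lemma isoc_nu w : isoc kb w = (m.-1 * nu w).+1.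
Proof.
have -> : (m.-1 * nu w)%N = #|finset.setX [set s : Fm | s != 0] [set x in X | fb kb x w == 0]|.
  rewrite cardsX; congr (_ * _)%N; rewrite (_ : [set s : Fm | s != 0] = [set~ 0]) ?cardsC1 ?card_Fp //.
  by apply/setP => s; rewrite !inE.
rewrite -(card_in_imset (f := fun p : Fm * V => sc p.1 p.2)); last first.
  move=> [s x] [s' x']; rewrite !inE /= => /andP [s0 /andP [/andP [nx _] _]] /andP [s'0 /andP [/andP [nx' _] _]].
  by move/(norm_uniq s0 s'0 nx nx') => [-> ->].
rewrite /isoc (cardsD1 (0 : V)) inE; have -> : (fq kb (0 : V) == 0) && (fb kb 0 w == 0).
  have z0 : (0 : V) = sc 0 0 by apply/ffunP => j; rewrite !ffunE mul0r.
  by rewrite z0 fq_sc fb_sc !mul0r expr0n mul0r !eqxx.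
rewrite add1n; congr S; apply: eq_card => y; apply/idP/imsetP.
  rewrite !inE => /andP [y0 /andP [q0 b0]]; have [s [x [s0 nx yE]]] := norm_ex y0.
  exists (s, x) => //; rewrite !inE /= s0 nx /=; move: q0 b0.
  by rewrite yE fq_sc fb_sc !mulf_eq0 (negPf s0) /= => -> ->.
move=> [[s x]]; rewrite !inE /= => /andP [s0 /andP [/andP [nx /eqP q0] /eqP b0]] ->.
rewrite fq_sc fb_sc q0 b0 !mulr0 eqxx andbT /=.
rewrite andbT; apply: (contra _ (norm_n0 nx)) => /eqP /ffunP h; apply/eqP/ffunP => a; have := h a.
by rewrite !ffunE => /eqP; rewrite mulf_eq0 (negPf s0) /= => /eqP.
Qed.

Lemma nu_eq w : fq kb w != 0 ->
  (m ^ 2 * (m.-1 * nu w).+1)%N%:Z = (m ^ r)%N%:Z + (m.-1)%:Z * leg (- fq kb w * \prod_j kb j) * (leg (-1 : Fm) * m%:Z) ^+ r.+1./2.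
Proof. by move=> w0; rewrite -isoc_nu; apply: isoc_eq => //; [exact: m_odd|move=> j; exact: kb0]. Qed.

Lemma fq_vb (v : 'rV[int]_r) : fq kb (vb v) = (Qf k v)%:R.
Proof.
rewrite pmulrn -bil_Qf bil_fb //; apply: eq_bigr => a _; ring.
Qed.

Lemma vb0 (v : 'rV[int]_r) : vb v = 0 -> exists w, v = m%:Z *: w.
Proof.
move=> /ffunP h; exists (\row_j (v ord0 j %/ m%:Z)%Z); apply/rowP => j; rewrite !mxE mulrC divzK //.
by have := h j; rewrite !ffunE => /eqP; rewrite zF.
Qed.
Lemma vbZ (w : 'rV[int]_r) : vb (m%:Z *: w) = 0.
Proof. by apply/ffunP => j; rewrite !ffunE mxE; apply/eqP; rewrite zF // dvdz_mulr. Qed.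

Lemma vb_lin s (x y : 'rV[int]_r) : vb (s *: x + m%:Z *: y) = sc s%:~R (vb x).
Proof.
apply/ffunP => j; rewrite !ffunE !mxE rmorphD rmorphM /=.
have -> : (m%:Z * y ord0 j)%:~R = 0 :> Fm by apply/eqP; rewrite zF // dvdz_mulr.
by rewrite addr0.
Qed.

(** [Mx] tests membership in m times the neighbour. For v nonzero modulo m on the line of x, the
    orthogonality condition follows from m^2 | Q(v), because Q(v) determines bil x y modulo m; for v
    = m w it is the only condition. The reduced basis U P is integral, so the transported weight
    keeps its period 12. *)
Lemma neighbor (xb : V) : xb \in X -> exists Mx : 'rV[int]_r -> bool,
  [/\ forall v, vb v != 0 -> ((m ^ 2)%N %| Qf k v)%N -> Mx v = [exists s, vb v == sc s xb],
      forall w, Mx (m%:Z *: w) = (fb kb xb (vb w) == 0) &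
      exists (A : 'M[int]_r) (G : 'rV[int]_r -> F), [/\ forall i j, (absz (A i j) <= K)%N, per12 G &
        forall n, ws (Qf k) (fun v => if Mx v then Psi v else 0) (m ^ 2 * n)%N = thetaA A G n]].
Proof.
rewrite inE => /andP [nx /eqP q0].
have [i [j [x lx]]] := lift_ex k13 m_pr m_ge5 nx q0.
have [vx xi xlt _ xx] := lx.
have xb0 := norm_n0 nx.
exists (fun v => `[< inM k m x v >]); split.
- move=> v v0 mQ; apply/asboolP/existsP => [[[s [y vE]] _]|[s /eqP vs]].
    by exists s%:~R; rewrite vE vb_lin vx.
  pose s' := (val s)%:Z; have s's : s'%:~R = s by rewrite /s' -pmulrn natr_Zp.
  have [y hy] : exists y, v - s' *: x = m%:Z *: y.
    apply: vb0; apply/ffunP => a; have /ffunP /(_ a) := vs; rewrite -vx !ffunE !mxE rmorphB rmorphM /= s's => ->.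
    by rewrite subrr.
  have vE : v = s' *: x + m%:Z *: y by rewrite -hy addrC subrK.
  split; first by exists s', y.
  have s0 : s != 0.
    by apply: contraNneq v0 => s0; rewrite vs s0; apply/eqP/ffunP => a; rewrite !ffunE mul0r.
  rewrite vE inM_perp // -zF //.
  have : ((m ^ 2)%N%:Z %| bil k v v)%Z by rewrite bil_Qf dvdzE.
  have -> : bil k v v = s' ^+ 2 * bil k x x + m%:Z * (2 * s' * bil k x y) + (m ^ 2)%N%:Z * bil k y y.
    by rewrite {2}vE bil_lin ![bil k v _]bilC vE !bil_lin [bil k y x]bilC PoszX; ring.
  rewrite rpredDr ?dvdz_mulr // rpredDl; last by rewrite dvdz_mull.
  rewrite dvd_m2 // -zF // !rmorphM /= s's !mulf_eq0 (negPf s0) orbF.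
  by rewrite (negPf (two_neq0 m_pr (m_odd m_pr m_ge5))).
- move=> w; apply/asboolP/idP => [[_]|h].
    rewrite -[m%:Z *: w]add0r -[0](scale0r x) inM_perp // -zF // bil_fb // vx.
    by [].
  split; first by exists 0, w; rewrite scale0r add0r.
  by rewrite -[m%:Z *: w]add0r -[0](scale0r x) inM_perp // -zF // bil_fb // vx.
have [U Uu Ub] := hK (Gm_pdef k13 m_pr m_ge5 lx) (Gm_det k13 m_pr m_ge5 lx).
set P := Pm k i j x xb; set A := U *m _ *m U^T in Ub.
exists A, (fun w => Psi (w *m (U *m P))); split => //.
  move=> v w vw; apply: Psi_per => a; rewrite !mxE.
  apply/eqP; rewrite eqz_mod_dvd -sumrB; apply: rpred_sum => b _; rewrite -mulrBl dvdz_mulr //.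
  by rewrite -eqz_mod_dvd; apply/eqP; exact: vw.
move=> n.
rewrite (@ws_reindex _ _ _ (fun w : 'rV[int]_r => w *m (U *m P)) (fun w => Qf k (w *m (U *m P))) _ (fun w => Psi (w *m (U *m P)))) //.
- rewrite /ws /thetaA; apply: eq_fsbigl; apply/seteqP; split => w /=.
    move=> h; have := qf_Gm k13 m_pr m_ge5 lx (w *m U); rewrite -mulmxA -/P h PoszM.
    by move/(mulfI (m2z m_pr)); rewrite -qf_conj.
  rewrite qf_conj => h; have := qf_Gm k13 m_pr m_ge5 lx (w *m U); rewrite h -mulmxA -/P -PoszM => -[] ->.
  by [].
- move=> w w'; rewrite !mulmxA => /(mulP_inj m_pr lx) h.
  by rewrite -[w](mulmxK Uu) h mulmxK.
- by move=> w; rewrite asboolT // mulmxA; exact: inM_P.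
- move=> v; case: asboolP => [|_]; last by rewrite eqxx.
  move=> /(inM_surj k13 m_pr m_ge5 lx) [w vE] _; exists (w *m invmx U).
  by rewrite mulmxA mulmxKV // vE.
Qed.

(* A vector of norm [m^2 n] outside [m Z^r] lies in exactly one neighbour, and [m w] in those whose isotropic line is orthogonal to [w]. *)
Lemma hecke_id :
  exists2 s : F, s = 1 \/ s = -1 & exists AG : V -> ('M[int]_r * ('rV[int]_r -> F))%type,
   (forall x, x \in X -> (forall i j, (absz ((AG x).1 i j) <= K)%N) /\ per12 (AG x).2) /\
   forall n, ~~ (m %| n)%N -> forall nn, (forall w, Qf k w = n -> nu (vb w) = nn) ->
   \sum_(x in X) thetaA (AG x).1 (AG x).2 n = acoef (m ^ 2 * n)%N + (nn%:R - 1) * (s * acoef n).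
Proof.
have [s s1 Ps] := Psi_sgn m_pr m_ge5; exists s => //.
have /choice [Mx hMx] : forall xb : V, exists Mx : 'rV[int]_r -> bool, xb \in X ->
  [/\ forall v, vb v != 0 -> ((m ^ 2)%N %| Qf k v)%N -> Mx v = [exists s, vb v == sc s xb],
      forall w, Mx (m%:Z *: w) = (fb kb xb (vb w) == 0) &
      exists (A : 'M[int]_r) (G : 'rV[int]_r -> F), [/\ forall i j, (absz (A i j) <= K)%N, per12 G &
        forall n, ws (Qf k) (fun v => if Mx v then Psi v else 0) (m ^ 2 * n)%N = thetaA A G n]].
  move=> xb; case: (boolP (xb \in X)) => [/neighbor [Mx h]|_]; last by exists (fun=> true).
  by exists Mx.
have /choice [AG hAG] : forall xb : V, exists AG : ('M[int]_r * ('rV[int]_r -> F))%type, xb \in X ->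
  [/\ forall i j, (absz (AG.1 i j) <= K)%N, per12 AG.2 &
   forall n, ws (Qf k) (fun v => if Mx xb v then Psi v else 0) (m ^ 2 * n)%N = thetaA AG.1 AG.2 n].
  move=> xb; case: (boolP (xb \in X)) => [/hMx [_ _ [A [G h]]]|_]; first by exists (A, G).
  by exists (0, Psi).
exists AG; split; first by move=> x /hAG [].
move=> n mn nn hnn.
have fQ : finfib (Qf k) by apply: finfib_Qf; exact: k_gt0.
pose fib := fset_set [set t | (Qf k t <= m ^ 2 * n)%N]%classic.
have wE psi : ws (Qf k) psi (m ^ 2 * n)%N = \sum_(t <- fib | Qf k t == (m ^ 2 * n)%N) psi t :> F by exact: wsE.
transitivity (\sum_(t <- fib | Qf k t == (m ^ 2 * n)%N) (#|[set x in X | Mx x t]|)%:R * Psi t).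
  rewrite (eq_bigr (fun x => \sum_(t <- fib | Qf k t == (m ^ 2 * n)%N) (if Mx x t then Psi t else 0))); last first.
    by move=> x /hAG [_ _ <-]; rewrite wE.
  rewrite exchange_big /=; apply: eq_bigr => t _.
  rewrite -big_mkcondr /= sumr_const mulr_natl; congr (_ *+ _); by apply: eq_card => x; rewrite [RHS]inE.
(* The vectors v = m w contribute s a(n) in total, and are counted nn times instead of once; this is
   the origin of nn - 1. *)
have -> : s * acoef n = ws (Qf k) (fun v => if vb v == 0 then Psi v else 0) (m ^ 2 * n)%N.
  rewrite [ws _ (fun v => if _ then _ else _)](@ws_reindex _ _ _ (fun w : 'rV[int]_r => m%:Z *: w) (fun w => Qf k (m%:Z *: w)) _ (fun w => s * Psi w)) //.
  - rewrite -(sCE s acoef) wsZ // /ws; apply: eq_fsbigl.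
    have QZ w : Qf k (m%:Z *: w) = (m ^ 2 * Qf k w)%N.
      rewrite /Qf big_distrr /=; apply: eq_bigr => j _; rewrite mxE /tq abszM expnMn /=; lia.
    apply/seteqP; split => w /=; rewrite QZ; first by move=> ->.
    by move/eqP; rewrite eqn_pmul2l ?expn_gt0 ?prime_gt0 // => /eqP.
  - by move=> w w' /rowP h; apply/rowP => j; have := h j; rewrite !mxE => /(mulfI (m0z m_pr)).
  - by move=> w; rewrite vbZ eqxx.
  - by move=> v; case: (eqVneq (vb v) 0) => [e _|_]; [have [w ->] := vb0 e; exists w|rewrite eqxx].
rewrite !wE mulr_sumr -big_split /=; apply: eq_bigr => v /eqP Qv.
case: (eqVneq (vb v) 0) => [e|v0].
  have [w vw] := vb0 e.
  have -> : [set x in X | Mx x v] = [set x in X | fb kb x (vb w) == 0].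
    apply/setP => x; rewrite [LHS]inE [RHS]inE; apply: andb_id2l => xX.
    by rewrite vw; have [_ -> _] := hMx x xX.
  rewrite -/(nu (vb w)) hnn; first by ring.
  have : (m ^ 2 * Qf k w = m ^ 2 * n)%N.
    rewrite -Qv vw /Qf big_distrr /=; apply: eq_bigr => j _; rewrite mxE /tq abszM expnMn /=; lia.
  by move/eqP; rewrite eqn_pmul2l ?expn_gt0 ?prime_gt0 // => /eqP.
rewrite mulr0 addr0.
have [s0 [x0 [s00 nx0 vE]]] := norm_ex v0.
have x0X : x0 \in X.
  rewrite inE nx0 /=; have : fq kb (vb v) == 0 by rewrite fq_vb Qv (pnat_eq0 m_pr) -mulnA dvdn_mulr.
  by rewrite vE fq_sc mulf_eq0 expf_eq0 (negPf s00).
suff -> : [set x in X | Mx x v] = [set x0] by rewrite cards1 mul1r.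
have mQ : ((m ^ 2)%N %| Qf k v)%N by rewrite Qv dvdn_mulr.
apply/setP => x; rewrite inE finset.in_set1; apply/andP/eqP => [[xX]|->].
  have [-> // _ _] := hMx x xX; move=> /existsP [s1' /eqP h].
  have nx : normalized x by move: xX; rewrite inE => /andP [].
  have s10 : s1' != 0 by apply: contraNneq v0 => e; rewrite h e; apply/eqP/ffunP => a; rewrite !ffunE mul0r.
  by rewrite vE in h; have [_ ->] := norm_uniq s00 s10 nx0 nx h.
split=> //; have [-> // _ _] := hMx x0 x0X; apply/existsP; exists s0; exact/eqP.
Qed.
End Prime.

(** Equal [tau] gives equal sums over neighbours, hence equal line counts nu in F. By [nu_eq] their
    difference is, up to units of F, a difference of two Legendre symbols, and l > 2 lifts its
    vanishing from F to the integers. *)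
Lemma hecke_type : exists (Y : finType) (tau : nat -> Y),
  (forall n1 n2, tau n1 = tau n2 -> acoef n1 = acoef n2) /\
  (forall m n1 n2, prime m -> (5 <= m)%N -> m != l -> ~~ (m %| n1)%N -> ~~ (m %| n2)%N -> tau n1 = tau n2 ->
    acoef n1 != 0 -> acoef (m ^ 2 * n1)%N = acoef (m ^ 2 * n2)%N -> leg (n1%:R : 'F_m) = leg (n2%:R : 'F_m)).
Proof.
have [K hK] := bounded_gram r (3 ^ r).
have [Y [tau htau]] := finite_types F r K.
exists (Y * F)%type, (fun n => (tau n, acoef n)); split; first by move=> n1 n2 [].
move=> m n1 n2 m_pr m5 ml m1 m2 [tt a12] a0 am.
have wit n : acoef n != 0 -> exists w, Qf k w = n.
  move=> an; apply: contrapT => ne; move/eqP: an; apply; rewrite /ws fsbig1 // => w /= h.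
  by case: ne; exists w.
have [w1 w1E] := wit _ a0; have [w2 w2E] : exists w, Qf k w = n2 by apply: wit; rewrite -a12.
pose P : 'F_m := \prod_j kb k m j.
have P0 : P != 0 by rewrite prodf_seq_neq0; apply/allP => j _ /=; exact: kb0.
have nuE w n : Qf k w = n -> ~~ (m %| n)%N -> (m ^ 2 * (m.-1 * nu (vb m w)).+1)%N%:Z =
   (m ^ r)%N%:Z + (m.-1)%:Z * leg (- (n%:R : 'F_m) * P) * (leg (-1 : 'F_m) * m%:Z) ^+ r.+1./2.
  by move=> Qw mn; rewrite nu_eq // fq_vb // Qw // (pnat_eq0 m_pr).
have nuC w w' n : Qf k w = n -> Qf k w' = n -> ~~ (m %| n)%N -> nu (vb m w) = nu (vb m w').
  move=> Qw Qw' mn; have := nuE _ _ Qw mn; rewrite -(nuE _ _ Qw' mn) => -[] /eqP.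
  by rewrite eqn_pmul2l ?expn_gt0 ?prime_gt0 // eqSS eqn_pmul2l ?(eqP) //; [move/eqP|have := prime_gt1 m_pr; lia].
have [s s1 [AG [hAG hid]]] := hecke_id m_pr m5 hK.
have e1 := hid n1 m1 _ (fun w Qw => nuC w w1 n1 Qw w1E m1).
have e2 := hid n2 m2 _ (fun w Qw => nuC w w2 n2 Qw w2E m2).
have e12 : \sum_(x in X m) thetaA (AG x).1 (AG x).2 n1 = \sum_(x in X m) thetaA (AG x).1 (AG x).2 n2.
  by apply: eq_bigr => x /hAG [h1 h2]; exact: htau.
move: e12; rewrite e1 e2 am -a12 => /addrI.
have sa0 : s * acoef n1 != 0 by rewrite mulf_neq0 //; case: s1 => ->; rewrite ?oppr_eq0 oner_eq0.
move=> /(mulIf sa0) /addIr nn.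
have mF : (m%:R : F) != 0 by rewrite (pnat_eq0 l_pr) dvdn_prime2 // eq_sym.
have dif : (m ^ 2)%N%:Z * ((nu (vb m w1))%:Z - (nu (vb m w2))%:Z) =
   (leg (- (n1%:R : 'F_m) * P) - leg (- (n2%:R : 'F_m) * P)) * (leg (-1 : 'F_m) * m%:Z) ^+ r.+1./2.
  have m10 : (m.-1)%:Z != 0 by have := prime_gt1 m_pr; lia.
  apply: (mulfI m10); have := nuE _ _ w1E m1; have := nuE _ _ w2E m2.
  rewrite !PoszM !(intS (m.-1 * _)) !PoszM.
  move: ((leg (-1) * _) ^+ _) (leg (- n1%:R * P)) (leg (- n2%:R * P)) => a b c h2 h1.
  have -> : m.-1%:Z * ((m ^ 2)%N%:Z * ((nu (vb m w1))%:Z - (nu (vb m w2))%:Z)) =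
    (m ^ 2)%N%:Z * (1 + m.-1%:Z * (nu (vb m w1))%:Z) - (m ^ 2)%N%:Z * (1 + m.-1%:Z * (nu (vb m w2))%:Z) by ring.
  by rewrite h1 h2; ring.
have difF : ((leg (- (n1%:R : 'F_m) * P) - leg (- (n2%:R : 'F_m) * P)))%:~R = 0 :> F.
  have := congr1 (fun z : int => z%:~R : F) dif; rewrite !rmorphM rmorphB /= -!pmulrn nn subrr mulr0.
  move/esym/eqP; rewrite mulf_eq0 => /orP [/eqP //|].
  rewrite rmorphXn expf_eq0 => /andP [_]; rewrite rmorphM mulf_eq0 /= -pmulrn (negPf mF) orbF.
  have m1F : (-1 : 'F_m) != 0 by rewrite oppr_eq0 oner_eq0.
  by case: (leg_vals m1F) => ->; rewrite ?mulrN1z ?oppr_eq0 oner_eq0.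
have mo := m_odd m_pr m5.
have legs : leg (- (n1%:R : 'F_m) * P) = leg (- (n2%:R : 'F_m) * P).
  apply: (int3_inj l_pr l_odd); rewrite ?leg_abs //.
  by apply/eqP; rewrite -subr_eq0; apply/eqP; rewrite -[RHS]difF rmorphB.
have Pm0 : leg (- P) != 0 by rewrite leg_eq0 oppr_eq0.
apply: (mulfI Pm0); rewrite -!(legM m_pr mo).
have cE n : - P * n%:R = - (n%:R : 'F_m) * P by ring.
by rewrite !cE legs.
Qed.
End Hecke.
End HeckeRelation.

(** * The Jacobi symbol *)

Module JacobiSymbol.
Import structures.
Import all_boot all_order all_algebra all_fingroup all_solvable all_field.
Import zify ring lra.
Import LegendreSymbol QuadraticReciprocity.
Import Order.TTheory GRing.Theory Num.Theory.
Local Open Scope ring_scope.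

Definition legn (p k : nat) : int := leg (k%:R : 'F_p).

Lemma natF_mod p (a b : nat) : prime p -> a = b %[mod p] -> (a%:R : 'F_p) = b%:R.
Proof. by move=> pp h; apply/val_inj; rewrite /= !val_Fp_nat. Qed.
Lemma legn_mod p a b : prime p -> a = b %[mod p] -> legn p a = legn p b.
Proof. by move=> pp h; rewrite /legn (natF_mod pp h). Qed.
Lemma legnM p a b : prime p -> odd p -> legn p (a * b) = legn p a * legn p b.
Proof. by move=> pp op; rewrite /legn natrM legM. Qed.
Lemma legn1 p : prime p -> odd p -> legn p 1 = 1.
Proof. exact: leg1. Qed.
Lemma legn_eq0 p k : prime p -> (legn p k == 0) = (p %| k)%N.
Proof. by move=> pp; rewrite /legn leg_eq0 pnat_eq0. Qed.
Lemma legn_sgn p k : prime p -> ~~ (p %| k)%N -> legn p k = 1 \/ legn p k = -1.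
Proof. by move=> pp pk; apply: leg_vals; rewrite pnat_eq0. Qed.

(* [jac n k] is the Jacobi symbol [(k / n)]: the modulus comes first. *)
Definition jac (n k : nat) : int := \prod_(p <- primes n) legn p k ^+ logn p n.

Lemma jac_sub n k (s : seq nat) : uniq s -> {subset primes n <= s} -> jac n k = \prod_(p <- s) legn p k ^+ logn p n.
Proof.
move=> us sub; rewrite [RHS](bigID (mem (primes n))) /= [X in _ * X]big1 ?mulr1 => [|p np]; last first.
  by move: np; rewrite -logn_gt0 -eqn0Ngt => /eqP ->.
rewrite -[RHS]big_filter; apply: perm_big; apply: uniq_perm; rewrite ?primes_uniq ?filter_uniq // => p.
by rewrite mem_filter /=; apply/idP/andP => [h|[]//]; split=> //; exact: sub.
Qed.

Lemma jac1 k : jac 1 k = 1. Proof. by rewrite /jac big_nil. Qed.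
Lemma jac_muln m n k : (0 < m)%N -> (0 < n)%N -> jac (m * n) k = jac m k * jac n k.
Proof.
move=> m0 n0; have us := primes_uniq (m * n).
have sm : {subset primes m <= primes (m * n)} by move=> p h; rewrite primesM // h.
have sn : {subset primes n <= primes (m * n)} by move=> p h; rewrite primesM // h orbT.
rewrite (jac_sub k us sm) (jac_sub k us sn) -big_split /=; apply: eq_bigr => p _.
by rewrite lognM // exprD.
Qed.
Lemma jac_prime p k : prime p -> jac p k = legn p k.
Proof. by move=> pp; rewrite /jac primes_prime // big_seq1 logn_prime // eqxx. Qed.

Lemma odd_prime_div n p : odd n -> p \in primes n -> prime p /\ odd p.
Proof.
move=> on; rewrite mem_primes => /and3P [pp _ pn]; split=> //.
by move: on; case/dvdnP: pn => k ->; rewrite oddM => /andP [].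
Qed.

Lemma jacM n a b : odd n -> jac n (a * b) = jac n a * jac n b.
Proof.
move=> on; rewrite /jac -big_split big_seq [RHS]big_seq; apply: eq_bigr => p /(odd_prime_div on) [pp op].
by rewrite legnM // exprMn.
Qed.
Lemma jac_mod n a b : a = b %[mod n] -> jac n a = jac n b.
Proof.
move=> h; rewrite /jac big_seq [RHS]big_seq; apply: eq_bigr => p; rewrite mem_primes => /and3P [pp n0 pn].
congr (_ ^+ _); apply: legn_mod => //; rewrite -(modn_dvdm a pn) -(modn_dvdm b pn) h //.
Qed.
Lemma jac_vals n k : (0 < n)%N -> if coprime k n then jac n k = 1 \/ jac n k = -1 else jac n k = 0.
Proof.
move=> n0; case: (boolP (coprime k n)) => c.
  rewrite /jac big_seq; elim/big_ind: _ => [|x y|p]; first by left.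
    by case=> [->|->] [->|->]; [left|right|right|left]; ring.
  rewrite mem_primes => /and3P [pp _ pn].
  have pk : ~~ (p %| k)%N.
    apply/negP => pk; have : (p %| gcdn k n)%N by rewrite dvdn_gcd pk pn.
    by rewrite (eqP c) dvdn1 => /eqP p1; rewrite p1 in pp.
  by case: (legn_sgn pp pk) => ->; rewrite ?expr1n; [left|rewrite -signr_odd; case: (odd _); [right|left]].
have g1 : (1 < gcdn k n)%N.
  by have := gcdn_gt0 k n; rewrite n0 orbT; move: c; rewrite /coprime; case: (gcdn k n) => [|[|]].
have pp := pdiv_prime g1; have := pdiv_dvd (gcdn k n); rewrite dvdn_gcd => /andP [pk pn].
apply/eqP; rewrite prodf_seq_eq0; apply/hasP; exists (pdiv (gcdn k n)); first by rewrite mem_primes pp n0.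
rewrite /= expf_eq0 logn_gt0 mem_primes pp n0 pn /= legn_eq0 //.
Qed.
Lemma jac_abs n k : (0 < n)%N -> `|jac n k| <= 1.
Proof. by move=> n0; have := jac_vals k n0; case: ifP => _; [case=> ->|move=> ->]. Qed.

Lemma odd_half_muln p m : odd p -> odd m -> odd (p * m)./2 = odd (p./2 + m./2).
Proof.
move=> op om.
have [a pE] : exists a, p = a.*2.+1 by exists p./2; have := odd_double_half p; rewrite op; lia.
have [b mE] : exists b, m = b.*2.+1 by exists m./2; have := odd_double_half m; rewrite om; lia.
have -> : (p * m = (a * b).*2.*2 + (a + b).*2 + 1)%N by rewrite pE mE -!muln2; nia.
rewrite pE mE; have -> : (((a * b).*2.*2 + (a + b).*2 + 1)./2 = (a * b).*2 + (a + b))%N by lia.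
have -> : ((a.*2.+1)./2 = a)%N by lia.
have -> : ((b.*2.+1)./2 = b)%N by lia.
by rewrite oddD odd_double.
Qed.

(** Induction on the prime factors of n; the signs multiply because n -> floor(n/2) is additive
    modulo 2 on products of odd numbers. *)
Lemma jac_reciprocity n Q : odd n -> prime Q -> odd Q -> ~~ (Q %| n)%N ->
  legn Q n = (-1) ^+ (Q./2 * n./2) * jac n Q.
Proof.
move=> + pQ oQ; elim/ltn_ind: n => n IH on Qn.
have n0 : (0 < n)%N by case: n on {IH Qn}.
case: (eqVneq n 1%N) => [->|n1]; first by rewrite jac1 muln0 mulr1 legn1.
have np : (1 < n)%N by lia.
have pp := pdiv_prime np; have pn := pdiv_dvd n; set p := pdiv n in pp pn.
have [m nE] := dvdnP pn; rewrite mulnC in nE.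
have [op om] : odd p /\ odd m by move: on; rewrite nE oddM => /andP [].
have m0 : (0 < m)%N by case: (m) om.
have mn : (m < n)%N by rewrite nE -{1}(mul1n m) ltn_pmul2r // prime_gt1.
have Qm : ~~ (Q %| m)%N by apply: contra Qn => h; rewrite nE dvdn_mull.
have Qp : Q != p by apply: contraNneq Qn => ->; rewrite nE dvdn_mulr.
rewrite nE legnM // jac_muln ?(prime_gt0 pp) // jac_prime // (IH m mn om Qm).
rewrite {1}/legn (quadratic_reciprocity pQ oQ pp op Qp) -/(legn p Q).
have -> : ((-1) ^+ (Q./2 * (p * m)./2) : int) = (-1) ^+ (Q./2 * p./2) * (-1) ^+ (Q./2 * m./2).
  rewrite -exprD -mulnDr -[LHS]signr_odd -[RHS]signr_odd !oddM; congr (_ ^+ (nat_of_bool (_ && _))).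
  exact: odd_half_muln.
by ring.
Qed.

Lemma square_of_logs n : (0 < n)%N -> (forall p, prime p -> ~~ odd (logn p n)) -> exists k, n = (k ^ 2)%N.
Proof.
move=> n0 h; exists (\prod_(p <- primes n) p ^ (logn p n)./2)%N.
rewrite {1}(prod_prime_decomp n0) prime_decompE big_map /= -mulnn -big_split /=.
rewrite big_seq [RHS]big_seq; apply: eq_bigr => p; rewrite mem_primes => /and3P [pp _ _].
rewrite -expnD addnn; congr (_ ^ _)%N; have := odd_double_half (logn p n); rewrite (negPf (h p pp)); lia.
Qed.

(** A nonresidue modulo one prime of odd exponent, made congruent to 1 modulo the rest of n by the
    Chinese remainder theorem. *)
Lemma jac_neg n : odd n -> (forall k, n <> (k ^ 2)%N) -> exists2 u, coprime u n & jac n u = -1.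
Proof.
move=> on nsq; have n0 : (0 < n)%N by case: (n) on.
have [p pp op] : exists2 p, prime p & odd (logn p n).
  case: (boolP (has (fun p => odd (logn p n)) (primes n))) => [/hasP [p]|/hasPn h].
    by rewrite mem_primes => /and3P [pp _ _] o; exists p.
  case: (square_of_logs n0) => [p pp|k /nsq //].
  case: (boolP (p \in primes n)) => [/h //|]; rewrite -logn_gt0 -eqn0Ngt => /eqP -> //.
have pn : p \in primes n by rewrite -logn_gt0; case: (logn p n) op.
have [_ podd] := odd_prime_div on pn.
have [a ha] := ex_nonres pp podd.
have [n' cp nE] := pfactor_coprime pp n0.
have cp' : coprime (p ^ logn p n) n' by rewrite coprimeXl.
pose u := chinese (p ^ logn p n) n' (val a) 1.
have up : legn p u = -1.
  rewrite -ha /legn; congr leg; rewrite -[RHS]natr_Zp; apply: natF_mod => //.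
  have e : u = val a %[mod p ^ logn p n] by exact: chinese_modl.
  have dv : (p %| p ^ logn p n)%N by rewrite dvdn_exp // logn_gt0.
  by rewrite -(modn_dvdm u dv) e modn_dvdm.
have ju : jac n u = -1.
  rewrite /jac (bigD1_seq p) ?primes_uniq //= up -signr_odd op big_seq_cond big1 ?mulr1 // => q /andP [qn qp].
  have [pq oq] := odd_prime_div on qn.
  have qn' : (q %| n')%N.
    move: qn; rewrite mem_primes => /and3P [_ _]; rewrite nE Gauss_dvdl //.
    by rewrite coprime_sym coprimeXl // prime_coprime // dvdn_prime2 // eq_sym.
  rewrite (@legn_mod q u 1) ?legn1 ?expr1n //.
  have e : u = 1 %[mod n'] by exact: chinese_modr.
  by rewrite -(modn_dvdm u qn') e modn_dvdm.
exists u => //; have := jac_vals u n0; case: ifP => // _; by rewrite ju.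
Qed.

Lemma jac_sum0 n : odd n -> (forall k, n <> (k ^ 2)%N) -> \sum_(0 <= k < n) jac n k = 0.
Proof.
move=> on nsq; have n0 : (0 < n)%N by case: (n) on.
have [u cu ju] := jac_neg on nsq; rewrite big_mkord.
have [m nE] : exists m, n = m.+1 by exists n.-1; rewrite prednK.
have inj : injective (fun i : 'I_n => Ordinal (ltn_pmod (u * i) n0)).
  move=> i j /(congr1 val) /= h; have {}h : (u * i == u * j %[mod n])%N by rewrite h.
  wlog ij : i j h / (i <= j)%N.
    by move=> H; case: (leqP i j) => [|/ltnW] ij; [exact: H|symmetry; apply: H => //; rewrite eq_sym].
  rewrite eq_sym eqn_mod_dvd ?leq_mul2l ?ij ?orbT // -mulnBr Gauss_dvdr 1?coprime_sym // in h.
  apply/val_inj/eqP; rewrite eqn_leq ij /= -subn_eq0; apply/negPn/negP => ne.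
  by have := dvdn_leq _ h; rewrite lt0n ne => /(_ isT); have := ltn_ord j; lia.
have e : \sum_(i < n) jac n i = - \sum_(i < n) jac n i.
  rewrite {1}(reindex_inj inj) -sumrN; apply: eq_bigr => i _ /=.
  rewrite (@jac_mod n _ (u * i)) ?modn_mod // jacM // ju mulN1r //.
by move: e; move: (\sum_(i < n) _) => s; lia.
Qed.
End JacobiSymbol.

(** * Divisor sums, the Moebius and von Mangoldt functions, the logarithm *)

Module ArithmeticFunctions.
Import structures.
Import all_boot all_order all_algebra.
Import boolp reals exp.
Import zify ring lra.
Import Order.TTheory GRing.Theory Num.Theory.
Local Open Scope ring_scope.

Section Sums.
Variable V : nmodType.
Lemma sum_mult (d x : nat) (G : nat -> V) : (0 < d)%N ->
  \sum_(1 <= n < x.+1 | (d %| n)%N) G n = \sum_(1 <= e < (x %/ d).+1) G (d * e)%N.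
Proof.
move=> d0; rewrite -big_filter -(big_map (muln d) xpredT G); apply: perm_big; apply: uniq_perm.
- by rewrite filter_uniq // iota_uniq.
- by rewrite map_inj_uniq ?iota_uniq // => a b /eqP; rewrite eqn_pmul2l // => /eqP.
- move=> n; rewrite mem_filter mem_index_iota; apply/idP/mapP.
    move=> /andP [dn /andP [n1 nx]]; exists (n %/ d)%N; last by rewrite mulnC divnK.
    by rewrite mem_index_iota divn_gt0 // dvdn_leq // ltnS leq_div2r.
  move=> [e]; rewrite mem_index_iota ltnS leq_divRL // => /andP [e1 ex] ->.
  by rewrite dvdn_mulr // muln_gt0 d0 e1 ltnS mulnC ex.
Qed.

Lemma dirichlet_swap x (G : nat -> nat -> V) :
  \sum_(1 <= n < x.+1) \sum_(1 <= d < x.+1 | (d %| n)%N) G d (n %/ d)%N =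
  \sum_(1 <= d < x.+1) \sum_(1 <= e < (x %/ d).+1) G d e.
Proof.
rewrite (exchange_big_dep_nat xpredT) //= big_nat_cond [RHS]big_nat_cond; apply: eq_bigr => d /andP [/andP [d1 _] _].
by rewrite sum_mult //; apply: eq_bigr => e _; rewrite mulKn.
Qed.

Lemma sum_ltn (x y : nat) (P : pred nat) (G : nat -> V) : (x <= y)%N -> (forall d, P d -> (d <= x)%N) ->
  \sum_(1 <= d < y.+1 | P d) G d = \sum_(1 <= d < x.+1 | P d) G d.
Proof.
move=> xy hP; rewrite (big_cat_nat (n := x.+1)) //= [X in _ + X]big1_seq ?addr0 // => d /andP [/hP dx].
by rewrite mem_index_iota; lia.
Qed.
End Sums.

Definition sqf n := (0 < n)%N && all (fun p => logn p n == 1%N) (primes n).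
Definition mu n : int := if sqf n then (-1) ^+ size (primes n) else 0.

Lemma mu1 : mu 1 = 1. Proof. by rewrite /mu. Qed.
Lemma mu_abs n : `|mu n| <= 1.
Proof. by rewrite /mu; case: ifP => // _; rewrite normrX normrN1 expr1n. Qed.
Lemma mu_sq n : sqf n -> mu n * mu n = 1.
Proof. by rewrite /mu => ->; rewrite -expr2 sqrr_sign. Qed.

Lemma mu_prime_mul p e : prime p -> ~~ (p %| e)%N -> mu (p * e) = - mu e.
Proof.
move=> pp pe; have e0 : (0 < e)%N by case: e pe => //; rewrite dvdn0.
have p0 := prime_gt0 pp.
have ppe : perm_eq (primes (p * e)) (p :: primes e).
  apply: uniq_perm; first exact: primes_uniq.
    by rewrite /= primes_uniq andbT mem_primes pp e0.
  by move=> q; rewrite primesM // primes_prime // !inE.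
rewrite /mu /sqf muln_gt0 p0 e0 /= (perm_all _ ppe) (perm_size ppe) /= exprS mulN1r.
have lp : logn p (p * e) = 1%N.
  have pl : logn p e = 0%N by apply/eqP; rewrite -leqn0 leqNgt logn_gt0 mem_primes (negPf pe) !andbF.
  by rewrite lognM // pl addn0 logn_prime // eqxx.
rewrite lp eqxx /=.
have -> : all (fun p0 => logn p0 (p * e) == 1%N) (primes e) = all (fun p => logn p e == 1%N) (primes e).
  apply: eq_in_all => q qe; rewrite lognM // logn_prime //; case: (eqVneq q p) => [pq|_]; last by rewrite add0n.
  by move: qe; rewrite pq mem_primes (negPf pe) !andbF.
by case: ifP; rewrite ?oppr0.
Qed.
Lemma mu_prime_sq p e : prime p -> (p %| e)%N -> mu (p * e) = 0.
Proof.
move=> pp pe; rewrite /mu /sqf; case: ifP => // /andP [pe0 /allP h].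
have e0 : (0 < e)%N by move: pe0; rewrite muln_gt0 => /andP [].
have l2 : (0 < logn p e)%N by rewrite logn_gt0 mem_primes pp e0 pe.
have := h p; rewrite mem_primes pp pe0 dvdn_mulr // => /(_ isT).
have -> : logn p (p * e) = (1 + logn p e)%N by rewrite lognM ?(prime_gt0 pp) // logn_prime // eqxx.
by case: (logn p e) l2.
Qed.

(** For a prime p dividing n, the divisors p e with p not dividing e cancel the divisors e;
    multiples of p^2 contribute 0. *)
Lemma mu_sum n x : (0 < n)%N -> (n <= x)%N -> \sum_(1 <= d < x.+1 | (d %| n)%N) mu d = (n == 1%N)%:R.
Proof.
move=> n0 nx; rewrite (@sum_ltn _ n x) //; last by move=> d; exact: dvdn_leq.
case: (eqVneq n 1%N) => [->|n1]; first by rewrite big_mkcond big_nat1.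
have np : (1 < n)%N by lia.
have pp := pdiv_prime np; have pn := pdiv_dvd n; set p := pdiv n in pp pn.
rewrite (bigID (fun d => p %| d)%N) /=.
rewrite (eq_bigl (fun d => (p %| d) && (d %| n))%N); last by move=> d; rewrite andbC.
rewrite [X in X + _]big_mkcondr /= (sum_mult _ (fun d => if (d %| n)%N then mu d else 0)) ?prime_gt0 //.
apply/eqP; rewrite addr_eq0; apply/eqP.
rewrite -sumrN (eq_bigr (fun e => if (e %| n %/ p)%N && ~~ (p %| e)%N then - mu e else 0)); last first.
  move=> e _; rewrite -{1}(divnK pn) mulnC dvdn_pmul2r ?prime_gt0 // mulnC.
  case: ifP => //= en; case: (boolP (p %| e)%N) => pe /=; first exact: mu_prime_sq.
  by rewrite mu_prime_mul.
rewrite -big_mkcond /= (@sum_ltn _ (n %/ p) n); [| exact: leq_div |]; last first.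
  move=> e /andP [en pe]; apply: dvdn_leq; first by rewrite divn_gt0 ?prime_gt0 // dvdn_leq.
  by move: en; rewrite -{1}(divnK pn) Gauss_dvdl // coprime_sym prime_coprime.
apply: eq_bigl => e; case: (boolP (p %| e)%N); rewrite ?andbF ?andbT // => pe.
by rewrite -{2}(divnK pn) Gauss_dvdl // coprime_sym prime_coprime.
Qed.

Lemma divisor_sum (V : nmodType) (f : nat -> V) n x : (0 < n)%N -> (n <= x)%N ->
  \sum_(1 <= d < x.+1 | (d %| n)%N) f (n %/ d)%N = \sum_(1 <= d < x.+1 | (d %| n)%N) f d.
Proof.
move=> n0 nx; rewrite -big_filter -[RHS]big_filter -(big_map (fun d => n %/ d)%N xpredT f); apply: perm_big.
have inj : {in [seq d <- index_iota 1 x.+1 | (d %| n)%N] &, injective (fun d => n %/ d)%N}.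
  move=> a b; rewrite !mem_filter => /andP [an _] /andP [bn _] h.
  have b0 := dvdn_gt0 n0 bn; have nb : (0 < n %/ b)%N by rewrite divn_gt0 // dvdn_leq.
  have : (n %/ b * a == n %/ b * b)%N by rewrite -{1}h !divnK.
  by rewrite eqn_pmul2l // => /eqP.
apply: uniq_perm; rewrite ?map_inj_in_uniq ?filter_uniq ?iota_uniq // => d.
apply/mapP/idP => [[e]|]; rewrite !mem_filter !mem_index_iota.
  move=> /andP [en _] ->; have e0 := dvdn_gt0 n0 en; rewrite dvdn_div // divn_gt0 // dvdn_leq //=.
  by rewrite ltnS (leq_trans (leq_div _ _)).
move=> /andP [dn _]; have d0 := dvdn_gt0 n0 dn; exists (n %/ d)%N.
  by rewrite mem_filter mem_index_iota dvdn_div // divn_gt0 // dvdn_leq //= ltnS (leq_trans (leq_div _ _)).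
by rewrite divnA // mulKn.
Qed.

Section Real.
Variable R : realType.
Definition lnn (n : nat) : R := ln n%:R.
Lemma lnn1 : lnn 1 = 0. Proof. exact: ln1. Qed.
Lemma lnnM m n : (0 < m)%N -> (0 < n)%N -> lnn (m * n) = lnn m + lnn n.
Proof. by move=> m0 n0; rewrite /lnn natrM lnM // posrE ltr0n. Qed.
Lemma lnn_ge0 n : 0 <= lnn n.
Proof. by case: n => [|n]; [rewrite /lnn ln0|rewrite /lnn ln_ge0 // ler1n]. Qed.
Lemma lnn_le m n : (0 < m)%N -> (m <= n)%N -> lnn m <= lnn n.
Proof. by move=> m0 mn; rewrite /lnn ler_ln ?posrE ?ltr0n ?ler_nat // (leq_trans m0). Qed.
Lemma lnn_step n : (0 < n)%N -> (n.+1%:R)^-1 <= lnn n.+1 - lnn n <= n%:R^-1.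
Proof.
move=> n0; have n0' : (n%:R : R) != 0 by rewrite pnatr_eq0; lia.
have n1' : (n.+1%:R : R) != 0 by rewrite pnatr_eq0.
have e1 : lnn n.+1 - lnn n = ln (1 + n%:R^-1).
  by rewrite /lnn -ln_div ?posrE ?ltr0n // -natr1 mulrDl mul1r divff.
have e2 : lnn n - lnn n.+1 = ln (1 + - n.+1%:R^-1).
  rewrite /lnn -ln_div ?posrE ?ltr0n //; congr ln.
  by apply: (mulIf n1'); rewrite divfK // mulrBl mul1r mulVf // -natr1 addrK.
apply/andP; split; last first.
  by rewrite e1; apply: le_ln1Dx; apply: lt_le_trans (_ : 0 <= _); rewrite ?invr_ge0 // ltrN10.
rewrite -[X in _ <= X]opprK opprB e2 lerNr; apply: le_ln1Dx.
by rewrite ltrN2 invf_lt1 ?ltr0n // ltr1n.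
Qed.
Lemma lnn_leq n : lnn n <= n%:R.
Proof.
elim: n => [|n IH]; first by rewrite /lnn ln0.
case: n IH => [|n] IH; first by rewrite lnn1.
have /andP [_ h] := lnn_step (ltn0Sn n); rewrite -[n.+2%:R]natr1.
have : (n.+1%:R : R)^-1 <= 1 by rewrite invf_le1 ?ler1n ?ltr0n.
by move: IH h; move: (lnn n.+1) (lnn n.+2) (n.+1%:R : R) (n.+1%:R^-1 : R) => a b c e; lra.
Qed.

Lemma sum_lnn x : x%:R * lnn x - x%:R <= \sum_(1 <= n < x.+1) lnn n <= x%:R * lnn x.
Proof.
elim: x => [|x /andP [IH1 IH2]]; first by rewrite big_geq // !mul0r subr0 lexx.
rewrite big_nat_recr //=; case: x IH1 IH2 => [|x] IH1 IH2.
  by rewrite big_geq // lnn1 mulr0 addr0 lexx sub0r lerN10.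
have /andP [h1 h2] := lnn_step (ltn0Sn x).
have x0 : (0 : R) < x.+1%:R by rewrite ltr0n.
have e : (x.+2%:R : R) = x.+1%:R + 1 by rewrite natr1.
have g2 : x.+1%:R * (lnn x.+2 - lnn x.+1) <= 1 by rewrite -[X in _ <= X](divff (lt0r_neq0 x0)) ler_pM2l.
have g1 : 0 <= x.+1%:R * (lnn x.+2 - lnn x.+1) by rewrite mulr_ge0 ?(ltW x0) // (le_trans _ h1) // invr_ge0.
move: IH1 IH2 g1 g2; rewrite e; set S := \sum_(1 <= n < x.+2) lnn n; set a := x.+1%:R; set u := lnn x.+1; set v := lnn x.+2.
move=> IH1 IH2 g1 g2; apply/andP; split; lra.
Qed.

(** The von Mangoldt function: a prime power is a power of its least prime factor. *)
Definition vonM n : R := if (1 < n)%N && (n == pdiv n ^ logn (pdiv n) n)%N then lnn (pdiv n) else 0.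
Lemma vonM_ge0 n : 0 <= vonM n.
Proof. by rewrite /vonM; case: ifP => // _; exact: lnn_ge0. Qed.
Lemma vonM_pk p k : prime p -> (0 < k)%N -> vonM (p ^ k) = lnn p.
Proof.
move=> pp k0; have pd : pdiv (p ^ k) = p by case: k k0 => // k _; rewrite pdiv_pfactor.
by rewrite /vonM pd pfactorK // eqxx andbT (leq_trans (prime_gt1 pp)) // -{1}(expn1 p) leq_exp2l // prime_gt1.
Qed.
Lemma vonM_neq0 n : vonM n != 0 -> exists p k, [/\ prime p, (0 < k)%N & n = (p ^ k)%N].
Proof.
rewrite /vonM; case: ifP => [/andP [n1 /eqP h] _|]; last by rewrite eqxx.
exists (pdiv n), (logn (pdiv n) n); split => //; first exact: pdiv_prime.
by rewrite logn_gt0 mem_primes pdiv_prime // pdiv_dvd ltnW.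
Qed.

Lemma vonM_sum n x : (0 < n)%N -> (n <= x)%N -> \sum_(1 <= d < x.+1 | (d %| n)%N) vonM d = lnn n.
Proof.
elim/ltn_ind: n => n IH n0 nx.
case: (eqVneq n 1%N) => [->|n1].
  rewrite lnn1 big1 // => d; rewrite dvdn1 => /eqP ->; by rewrite /vonM.
have np : (1 < n)%N by lia.
have pp := pdiv_prime np; have pn := pdiv_dvd n; set p := pdiv n in pp pn.
have p1 := prime_gt1 pp; set m := (n %/ p)%N; have nE : n = (p * m)%N by rewrite mulnC divnK.
have m0 : (0 < m)%N by move: n0; rewrite nE muln_gt0 => /andP [].
have mn : (m < n)%N by rewrite nE -{1}(mul1n m) ltn_pmul2r.
rewrite (bigID (fun d => d %| m)%N) /= (eq_bigl (fun d => d %| m)%N); last first.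
  by move=> d; apply/andb_idl => dm; rewrite nE dvdn_mull.
rewrite IH ?(leq_trans (ltnW mn)) // {2}nE lnnM ?(prime_gt0 pp) // addrC; congr (_ + _).
set k := logn p n; have k0 : (0 < k)%N by rewrite /k logn_gt0 mem_primes pp n0.
have km : k = (logn p m).+1 by rewrite /k nE lognM ?(prime_gt0 pp) // logn_prime // eqxx.
rewrite -big_filter (bigD1_seq (p ^ k)%N) /=; first last.
- by rewrite filter_uniq // iota_uniq.
- rewrite mem_filter mem_index_iota !pfactor_dvdn // leqnn /= km ltnn /= expn_gt0 prime_gt0 //= ltnS -km.
  by rewrite (leq_trans _ nx) // dvdn_leq // pfactor_dvdn.
rewrite vonM_pk // big_seq_cond big1 ?addr0 // => d /andP []; rewrite mem_filter => /andP [/andP [dn dm] _] dk.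
apply/eqP/negPn/negP => /vonM_neq0 [q [j [qp j0 dE]]]; move: dn dm dk; rewrite dE.
rewrite !pfactor_dvdn // nE lognM ?(prime_gt0 pp) // logn_prime //.
case: (eqVneq p q) => [<-|_]; last by rewrite add0n => ->.
by rewrite add1n => h1 h2; rewrite km (_ : j = (logn p m).+1) ?eqxx //; lia.
Qed.
End Real.
End ArithmeticFunctions.

(** * Chebyshev and Mertens estimates, and L(1, X) <> 0 for a real character *)

Module Mertens.
Import structures.
Import all_boot all_order all_algebra.
Import boolp reals exp.
Import zify ring lra.
Import ArithmeticFunctions.
Import Order.TTheory GRing.Theory Num.Theory.
Local Open Scope ring_scope.

Section Dir1.
Variable R : realType.
Implicit Types f h : nat -> R.

Lemma abel_sum h f (a b : nat) (B : R) : (a <= b)%N -> (forall n, (a <= n)%N -> f n.+1 <= f n) -> (forall n, (a <= n)%N -> 0 <= f n) ->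
  (forall x, (a <= x)%N -> `|\sum_(a <= n < x) h n| <= B) -> `|\sum_(a <= n < b) h n * f n| <= B * f a.
Proof.
move=> ab fd f0 hB.
have key : `|\sum_(a <= n < b) h n * f n - (\sum_(a <= n < b) h n) * f b| <= B * (f a - f b).
  elim: b ab => [|b IH] ab.
    have -> : a = 0%N by lia.
    by rewrite !big_geq // mul0r subrr normr0 subrr mulr0.
  case: (leqP a b) => [ab'|ab']; last first.
    have -> : a = b.+1 by lia.
    by rewrite !big_geq // mul0r subrr normr0 subrr mulr0.
  have hb := hB _ ab; rewrite big_nat_recr //= big_nat_recr //= in hb *.
  set S := \sum_(a <= n < b) h n in hb *; set T := \sum_(a <= n < b) h n * f n.
  have -> : T + h b * f b - (S + h b) * f b.+1 = (T - S * f b) + (S + h b) * (f b - f b.+1) by ring.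
  apply: le_trans (ler_normD _ _) _; rewrite normrM [`|f b - _|]ger0_norm ?subr_ge0 ?fd //.
  have -> : B * (f a - f b.+1) = B * (f a - f b) + B * (f b - f b.+1) by ring.
  by apply: lerD; [exact: IH|rewrite ler_wpM2r // subr_ge0 fd].
have -> : \sum_(a <= n < b) h n * f n = (\sum_(a <= n < b) h n * f n - (\sum_(a <= n < b) h n) * f b) + (\sum_(a <= n < b) h n) * f b by rewrite subrK.
apply: le_trans (ler_normD _ _) _; have -> : B * f a = B * (f a - f b) + B * f b by ring.
by apply: lerD => //; rewrite normrM [`|f b|]ger0_norm ?f0 // ler_wpM2r ?f0 // hB.
Qed.

Lemma per_sum h (M : nat) (K : R) : (0 < M)%N -> (forall n, h (n + M)%N = h n) -> \sum_(0 <= n < M) h n = 0 -> (forall n, `|h n| <= K) ->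
  forall a b, (a <= b)%N -> `|\sum_(a <= n < b) h n| <= 2 * (M%:R * K).
Proof.
move=> M0 hp h0 hK.
have main x : `|\sum_(0 <= n < x) h n| <= M%:R * K.
  elim/ltn_ind: x => x IH; case: (leqP M x) => [Mx|xM].
    rewrite (big_cat_nat (n := M)) //= h0 add0r.
    have -> : \sum_(M <= n < x) h n = \sum_(0 <= n < x - M) h n.
      by rewrite -{1}(add0n M) big_addn; apply: eq_bigr => i _; rewrite hp.
    by apply: IH; lia.
  apply: le_trans (ler_norm_sum _ _ _) _.
  apply: (@le_trans _ _ (\sum_(0 <= n < x) K)); first by apply: ler_sum.
  rewrite sumr_const_nat subn0 -[K *+ x]mulr_natl ler_wpM2r ?ler_nat ?(ltnW xM) //.
  exact: le_trans (hK 0%N).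
move=> a b ab; have -> : \sum_(a <= n < b) h n = \sum_(0 <= n < b) h n - \sum_(0 <= n < a) h n.
  by rewrite [X in _ = X - _](big_cat_nat (n := a)) //= addrAC subrr add0r.
apply: le_trans (ler_normB _ _) _; rewrite mulr_natl mulr2n; exact: lerD.
Qed.

Lemma sum_vonM x : \sum_(1 <= n < x.+1) lnn R n = \sum_(1 <= d < x.+1) vonM R d * (x %/ d)%:R.
Proof.
transitivity (\sum_(1 <= n < x.+1) \sum_(1 <= d < x.+1 | (d %| n)%N) vonM R d).
  by apply: eq_big_nat => n /andP [n1 nx]; rewrite vonM_sum.
rewrite (dirichlet_swap x (fun d _ => vonM R d)); apply: eq_big_nat => d _.
by rewrite sumr_const_nat subn1 /= mulr_natr.
Qed.

Definition cheb x : R := \sum_(1 <= d < x.+1) vonM R d.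
(** The sum of vonM d (floor(2n/d) - 2 floor(n/d)) is log (2n)! - 2 log n! = O(n); every bracket is
    nonnegative and equals 1 for n < d <= 2n. *)
Lemma cheb_double n : cheb n.*2 <= cheb n + 4 * n%:R.
Proof.
case: n => [|n]; first by rewrite mulr0 addr0.
set m := n.+1; have m0 : (0 < m)%N by [].
have A2 := sum_vonM m.*2; have A1 := sum_vonM m.
have e : \sum_(1 <= d < m.*2.+1) vonM R d * (m.*2 %/ d)%:R - 2 * \sum_(1 <= d < m.+1) vonM R d * (m %/ d)%:R =
  \sum_(1 <= d < m.*2.+1) vonM R d * ((m.*2 %/ d)%:R - 2 * (m %/ d)%:R).
  have -> : \sum_(1 <= d < m.+1) vonM R d * (m %/ d)%:R = \sum_(1 <= d < m.*2.+1) vonM R d * (m %/ d)%:R.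
    rewrite [RHS](big_cat_nat (n := m.+1)) //=; last by lia.
    rewrite [X in _ = _ + X]big_nat [X in _ = _ + X]big1 ?addr0 // => d /andP [md _].
    by rewrite divn_small ?mulr0.
  by rewrite mulr_sumr -sumrB; apply: eq_bigr => d _; ring.
have up : \sum_(1 <= d < m.*2.+1) vonM R d * ((m.*2 %/ d)%:R - 2 * (m %/ d)%:R) <= 4 * m%:R.
  rewrite -e -A1 -A2; have /andP [_ h2] := sum_lnn R m.*2; have /andP [h1 _] := sum_lnn R m.
  have l2 : lnn R m.*2 = lnn R 2 + lnn R m by rewrite -mul2n lnnM.
  have l21 : lnn R 2 <= 1 by have /andP [_] := lnn_step R (isT : 0 < 1)%N; rewrite lnn1 subr0 invr1.
  have mm : (m.*2%:R : R) = 2 * m%:R by rewrite -mul2n natrM.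
  have mp : (0 : R) <= m%:R by [].
  have : m%:R * lnn R 2 <= (m%:R : R) by rewrite ler_piMr.
  move: h1 h2; rewrite l2 mm.
  move: (\sum_(_ <= _ < _) _) (\sum_(_ <= _ < _) _) (m%:R : R) (lnn R 2) (lnn R m) => S1 S2 a b c; lra.
have lo : cheb m.*2 - cheb m <= \sum_(1 <= d < m.*2.+1) vonM R d * ((m.*2 %/ d)%:R - 2 * (m %/ d)%:R).
  have -> : cheb m.*2 - cheb m = \sum_(m.+1 <= d < m.*2.+1) vonM R d.
    rewrite /cheb (big_cat_nat (n := m.+1)) //=; last by lia.
    by rewrite [X in X - _]addrC addrK.
  rewrite [X in _ <= X](big_cat_nat (n := m.+1)) //=; last by lia.
  have pos (d : nat) : (0 : R) <= (m.*2 %/ d)%:R - 2 * (m %/ d)%:R.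
    rewrite subr_ge0 -natrM ler_nat; case: d => // d; rewrite leq_divRL // -mulnA mulnC -[X in (_ <= X)%N]muln2 leq_mul2r /=.
    exact: leq_trunc_div.
  rewrite -[X in X <= _]add0r; apply: lerD.
    by apply: sumr_ge0 => d _; rewrite mulr_ge0 // vonM_ge0.
  apply: ler_sum_nat => d /andP [d1 d2].
  have -> : (m %/ d = 0)%N by rewrite divn_small.
  have -> : (m.*2 %/ d = 1)%N by apply/eqP; rewrite eqn_leq -ltnS ltn_divLR ?divn_gt0; lia.
  by rewrite mulr0 subr0 mulr1.
by rewrite -lerBlDl (le_trans lo).
Qed.

Lemma cheb_le x : cheb x <= 8 * x%:R.
Proof.
elim/ltn_ind: x => x IH; case: (leqP x 1) => x1.
  rewrite /cheb; case: x x1 {IH} => [|[|]] // _; first by rewrite big_geq // mulr0.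
  by rewrite big_nat1 /vonM /= mulr_ge0.
have hx : (x./2 < x)%N by lia.
have h := IH _ hx; have d := cheb_double x./2.
have [ox|ex] := boolP (odd x); last first.
  have xE : x = x./2.*2 by lia.
  rewrite {1}xE (le_trans d) //; have -> : (x%:R : R) = 2 * (x./2)%:R by rewrite {1}xE -mul2n natrM.
  by move: h; have : (0 : R) <= (x./2)%:R by []; move: (x./2%:R : R) (cheb _) => a b; lra.
have xE : x = x./2.*2.+1 by lia.
have -> : cheb x = cheb x./2.*2 + vonM R x by rewrite {1 3}xE /cheb big_nat_recr.
have v : vonM R x <= x%:R.
  rewrite /vonM; case: ifP => // _; apply: le_trans (lnn_leq _ _) _; rewrite ler_nat dvdn_leq ?pdiv_dvd //; lia.
have xr : (x%:R : R) = 2 * (x./2)%:R + 1 by rewrite {1}xE -natr1 -mul2n natrM.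
by move: h d v; rewrite xr; have : (0 : R) <= (x./2)%:R by []; move: (x./2%:R : R) (cheb _) (cheb _) => a b c; lra.
Qed.

Lemma floor_bounds x d : (0 < d)%N -> (x %/ d)%:R <= (x%:R / d%:R : R) <= (x %/ d)%:R + 1.
Proof.
move=> d0; have d0' : (0 : R) < d%:R by rewrite ltr0n.
apply/andP; split; first by rewrite ler_pdivlMr // -natrM ler_nat leq_trunc_div.
by rewrite ler_pdivrMr // natr1 -natrM ler_nat ltnW // ltn_ceil.
Qed.

Lemma floor_inv x d : (0 < d)%N -> (0 < x)%N -> ((x %/ d).+1%:R)^-1 <= (d%:R / x%:R : R).
Proof.
move=> d0 x0; rewrite -[X in _ <= X]invrK invf_div lef_pV2 ?posrE ?divr_gt0 ?ltr0n //.
by rewrite -natr1; have /andP [] := floor_bounds x d0.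
Qed.

(** log x! is the sum of vonM d floor(x/d), and removing the floors costs at most [cheb x], which is
    at most 8x. *)
Lemma mertens x : (0 < x)%N -> `|\sum_(1 <= d < x.+1) vonM R d / d%:R - lnn R x| <= 8.
Proof.
move=> x0; have x0' : (0 : R) < x%:R by rewrite ltr0n.
have /andP [s1 s2] := sum_lnn R x; rewrite sum_vonM in s1 s2.
set S := \sum_(1 <= d < x.+1) vonM R d / d%:R.
have h1 : \sum_(1 <= d < x.+1) vonM R d * (x %/ d)%:R <= x%:R * S.
  rewrite mulr_sumr; apply: ler_sum_nat => d /andP [d0 _]; rewrite mulrCA ler_wpM2l ?vonM_ge0 //.
  by have /andP [] := floor_bounds x d0.
have h2 : x%:R * S <= \sum_(1 <= d < x.+1) vonM R d * (x %/ d)%:R + cheb x.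
  rewrite mulr_sumr /cheb -big_split /=; apply: ler_sum_nat => d /andP [d0 _].
  rewrite mulrCA -{3}[vonM R d]mulr1 -mulrDr ler_wpM2l ?vonM_ge0 //.
  by have /andP [] := floor_bounds x d0.
have c := cheb_le x.
rewrite ler_norml; apply/andP; split; rewrite -(ler_pM2l x0') mulrBr; move: s1 s2 h1 h2 c x0'; move: (x%:R : R) (lnn R x) S (\sum_(_ <= _ < _) _) (cheb x) => a b s t u; lra.
Qed.

Lemma sum_log_ratio x : \sum_(1 <= a < x.+1) (lnn R x - lnn R a) <= x%:R.
Proof.
rewrite sumrB sumr_const_nat subn1 /= -[lnn R x *+ x]mulr_natl; have /andP [h _] := sum_lnn R x.
by move: h; move: (\sum_(_ <= _ < _) _) (x%:R * lnn R x) (x%:R) => a b c; lra.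
Qed.

Local Notation sq n := (Num.sqrt (n%:R : R)).
Lemma sq_gt0 n : (0 < n)%N -> 0 < sq n. Proof. by move=> n0; rewrite sqrtr_gt0 ltr0n. Qed.
Lemma sq_sq n : sq n * sq n = n%:R. Proof. by rewrite -expr2 sqr_sqrtr. Qed.
Lemma sq_le m n : (m <= n)%N -> sq m <= sq n. Proof. by move=> mn; rewrite ler_sqrt ?ler_nat ?ltr0n //; case: n mn. Qed.
Lemma sq_step n : (0 < n)%N -> (sq n.+1)^-1 <= 2 * (sq n.+1 - sq n) <= (sq n)^-1.
Proof.
move=> n0; have a0 := sq_gt0 n0; have b0 := sq_gt0 (ltn0Sn n); have ab := sq_le (leqnSn n).
have e : (sq n.+1 - sq n) * (sq n.+1 + sq n) = 1.
  rewrite -subr_sqr !expr2 !sq_sq -natr1; ring.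
move: a0 b0 ab e; move: (sq n) (sq n.+1) => a b a0 b0 ab e.
apply/andP; split.
  rewrite -subr_ge0 -(pmulr_lge0 _ b0) mulrBl mulVf ?lt0r_neq0 //; nra.
rewrite -subr_ge0 -(pmulr_lge0 _ a0) mulrBl mulVf ?lt0r_neq0 //; nra.
Qed.

Definition Tq z : R := \sum_(1 <= e < z.+1) (sq e)^-1.
(** The function Tq z - 2 sqrt z decreases; its value at x stands for its limit and serves as c for
    all z up to x. *)
Lemma Tq_approx x : (0 < x)%N -> exists2 c, `|c| <= 2 & forall z, (0 < z)%N -> (z <= x)%N -> `|Tq z - 2 * sq z - c| <= (sq z)^-1.
Proof.
move=> x0; pose a z := Tq z - 2 * sq z.
have st z : (0 < z)%N -> 0 <= a z - a z.+1 <= (sq z)^-1 - (sq z.+1)^-1.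
  move=> z0; have := sq_step z0; rewrite /a /Tq [X in _ - (X - _)]big_nat_recr //=.
  move: (\sum_(_ <= _ < _) _) => S /andP [h1 h2]; apply/andP; split; lra.
have tel z k : (0 < z)%N -> 0 <= a z - a (z + k)%N <= (sq z)^-1 - (sq (z + k))^-1.
  move=> z0; elim: k => [|k /andP [IH1 IH2]]; first by rewrite addn0 !subrr lexx.
  have /andP [s1 s2] := st (z + k)%N (leq_trans z0 (leq_addr _ _)); rewrite addnS.
  by apply/andP; split; lra.
exists (a x).
  have a1 : a 1%N = -1 by rewrite /a /Tq big_nat1 sqrtr1 invr1; ring.
  have := tel 1%N x.-1 isT; rewrite add1n prednK // a1 sqrtr1 invr1 => /andP [h1 h2].
  have := sq_gt0 x0; rewrite -(invr_gt0 (sq x)) ler_norml => p; apply/andP; split; lra.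
move=> z z0 zx; have := tel z (x - z)%N z0; rewrite subnKC // => /andP [h1 h2].
rewrite -/(a z) ger0_norm //; apply: le_trans h2 _; have := sq_gt0 x0; rewrite -(invr_gt0 (sq x)); lra.
Qed.
Lemma Tq_le z : Tq z <= 2 * sq z.
Proof.
elim: z => [|z IH]; first by rewrite /Tq big_geq // sqrtr0 mulr0.
case: z IH => [|z] IH; first by rewrite /Tq big_nat1 sqrtr1 invr1; lra.
rewrite /Tq big_nat_recr //= -/(Tq _); have /andP [h _] := sq_step (ltn0Sn z); lra.
Qed.

Section RealChar.
Variable X : nat -> R.
Hypothesis XM : forall m n, X (m * n)%N = X m * X n.
Hypothesis X1 : X 1%N = 1.
Hypothesis Xv : forall n, X n = 0 \/ X n = 1 \/ X n = -1.

(** The Dirichlet coefficients of zeta(s) L(s, X). *)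
Definition rr n : R := \sum_(1 <= d < n.+1 | (d %| n)%N) X d.
Lemma XE p i : X (p ^ i)%N = X p ^+ i.
Proof. by elim: i => [|i IH]; rewrite ?expn0 ?X1 // expnS XM IH exprS. Qed.

Lemma rr_pk p k m : prime p -> ~~ (p %| m)%N -> rr (p ^ k * m) = (\sum_(i < k.+1) X p ^+ i) * rr m.
Proof.
move=> pp pm; have m0 : (0 < m)%N by case: m pm => //; rewrite dvdn0.
have p0 := prime_gt0 pp.
elim: k => [|k IH]; first by rewrite expn0 mul1n big_ord1 expr0 mul1r.
rewrite big_ord_recr /= mulrDl -IH; set n := (p ^ k.+1 * m)%N; set n' := (p ^ k * m)%N.
have n0 : (0 < n)%N by rewrite muln_gt0 expn_gt0 p0.
have nn : n = (p * n')%N by rewrite /n expnS mulnA.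
have n'0 : (0 < n')%N by rewrite muln_gt0 expn_gt0 p0.
have n'n : (n' <= n)%N by rewrite nn leq_pmull.
rewrite {1}/rr (bigID (fun d => d %| n')%N) /=; congr (_ + _).
  rewrite /rr -(@sum_ltn _ n' n) //; last by move=> d; exact: dvdn_leq.
  by apply: eq_bigl => d; apply/andb_idl => dn; rewrite nn dvdn_mull.
rewrite (eq_bigl (fun d => (p ^ k.+1 %| d) && (d %| n))%N); last first.
  move=> d; rewrite andbC; apply/andb_id2r => dn.
  have d0 := dvdn_gt0 n0 dn.
  have [j _ [d' pd' dE]] : exists2 j, True & exists2 d', ~~ (p %| d')%N & d = (p ^ j * d')%N.
    by exists (logn p d) => //; have [d' pd' dE] := pfactor_coprime pp d0; exists d'; [rewrite -prime_coprime|rewrite {1}dE mulnC].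
  have d'0 : (0 < d')%N by case: d' pd' {dE} => //; rewrite dvdn0.
  have d'm : (d' %| m)%N.
    have : (d' %| n)%N by apply: dvdn_trans dn; rewrite dE dvdn_mull.
    by rewrite /n Gauss_dvdr // coprime_sym coprimeXl // prime_coprime.
  rewrite pfactor_dvdn // {2}dE lognM ?expn_gt0 ?p0 // pfactorK //.
  have -> : logn p d' = 0%N by apply/eqP; rewrite -leqn0 leqNgt logn_gt0 mem_primes (negPf pd') !andbF.
  rewrite addn0 ltnNge; congr (~~ _); rewrite dE /n'.
  apply/idP/idP => [h|jk]; last by rewrite dvdn_mul // dvdn_exp2l.
  have : (p ^ j %| p ^ k * m)%N by apply: dvdn_trans h; rewrite dvdn_mulr.
  by rewrite Gauss_dvdl ?dvdn_Pexp2l ?prime_gt1 // coprimeXl // prime_coprime.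
rewrite big_mkcondr /= (sum_mult _ (fun d => if (d %| n)%N then X d else 0)) ?expn_gt0 ?p0 //.
rewrite /n mulKn ?expn_gt0 ?p0 // /rr mulr_sumr [RHS]big_mkcond; apply: eq_bigr => e _.
by rewrite dvdn_pmul2l ?expn_gt0 ?p0 // XM XE; case: ifP; rewrite ?mulr0.
Qed.

Lemma geom_X p k : 0 <= \sum_(i < k.+1) X p ^+ i /\ (~~ odd k -> 1 <= \sum_(i < k.+1) X p ^+ i).
Proof.
case: (Xv p) => [->|[->|->]].
- have -> : \sum_(i < k.+1) (0 : R) ^+ i = 1.
    by rewrite big_ord_recl expr0 big1 ?addr0 // => i _; rewrite expr0n.
  by split.
- rewrite (eq_bigr (fun=> 1)) => [|i _]; last by rewrite expr1n.
  by rewrite sumr_const card_ord; split=> // _; rewrite ler1n.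
- have -> : \sum_(i < k.+1) (-1 : R) ^+ i = (~~ odd k)%:R.
    elim: k => [|k IH]; first by rewrite big_ord1 expr0.
    by rewrite big_ord_recr /= IH -signr_odd /=; case: (odd k); rewrite /= ?expr0 ?expr1; ring.
  by case: (odd k) => /=; split.
Qed.

Lemma rr_ge0 n : 0 <= rr n.
Proof.
elim/ltn_ind: n => n IH; case: (posnP n) => [->|n0]; first by rewrite /rr big_geq.
case: (eqVneq n 1%N) => [->|n1]; first by rewrite /rr big_mkcond big_nat1 /= X1.
have np : (1 < n)%N by lia.
have pp := pdiv_prime np; have [m pm nE] := pfactor_coprime pp n0; rewrite nE mulnC rr_pk -?prime_coprime //.
rewrite mulr_ge0 ?(geom_X _ _).1 // IH // [X in (_ < X)%N]nE ltn_Pmulr //; last by case: m nE pm {IH} => // nE; rewrite nE in n0.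
by rewrite -(expn0 (pdiv n)) ltn_exp2l ?prime_gt1 // logn_gt0 mem_primes pp n0 pdiv_dvd.
Qed.

Lemma rr_sq n : (0 < n)%N -> 1 <= rr (n ^ 2).
Proof.
elim/ltn_ind: n => n IH n0; case: (eqVneq n 1%N) => [->|n1]; first by rewrite /rr big_mkcond big_nat1 /= X1.
have np : (1 < n)%N by lia.
have pp := pdiv_prime np; have [m pm nE] := pfactor_coprime pp n0.
have m0 : (0 < m)%N by case: m nE pm => // nE; rewrite nE in n0.
rewrite [X in rr (X ^ 2)]nE expnMn mulnC -expnM rr_pk //; last by rewrite -prime_coprime // coprimeXr.
have mn : (m < n)%N.
  by rewrite [X in (_ < X)%N]nE ltn_Pmulr // -(expn0 (pdiv n)) ltn_exp2l ?prime_gt1 // logn_gt0 mem_primes pp n0 pdiv_dvd.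
rewrite -[X in X <= _]mulr1; apply: ler_pM => //; last exact: IH.
by apply: (geom_X _ _).2; rewrite muln2 odd_double.
Qed.

Variables (B C : R).
Hypothesis XB : forall a b, (a <= b)%N -> `|\sum_(a <= n < b) X n| <= B.
(** The partial sums tend to 0: this is the assumption L(1, X) = 0, with a rate. *)
Hypothesis XC : forall y, `|\sum_(1 <= n < y.+1) X n / n%:R| <= C / y.+1%:R.

Lemma X_sqrt a b : (0 < a)%N -> (a <= b)%N -> `|\sum_(a <= n < b) X n * (sq n)^-1| <= B * (sq a)^-1.
Proof.
move=> a0 ab; apply: (abel_sum (f := fun n => (sq n)^-1)) => // [n an|n an|x ax]; last exact: XB.
  by rewrite lef_pV2 ?posrE ?sq_gt0 ?sq_le //; lia.
by rewrite invr_ge0 sqrtr_ge0.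
Qed.

(** Only the squares n = k^2 are kept; each contributes at least 1/k. *)
Lemma rr_sum_lower y : lnn R y.+1 <= \sum_(1 <= n < (y ^ 2).+1) rr n * (sq n)^-1.
Proof.
elim: y => [|y IH]; first by rewrite lnn1 big_geq.
rewrite (big_cat_nat (n := (y ^ 2).+1)) //=; last by rewrite ltnS leq_sqr.
rewrite [X in _ <= _ + X]big_nat_recr /=; last by rewrite ltn_sqr.
have p0 : 0 <= \sum_((y ^ 2).+1 <= n < (y.+1 ^ 2)) rr n * (sq n)^-1.
  by apply: sumr_ge0 => n _; rewrite mulr_ge0 ?rr_ge0 // invr_ge0 sqrtr_ge0.
have e : (y.+1%:R)^-1 <= rr (y.+1 ^ 2) * (sq (y.+1 ^ 2))^-1.
  have -> : sq (y.+1 ^ 2) = y.+1%:R by rewrite natrX sqrtr_sqr ger0_norm.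
  by rewrite ler_peMl ?invr_ge0 // rr_sq.
have /andP [_ h] := lnn_step R (ltn0Sn y).
move: IH h e p0; move: (\sum_(_ <= _ < _) _) (\sum_(_ <= _ < _) _) (rr _ * _) (_^-1) (lnn R y.+1) (lnn R y.+2) => s t u v a b; lra.
Qed.

(** Dirichlet's hyperbola method at x = y^2. The range d > y gives 2B. For d <= y the inner sum is
    2y / sqrt d + c up to an error: the main term is 2y times a partial sum of L(1, X), at most 2C
    by [XC], and the other two terms give 2B and 4. *)
Lemma rr_sum_upper y : (0 < y)%N -> \sum_(1 <= n < (y ^ 2).+1) rr n * (sq n)^-1 <= 2 * B + (2 * C + 2 * B + 4).
Proof.
move=> y0; set x := (y ^ 2)%N; have x0 : (0 < x)%N by rewrite expn_gt0 y0.
have yx : (y <= x)%N by rewrite /x expnS leq_pmulr // expn1.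
have B0 : 0 <= B by apply: le_trans (XB (leqnn 0)).
have -> : \sum_(1 <= n < x.+1) rr n * (sq n)^-1 = \sum_(1 <= d < x.+1) \sum_(1 <= e < (x %/ d).+1) X d * (sq d)^-1 * (sq e)^-1.
  rewrite -(dirichlet_swap x (fun d e => X d * (sq d)^-1 * (sq e)^-1)); apply: eq_big_nat => n /andP [n1 nx].
  rewrite /rr -(@sum_ltn _ n x) ?mulr_suml //; last by move=> d; exact: dvdn_leq.
  apply: eq_bigr => d dn; rewrite -{1}(divnK dn) mulnC natrM sqrtrM // invfM mulrA //.
rewrite (big_cat_nat (n := y.+1)) //= addrC.
apply: lerD.
  rewrite (eq_big_nat _ _ (F2 := fun d => \sum_(1 <= e < x.+1 | (d * e <= x)%N) X d * (sq d)^-1 * (sq e)^-1)); last first.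
    move=> d /andP [d1 _]; have d0 : (0 < d)%N by lia.
    rewrite [RHS](@sum_ltn _ (x %/ d) x) ?leq_div //; last by move=> e; rewrite leq_divRL // mulnC.
    rewrite big_nat_cond [RHS]big_nat_cond; apply: eq_bigl => e; rewrite andbT ltnS leq_divRL // [(e * d)%N]mulnC.
    by case: (0 < e)%N => //=; case: (d * e <= x)%N.
  rewrite (exchange_big_dep_nat xpredT) //=.
  apply: (@le_trans _ _ (\sum_(1 <= e < x.+1) if (e <= y)%N then B * (sq y)^-1 * (sq e)^-1 else 0)).
    apply: ler_sum_nat => e /andP [e0 ex]; rewrite -mulr_suml.
    case: leqP => ey; last first.
      rewrite big_nat_cond big_pred0 ?mul0r // => d; apply/negbTE; rewrite negb_and -ltnNge.
      case: (leqP y.+1 d) => //= yd; apply/orP; right; rewrite /x expnS expn1; apply: ltn_mul => //.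
    rewrite ler_wpM2r ?invr_ge0 ?sqrtr_ge0 //; apply: le_trans (ler_norm _) _.
    have xe : (x %/ e <= x)%N by exact: leq_div.
    have yxe : (y.+1 <= (x %/ e).+1)%N by rewrite ltnS leq_divRL // /x expnS expn1 leq_mul2l ey orbT.
    have -> : \sum_(y.+1 <= d < x.+1 | (d * e <= x)%N) X d * (sq d)^-1 = \sum_(y.+1 <= d < (x %/ e).+1) X d * (sq d)^-1.
      rewrite (big_cat_nat (n := (x %/ e).+1)) //= [X in _ + X]big1_seq ?addr0 => [|d /andP []]; last first.
        by rewrite -leq_divRL // mem_index_iota => h1 /andP [h2 _]; lia.
      rewrite big_nat_cond [RHS]big_nat_cond; apply: eq_bigl => d; rewrite andbT ltnS -leq_divRL //.
      by case: (y < d)%N => //=; case: leqP.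
    apply: le_trans (X_sqrt _ yxe) _ => //; rewrite ler_wpM2l // lef_pV2 ?posrE ?sq_gt0 // sq_le //.
  rewrite -big_mkcond /=.
  rewrite (@sum_ltn _ y x) // big_nat_cond (eq_bigl (fun e => (1 <= e < y.+1)%N && true)); last by move=> e; rewrite ltnS andbT -andbA andbb.
  rewrite -big_nat_cond -mulr_sumr -/(Tq y).
  apply: le_trans (ler_wpM2l _ (Tq_le y)) _; first by rewrite mulr_ge0 // invr_ge0 sqrtr_ge0.
  by rewrite mulrACA [B * 2]mulrC -mulrA mulVf ?mulr1 // lt0r_neq0 // sq_gt0.
have [c c2 Tc] := Tq_approx x0.
rewrite (eq_big_nat _ _ (F2 := fun d => 2 * y%:R * (X d / d%:R) + c * (X d * (sq d)^-1) + X d * (sq d)^-1 * (Tq (x %/ d) - 2 * y%:R * (sq d)^-1 - c))); last first.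
  move=> d /andP [d0 dy]; rewrite -mulr_sumr -/(Tq _).
  have -> : X d / d%:R = X d * (sq d)^-1 * (sq d)^-1 by rewrite -mulrA -invfM sq_sq.
  by ring.
rewrite !big_split /= -!mulr_sumr; apply: lerD; first apply: lerD.
- apply: le_trans (ler_norm _) _; rewrite normrM ger0_norm ?mulr_ge0 //.
  apply: le_trans (ler_wpM2l _ (XC y)) _; first by rewrite mulr_ge0.
  have C0 : 0 <= C.
    have := le_trans (normr_ge0 _) (XC 0); by rewrite divr1.
  rewrite -mulrA ler_wpM2l // mulrCA ler_piMr // ler_pdivrMr ?ltr0n // mul1r ler_nat; lia.
- apply: le_trans (ler_norm _) _; rewrite normrM; apply: ler_pM => //.
  by apply: le_trans (X_sqrt _ _) _ => //; rewrite sqrtr1 invr1 mulr1.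
- apply: (@le_trans _ _ (\sum_(1 <= d < y.+1) (sq d)^-1 * (2 * (sq y)^-1))); last first.
    rewrite -mulr_suml -/(Tq y); have := Tq_le y; have := sq_gt0 y0 => s0 h.
    apply: (@le_trans _ _ (2 * sq y * (2 * (sq y)^-1))); first by rewrite ler_wpM2r // mulr_ge0 // invr_ge0 ltW.
    by rewrite mulrACA mulfV ?lt0r_neq0 // mulr1; lra.
  apply: ler_sum_nat => d /andP [d0 dy]; apply: le_trans (ler_norm _) _; rewrite normrM normrM.
  have X1' : `|X d| <= 1 by case: (Xv d) => [->|[->|->]]; rewrite ?normr0 ?normrN ?normr1.
  have s0 := sq_gt0 d0; have sy := sq_gt0 y0.
  apply: ler_pM => //; first by rewrite mulr_ge0.
    by rewrite [`|_^-1|]ger0_norm ?invr_ge0 ?(ltW s0) // ler_piMl // invr_ge0 ltW.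
  set z := (x %/ d)%N; have yz : (y <= z)%N by rewrite leq_divRL // /x expnS expn1 leq_mul2l; lia.
  have z0 : (0 < z)%N by lia.
  have h1 := Tc z z0 (leq_div _ _); have sz := sq_gt0 z0.
  have syz := sq_le yz.
  have hz : (sq z)^-1 <= (sq y)^-1 by rewrite lef_pV2 ?posrE.
  have w1 : sq z <= y%:R * (sq d)^-1.
    rewrite ler_pdivlMr // -sqrtrM // -natrM -[X in _ <= X]ger0_norm // -sqrtr_sqr ler_sqrt ?exprn_ge0 //.
    by rewrite -natrX ler_nat leq_trunc_div.
  have w2 : 2 * (y%:R * (sq d)^-1 - sq z) <= (sq z)^-1.
    have : y%:R * (sq d)^-1 <= sq z.+1.
      rewrite ler_pdivrMr // -sqrtrM // -natrM -[X in X <= _]ger0_norm // -sqrtr_sqr ler_sqrt ?ler0n //.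
      by rewrite -natrX ler_nat ltnW // ltn_ceil.
    have /andP [_ h] := sq_step z0; lra.
  move: h1; rewrite !ler_norml => /andP [h1 h2]; apply/andP; split; rewrite -[2 * y%:R * _]mulrA; lra.
Qed.

Lemma real_char_absurd : False.
Proof.
pose K := 2 * B + (2 * C + 2 * B + 4).
have hb y : (0 < y)%N -> lnn R y.+1 <= K by move=> y0; exact: le_trans (rr_sum_lower y) (rr_sum_upper y0).
have K0 : 0 <= K by apply: le_trans (hb 1%N isT); exact: lnn_ge0.
have l2 : 2^-1 <= lnn R 2.
  by have /andP [] := lnn_step R (isT : 0 < 1)%N; rewrite lnn1 subr0.
have lp k : (k%:R / 2 : R) <= lnn R (2 ^ k).
  elim: k => [|k IH]; first by rewrite mul0r lnn_ge0.
  by rewrite expnS lnnM ?expn_gt0 // -natr1 mulrDl mul1r addrC lerD.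
pose k := (Num.truncn (2 * K)).+1.
have hk : 2 * K < k%:R by have := truncnS_gt (2 * K); rewrite /k.
have := hb (2 ^ k).-1; rewrite prednK ?expn_gt0 //.
have k1 : (0 < (2 ^ k).-1)%N by rewrite -ltnS prednK ?expn_gt0 // -{1}(expn0 2) ltn_exp2l.
move=> /(_ k1) h; have := lp k; lra.
Qed.
End RealChar.
End Dir1.
End Mertens.

(** * The operator on functions of units modulo M that encodes the values L(1, chi) *)

Module ResidueOperator.
Import structures.
Import all_boot all_order all_algebra.
Import boolp classical_sets reals exp.
Import zify ring lra.
Import ArithmeticFunctions Mertens.
Import Order.TTheory GRing.Theory Num.Theory.
Local Open Scope ring_scope.

Section Limits.
Variable R : realType.
Definition bnd (f : nat -> R) := exists C : R, forall x, (0 < x)%N -> `|f x| <= C.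

Lemma bndD f g : bnd f -> bnd g -> bnd (fun x => f x + g x).
Proof.
move=> [C hC] [D hD]; exists (C + D) => x x0; apply: le_trans (ler_normD _ _) _.
by apply: lerD; [exact: hC|exact: hD].
Qed.
Lemma bndZ c f : bnd f -> bnd (fun x => c * f x).
Proof. by move=> [C hC]; exists (`|c| * C) => x x0; rewrite normrM ler_wpM2l ?hC. Qed.
Lemma bndB f g : bnd f -> bnd g -> bnd (fun x => f x - g x).
Proof.
move=> hf hg; have [C hC] := bndD hf (bndZ (-1) hg); exists C => x x0.
by have := hC x x0; rewrite mulN1r.
Qed.
Lemma bnd_eq f g : (forall x, f x = g x) -> bnd f -> bnd g.
Proof. by move=> h [C hC]; exists C => x x0; rewrite -h hC. Qed.
Lemma bnd_sum (I : finType) (P : pred I) (F : I -> nat -> R) : (forall i, P i -> bnd (F i)) -> bnd (fun x => \sum_(i | P i) F i x).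
Proof.
move=> h; have /choice [C hC] : forall i, exists C : R, P i -> forall x, (0 < x)%N -> `|F i x| <= C.
  by move=> i; case: (boolP (P i)) => [/h [C hC]|_]; [exists C|exists 0].
exists (\sum_(i | P i) C i) => x x0; apply: le_trans (ler_norm_sum _ _ _) _.
by apply: ler_sum => i Pi; exact: hC.
Qed.

Lemma lnn_unbounded c : bnd (fun x => c * lnn R x) -> c = 0.
Proof.
move=> [C hC]; apply/eqP/negPn/negP => c0.
have l2 : 2^-1 <= lnn R 2 by have /andP [] := lnn_step R (isT : 0 < 1)%N; rewrite lnn1 subr0.
have lp k : (k%:R / 2 : R) <= lnn R (2 ^ k).
  elim: k => [|k IH]; first by rewrite mul0r lnn_ge0.
  by rewrite expnS lnnM ?expn_gt0 // -natr1 mulrDl mul1r addrC lerD.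
pose k := (Num.truncn (2 * (C / `|c|))).+1.
have hk : 2 * (C / `|c|) < k%:R by have := truncnS_gt (2 * (C / `|c|)).
have := hC (2 ^ k)%N; rewrite expn_gt0 => /(_ isT); rewrite normrM [`|lnn R _|]ger0_norm ?lnn_ge0 //.
rewrite mulrC -ler_pdivlMr ?normr_gt0 // => h; have := lp k; lra.
Qed.

Lemma inv_small (a C : R) : (forall y : nat, `|a| <= C / y.+1%:R) -> a = 0.
Proof.
move=> h; apply/eqP/negPn/negP => a0; have an : 0 < `|a| by rewrite normr_gt0.
pose y := Num.truncn (C / `|a|); have hy : C / `|a| < y.+1%:R by exact: truncnS_gt.
have := h y; rewrite ler_pdivlMr ?ltr0n // mulrC -ler_pdivlMr // => h'.
by have := lt_le_trans hy h'; rewrite ltxx.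
Qed.

Lemma lim_uniq (s : nat -> R) (a b C D : R) : (forall y : nat, `|s y - a| <= C / y.+1%:R) -> (forall y : nat, `|s y - b| <= D / y.+1%:R) -> a = b.
Proof.
move=> ha hb; apply/eqP; rewrite -subr_eq0; apply/eqP/(@inv_small _ (C + D)) => y.
have -> : a - b = (s y - b) - (s y - a) by ring.
by apply: le_trans (ler_normB _ _) _; rewrite mulrDl addrC; apply: lerD.
Qed.

Lemma cauchy_limit (s : nat -> R) (C : R) : (forall y z : nat, (y <= z)%N -> `|s z - s y| <= C / y.+1%:R) ->
  exists L, forall y : nat, `|s y - L| <= C / y.+1%:R.
Proof.
move=> h; pose E := [set t | exists y : nat, t = s y - C / y.+1%:R]%classic.
have ub (y : nat) : ubound E (s y + C / y.+1%:R).
  move=> _ [z ->]; have hz := le_trans (normr_ge0 _) (h z z (leqnn z)); have hy := le_trans (normr_ge0 _) (h y y (leqnn y)).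
  case: (leqP y z) => yz.
    have := h y z yz; rewrite ler_norml => /andP [_]; move: hz hy.
    by move: (C / y.+1%:R) (C / z.+1%:R) => a b; lra.
  have := h z y (ltnW yz); rewrite ler_norml => /andP [+ _]; move: hz hy.
  by move: (C / y.+1%:R) (C / z.+1%:R) => a b; lra.
exists (sup E) => y; rewrite ler_norml; apply/andP; split.
  have : sup E <= s y + C / y.+1%:R by apply: ge_sup; [exists (s y - C / y.+1%:R), y|exact: ub].
  by move: (C / y.+1%:R) (sup E) => a b; lra.
have : s y - C / y.+1%:R <= sup E by apply: ub_le_sup; [exists (s y + C / y.+1%:R); exact: ub|exists y].
by move: (C / y.+1%:R) (sup E) => a b; lra.
Qed.

Lemma geom_tail p K : (1 < p)%N -> \sum_(2 <= k < K) (p%:R ^- k : R) <= (p%:R * (p%:R - 1))^-1.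
Proof.
move=> p1; have p0 : (0 : R) < p%:R by rewrite ltr0n; lia.
have q0 : (0 : R) < p%:R - 1 by rewrite subr_gt0 ltr1n.
case: (leqP K 2) => K2; first by rewrite big_geq // invr_ge0 mulr_ge0 // ltW.
have -> : K = (K - 2).+2 by lia.
suff -> : \sum_(2 <= k < (K - 2).+2) (p%:R ^- k : R) = (p%:R * (p%:R - 1))^-1 - p%:R ^- (K - 2).+1 / (p%:R - 1).
  by rewrite gerBl mulr_ge0 ?invr_ge0 ?exprn_ge0 ?ltW.
elim: (K - 2)%N => [|j IH]; first by rewrite big_geq // expr1 invfM subrr.
rewrite big_nat_recr //= IH; have -> : p%:R ^- j.+2 = p%:R^-1 * p%:R ^- j.+1 :> R by rewrite exprS invfM.
by move: (p%:R ^- j.+1) => e; field; rewrite !lt0r_neq0.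
Qed.

Lemma sum_log_sq x : \sum_(2 <= n < x.+1) lnn R n / (n%:R * (n%:R - 1)) <= 2.
Proof.
case: x => [|x]; first by rewrite big_geq.
suff : \sum_(2 <= n < x.+2) lnn R n / (n%:R * (n%:R - 1)) <= 2 - (lnn R x.+1 + 2) / x.+1%:R.
  move=> h; apply: le_trans h _; rewrite gerBl divr_ge0 // addr_ge0 ?lnn_ge0 //.
elim: x => [|x IH]; first by rewrite big_geq // lnn1 divr1; lra.
rewrite big_nat_recr //=; apply: le_trans (lerD IH (lexx _)) _.
have /andP [_ h] := lnn_step R (ltn0Sn x).
have e : (x.+2%:R : R) = x.+1%:R + 1 by rewrite natr1.
rewrite e addrK; have a1 : (1 : R) <= x.+1%:R by rewrite ler1n.
move: h a1 {IH e}; move: (lnn R x.+1) (lnn R x.+2) (x.+1%:R) => u v a h a1.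
have a0 : 0 < a by lra.
have ai : a * a^-1 = 1 by rewrite mulfV ?lt0r_neq0.
rewrite -subr_ge0.
have -> : 2 - (v + 2) / (a + 1) - (2 - (u + 2) / a + v / ((a + 1) * a)) = ((a + 1) * (u - v) + 2) / ((a + 1) * a).
  by field; rewrite !lt0r_neq0 //; lra.
rewrite divr_ge0 ?mulr_ge0 //; try lra.
have i1 : a^-1 <= 1 by rewrite invf_le1.
nra.
Qed.

(** Prime powers of exponent at least 2 contribute at most the sum of log n / (n (n - 1)), which is
    at most 2. *)
Lemma vonM_primes (P : pred nat) x :
  \sum_(1 <= d < x.+1 | P d) vonM R d / d%:R <= \sum_(1 <= p < x.+1 | prime p && P p) lnn R p / p%:R + 2.
Proof.
apply: (@le_trans _ _ (\sum_(1 <= p < x.+1 | prime p && P p) lnn R p / p%:R +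
  \sum_(1 <= d < x.+1) \sum_(2 <= p < x.+1) \sum_(2 <= k < x.+1) (d == (p ^ k)%N)%:R * (lnn R p * p%:R ^- k))).
  rewrite big_mkcond [X in X + _]big_mkcond -big_split /=; apply: ler_sum_nat => d /andP [d1 dx].
  have pos : 0 <= \sum_(2 <= p < x.+1) \sum_(2 <= k < x.+1) (d == (p ^ k)%N)%:R * (lnn R p * p%:R ^- k).
    by apply: sumr_ge0 => p _; apply: sumr_ge0 => k _; rewrite !mulr_ge0 ?lnn_ge0 ?invr_ge0 ?exprn_ge0.
  have pos2 : 0 <= (if prime d && P d then lnn R d / d%:R else 0) by case: ifP => // _; rewrite divr_ge0 ?lnn_ge0.
  case: (boolP (P d)) => [Pd|_]; last by rewrite addr_ge0 //; case: ifP => // _; rewrite divr_ge0 ?lnn_ge0.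
  case: (eqVneq (vonM R d) 0) => [->|/vonM_neq0 [p [k [pp k0 dE]]]]; first by rewrite mul0r addr_ge0 //; rewrite Pd in pos2.
  have p2 := prime_gt1 pp.
  case: (eqVneq k 1%N) => [k1|k1].
    have dp : d = p by rewrite dE k1 expn1.
    rewrite andbT dp pp -[X in vonM R X](expn1 p) vonM_pk // lerDl; by rewrite dp in pos.
  have k2 : (2 <= k)%N by lia.
  have pd : (p < x.+1)%N by apply: leq_ltn_trans dx; rewrite dE -{1}(expn1 p) leq_exp2l.
  have kd : (k < x.+1)%N by apply: leq_ltn_trans dx; rewrite dE ltnW // ltn_expl.
  rewrite -[X in X <= _]add0r; apply: lerD; first by rewrite Pd in pos2.
  rewrite dE vonM_pk // (bigD1_seq p) ?mem_index_iota ?iota_uniq ?p2 //= (bigD1_seq k) ?mem_index_iota ?iota_uniq ?k2 //=.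
  rewrite eqxx mul1r -natrX -addrA lerDl addr_ge0 //; apply: sumr_ge0 => q _; last apply: sumr_ge0 => j _;
    by rewrite !mulr_ge0 ?lnn_ge0 ?invr_ge0 ?exprn_ge0.
rewrite lerD2l; apply: le_trans (sum_log_sq x).
rewrite exchange_big_nat /=; apply: ler_sum_nat => p /andP [p2 px].
rewrite exchange_big_nat /= -[X in _ <= X]mulr1 mulrAC -mulrA -[X in _ <= lnn R p * X]mulr1.
apply: le_trans (_ : \sum_(2 <= k < x.+1) lnn R p * p%:R ^- k <= _); last first.
  by rewrite -mulr_sumr mulr1 ler_wpM2l ?lnn_ge0 // ?mul1r geom_tail.
apply: ler_sum_nat => k _; rewrite -mulr_suml ler_piMl ?mulr_ge0 ?lnn_ge0 ?invr_ge0 ?exprn_ge0 //.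
case: (boolP ((p ^ k)%N \in index_iota 1 x.+1)) => h.
  by rewrite (bigD1_seq (p ^ k)%N) ?iota_uniq //= eqxx big1 ?addr0 // => d /negPf ->.
by rewrite big1_seq ?ler01 // => d /= dI; case: eqP => // dE; move: dI; rewrite dE (negPf h).
Qed.
End Limits.

Section Op.
Variables (R : realType) (Mp : nat).
Local Notation M := Mp.+1.
Hypothesis M1 : (1 < M)%N.
Implicit Types (w u v : 'rV[R]_M) (g n : nat).

(** A row vector stands for a function on the units modulo M, extended by 0 and made periodic. *)
Definition ev w n : R := if coprime n M then w ord0 (inord (n %% M)) else 0.
Definition supp w := forall j : 'I_M, ~~ coprime j M -> w ord0 j = 0.
Definition mz w := \sum_(i < M) ev w i = 0.

Lemma ev_mod w m n : m = n %[mod M] -> ev w m = ev w n.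
Proof. by move=> h; rewrite /ev -coprime_modl h coprime_modl. Qed.
Lemma ev_ord w (j : 'I_M) : coprime j M -> ev w j = w ord0 j.
Proof. by move=> c; rewrite /ev c modn_small // inord_val. Qed.
Lemma ev_inord w n : ev w (inord (n %% M) : 'I_M) = ev w n.
Proof. by apply: ev_mod; rewrite inordK ?ltn_pmod // modn_mod. Qed.
Lemma ev0 w n : ~~ coprime n M -> ev w n = 0.
Proof. by rewrite /ev => /negPf ->. Qed.
Lemma evMl w g n : ~~ coprime g M -> ev w (g * n) = 0.
Proof. by move=> cg; rewrite ev0 // coprimeMl negb_and cg. Qed.
Lemma evMr w g n : ~~ coprime n M -> ev w (g * n) = 0.
Proof. by rewrite mulnC; exact: evMl. Qed.
Lemma ev_ext w w' : supp w -> supp w' -> (forall n, coprime n M -> ev w n = ev w' n) -> w = w'.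
Proof.
move=> sw sw' h; apply/rowP => j; case: (boolP (coprime j M)) => cj; last by rewrite sw ?sw'.
by have := h j cj; rewrite !ev_ord.
Qed.

Definition nrm w : R := \sum_j `|w ord0 j|.
Lemma ev_bound w n : `|ev w n| <= nrm w.
Proof.
rewrite /ev; case: ifP => _; last by rewrite normr0 sumr_ge0.
by rewrite /nrm (bigD1 (inord (n %% M))) //= lerDl sumr_ge0.
Qed.

Lemma mulg_inj g : coprime g M -> injective (fun i : 'I_M => inord ((g * i) %% M) : 'I_M).
Proof.
move=> cg i j /(congr1 val); rewrite /= !inordK ?ltn_pmod // => h.
have {}h : g * i == g * j %[mod M] by rewrite h.
wlog ij : i j h / (i <= j)%N.
  by move=> H; case: (leqP i j) => [|/ltnW] ij; [exact: H|symmetry; apply: H => //; rewrite eq_sym].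
rewrite eq_sym eqn_mod_dvd ?leq_mul2l ?ij ?orbT // -mulnBr Gauss_dvdr 1?coprime_sym // in h.
apply/val_inj/eqP; rewrite eqn_leq ij /= -subn_eq0; apply/negPn/negP => ne.
by have := dvdn_leq _ h; rewrite lt0n ne => /(_ isT); have := ltn_ord j; lia.
Qed.

Lemma mz_tr w g : mz w -> \sum_(i < M) ev w (g * i) = 0.
Proof.
move=> zw; case: (boolP (coprime g M)) => cg; last by rewrite big1 // => i _; exact: evMl.
rewrite -[RHS]zw [RHS](reindex_inj (mulg_inj cg)) /=; apply: eq_bigr => i _.
by rewrite ev_inord.
Qed.

Lemma ev_sums w g a b : mz w -> (a <= b)%N -> `|\sum_(a <= n < b) ev w (g * n)| <= 2 * (M%:R * nrm w).
Proof.
move=> zw; apply: (@per_sum _ (fun n => ev w (g * n))) => // [n||n]; last exact: ev_bound.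
  by apply: ev_mod; rewrite mulnDr addnC modnMDl.
by rewrite big_mkord; exact: mz_tr.
Qed.

Definition psum w g y : R := \sum_(1 <= n < y.+1) ev w (g * n) / n%:R.
Lemma L_ex w g : mz w -> exists L, forall y : nat, `|psum w g y - L| <= 2 * (M%:R * nrm w) / y.+1%:R.
Proof.
move=> zw; apply: cauchy_limit => y z yz.
have -> : psum w g z - psum w g y = \sum_(y.+1 <= n < z.+1) ev w (g * n) * n%:R^-1.
  by rewrite /psum (big_cat_nat (n := y.+1)) //= addrAC subrr add0r.
apply: (abel_sum (f := fun n => n%:R^-1)) => // [n yn|n yn|x yx]; last exact: ev_sums.
  by rewrite lef_pV2 ?posrE ?ltr0n ?ler_nat //; lia.
by rewrite invr_ge0.
Qed.

Definition Nu : R := \sum_(i < M) (coprime i M)%:R.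
Lemma Nu_ge1 : 1 <= Nu.
Proof.
rewrite /Nu (bigD1 (inord 1)) //= inordK // coprime1n lerDl; apply: sumr_ge0 => i _; by case: coprime.
Qed.
Lemma Nu_neq0 : Nu != 0. Proof. by rewrite lt0r_neq0 // (lt_le_trans ltr01 Nu_ge1). Qed.

(** The point mass at h minus its mean; for units h these span the mean-zero functions. *)
Definition uh (h : 'I_M) : 'rV[R]_M := \row_j (if coprime j M then (j == h)%:R - Nu^-1 else 0).
Lemma uh_supp (h : 'I_M) : supp (uh h). Proof. by move=> j /negPf cj; rewrite mxE cj. Qed.
Lemma ev_uh (h : 'I_M) n : coprime n M -> ev (uh h) n = (inord (n %% M) == h)%:R - Nu^-1.
Proof. by move=> cn; rewrite /ev cn mxE inordK ?ltn_pmod // coprime_modl cn. Qed.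
Lemma uh_mz (h : 'I_M) : coprime h M -> mz (uh h).
Proof.
move=> ch; rewrite /mz (eq_bigr (fun i : 'I_M => (i == h)%:R - (coprime i M)%:R * Nu^-1)); last first.
  move=> i _; case: (boolP (coprime i M)) => ci; first by rewrite ev_ord // mxE ci mul1r.
  by rewrite ev0 // mul0r subr0; case: eqP => // ih; rewrite ih ch in ci.
rewrite sumrB -mulr_suml mulfV ?Nu_neq0 // (bigD1 h) //= eqxx big1 ?addr0 ?subrr // => i /negPf ->; by [].
Qed.
Lemma uh_nrm (h : 'I_M) : nrm (uh h) <= 2 * M%:R.
Proof.
apply: (@le_trans _ _ (\sum_(j < M) 2)); last by rewrite sumr_const card_ord mulr_natr.
apply: ler_sum => j _; rewrite mxE; case: ifP => _; last by rewrite normr0.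
have i1 : Nu^-1 <= 1 by rewrite invf_le1 ?Nu_ge1 // (lt_le_trans ltr01 Nu_ge1).
have i0 : 0 <= Nu^-1 by rewrite invr_ge0 (le_trans ler01 Nu_ge1).
by case: (j == h); rewrite ler_norml; apply/andP; split; rewrite /=; lra.
Qed.
Lemma sum_unit w : mz w -> \sum_(h < M | coprime h M) w ord0 h = 0.
Proof.
move=> zw; rewrite -[RHS]zw big_mkcond; apply: eq_bigr => i _.
by case: ifP => ci; [rewrite ev_ord|rewrite ev0 ?ci].
Qed.
Lemma ev_decomp w n : mz w -> ev w n = \sum_(h < M | coprime h M) w ord0 h * ev (uh h) n.
Proof.
move=> zw; case: (boolP (coprime n M)) => cn; last first.
  by rewrite ev0 // big1 // => h _; rewrite ev0 ?mulr0.
rewrite (eq_bigr (fun h : 'I_M => w ord0 h * (inord (n %% M) == h)%:R - w ord0 h * Nu^-1)); last first.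
  by move=> h _; rewrite ev_uh // mulrBr.
have cn' : coprime (inord (n %% M) : 'I_M) M by rewrite inordK ?ltn_pmod // coprime_modl.
rewrite sumrB -mulr_suml sum_unit // mul0r subr0 (bigD1 (inord (n %% M))) //= eqxx mulr1 big1 ?addr0.
  by rewrite /ev cn.
by move=> h /andP [_ /negPf hn]; rewrite eq_sym hn mulr0.
Qed.

Lemma nrm_ge0 w : 0 <= nrm w. Proof. exact: sumr_ge0. Qed.
Definition C0 : R := 2 * (M%:R * (2 * M%:R)).
Lemma C0_ge0 : 0 <= C0. Proof. by rewrite !mulr_ge0. Qed.
Lemma Lmat_ex : exists Lm : 'M[R]_M, forall h g : 'I_M,
  (coprime h M && coprime g M -> forall y : nat, `|psum (uh h) g y - Lm h g| <= C0 / y.+1%:R) /\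
  (~~ (coprime h M && coprime g M) -> Lm h g = 0).
Proof.
have /choice [L hL] : forall p : 'I_M * 'I_M, exists L : R,
  (coprime p.1 M && coprime p.2 M -> forall y : nat, `|psum (uh p.1) p.2 y - L| <= C0 / y.+1%:R) /\
  (~~ (coprime p.1 M && coprime p.2 M) -> L = 0).
  move=> [h g] /=; case: (boolP (coprime h M && coprime g M)) => [/andP [ch cg]|_]; last by exists 0.
  have [L hL] := L_ex g (uh_mz ch); exists L; split=> // _ y; apply: le_trans (hL y) _.
  by rewrite ler_wpM2r ?invr_ge0 // ler_wpM2l // ler_wpM2l // uh_nrm.
by exists (\matrix_(h, g) L (h, g)) => h g; rewrite mxE; exact: (hL (h, g)).
Qed.
Definition Lmat := projT1 (cid Lmat_ex).
Lemma LmatP (h g : 'I_M) : (coprime h M && coprime g M -> forall y : nat, `|psum (uh h) g y - Lmat h g| <= C0 / y.+1%:R) /\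
  (~~ (coprime h M && coprime g M) -> Lmat h g = 0).
Proof. exact: (projT2 (cid Lmat_ex)). Qed.
(** On mean-zero w this is g -> sum of w(g n) / n. A nontrivial character chi is an eigenvector with
    eigenvalue L(1, chi), so the nonvanishing of these values becomes the injectivity of one real
    operator. *)
Definition Lop w := w *m Lmat.

Lemma Lop_supp w : supp (Lop w).
Proof. by move=> j cj; rewrite mxE big1 // => h _; rewrite (LmatP h j).2 ?mulr0 // negb_and cj orbT. Qed.

Lemma psum_mod w g g' y : g = g' %[mod M] -> psum w g y = psum w g' y.
Proof. by move=> h; apply: eq_bigr => n _; congr (_ / _); apply: ev_mod; rewrite -modnMml h modnMml. Qed.

Lemma Lop_approx w g y : mz w -> coprime g M -> `|psum w g y - ev (Lop w) g| <= nrm w * C0 / y.+1%:R.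
Proof.
move=> zw cg; set g' : 'I_M := inord (g %% M).
have cg' : coprime g' M by rewrite inordK ?ltn_pmod // coprime_modl.
have gg' : g = g' %[mod M] by rewrite inordK ?ltn_pmod // modn_mod.
rewrite (psum_mod _ _ gg') -(ev_inord _ g) -/g' ev_ord //.
have -> : psum w g' y = \sum_(h < M | coprime h M) w ord0 h * psum (uh h) g' y.
  rewrite /psum (eq_bigr (fun n => \sum_(h < M | coprime h M) w ord0 h * (ev (uh h) (g' * n) / n%:R))).
    by rewrite exchange_big /=; apply: eq_bigr => h _; rewrite mulr_sumr.
  by move=> n _; rewrite ev_decomp // mulr_suml; apply: eq_bigr => h _; rewrite mulrA.
have -> : (Lop w) ord0 g' = \sum_(h < M | coprime h M) w ord0 h * Lmat h g'.
  rewrite mxE [RHS]big_mkcond; apply: eq_bigr => h _; case: ifP => // ch.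
  by rewrite (LmatP h g').2 ?mulr0 // ch.
rewrite -sumrB; apply: le_trans (ler_norm_sum _ _ _) _; rewrite /nrm -mulrA mulr_suml [X in X <= _]big_mkcond.
apply: ler_sum => h _; case: ifP => ch; last by rewrite mulr_ge0 // divr_ge0 ?C0_ge0.
by rewrite -mulrBr normrM ler_wpM2l // (LmatP h g').1 // ch cg'.
Qed.

Lemma Lop_mz w : mz w -> mz (Lop w).
Proof.
move=> zw; apply: (@inv_small _ _ (M%:R * (nrm w * C0))) => y.
have z : \sum_(g < M) psum w g y = 0.
  rewrite exchange_big big1 // => n _; rewrite -mulr_suml.
  rewrite (eq_bigr (fun g : 'I_M => ev w (n * g))); last by move=> g _; rewrite mulnC.
  by rewrite mz_tr ?mul0r.
have -> : \sum_(i < M) ev (Lop w) i = - \sum_(i < M) (psum w i y - ev (Lop w) i) by rewrite sumrB z sub0r opprK.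
rewrite normrN; apply: le_trans (ler_norm_sum _ _ _) _.
apply: (@le_trans _ _ (\sum_(i < M) nrm w * C0 / y.+1%:R)); last by rewrite sumr_const card_ord -[X in X <= _]mulr_natl !mulrA lexx.
apply: ler_sum => g _; case: (boolP (coprime g M)) => cg; first exact: Lop_approx.
rewrite ev0 // subr0 /psum big1 ?normr0 => [|n _]; last by rewrite evMl ?mul0r.
by rewrite divr_ge0 // mulr_ge0 ?nrm_ge0 ?C0_ge0.
Qed.

Definition Yo x w g : R := \sum_(1 <= d < x.+1) vonM R d / d%:R * ev w (g * d).

Lemma logn_decr n : (4 <= n)%N -> lnn R n.+1 / n.+1%:R <= lnn R n / n%:R.
Proof.
move=> n4; have n0 : (0 < n)%N by lia.
have l1 : 1 <= lnn R n.
  have l2 : 2^-1 <= lnn R 2 by have /andP [] := lnn_step R (isT : 0 < 1)%N; rewrite lnn1 subr0.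
  have : lnn R 4 <= lnn R n by exact: lnn_le.
  by rewrite (_ : 4 = 2 * 2)%N // lnnM //; lra.
have /andP [_ h] := lnn_step R n0.
have a0 : (0 : R) < n%:R by rewrite ltr0n.
rewrite ler_pdivrMr ?ltr0n // mulrAC ler_pdivlMr // -natr1.
have ai : n%:R * n%:R^-1 = 1 :> R by rewrite mulfV ?lt0r_neq0.
have g : n%:R * (lnn R n.+1 - lnn R n) <= 1 by rewrite -[X in _ <= X]ai ler_wpM2l // ltW.
by move: g l1; move: (lnn R n) (lnn R n.+1) (n%:R) => u v a; lra.
Qed.

(** The sum of w(g n) log n / n is bounded by Abel summation. Expanding log n as a sum of vonM d
    over d | n gives inner sums that approximate [Lop w] with error O(d/x), and Chebyshev's bound
    controls the total error. *)
Lemma Y1 w g : mz w -> coprime g M -> bnd (fun x => Yo x (Lop w) g).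
Proof.
move=> zw cg; set K := nrm w * C0.
have K0 : 0 <= K by rewrite mulr_ge0 ?sumr_ge0 // !mulr_ge0.
have [C hC] : bnd (fun x => \sum_(1 <= n < x.+1) ev w (g * n) * (lnn R n / n%:R)).
  set B := 2 * (M%:R * nrm w); have B0 : 0 <= B by rewrite !mulr_ge0 ?sumr_ge0.
  (* Abel summation starts at 4, where [logn_decr] applies; the first three terms are bounded one by
     one. *)
  exists (\sum_(1 <= n < 4) nrm w * (lnn R n / n%:R) + B * (lnn R 4 / 4)) => x x0.
  case: (leqP 3 x) => x3.
    rewrite (big_cat_nat (n := 4)) //=; apply: le_trans (ler_normD _ _) _; apply: lerD.
      apply: le_trans (ler_norm_sum _ _ _) _; apply: ler_sum => n _.
      by rewrite normrM [`|_ / _|]ger0_norm ?divr_ge0 ?lnn_ge0 // ler_wpM2r ?ev_bound ?divr_ge0 ?lnn_ge0.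
    apply: (abel_sum (f := fun n => lnn R n / n%:R)) => // [n n4|n _|y y4]; last exact: ev_sums.
      exact: logn_decr.
    by rewrite divr_ge0 ?lnn_ge0.
  apply: le_trans (ler_norm_sum _ _ _) _; rewrite -[X in X <= _]addr0; apply: lerD; last by rewrite mulr_ge0 // divr_ge0 ?lnn_ge0.
  have e4 : \sum_(1 <= n < 4) nrm w * (lnn R n / n%:R) = \sum_(1 <= n < x.+1) nrm w * (lnn R n / n%:R) + \sum_(x.+1 <= n < 4) nrm w * (lnn R n / n%:R).
    by rewrite -big_cat_nat //=; lia.
  rewrite e4 -[X in X <= _]addr0; apply: lerD; last first.
    by apply: sumr_ge0 => n _; rewrite mulr_ge0 ?divr_ge0 ?lnn_ge0 ?sumr_ge0.
  apply: ler_sum => n _.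
  by rewrite normrM [`|_ / _|]ger0_norm ?divr_ge0 ?lnn_ge0 // ler_wpM2r ?ev_bound ?divr_ge0 ?lnn_ge0.
exists (C + 8 * K) => x x0.
have e : \sum_(1 <= n < x.+1) ev w (g * n) * (lnn R n / n%:R) = \sum_(1 <= d < x.+1) vonM R d / d%:R * psum w (g * d) (x %/ d).
  transitivity (\sum_(1 <= n < x.+1) \sum_(1 <= d < x.+1 | (d %| n)%N) vonM R d / d%:R * (ev w (g * d * (n %/ d)) / (n %/ d)%:R)).
    apply: eq_big_nat => n /andP [n1 nx]; rewrite -(@vonM_sum R n x) // mulr_suml mulr_sumr; apply: eq_bigr => d dn.
    have nE : n = (d * (n %/ d))%N by rewrite mulnC divnK.
    have -> : (n%:R : R) = d%:R * (n %/ d)%:R by rewrite -natrM -nE.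
    by rewrite -mulnA -nE invfM; ring.
  rewrite (dirichlet_swap x (fun d e => vonM R d / d%:R * (ev w (g * d * e) / e%:R))).
  by apply: eq_bigr => d _; rewrite -mulr_sumr.
have -> : Yo x (Lop w) g = \sum_(1 <= n < x.+1) ev w (g * n) * (lnn R n / n%:R) -
    \sum_(1 <= d < x.+1) vonM R d / d%:R * (psum w (g * d) (x %/ d) - ev (Lop w) (g * d)).
  by rewrite e -sumrB; apply: eq_bigr => d _; ring.
apply: le_trans (ler_normB _ _) _; apply: lerD; first exact: hC.
apply: le_trans (ler_norm_sum _ _ _) _.
apply: (@le_trans _ _ (\sum_(1 <= d < x.+1) vonM R d * (K / x%:R))); last first.
  rewrite -mulr_suml -/(cheb R x); apply: (@le_trans _ _ (8 * x%:R * (K / x%:R))).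
    by rewrite ler_wpM2r ?divr_ge0 // cheb_le.
  by rewrite -mulrA [x%:R * _]mulrC divfK // lt0r_neq0 // ltr0n.
apply: ler_sum_nat => d /andP [d0 dx]; have d0' : (0 : R) < d%:R by rewrite ltr0n.
rewrite normrM [`|_ / _|]ger0_norm ?divr_ge0 ?vonM_ge0 // -mulrA ler_wpM2l ?vonM_ge0 //.
rewrite mulrC ler_pdivrMr //.
case: (boolP (coprime (g * d) M)) => c; last first.
  rewrite ev0 // subr0 /psum big1 ?normr0 => [|n _]; last by rewrite evMl ?mul0r.
  by rewrite mulr_ge0 ?divr_ge0.
apply: le_trans (Lop_approx _ zw c) _; rewrite -/K -[K / x%:R * d%:R]mulrA ler_wpM2l // mulrC; exact: floor_inv.
Qed.

Lemma dvdn_pair n a d : (0 < a)%N -> (0 < n)%N -> (a %| n)%N && (d %| n %/ a)%N = (a * d %| n)%N.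
Proof.
move=> a0 n0; apply/andP/idP => [[h1 h2]|h].
  by rewrite mulnC -dvdn_divRL.
have an : (a %| n)%N by apply: dvdn_trans h; rewrite dvdn_mulr.
by rewrite an dvdn_divRL // mulnC.
Qed.

(** Moebius inversion gives the sum of mu(a) log(n/a); the part with log n vanishes, since the sum
    of mu is 0 unless n = 1, and log 1 = 0. *)
Lemma vonM_mu n x : (0 < n)%N -> (n <= x)%N -> vonM R n = - \sum_(1 <= a < x.+1 | (a %| n)%N) (mu a)%:~R * lnn R a.
Proof.
move=> n0 nx.
have ms k : (0 < k)%N -> (k <= x)%N -> \sum_(1 <= a < x.+1 | (a %| k)%N) (mu a)%:~R = (k == 1%N)%:R :> R.
  by move=> k0 kx; rewrite -(rmorph_sum (intmul (1 : R))) mu_sum //=; case: eqP.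
have key : \sum_(1 <= a < x.+1 | (a %| n)%N) (mu a)%:~R * lnn R (n %/ a) = vonM R n.
  transitivity (\sum_(1 <= a < x.+1) \sum_(1 <= d < x.+1) if (a * d %| n)%N then (mu a)%:~R * vonM R d else 0).
    rewrite big_mkcond; apply: eq_big_nat => a /andP [a0 _].
    case: ifP => an; last first.
      by rewrite big1 // => d _; rewrite -dvdn_pair // an.
    have na : (0 < n %/ a)%N by rewrite divn_gt0 // dvdn_leq.
    rewrite -(@vonM_sum R (n %/ a) x) ?(leq_trans (leq_div _ _)) // mulr_sumr big_mkcond; apply: eq_bigr => d _.
    by rewrite -dvdn_pair // an.
  rewrite exchange_big_nat /=.
  transitivity (\sum_(1 <= d < x.+1) if d == n then vonM R d else 0).
    apply: eq_big_nat => d /andP [d0 _].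
    case: (boolP (d %| n)%N) => dn; last first.
      rewrite big1 => [|a _]; first by case: eqP => // dE; rewrite dE dvdnn in dn.
      by rewrite mulnC -dvdn_pair // (negPf dn).
    have nd : (0 < n %/ d)%N by rewrite divn_gt0 // dvdn_leq.
    rewrite (eq_bigr (fun a => (if (a %| n %/ d)%N then (mu a)%:~R else 0) * vonM R d)); last first.
      by move=> a _; rewrite mulnC -dvdn_pair // dn /=; case: ifP; rewrite ?mul0r.
    rewrite -mulr_suml -big_mkcond /= ms // ?(leq_trans (leq_div _ _)) //.
    have -> : (n %/ d == 1)%N = (d == n) by rewrite [(_ %/ _ == _)%N]eq_sym eqn_div // mul1n.
    by case: eqP; rewrite ?mul1r ?mul0r.
  rewrite (bigD1_seq n) ?iota_uniq //=; last by rewrite mem_index_iota n0 ltnS.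
  by rewrite eqxx big1 ?addr0 // => d /negPf ->.
rewrite -key.
have -> : \sum_(1 <= a < x.+1 | (a %| n)%N) (mu a)%:~R * lnn R (n %/ a) =
   (\sum_(1 <= a < x.+1 | (a %| n)%N) (mu a)%:~R) * lnn R n - \sum_(1 <= a < x.+1 | (a %| n)%N) (mu a)%:~R * lnn R a.
  rewrite mulr_suml -sumrB big_nat_cond [RHS]big_nat_cond; apply: eq_bigr => a /andP [/andP [a0 _] an].
  have na : (0 < n %/ a)%N by rewrite divn_gt0 // dvdn_leq.
  have -> : lnn R n = lnn R (n %/ a) + lnn R a by rewrite -lnnM // divnK.
  by ring.
by rewrite ms //; case: eqP => [->|_]; rewrite ?lnn1 ?mulr0 ?mul0r sub0r.
Qed.
End Op.
End ResidueOperator.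

(** * Invertibility of the operator, and primes in arithmetic progressions *)

Module DirichletTheorem.
Import structures.
Import all_boot all_order all_algebra.
Import boolp classical_sets reals exp cyclic.
Import zify ring lra.
Import ArithmeticFunctions Mertens ResidueOperator.
Import Order.TTheory GRing.Theory Num.Theory.
Local Open Scope ring_scope.

Section Op3.
Variables (R : realType) (Mp : nat).
Local Notation M := Mp.+1.
Hypothesis M1 : (1 < M)%N.
Implicit Types (w u v : 'rV[R]_M) (g n : nat).

(** Moebius inversion writes the left side as the sum over a of mu(a)/a log(x/a) times
    [psum w (g * a) (x %/ a)]. When [Lop w] vanishes on the units these partial sums tend to 0 and
    are O(a/x), and the sum of log(x/a) is at most x. *)
Lemma Y2 w g : mz w -> (forall g', coprime g' M -> ev (Lop M1 w) g' = 0) -> coprime g M ->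
  bnd (fun x => Yo x w g + ev w g * lnn R x).
Proof.
move=> zw L0 cg; set K := nrm w * C0 R Mp; have K0 : 0 <= K by rewrite mulr_ge0 ?nrm_ge0 ?C0_ge0.
exists K => x x0.
have ms k : (0 < k)%N -> (k <= x)%N -> \sum_(1 <= a < x.+1 | (a %| k)%N) (mu a)%:~R = (k == 1%N)%:R :> R.
  by move=> k0 kx; rewrite -(rmorph_sum (intmul (1 : R))) mu_sum //=; case: eqP.
have -> : Yo x w g + ev w g * lnn R x = \sum_(1 <= a < x.+1) (mu a)%:~R / a%:R * (lnn R x - lnn R a) * psum w (g * a) (x %/ a).
  rewrite [RHS](eq_bigr (fun a => \sum_(1 <= b < (x %/ a).+1) (mu a)%:~R / a%:R * (lnn R x - lnn R a) * (ev w (g * a * b) / b%:R))); last first.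
    by move=> a _; rewrite mulr_sumr.
  rewrite -(dirichlet_swap x (fun a b => (mu a)%:~R / a%:R * (lnn R x - lnn R a) * (ev w (g * a * b) / b%:R))).
  have e (k : nat) : (1 <= k < x.+1)%N -> \sum_(1 <= a < x.+1 | (a %| k)%N) (mu a)%:~R / a%:R * (lnn R x - lnn R a) * (ev w (g * a * (k %/ a)) / (k %/ a)%:R) =
      ev w (g * k) / k%:R * ((k == 1%N)%:R * lnn R x + vonM R k).
    move=> /andP [k0 kx]; rewrite -(ms k) // (vonM_mu R k0 (x := x)) // mulr_suml -sumrB mulr_sumr; apply: eq_bigr => a ak.
    have kE : k = (a * (k %/ a))%N by rewrite mulnC divnK.
    have -> : (k%:R : R) = a%:R * (k %/ a)%:R by rewrite -natrM -kE.
    by rewrite -mulnA -kE invfM; ring.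
  rewrite [RHS](eq_big_nat _ _ e) (eq_big_nat _ _ (F2 := fun k => ev w (g * k) / k%:R * ((k == 1%N)%:R * lnn R x) + vonM R k / k%:R * ev w (g * k))); last first.
    by move=> k _; ring.
  rewrite big_split /= addrC; congr (_ + _); rewrite (bigD1_seq 1%N) ?iota_uniq ?mem_index_iota //=.
  rewrite big1 ?addr0 => [|k /negPf ->]; last by rewrite mul0r mulr0.
  by rewrite muln1 divr1 mul1r.
apply: le_trans (ler_norm_sum _ _ _) _.
apply: (@le_trans _ _ (\sum_(1 <= a < x.+1) (lnn R x - lnn R a) * (K / x%:R))); last first.
  rewrite -mulr_suml; apply: (@le_trans _ _ (x%:R * (K / x%:R))); first by rewrite ler_wpM2r ?divr_ge0 // sum_log_ratio.
  by rewrite mulrC divfK // lt0r_neq0 // ltr0n.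
apply: ler_sum_nat => a /andP [a0 ax]; have a0' : (0 : R) < a%:R by rewrite ltr0n.
have l0 : 0 <= lnn R x - lnn R a by rewrite subr_ge0 lnn_le.
have -> : `|(mu a)%:~R / a%:R * (lnn R x - lnn R a) * psum w (g * a) (x %/ a)| =
    (lnn R x - lnn R a) * (`|psum w (g * a) (x %/ a)| * (`|(mu a)%:~R| * a%:R^-1)).
  by rewrite !normrM [`|lnn R x - _|]ger0_norm // [`|a%:R^-1|]ger0_norm ?invr_ge0 //; ring.
rewrite ler_wpM2l //.
have m1 : `|(mu a)%:~R| <= 1 :> R by rewrite -intr_norm lerz1 mu_abs.
have ps : `|psum w (g * a) (x %/ a)| <= K / x%:R * a%:R.
  case: (boolP (coprime (g * a) M)) => c; last first.
    rewrite /psum big1 ?normr0 => [|n _]; last by rewrite evMl ?mul0r.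
    by rewrite mulr_ge0 ?divr_ge0.
  have := Lop_approx M1 (x %/ a) zw c; rewrite L0 // subr0 -/K => h; apply: le_trans h _.
  by rewrite -[K / x%:R * a%:R]mulrA ler_wpM2l // [x%:R^-1 * _]mulrC floor_inv.
apply: (@le_trans _ _ (K / x%:R * a%:R * (1 * a%:R^-1))).
  by apply: ler_pM => //; rewrite ?mulr_ge0 ?invr_ge0 // ler_wpM2r ?invr_ge0.
by rewrite mul1r mulfK // lt0r_neq0.
Qed.

Definition qq (h : 'I_M) (x : nat) : R := \sum_(1 <= d < x.+1 | (d %% M)%N == h) vonM R d / d%:R.
Lemma qq_ge0 h x : 0 <= qq h x.
Proof. by apply: sumr_ge0 => d _; rewrite divr_ge0 ?vonM_ge0. Qed.

Lemma Yq x w g : Yo x w g = \sum_(h < M | coprime h M) qq h x * ev w (g * h).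
Proof.
rewrite (eq_bigr (fun h : 'I_M => \sum_(1 <= d < x.+1) if (d %% M)%N == h then vonM R d / d%:R * ev w (g * d) else 0)); last first.
  move=> h _; rewrite mulr_suml big_mkcond; apply: eq_bigr => d _; case: eqP => // dh.
  by congr (_ * _); apply: ev_mod; rewrite -dh modnMmr.
rewrite exchange_big; apply: eq_bigr => d _.
case: (boolP (coprime d M)) => cd; last first.
  by rewrite evMr // mulr0 big1 // => h _; case: ifP.
have cd' : coprime (inord (d %% M) : 'I_M) M by rewrite inordK ?ltn_pmod // coprime_modl.
rewrite (bigD1 (inord (d %% M))) //= inordK ?ltn_pmod // eqxx big1 ?addr0 // => h /andP [_ hd].
by case: eqP => // dh; case/negP: hd; rewrite -val_eqE /= inordK ?ltn_pmod // dh.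
Qed.

Lemma units_log : bnd (fun x => \sum_(h < M | coprime h M) qq h x - lnn R x).
Proof.
pose w1 : 'rV[R]_M := const_mx 1.
have e x : \sum_(h < M | coprime h M) qq h x = \sum_(1 <= d < x.+1) vonM R d / d%:R - \sum_(1 <= d < x.+1 | ~~ coprime d M) vonM R d / d%:R.
  rewrite (eq_bigr (fun h : 'I_M => qq h x * ev w1 (1 * h))); last by move=> h ch; rewrite mul1n ev_ord // mxE mulr1.
  rewrite -Yq /Yo [X in _ - X]big_mkcond /= -sumrB; apply: eq_bigr => d _; rewrite mul1n /ev.
  by case: ifP => c /=; rewrite ?mxE ?mulr1 ?mulr0 ?subr0 ?subrr.
exists (8 + (\sum_(1 <= p < M.+1) lnn R p + 2)) => x x0; rewrite e addrAC.
apply: le_trans (ler_normB _ _) _; apply: lerD; first exact: mertens.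
rewrite ger0_norm; last by apply: sumr_ge0 => d _; rewrite divr_ge0 ?vonM_ge0.
apply: le_trans (vonM_primes _ _ _) _; rewrite lerD2r.
have pM p : prime p && ~~ coprime p M -> (p <= M)%N by move=> /andP [pp]; rewrite prime_coprime // negbK; exact: dvdn_leq.
apply: (@le_trans _ _ (\sum_(1 <= p < (maxn x M).+1 | prime p && ~~ coprime p M) lnn R p / p%:R)).
  rewrite [X in _ <= X](big_cat_nat (n := x.+1)) //=; last by rewrite ltnS leq_maxl.
  by rewrite lerDl; apply: sumr_ge0 => p _; rewrite divr_ge0 ?lnn_ge0.
rewrite (@sum_ltn _ M) ?leq_maxr // big_mkcond; apply: ler_sum_nat => p /andP [p0 _].
case: ifP => _; last exact: lnn_ge0.
by rewrite ler_piMr ?lnn_ge0 // invf_le1 ?ltr0n // ler1n.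
Qed.

Lemma lnn_not_bnd : ~ bnd (fun x => lnn R x).
Proof.
move=> h; have /eqP := @lnn_unbounded R 1 (bnd_eq (fun x => esym (mul1r _)) h).
by rewrite oner_eq0.
Qed.

(** Classes with bounded [qq] change the sum by O(1). On the others w(g h) is constant, and all
    classes together carry log x. *)
Lemma YH w g : (forall h : 'I_M, coprime h M -> ~ bnd (qq h) -> ev w (g * h) = ev w g) ->
  bnd (fun x => Yo x w g - ev w g * lnn R x).
Proof.
move=> hw; apply: (@bnd_eq _ (fun x => \sum_(h < M | coprime h M) (ev w (g * h) - ev w g) * qq h x + ev w g * (\sum_(h < M | coprime h M) qq h x - lnn R x))).
  move=> x; rewrite Yq mulrBr addrA mulr_sumr -big_split /=; congr (_ - _); apply: eq_bigr => h _; ring.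
apply: bndD; last by apply: bndZ; exact: units_log.
apply: bnd_sum => h ch; case: (pselect (bnd (qq h))) => [b|nb]; first exact: bndZ.
by exists 0 => x _; rewrite hw // subrr mul0r normr0.
Qed.

Section Kernel.
Variable v : 'rV[R]_M.
Hypotheses (zv : mz v) (Lv : forall g, coprime g M -> ev (Lop M1 v) g = 0).
Variable g0 : nat.
Hypotheses (v0 : ev v g0 != 0) (vmax : forall n, `|ev v n| <= `|ev v g0|).

Definition goodT (t : 'I_M) := coprime t M /\ ~ bnd (qq t).
Definition prodl (ts : seq 'I_M) : nat := (\prod_(t <- ts) t)%N.

Lemma cop_g0 g : ev v g != 0 -> coprime g M.
Proof. by apply: contraR => c; rewrite ev0. Qed.

(** With s = v(g) of maximal size, all s^2 + s v(g h) are nonnegative. Weighted by [qq] their sum is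
    bounded, since the log x terms of [units_log] and [Y2] cancel; hence the coefficient of an
    unbounded [qq t] is 0. *)
Lemma T1 g (t : 'I_M) : `|ev v g| = `|ev v g0| -> goodT t -> ev v (g * t) = - ev v g.
Proof.
move=> ge [ct nb]; set s := ev v g in ge *; have s0 : s != 0 by rewrite -normr_eq0 ge normr_eq0.
have cg := cop_g0 s0.
have pos h : 0 <= s ^+ 2 + s * ev v (g * h).
  have : `|s * ev v (g * h)| <= s ^+ 2 by rewrite normrM -(real_normK (num_real s)) expr2 ler_wpM2l // ge vmax.
  by rewrite ler_norml => /andP [h1 _]; lra.
have [C hC] : bnd (fun x => \sum_(h < M | coprime h M) (s ^+ 2 + s * ev v (g * h)) * qq h x).
  apply: (@bnd_eq _ (fun x => s ^+ 2 * (\sum_(h < M | coprime h M) qq h x - lnn R x) + s * (Yo x v g + s * lnn R x))).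
    move=> x; rewrite Yq mulrBr mulrDr !mulr_sumr.
    have -> : \sum_(h < M | coprime h M) (s ^+ 2 + s * ev v (g * h)) * qq h x = \sum_(h < M | coprime h M) s ^+ 2 * qq h x + \sum_(h < M | coprime h M) s * (qq h x * ev v (g * h)).
      by rewrite -big_split; apply: eq_bigr => h _ /=; ring.
    by ring.
  by apply: bndD; apply: bndZ; [exact: units_log|exact: Y2].
have [z|nz] := eqVneq (s ^+ 2 + s * ev v (g * t)) 0.
  by apply: (mulfI s0); rewrite mulrN -expr2; apply/eqP; rewrite -addr_eq0 addrC z.
exfalso; apply: nb; exists (C / (s ^+ 2 + s * ev v (g * t))) => x x0.
have p : 0 < s ^+ 2 + s * ev v (g * t) by rewrite lt0r nz pos.
rewrite ger0_norm ?qq_ge0 // ler_pdivlMr // mulrC; apply: le_trans (le_trans (ler_norm _) (hC x x0)).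
rewrite (bigD1 t) //= lerDl; apply: sumr_ge0 => h _; by rewrite mulr_ge0 ?qq_ge0.
Qed.

Lemma prodl_v ts g : (forall t, t \in ts -> goodT t) -> `|ev v g| = `|ev v g0| ->
  ev v (g * prodl ts) = (-1) ^+ size ts * ev v g.
Proof.
elim: ts g => [|t ts IH] g hts ge; first by rewrite /prodl big_nil muln1 mul1r.
have h1 := T1 ge (hts t (mem_head _ _)).
rewrite /prodl big_cons mulnA -/(prodl ts) IH; last 2 first.
- by move=> t' ht'; apply: hts; rewrite inE ht' orbT.
- by rewrite h1 normrN.
by rewrite h1 /= exprS; ring.
Qed.

(** The subgroup of units generated by the good classes; inverses are positive powers, so products
    suffice. *)
Definition inH n := exists2 ts, (forall t, t \in ts -> goodT t) & n = prodl ts %[mod M].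

Lemma inH_mul n (t : 'I_M) : goodT t -> inH (n * t) <-> inH n.
Proof.
move=> gt; split=> [[ts hts e]|[ts hts e]]; last first.
  exists (t :: ts); first by move=> t'; rewrite inE => /orP [/eqP ->//|]; exact: hts.
  by rewrite /prodl big_cons mulnC -modnMmr e modnMmr.
exists (ts ++ nseq (totient M).-1 t).
  by move=> t'; rewrite mem_cat => /orP [|/nseqP [-> _]//]; exact: hts.
have tp : (0 < totient M)%N by rewrite totient_gt0.
rewrite /prodl big_cat /= -/(prodl ts) -modnMml -e modnMml -mulnA.
have -> : (\prod_(i <- nseq (totient M).-1 t) i = t ^ (totient M).-1)%N.
  by rewrite big_nseq; elim: (totient M).-1 => //= k ->; rewrite expnS.
by rewrite -expnS prednK // -modnMmr (Euler_exp_totient gt.1) modnMmr muln1.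
Qed.

(** Otherwise let u be the indicator of the subgroup on units minus its mean. It is invariant under
    good classes, and so is [Lop u]. Comparing [YH] with [Y1] gives [Lop u] = 0, and then with [Y2]
    gives u = 0, which is false. *)
Lemma inH_all c : coprime c M -> inH c.
Proof.
move=> cc; apply: contrapT => nc.
pose a (j : nat) : R := (`[< inH j >])%:R.
pose kappa := (\sum_(j < M | coprime j M) a j) / Nu R Mp.
pose u : 'rV[R]_M := \row_j (if coprime j M then a j - kappa else 0).
have aM n : a (n %% M)%N = a n.
  congr (_%:R); congr nat_of_bool; apply/asboolP/asboolP => -[ts h e]; exists ts => //.
    by rewrite -e modn_mod.
  by rewrite modn_mod.
have ue n : coprime n M -> ev u n = a n - kappa.
  by move=> cn; rewrite /ev cn mxE inordK ?ltn_pmod // coprime_modl cn aM.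
have zu : mz u.
  rewrite /mz (eq_bigr (fun i : 'I_M => (if coprime i M then a i else 0) - (coprime i M)%:R * kappa)); last first.
    move=> i _; case: (boolP (coprime i M)) => ci; first by rewrite ue // mul1r.
    by rewrite ev0 // mul0r subrr.
  rewrite sumrB -big_mkcond -mulr_suml /= /kappa mulrC divfK ?subrr //.
  exact: Nu_neq0.
have ui g (t : 'I_M) : goodT t -> ev u (g * t) = ev u g.
  move=> gt; case: (boolP (coprime g M)) => cg; last by rewrite evMl // ev0.
  rewrite !ue ?coprimeMl ?cg ?gt.1 //; congr (_ - _); congr (_%:R); congr nat_of_bool.
  by apply/asboolP/asboolP => h; apply/(inH_mul _ gt).
have Li g (t : 'I_M) : goodT t -> coprime g M -> ev (Lop M1 u) (g * t) = ev (Lop M1 u) g.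
  move=> gt cg; have cgt : coprime (g * t) M by rewrite coprimeMl cg gt.1.
  apply: (@lim_uniq R (psum u g)) => [y|y]; last exact: (Lop_approx M1 y zu cg).
  have -> : psum u g y = psum u (g * t) y; last exact: (Lop_approx M1 y zu cgt).
  by apply: eq_bigr => n _; rewrite mulnAC ui.
have L0 g : coprime g M -> ev (Lop M1 u) g = 0.
  move=> cg; apply: lnn_unbounded.
  have b1 : bnd (fun x => Yo x (Lop M1 u) g - ev (Lop M1 u) g * lnn R x) by apply: YH => h ch nb; apply: Li.
  by apply: (bnd_eq _ (bndB (Y1 M1 zu cg) b1)) => x; ring.
have u0 g : coprime g M -> ev u g = 0.
  move=> cg; have b1 : bnd (fun x => Yo x u g - ev u g * lnn R x) by apply: YH => h ch nb; apply: ui.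
  have b2 := Y2 zu L0 cg.
  have : 2 * ev u g = 0 by apply: lnn_unbounded; apply: (bnd_eq _ (bndB b2 b1)) => x; ring.
  by move/eqP; rewrite mulf_eq0 pnatr_eq0 /= => /eqP.
have h1 := u0 1%N (coprime1n _); have hc := u0 c cc; move: h1 hc; rewrite !ue ?coprime1n // /a.
rewrite asboolT; last by exists [::]; rewrite /prodl ?big_nil.
by rewrite asboolF //=; lra.
Qed.

(** By [T1] and [inH_all] the ratio v(g0 n) / v(g0) is a sign, multiplicative in n: a real character
    with L(1, X) = 0. *)
Lemma kernel_absurd : False.
Proof.
pose X n : R := ev v (g0 * n) / ev v g0.
have cg := cop_g0 v0.
have Xs n : coprime n M -> exists2 ts, (forall t, t \in ts -> goodT t) /\ n = prodl ts %[mod M] & X n = (-1) ^+ size ts.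
  move=> cn; have [ts hts e] := inH_all cn; exists ts => //.
  rewrite /X (_ : ev v (g0 * n) = ev v (g0 * prodl ts)); last by apply: ev_mod; rewrite -modnMmr e modnMmr.
  by rewrite prodl_v // mulfK.
have X0 n : ~~ coprime n M -> X n = 0 by move=> cn; rewrite /X evMr // mul0r.
apply: (@real_char_absurd R X _ _ _ (2 * (M%:R * nrm v) / `|ev v g0|) (nrm v * C0 R Mp / `|ev v g0|)).
- move=> m n; case: (boolP (coprime m M)) => cm; last by rewrite (X0 m) // mul0r X0 // coprimeMl negb_and cm.
  case: (boolP (coprime n M)) => cn; last by rewrite (X0 n) // mulr0 X0 // coprimeMl negb_and cn orbT.
  have [ts [hts e] ->] := Xs m cm; have [ts' [hts' e'] ->] := Xs n cn.
  rewrite /X (_ : ev v (g0 * (m * n)) = ev v (g0 * prodl (ts ++ ts'))).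
    rewrite prodl_v ?size_cat ?exprD ?mulfK // => t; rewrite mem_cat => /orP [|]; [exact: hts|exact: hts'].
  apply: ev_mod; rewrite /prodl big_cat /= -modnMmr -[in RHS]modnMmr; congr ((_ * _) %% _)%N.
  by rewrite -modnMml e modnMml -modnMmr e' modnMmr.
- by rewrite /X muln1 divff.
- move=> n; case: (boolP (coprime n M)) => cn; last by left; exact: X0.
  by right; have [ts _ ->] := Xs n cn; rewrite -signr_odd; case: (odd _); [right|left].
- move=> a b ab; rewrite /X -mulr_suml normrM normfV ler_wpM2r ?invr_ge0 //; exact: ev_sums.
- move=> y; have -> : \sum_(1 <= n < y.+1) X n / n%:R = psum v g0 y / ev v g0.
    by rewrite /psum mulr_suml; apply: eq_bigr => n _; rewrite /X mulrAC.
  rewrite normrM normfV mulrAC ler_wpM2r ?invr_ge0 //.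
  by have := Lop_approx M1 y zv cg; rewrite Lv // subr0.
Qed.
End Kernel.

Lemma Lop_inj w : mz w -> supp w -> Lop M1 w = 0 -> w = 0.
Proof.
move=> zw sw L0; apply/eqP/negPn/negP => w0.
have [j wj] : exists j, w ord0 j != 0.
  apply/existsP; apply: contraR w0; rewrite negb_exists => /forallP h; apply/eqP/rowP => j.
  by rewrite mxE; apply/eqP/negPn/h.
have cj : coprime j M by apply: contraR wj => c; rewrite sw.
pose F (i : 'I_M) := `|ev w i|.
case: (@Order.TotalTheory.arg_maxP _ _ _ j xpredT F isT) => g _ gmax.
have gm n : `|ev w n| <= `|ev w g| by have := gmax (inord (n %% M)) isT; rewrite /F ev_inord.
apply: (@kernel_absurd w zw _ g) => //; first by move=> n _; rewrite L0 /ev mxE if_same.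
by rewrite -normr_gt0; apply: lt_le_trans (gm j); rewrite ev_ord // normr_gt0.
Qed.

(** The projection of all vectors onto the mean-zero functions on units. *)
Definition Prm : 'M[R]_M := \matrix_h (if coprime h M then uh R h else 0).
Lemma Prm_ev f n : ev (f *m Prm) n = \sum_(h < M | coprime h M) f ord0 h * ev (uh R h) n.
Proof.
rewrite /ev; case: ifP => cn; last by rewrite big1 // => h _; rewrite mulr0.
rewrite mxE [RHS]big_mkcond; apply: eq_bigr => h _; rewrite mxE.
by case: ifP => //; rewrite mxE mulr0.
Qed.
Lemma Prm_mz (f : 'rV[R]_M) : mz (f *m Prm).
Proof.
rewrite /mz (eq_bigr (fun i : 'I_M => \sum_(h < M | coprime h M) f ord0 h * ev (uh R h) i)); last by move=> i _; exact: Prm_ev.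
rewrite exchange_big big1 // => h ch; rewrite -mulr_sumr; have := uh_mz R M1 ch.
by rewrite /mz => ->; rewrite mulr0.
Qed.
Lemma Prm_supp (f : 'rV[R]_M) : supp (f *m Prm).
Proof.
move=> j cj; rewrite mxE big1 // => h _; rewrite mxE; case: ifP => _; last by rewrite mxE mulr0.
by rewrite uh_supp ?mulr0.
Qed.
Lemma Prm_id w : mz w -> supp w -> w *m Prm = w.
Proof. by move=> zw sw; apply: ev_ext => //; [exact: Prm_supp|move=> n cn; rewrite Prm_ev -ev_decomp]. Qed.

Lemma Lop_surj u : mz u -> supp u -> exists2 w, mz w & Lop M1 w = u.
Proof.
(* E acts as [Lop] on the mean-zero functions and as the identity on the kernel of [Prm], so
   injectivity makes a square matrix invertible. *)
move=> zu su; pose E := Prm *m Lmat R M1 + 1%:M - Prm.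
have LP (f : 'rV[R]_M) : Lop M1 (f *m Prm) *m Prm = Lop M1 (f *m Prm).
  by apply: Prm_id; [apply: Lop_mz; exact: Prm_mz|exact: Lop_supp].
have EP (f : 'rV[R]_M) : f *m E *m Prm = Lop M1 (f *m Prm).
  rewrite /E mulmxBr mulmxDr mulmx1 mulmxBl mulmxDl mulmxA -/(Lop M1 (f *m Prm)) LP.
  by rewrite (Prm_id (Prm_mz f) (Prm_supp f)) addrK.
have Eu : E \in unitmx.
  rewrite -row_free_unit -kermx_eq0; apply/rowV0P => f /sub_kermxP fE.
  have h : f *m Prm = 0.
    by apply: Lop_inj; [exact: Prm_mz|exact: Prm_supp|rewrite -EP fE mul0mx].
  by move: fE; rewrite /E mulmxBr mulmxDr mulmx1 mulmxA h mul0mx add0r subr0.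
exists (u *m invmx E *m Prm); first exact: Prm_mz.
by rewrite -EP mulmxKV // Prm_id.
Qed.

(** Writing [uh c] as [Lop w], [Y1] keeps [qq c] within bounded distance of the mean of all [qq h],
    and that mean grows like log x. *)
Lemma qq_unbounded (c : 'I_M) : coprime c M -> ~ bnd (qq c).
Proof.
move=> cc bc; have [w zw Lw] := Lop_surj (uh_mz R M1 cc) (uh_supp R c).
have b1 := Y1 M1 zw (coprime1n M); rewrite Lw in b1.
have e x : Yo x (uh R c) 1 = qq c x - (Nu R Mp)^-1 * \sum_(h < M | coprime h M) qq h x.
  rewrite Yq (eq_bigr (fun h : 'I_M => qq h x * (h == c)%:R - (Nu R Mp)^-1 * qq h x)); last first.
    by move=> h ch; rewrite mul1n ev_uh // modn_small // inord_val; ring.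
  rewrite sumrB -mulr_sumr (bigD1 c) //= eqxx mulr1 big1 ?addr0 // => h /andP [_ /negPf ->]; by rewrite mulr0.
apply: lnn_not_bnd; have b2 : bnd (fun x => \sum_(h < M | coprime h M) qq h x).
  apply: (bnd_eq _ (bndZ (Nu R Mp) (bndB bc b1))) => x; rewrite e opprB addrC subrK mulrA mulfV ?mul1r //.
  exact: Nu_neq0.
by apply: (bnd_eq _ (bndB b2 units_log)) => x; ring.
Qed.
End Op3.

Section Dirichlet.
Variable R : realType.
Theorem dirichlet (M c N : nat) : (1 < M)%N -> coprime c M -> exists p, [/\ prime p, (N < p)%N & p = c %[mod M]].
Proof.
case: M => // Mp M1 cc; apply: contrapT => ne.
set c' : 'I_Mp.+1 := inord (c %% Mp.+1).
have cc' : coprime c' Mp.+1 by rewrite inordK ?ltn_pmod // coprime_modl.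
apply: (@qq_unbounded R Mp M1 c' cc'); exists (\sum_(1 <= p < N.+1) lnn R p + 2) => x x0.
rewrite ger0_norm ?qq_ge0 //; apply: le_trans (vonM_primes _ _ _) _; rewrite lerD2r.
have pN p : prime p && ((p %% Mp.+1)%N == c') -> (p <= N)%N.
  move=> /andP [pp /eqP pc]; rewrite leqNgt; apply/negP => Np; apply: ne; exists p; split => //.
  by rewrite pc inordK ?ltn_pmod.
apply: (@le_trans _ _ (\sum_(1 <= p < (maxn x N).+1 | prime p && ((p %% Mp.+1)%N == c')) lnn R p / p%:R)).
  rewrite [X in _ <= X](big_cat_nat (n := x.+1)) //=; last by rewrite ltnS leq_maxl.
  by rewrite lerDl; apply: sumr_ge0 => p _; rewrite divr_ge0 ?lnn_ge0.
rewrite (@sum_ltn _ N) ?leq_maxr // big_mkcond; apply: ler_sum_nat => p /andP [p0 _].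
case: ifP => _; last exact: lnn_ge0.
by rewrite ler_piMr ?lnn_ge0 // invf_le1 ?ltr0n // ler1n.
Qed.
End Dirichlet.
End DirichletTheorem.

(** * Selberg's sieve and the second moment of sums of Jacobi symbols *)

Module SecondMoment.
Import structures.
Import all_boot all_order all_algebra cyclic.
Import boolp reals exp.
Import zify ring lra.
Import ArithmeticFunctions Mertens LegendreSymbol QuadraticReciprocity JacobiSymbol.
Import Order.TTheory GRing.Theory Num.Theory.
Local Open Scope ring_scope.

Section Sieve.
Variable R : realType.

Lemma sqf_decomp n : (0 < n)%N -> exists r f, [/\ sqf r, (0 < f)%N & n = (r * f ^ 2)%N].
Proof.
elim/ltn_ind: n => n IH n0; case: (boolP (sqf n)) => sn.
  by exists n, 1%N; rewrite exp1n muln1.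
move: sn; rewrite /sqf n0 /= => /allPn [p]; rewrite mem_primes => /and3P [pp _ pn] lp.
have l1 : (0 < logn p n)%N by rewrite logn_gt0 mem_primes pp n0 pn.
have l2 : (2 <= logn p n)%N by move: l1 lp; case: (logn p n) => [|[|]].
have /dvdnP [m nE] : (p ^ 2 %| n)%N by rewrite pfactor_dvdn.
have m0 : (0 < m)%N by move: n0; rewrite nE muln_gt0 => /andP [].
have mn : (m < n)%N by rewrite nE -{1}(muln1 m) ltn_pmul2l // -(exp1n 2) ltn_exp2r // prime_gt1.
have [r [f [sr f0 mE]]] := IH m mn m0; exists r, (p * f)%N; split => //; first by rewrite muln_gt0 prime_gt0.
by rewrite nE mE expnMn; lia.
Qed.

Definition Lz z : R := \sum_(1 <= r < z.+1) ((mu r)%:~R ^+ 2) / (totient r)%:R.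

Lemma sum_inv_sq z : \sum_(1 <= f < z.+1) (f%:R ^- 2 : R) <= 2.
Proof.
case: z => [|z]; first by rewrite big_geq.
suff : \sum_(1 <= f < z.+2) (f%:R ^- 2 : R) <= 2 - z.+1%:R^-1.
  by move=> h; apply: le_trans h _; rewrite gerBl invr_ge0.
elim: z => [|z IH]; first by rewrite big_nat1 expr1n invr1; lra.
rewrite big_nat_recr //=; apply: le_trans (lerD IH (lexx _)) _.
have e : (z.+2%:R : R) = z.+1%:R + 1 by rewrite natr1.
have a0 : (0 : R) < z.+1%:R by rewrite ltr0n.
rewrite e; move: (z.+1%:R : R) a0 => a a0; rewrite -subr_ge0.
have -> : 2 - (a + 1)^-1 - (2 - a^-1 + (a + 1) ^- 2) = (a * (a + 1) ^+ 2)^-1.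
  by field; rewrite !lt0r_neq0 //; lra.
by rewrite invr_ge0 mulr_ge0 ?exprn_ge0 //; lra.
Qed.

Lemma harm_lower z : lnn R z.+1 <= \sum_(1 <= n < z.+1) (n%:R^-1 : R).
Proof.
elim: z => [|z IH]; first by rewrite lnn1 big_geq.
rewrite big_nat_recr //=; have /andP [_ h] := lnn_step R (ltn0Sn z).
by move: IH h; move: (\sum_(_ <= _ < _) _) (lnn R z.+1) (lnn R z.+2) (_^-1) => a b c d; lra.
Qed.

(** Each n is r f^2 with r squarefree, so the harmonic sum is at most the sum of 1/r <= 1/phi(r)
    times the sum of 1/f^2, which is at most 2. *)
Lemma Lz_lower z : lnn R z.+1 / 2 <= Lz z.
Proof.
rewrite ler_pdivrMr //; apply: le_trans (harm_lower z) _.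
pose A : R := \sum_(1 <= r < z.+1) (sqf r)%:R / r%:R.
have AL : A <= Lz z.
  apply: ler_sum_nat => r /andP [r0 _].
  have t0 : (0 : R) < (totient r)%:R by rewrite ltr0n totient_gt0.
  have m2 : (mu r)%:~R ^+ 2 = (sqf r)%:R :> R.
    case: (boolP (sqf r)) => s; first by rewrite expr2 -intrM mu_sq.
    by rewrite /mu (negPf s) expr0n.
  have rr0 : (0 : R) < r%:R by rewrite ltr0n.
  rewrite m2 ler_wpM2l // lef_pV2 ?posrE // ler_nat.
  rewrite -[X in (_ <= X)%N](sum_totient_dvd r) (bigD1 ord_max) //=; exact: leq_addr.
have A0 : 0 <= A by apply: sumr_ge0 => r _; rewrite divr_ge0.
apply: (@le_trans _ _ (A * \sum_(1 <= f < z.+1) (f%:R ^- 2 : R))); last first.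
  by apply: (@le_trans _ _ (A * 2)); [rewrite ler_wpM2l ?sum_inv_sq|rewrite ler_wpM2r].
apply: (@le_trans _ _ (\sum_(1 <= n < z.+1) \sum_(1 <= r < z.+1) \sum_(1 <= f < z.+1) (n == (r * f ^ 2)%N)%:R * ((sqf r)%:R / r%:R * f%:R ^- 2))).
  apply: ler_sum_nat => n /andP [n0 nz]; have [r [f [sr f0 nE]]] := sqf_decomp n0.
  have r0 : (0 < r)%N by move: sr => /andP [].
  have rz : (r < z.+1)%N by apply: leq_ltn_trans nz; rewrite nE leq_pmulr // expn_gt0 f0.
  have fz : (f < z.+1)%N.
    by apply: leq_ltn_trans nz; rewrite nE (leq_trans _ (leq_pmull _ r0)) // expnS leq_pmulr // expn1.
  have pos (a b : nat) : 0 <= (n == (a * b ^ 2)%N)%:R * ((sqf a)%:R / a%:R * b%:R ^- 2) :> R.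
    by rewrite !mulr_ge0 ?invr_ge0 ?exprn_ge0.
  rewrite (bigD1_seq r) ?mem_index_iota ?iota_uniq ?r0 //= (bigD1_seq f) ?mem_index_iota ?iota_uniq ?f0 //=.
  have -> : (n == (r * f ^ 2)%N)%:R * ((sqf r)%:R / r%:R * f%:R ^- 2) = n%:R^-1 :> R.
    by rewrite -nE eqxx sr !mul1r -invfM -natrX -natrM -nE.
  rewrite -addrA lerDl addr_ge0 //; first by apply: sumr_ge0 => a _; exact: pos.
  by apply: sumr_ge0 => a _; apply: sumr_ge0 => b _; exact: pos.
rewrite exchange_big_nat /= mulr_suml; apply: ler_sum_nat => r _.
rewrite exchange_big_nat /= mulr_sumr; apply: ler_sum_nat => f _.
rewrite -mulr_suml ler_piMl ?mulr_ge0 ?divr_ge0 ?invr_ge0 ?exprn_ge0 //.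
case: (boolP ((r * f ^ 2)%N \in index_iota 1 z.+1)) => h.
  by rewrite (bigD1_seq (r * f ^ 2)%N) ?iota_uniq //= eqxx big1 ?addr0 // => d /negPf ->.
by rewrite big1_seq ?ler01 // => d /= dI; case: eqP => // dE; move: dI; rewrite dE (negPf h).
Qed.

Section Weights.
Variable z : nat.
Hypothesis z0 : (0 < z)%N.
Local Notation L := (Lz z).
Lemma Lz_ge1 : 1 <= L.
Proof.
rewrite /Lz big_ltn // mu1 expr1n divr1 lerDl; apply: sumr_ge0 => r _.
by rewrite divr_ge0 // sqr_ge0.
Qed.
Lemma Lz_neq0 : L != 0. Proof. by rewrite lt0r_neq0 // (lt_le_trans ltr01 Lz_ge1). Qed.

(** Selberg's choice: in these variables the quadratic form of [lam_quad] is diagonal, and these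
    values minimise it under [lam 1] = 1. *)
Definition yr r : R := (mu r)%:~R / ((totient r)%:R * L).
Definition lam d : R := d%:R * \sum_(1 <= r < z.+1 | (d %| r)%N) (mu (r %/ d))%:~R * yr r.

Lemma lam1 : lam 1 = 1.
Proof.
rewrite /lam mul1r -[RHS](mulfV Lz_neq0) {1}/Lz mulr_suml big_mkcond; apply: eq_bigr => r _.
by rewrite dvd1n divn1 /yr invfM expr2; ring.
Qed.

Lemma lam_inv r : (0 < r)%N -> (r <= z)%N -> \sum_(1 <= d < z.+1 | (r %| d)%N) lam d / d%:R = yr r.
Proof.
move=> r0 rz.
transitivity (\sum_(1 <= d < z.+1) \sum_(1 <= s < z.+1) if (r %| d)%N && (d %| s)%N then (mu (s %/ d))%:~R * yr s else 0).
  rewrite big_mkcond; apply: eq_big_nat => d /andP [d0 _]; case: ifP => rd; last by rewrite big1.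
  rewrite /lam mulrC mulKf ?pnatr_eq0 -?lt0n // big_mkcond; by apply: eq_bigr.
rewrite exchange_big_nat /=.
transitivity (\sum_(1 <= s < z.+1) if s == r then yr s else 0); last first.
  by rewrite (bigD1_seq r) ?iota_uniq ?mem_index_iota ?r0 //= eqxx big1 ?addr0 // => s /negPf ->.
apply: eq_big_nat => s /andP [s0 sz].
case: (boolP (r %| s)%N) => rs; last first.
  rewrite big1 => [|d _]; first by case: eqP => // e; rewrite e dvdnn in rs.
  by case: ifP => // /andP [h1 h2]; rewrite (dvdn_trans h1 h2) in rs.
have sr0 : (0 < s %/ r)%N by rewrite divn_gt0 // dvdn_leq.
transitivity ((\sum_(1 <= e < (z %/ r).+1 | (e %| s %/ r)%N) (mu ((s %/ r) %/ e))%:~R) * yr s).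
  rewrite -big_mkcond /= big_mkcondr /= (sum_mult _ (fun d => if (d %| s)%N then (mu (s %/ d))%:~R * yr s else 0)) //.
  rewrite mulr_suml [RHS]big_mkcond; apply: eq_bigr => e _.
  have -> : (r * e %| s)%N = (e %| s %/ r)%N by rewrite dvdn_divRL // mulnC.
  by rewrite divnMA.
have srz : (s %/ r <= z %/ r)%N by apply: leq_div2r; lia.
rewrite (divisor_sum (fun e => (mu e)%:~R : R)) // -(rmorph_sum (intmul (1 : R))) mu_sum //=.
have -> : (s %/ r == 1)%N = (s == r) by rewrite [(_ %/ _ == _)%N]eq_sym eqn_div // mul1n eq_sym.
by case: eqP => _; rewrite ?mul1r ?mul0r.
Qed.

Lemma gcd_totient d e : (0 < d)%N -> (d <= z)%N -> (gcdn d e)%:R = \sum_(1 <= r < z.+1) (if (r %| d)%N && (r %| e)%N then (totient r)%:R else 0) :> R.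
Proof.
move=> d0 dz; have g0 : (0 < gcdn d e)%N by rewrite gcdn_gt0 d0.
have gz : (gcdn d e <= z)%N by apply: leq_trans dz; rewrite dvdn_leq // dvdn_gcdl.
rewrite -big_mkcond /= (@sum_ltn _ (gcdn d e) z) //; last by move=> r; rewrite -dvdn_gcd; exact: dvdn_leq.
rewrite -{1}(sum_totient_dvd (gcdn d e)) natr_sum.
rewrite -(big_mkord (fun r => r %| gcdn d e)%N (fun r => (totient r)%:R : R)) big_mkcond big_ltn //=.
rewrite dvd0n (gtn_eqF g0) add0r [RHS]big_mkcond; apply: eq_bigr => r _; by rewrite dvdn_gcd.
Qed.

(** Since 1/lcm(d, e) = gcd(d, e)/(d e) and the gcd is the sum of phi(r) over common divisors, the
    form is the sum of phi(r) [yr r]^2. *)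
Lemma lam_quad : \sum_(1 <= d < z.+1) \sum_(1 <= e < z.+1) lam d * lam e / (lcmn d e)%:R = L^-1.
Proof.
transitivity (\sum_(1 <= d < z.+1) \sum_(1 <= e < z.+1) \sum_(1 <= r < z.+1)
   (totient r)%:R * ((if (r %| d)%N then lam d / d%:R else 0) * (if (r %| e)%N then lam e / e%:R else 0))).
  apply: eq_big_nat => d /andP [d0 dz]; apply: eq_big_nat => e /andP [e0 ez].
  have -> : ((lcmn d e)%:R : R)^-1 = (gcdn d e)%:R / (d%:R * e%:R).
    have h : (lcmn d e * gcdn d e = d * e)%N by rewrite muln_lcm_gcd.
    have l0 : ((lcmn d e)%:R : R) != 0 by rewrite pnatr_eq0 -lt0n lcmn_gt0 d0.
    have de0 : (d%:R * e%:R : R) != 0 by rewrite mulf_neq0 // pnatr_eq0 -lt0n.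
    apply: (mulfI l0); rewrite mulfV // mulrA -[(lcmn d e)%:R * _]natrM h natrM mulfV //.
  rewrite (@gcd_totient d e) // mulr_suml mulr_sumr; apply: eq_bigr => r _.
  by case: (r %| d)%N; case: (r %| e)%N; rewrite /= ?invfM; ring.
rewrite (eq_bigr (fun d => \sum_(1 <= r < z.+1) \sum_(1 <= e < z.+1)
   (totient r)%:R * ((if (r %| d)%N then lam d / d%:R else 0) * (if (r %| e)%N then lam e / e%:R else 0)))); last first.
  by move=> d _; rewrite exchange_big_nat.
rewrite exchange_big_nat /=.
transitivity (\sum_(1 <= r < z.+1) (totient r)%:R * yr r ^+ 2).
  apply: eq_big_nat => r /andP [r0 rz]; rewrite expr2 -(lam_inv r0) // [in RHS]big_mkcond big_distrlr /= mulr_sumr.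
  by apply: eq_bigr => d _; rewrite mulr_sumr.
rewrite -[RHS](mulfK Lz_neq0) -[X in _ = L^-1 * X / L]/L {2}/Lz mulr_sumr mulr_suml; apply: eq_big_nat => r /andP [r0 _].
have t0 : ((totient r)%:R : R) != 0 by rewrite pnatr_eq0 -lt0n totient_gt0.
by rewrite /yr; field; rewrite t0 Lz_neq0.
Qed.

Lemma lam_bound d : (d <= z)%N -> `|lam d| <= z%:R ^+ 2.
Proof.
move=> dz; rewrite /lam normrM ger0_norm // expr2; apply: ler_pM => //; first by rewrite ler_nat.
apply: le_trans (ler_norm_sum _ _ _) _; apply: (@le_trans _ _ (\sum_(1 <= r < z.+1) 1)); last first.
  by rewrite sumr_const_nat subn1.
rewrite big_mkcond; apply: ler_sum_nat => r /andP [r0 _]; case: ifP => // _.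
have m1 k : `|(mu k)%:~R| <= 1 :> R by rewrite -intr_norm lerz1 mu_abs.
have t1 : (1 : R) <= (totient r)%:R * L.
  by rewrite -[X in X <= _]mulr1; apply: ler_pM => //; [rewrite ler1n totient_gt0|exact: Lz_ge1].
rewrite normrM -[X in _ <= X]mulr1; apply: ler_pM => //; rewrite /yr normrM -[X in _ <= X]mulr1; apply: ler_pM => //.
by rewrite ger0_norm ?invr_ge0 ?(le_trans ler01 t1) // invf_le1 // (lt_le_trans ltr01 t1).
Qed.

Definition Wt k : R := (\sum_(1 <= d < z.+1 | (d %| k)%N) lam d) ^+ 2.
Lemma Wt_ge0 k : 0 <= Wt k. Proof. exact: sqr_ge0. Qed.
Lemma Wt_prime Q : prime Q -> (z < Q)%N -> Wt Q = 1.
Proof.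
move=> pQ zQ; rewrite /Wt big_ltn_cond // dvd1n lam1 big1_seq ?addr0 ?expr1n // => d /andP [dQ].
rewrite mem_index_iota => /andP [d2 dz]; exfalso.
by have /primeP [_ /(_ d dQ)] := pQ => /orP [/eqP h|/eqP h]; [rewrite h in d2|rewrite h in dz; lia].
Qed.

Lemma Wt_sum (g : nat -> R) X : (forall a b, g (a * b)%N = g a * g b) ->
  \sum_(1 <= k < X.+1) Wt k * g k =
  \sum_(1 <= d < z.+1) \sum_(1 <= e < z.+1) lam d * lam e * (g (lcmn d e) * \sum_(1 <= j < (X %/ lcmn d e).+1) g j).
Proof.
move=> gM.
transitivity (\sum_(1 <= k < X.+1) \sum_(1 <= d < z.+1) \sum_(1 <= e < z.+1) if (lcmn d e %| k)%N then lam d * lam e * g k else 0).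
  apply: eq_bigr => k _; rewrite /Wt expr2 [in LHS]big_mkcond big_distrlr /= mulr_suml; apply: eq_bigr => d _.
  rewrite mulr_suml; apply: eq_bigr => e _; rewrite dvdn_lcm.
  by case: ifP => _; case: ifP => _; rewrite /= ?(mul0r, mulr0).
rewrite exchange_big_nat /=; apply: eq_big_nat => d /andP [d0 _]; rewrite exchange_big_nat /=.
apply: eq_big_nat => e /andP [e0 _]; rewrite -big_mkcond /= sum_mult ?lcmn_gt0 ?d0 // !mulr_sumr.
by apply: eq_bigr => j _; rewrite gM.
Qed.

Lemma lam_err (E : nat -> nat -> R) (B : R) : 0 <= B -> (forall d e, (0 < d)%N -> (0 < e)%N -> `|E d e| <= B) ->
  `|\sum_(1 <= d < z.+1) \sum_(1 <= e < z.+1) lam d * lam e * E d e| <= z%:R ^+ 6 * B.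
Proof.
move=> B0 hE.
have -> : z%:R ^+ 6 * B = \sum_(1 <= d < z.+1) \sum_(1 <= e < z.+1) (z%:R ^+ 2 * z%:R ^+ 2 * B).
  by rewrite !sumr_const_nat subn1 /= -mulrnA -[RHS]mulr_natl natrM; ring.
apply: le_trans (ler_norm_sum _ _ _) _; apply: ler_sum_nat => d /andP [d0 dz].
apply: le_trans (ler_norm_sum _ _ _) _; apply: ler_sum_nat => e /andP [e0 ez].
rewrite normrM; apply: ler_pM; rewrite ?normr_ge0 ?hE // normrM.
by apply: ler_pM; rewrite ?normr_ge0 ?lam_bound.
Qed.

Lemma Wt_total X : \sum_(1 <= k < X.+1) Wt k <= X%:R / L + z%:R ^+ 6.
Proof.
rewrite (eq_bigr (fun k => Wt k * 1)); last by move=> k _; rewrite mulr1.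
rewrite (@Wt_sum (fun=> 1)) => [|a b]; last by rewrite mulr1.
rewrite (eq_big_nat _ _ (F2 := fun d => X%:R * (\sum_(1 <= e < z.+1) lam d * lam e / (lcmn d e)%:R) +
   \sum_(1 <= e < z.+1) lam d * lam e * ((X %/ lcmn d e)%:R - X%:R / (lcmn d e)%:R))); last first.
  move=> d _; rewrite mulr_sumr -big_split /=; apply: eq_bigr => e _.
  by rewrite sumr_const_nat subn1 /= mul1r; ring.
rewrite big_split /= -mulr_sumr lam_quad lerD2l; apply: le_trans (ler_norm _) _.
rewrite -[X in _ <= X]mulr1; apply: lam_err => // d e d0 e0.
have l0 : (0 < lcmn d e)%N by rewrite lcmn_gt0 d0.
have /andP [h1 h2] := floor_bounds R X l0; rewrite ler_norml; apply/andP; split; lra.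
Qed.

(** The symbol has period n and, as n is not a square, sum 0 over a period; so every inner sum is at
    most 2n. *)
Lemma Wt_jac n X : odd n -> (forall k, n <> (k ^ 2)%N) ->
  `|\sum_(1 <= k < X.+1) Wt k * (jac n k)%:~R| <= z%:R ^+ 6 * (2 * n%:R).
Proof.
move=> on nsq; have n0 : (0 < n)%N by case: (n) on.
rewrite Wt_sum => [|a b]; last by rewrite jacM // intrM.
apply: lam_err => [|d e d0 e0]; first by rewrite mulr_ge0.
have ja k : `|(jac n k)%:~R| <= 1 :> R by rewrite -intr_norm lerz1 jac_abs.
rewrite normrM -[X in _ <= X]mul1r; apply: ler_pM => //.
rewrite -[n%:R]mulr1; apply: (@per_sum R (fun k => (jac n k)%:~R)) => //.
- by move=> k; congr (_%:~R); apply: jac_mod; rewrite modnDr.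
- by rewrite -(rmorph_sum (intmul (1 : R))) jac_sum0.
Qed.
End Weights.

Definition ppi (X : nat) : R := \sum_(1 <= p < X.+1 | prime p) 1.

Lemma cheb_ppi X : (0 < X)%N -> cheb R X <= ppi X * lnn R X.
Proof.
move=> X0; rewrite /cheb /ppi mulr_suml.
apply: (@le_trans _ _ (\sum_(1 <= d < X.+1) \sum_(1 <= p < X.+1 | prime p) \sum_(1 <= k < X.+1) (d == (p ^ k)%N)%:R * lnn R p)).
  apply: ler_sum_nat => d /andP [d0 dX].
  have pos (p k : nat) : 0 <= (d == (p ^ k)%N)%:R * lnn R p :> R by rewrite mulr_ge0 ?lnn_ge0.
  case: (eqVneq (vonM R d) 0) => [->|/vonM_neq0 [p [k [pp k0 dE]]]].
    by apply: sumr_ge0 => p _; apply: sumr_ge0 => k _; exact: pos.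
  have pX : (p < X.+1)%N by apply: leq_ltn_trans dX; rewrite dE -{1}(expn1 p) leq_exp2l ?prime_gt1.
  have kX : (k < X.+1)%N by apply: leq_ltn_trans dX; rewrite dE ltnW // ltn_expl // prime_gt1.
  rewrite big_mkcond (bigD1_seq p) ?mem_index_iota ?iota_uniq ?prime_gt0 //= pp (bigD1_seq k) ?mem_index_iota ?iota_uniq ?k0 //=.
  rewrite {1 2}dE eqxx mul1r vonM_pk // -addrA lerDl addr_ge0 //; first by apply: sumr_ge0 => j _; exact: pos.
  by apply: sumr_ge0 => q _; case: ifP => // _; apply: sumr_ge0 => j _; exact: pos.
rewrite exchange_big_nat /= big_nat_cond [X in _ <= X]big_nat_cond; apply: ler_sum => p /andP [/andP [p0 pX] pp].
rewrite exchange_big_nat /= mul1r; have p1 := prime_gt1 pp; set T := trunc_log p X.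
apply: (@le_trans _ _ (\sum_(1 <= k < X.+1) if (k <= T)%N then lnn R p else 0)).
  apply: ler_sum_nat => k _; rewrite -mulr_suml.
  case: (boolP ((p ^ k)%N \in index_iota 1 X.+1)) => h.
    have -> : (k <= T)%N by apply: trunc_log_max => //; move: h; rewrite mem_index_iota => /andP [].
    by rewrite (bigD1_seq (p ^ k)%N) ?iota_uniq //= eqxx big1 ?addr0 ?mul1r // => d /negPf ->.
  rewrite big1_seq ?mul0r => [|d /= dI]; first by case: ifP => _ //; exact: lnn_ge0.
  by case: eqP => // dE; move: dI; rewrite dE (negPf h).
have lT j : lnn R (p ^ j) = j%:R * lnn R p.
  elim: j => [|j IH]; first by rewrite expn0 lnn1 mul0r.
  by rewrite expnS lnnM ?expn_gt0 ?prime_gt0 // IH -natr1; ring.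
have TX : (T <= X)%N by apply: leq_trans (ltnW (ltn_expl T p1)) (trunc_logP p1 X0).
rewrite -big_mkcond /= (@sum_ltn _ T X) //.
apply: (@le_trans _ _ (\sum_(1 <= k < T.+1) lnn R p)).
  by rewrite big_mkcond; apply: ler_sum_nat => k _; case: ifP => // _; exact: lnn_ge0.
rewrite sumr_const_nat subn1 /= -mulr_natl -lT; apply: lnn_le; first by rewrite expn_gt0 prime_gt0.
exact: trunc_logP.
Qed.

(** Chebyshev's lower bound: log (2n)! - 2 log n! is at least n log 2 and at most [cheb], since
    floor(2n/d) - 2 floor(n/d) <= 1. *)
Lemma ppi_lower X : (4 <= X)%N -> X%:R <= 8 * (ppi X * lnn R X).
Proof.
move=> X4; set n := X./2; have n0 : (0 < n)%N by rewrite /n; lia.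
have h2 : n%:R * lnn R 2 <= cheb R n.*2.
  have A2 := sum_vonM R n.*2; have A1 := sum_vonM R n.
  apply: (@le_trans _ _ (\sum_(1 <= d < n.*2.+1) lnn R d - 2 * \sum_(1 <= d < n.+1) lnn R d)).
    rewrite [X in _ <= X - _](big_cat_nat (n := n.+1)) //=; last by lia.
    have -> : \sum_(n.+1 <= d < n.*2.+1) lnn R d = \sum_(1 <= d < n.+1) lnn R (d + n).
      by rewrite -[in LHS]add1n -addnn -addSn big_addn addnK.
    have : \sum_(1 <= d < n.+1) (lnn R 2 + lnn R d) <= \sum_(1 <= d < n.+1) lnn R (d + n).
      apply: ler_sum_nat => d /andP [d0 dn]; rewrite -lnnM //; apply: lnn_le; lia.
    rewrite big_split /= sumr_const_nat subn1 /= -[lnn R 2 *+ n]mulr_natl.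
    by move: (\sum_(1 <= d < n.+1) lnn R (d + n)) (\sum_(1 <= d < n.+1) lnn R d) (n%:R * lnn R 2) => a b c; lra.
  rewrite A1 A2 /cheb.
  have -> : \sum_(1 <= d < n.+1) vonM R d * (n %/ d)%:R = \sum_(1 <= d < n.*2.+1) vonM R d * (n %/ d)%:R.
    rewrite [RHS](big_cat_nat (n := n.+1)) //=; last by lia.
    rewrite [X in _ = _ + X]big_nat [X in _ = _ + X]big1 ?addr0 // => d /andP [md _].
    by rewrite divn_small ?mulr0.
  rewrite mulr_sumr -sumrB; apply: ler_sum_nat => d /andP [d0 _].
  have -> : vonM R d * (n.*2 %/ d)%:R - 2 * (vonM R d * (n %/ d)%:R) = vonM R d * ((n.*2 %/ d)%:R - 2 * (n %/ d)%:R) by ring.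
  rewrite ler_piMr ?vonM_ge0 // lerBlDr -natrM addrC natr1 ler_nat -ltnS ltn_divLR //.
  have := ltn_ceil n d0; nia.
have l2 : 2^-1 <= lnn R 2 by have /andP [] := lnn_step R (isT : 0 < 1)%N; rewrite lnn1 subr0.
have ch : cheb R n.*2 <= cheb R X.
  rewrite /cheb [X in _ <= X](big_cat_nat (n := n.*2.+1)) //=; last by rewrite /n; lia.
  by rewrite lerDl; apply: sumr_ge0 => d _; exact: vonM_ge0.
have := cheb_ppi (leq_trans (isT : 0 < 4)%N X4).
have Xn : (X%:R : R) <= 4 * n%:R by rewrite -natrM ler_nat /n; lia.
have : n%:R * 2^-1 <= n%:R * lnn R 2 by rewrite ler_wpM2l.
move: h2 ch Xn; move: (X%:R : R) (n%:R : R) (cheb R n.*2) (cheb R X) (ppi X * _) (n%:R * lnn R 2) => a b c d e f; lra.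
Qed.

(** The square is opened under the sieve weights. Pairs i <> j have nonsquare product and leave only
    errors of size z^6; each pair i = i gives at most X / L plus such an error. *)
Lemma second_moment (I : finType) (nn : I -> nat) : (0 < #|I|)%N -> (forall i, odd (nn i)) ->
  (forall i j, i != j -> forall k, (nn i * nn j)%N <> (k ^ 2)%N) ->
  exists N0, forall X, (N0 <= X)%N ->
   \sum_(1 <= Q < X.+1 | prime Q) (\sum_i (jac (nn i) Q)%:~R) ^+ 2 <= 200 * #|I|%:R * ppi X.
Proof.
move=> I0 nodd nsq; set r := #|I|; set D := (\max_i nn i)%N.
have n0 i : (0 < nn i)%N by case: (nn i) (nodd i).
have nD i : (nn i <= D)%N by exact: leq_bigmax.
(* The coefficients of z^6 in the error: r from the diagonal, 2 r^2 D^2 from the character sums, r^2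
   from the primes up to z. The threshold on X forces z > 16 E for the largest z with z^8 <= X,
   whence E z^6 log X <= 16 E z^7 <= z^8 <= X. *)
pose E := (r + r * r * (2 * D * D) + r * r)%N.
exists ((16 * E).+2 ^ 8)%N => X X0.
pose z := \max_(z < X.+1 | (z ^ 8 <= X)%N) (z : nat).
have zP : (z ^ 8 <= X)%N /\ (X < z.+1 ^ 8)%N.
  split.
    have [] := @eq_bigmax_cond _ [pred i : 'I_X.+1 | (i ^ 8 <= X)%N] (fun i : 'I_X.+1 => i : nat).
      by apply/card_gt0P; exists ord0; rewrite inE /=.
    by rewrite -/z => i hi ->; move: hi; rewrite inE.
  rewrite ltnNge; apply/negP => h.
  have zX : (z.+1 < X.+1)%N by rewrite ltnS (leq_trans _ h) // -{1}(expn1 z.+1) leq_pexp2l.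
  have := @leq_bigmax_cond _ [pred i : 'I_X.+1 | (i ^ 8 <= X)%N] (fun i : 'I_X.+1 => i : nat) (Ordinal zX) h.
  by rewrite -/z ltnn.
have [z8 zX] := zP.
have zE : (16 * E < z)%N.
  rewrite ltnNge; apply/negP => h; have : (z.+1 ^ 8 <= X)%N by apply: leq_trans X0; rewrite leq_exp2r // ltnS (leq_trans h) ?leqnSn.
  by rewrite leqNgt zX.
have z0 : (0 < z)%N by lia.
have Xp : (0 < X)%N by rewrite (leq_trans _ z8) // expn_gt0 z0.
have zX' : (z <= X)%N by rewrite (leq_trans _ z8) // -{1}(expn1 z) leq_pexp2l.
pose S k : R := \sum_i (jac (nn i) k)%:~R.
have ja i k : `|(jac (nn i) k)%:~R| <= 1 :> R by rewrite -intr_norm lerz1 jac_abs.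
have Sb k : S k ^+ 2 <= r%:R ^+ 2.
  have : `|S k| <= r%:R.
    apply: le_trans (ler_norm_sum _ _ _) _; apply: (@le_trans _ _ (\sum_(i : I) 1)); first by apply: ler_sum => i _; exact: ja.
    by rewrite sumr_const.
  by move=> h; rewrite -(real_normK (num_real _)) lerXn2r ?nnegrE.
have step1 : \sum_(1 <= Q < X.+1 | prime Q) S Q ^+ 2 <= z%:R * r%:R ^+ 2 + \sum_(1 <= k < X.+1) Wt z k * S k ^+ 2.
  have -> : z%:R * r%:R ^+ 2 = \sum_(1 <= k < X.+1) (if (k <= z)%N then r%:R ^+ 2 else 0) :> R.
    rewrite -big_mkcond /= (@sum_ltn _ z X) // big_nat_cond (eq_bigl (fun e => (1 <= e < z.+1)%N && true)); last by move=> e; rewrite ltnS andbT -andbA andbb.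
    by rewrite -big_nat_cond sumr_const_nat subn1 /= mulr_natl.
  rewrite big_mkcond -big_split /=; apply: ler_sum_nat => Q _.
  have W0 : 0 <= Wt z Q * S Q ^+ 2 by rewrite mulr_ge0 ?Wt_ge0 ?sqr_ge0.
  case: ifP => pQ; last by rewrite addr_ge0 //; case: ifP => // _; exact: sqr_ge0.
  case: leqP => zQ; first by rewrite -[X in X <= _]addr0 lerD.
  by rewrite Wt_prime // mul1r add0r.
have step2 : \sum_(1 <= k < X.+1) Wt z k * S k ^+ 2 = \sum_i \sum_j \sum_(1 <= k < X.+1) Wt z k * (jac (nn i * nn j) k)%:~R.
  rewrite (eq_bigr (fun i => \sum_(1 <= k < X.+1) \sum_j Wt z k * (jac (nn i * nn j) k)%:~R)); last by move=> i _; rewrite exchange_big.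
  rewrite exchange_big /=; apply: eq_bigr => k _; rewrite expr2 /S big_distrlr /= mulr_sumr; apply: eq_bigr => i _.
  by rewrite mulr_sumr; apply: eq_bigr => j _; rewrite jac_muln // intrM.
have step3 i j : \sum_(1 <= k < X.+1) Wt z k * (jac (nn i * nn j) k)%:~R <=
   (if i == j then X%:R / Lz z + z%:R ^+ 6 else 0) + z%:R ^+ 6 * (2 * (D * D)%:R).
  have p0 : (0 : R) <= z%:R ^+ 6 * (2 * (D * D)%:R) by rewrite !mulr_ge0 ?exprn_ge0.
  case: (eqVneq i j) => [<-|ij]; last first.
    rewrite add0r; apply: le_trans (ler_norm _) _.
    apply: le_trans (Wt_jac z0 X _ (nsq i j ij)) _; first by rewrite oddM !nodd.
    by rewrite ler_wpM2l ?exprn_ge0 // ler_wpM2l // ler_nat leq_mul.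
  rewrite -[X in X <= _]addr0; apply: lerD => //; apply: le_trans (Wt_total z0 X).
  apply: ler_sum => k _; rewrite ler_piMr ?Wt_ge0 //; apply: le_trans (ler_norm _) _.
  by rewrite -intr_norm lerz1 jac_abs // muln_gt0 n0.
have step4 : \sum_(1 <= k < X.+1) Wt z k * S k ^+ 2 <= r%:R * (X%:R / Lz z + z%:R ^+ 6) + r%:R * r%:R * (z%:R ^+ 6 * (2 * (D * D)%:R)).
  rewrite step2; apply: (@le_trans _ _ (\sum_i \sum_j ((if i == j then X%:R / Lz z + z%:R ^+ 6 else 0) + z%:R ^+ 6 * (2 * (D * D)%:R)))).
    by apply: ler_sum => i _; apply: ler_sum => j _; exact: step3.
  rewrite (eq_bigr (fun i => (X%:R / Lz z + z%:R ^+ 6) + r%:R * (z%:R ^+ 6 * (2 * (D * D)%:R)))); last first.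
    move=> i _; rewrite big_split /= sumr_const; congr (_ + _); last by rewrite [RHS]mulr_natl.
    by rewrite (bigD1 i) //= eqxx big1 ?addr0 // => j; rewrite eq_sym => /negPf ->.
  by rewrite sumr_const -[X in X <= _]mulr_natl mulrDr -[r%:R * r%:R * _]mulrA; exact: lexx.
have lX : lnn R X <= 8 * lnn R z.+1.
  apply: (@le_trans _ _ (lnn R (z.+1 ^ 8))); first by apply: lnn_le => //; exact: ltnW.
  have lT j : lnn R (z.+1 ^ j) = j%:R * lnn R z.+1.
    elim: j => [|j IH]; first by rewrite expn0 lnn1 mul0r.
    by rewrite expnS lnnM ?expn_gt0 // IH -natr1; ring.
  by rewrite lT.
have X4 : (4 <= X)%N.
  by rewrite (leq_trans _ X0) // (leq_trans (_ : 4 <= 2 ^ 8)%N) // leq_exp2r //; lia.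
have pl := ppi_lower X4.
have lX0 : 0 < lnn R X.
  have l2 : 2^-1 <= lnn R 2 by have /andP [] := lnn_step R (isT : 0 < 1)%N; rewrite lnn1 subr0.
  have : lnn R 2 <= lnn R X by apply: lnn_le => //; lia.
  lra.
have pp : X%:R / lnn R X <= 8 * ppi X by rewrite ler_pdivrMr // -mulrA.
have Lb : X%:R / Lz z <= 16 * (X%:R / lnn R X).
  have L1 := Lz_lower z; have Lp : 0 < Lz z by rewrite (lt_le_trans ltr01) // Lz_ge1.
  rewrite mulrCA ler_wpM2l // -[X in X <= _]mul1r ler_pdivrMr // mulrAC ler_pdivlMr // mul1r.
  move: L1 lX; move: (lnn R z.+1) (lnn R X) (Lz z) => a b c; lra.
have zb : E%:R * z%:R ^+ 6 <= X%:R / lnn R X.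
  rewrite ler_pdivlMr //.
  have l16 : lnn R X <= 16 * z%:R.
    apply: le_trans lX _; have h := lnn_leq R z.+1; rewrite -natr1 in h.
    have z1 : (1 : R) <= z%:R by rewrite ler1n.
    lra.
  apply: (@le_trans _ _ (E%:R * z%:R ^+ 6 * (16 * z%:R))); first by rewrite ler_wpM2l // mulr_ge0 // exprn_ge0.
  apply: (@le_trans _ _ (z%:R ^+ 8)); last by rewrite -natrX ler_nat.
  have -> : E%:R * z%:R ^+ 6 * (16 * z%:R) = (16 * E)%:R * z%:R ^+ 7 :> R by rewrite natrM; ring.
  by rewrite [z%:R ^+ 8]exprS ler_wpM2r ?exprn_ge0 // ler_nat ltnW.
have z6 : z%:R <= z%:R ^+ 6 :> R by rewrite exprS ler_peMr // exprn_ege1 // ler1n.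
have ppi0 : 0 <= ppi X by apply: sumr_ge0.
have r1 : (1 : R) <= r%:R by rewrite ler1n.
have EE : (E%:R : R) = r%:R + r%:R * r%:R * (2 * (D * D)%:R) + r%:R ^+ 2.
  by rewrite /E !natrD !natrM; ring.
apply: le_trans step1 _; apply: le_trans (lerD (lexx _) step4) _.
apply: (@le_trans _ _ (r%:R * (16 * (X%:R / lnn R X)) + E%:R * z%:R ^+ 6)).
  have hA : r%:R * (X%:R / Lz z) <= r%:R * (16 * (X%:R / lnn R X)) by rewrite ler_wpM2l.
  have hB : z%:R * r%:R ^+ 2 <= z%:R ^+ 6 * r%:R ^+ 2 :> R by rewrite ler_wpM2r // sqr_ge0.
  rewrite EE; move: hA hB; move: (X%:R / Lz z) (X%:R / lnn R X) (z%:R ^+ 6 : R) (z%:R : R) (r%:R : R) ((D * D)%:R : R) => a b c d e f; lra.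
have : r%:R * (16 * (X%:R / lnn R X)) <= r%:R * (16 * (8 * ppi X)) by rewrite ler_wpM2l // ler_wpM2l.
have : ppi X <= r%:R * ppi X by rewrite ler_peMl.
move: zb pp ppi0; move: (E%:R * _) (X%:R / lnn R X) (ppi X) (r%:R : R) => a b c d h1 h2 h0 h3 h4.
(* The diagonal accounts for 16 * 8 = 128; the remaining 72 covers the error, at most 8 [ppi X]. *)
have -> : 200 * d * c = d * (16 * (8 * c)) + 72 * (d * c) by ring.
lra.
Qed.
End Sieve.
End SecondMoment.

(** * The coefficients a(n), and the residue class on which Q in S makes them vanish *)

Module PartitionCoefficients.
Import structures.
Import all_boot all_order all_algebra all_fingroup all_solvable all_field.
Import boolp.
Import zify ring lra.
Import Defs.
Import FormalSeries WeightedSeries ThetaFunctions EtaFunction LegendrePolynomial ThetaDerivatives PartitionTheta LatticeSums LegendreSymbol QuadraticReciprocity Reduction Neighbours HeckeRelation.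
Import Order.TTheory GRing.Theory Num.Theory.
Local Open Scope ring_scope.

Lemma coprime24 p : prime p -> (5 <= p)%N -> coprime p 24.
Proof.
move=> pp p5; rewrite (_ : 24 = 2 ^ 3 * 3)%N // coprimeMr coprimeXr; last by rewrite prime_coprime // dvdn_prime2 //; lia.
by rewrite prime_coprime // dvdn_prime2 //; lia.
Qed.

Section Coef.
Variables (l : nat) (delta : int).
Hypotheses (l_pr : prime l) (l_ge5 : (5 <= l)%N) (dP : delta = 0 \/ delta = -1).
Local Notation F := 'F_l.

Lemma l_odd5 : odd l.
Proof. by case: (even_prime l_pr) => // h; move: l_ge5; rewrite h. Qed.

Lemma legendreE (z : int) : legendre z l = leg (z%:~R : F).
Proof.
have d0 : (l%:Z %| z)%Z = (z%:~R == 0 :> F) by rewrite (pint_eq0 l_pr) dvdzE.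
have cl : (Zp_trunc (pdiv l)).+2 = l by rewrite -[RHS](card_Fp l_pr) card_ord.
rewrite /legendre /leg d0; case: ifP => // _; congr (if _ then _ else _).
apply/existsP/existsP => [[x]|[y /eqP yz]].
  move=> h; exists ((x : nat)%:R); rewrite -subr_eq0.
  have -> : ((x : nat)%:R : F) ^+ 2 - z%:~R = (Posz x * Posz x - z)%:~R by rewrite rmorphB rmorphM /= -!pmulrn expr2.
  by rewrite (pint_eq0 l_pr); move: h; rewrite dvdzE.
have yl : (val y < l)%N by rewrite -[X in (_ < X)%N]cl ltn_ord.
exists (Ordinal yl) => /=; rewrite dvdzE -(pint_eq0 l_pr) rmorphB rmorphM /= -!pmulrn -yz natr_Zp expr2 subrr //.
Qed.

Lemma coef_exists : exists a : nat -> F,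
  (forall n, (a n != 0) = (legendre (- n%:Z) l == delta) && ~~ (l %| p_div24 n)%N) /\
  exists (Y : finType) (tau : nat -> Y),
  (forall m n1 n2, prime m -> (5 <= m)%N -> m != l -> ~~ (m %| n1)%N -> ~~ (m %| n2)%N -> tau n1 = tau n2 ->
    a n1 != 0 -> a (m ^ 2 * n1)%N = a (m ^ 2 * n2)%N -> leg (n1%:R : 'F_m) = leg (n2%:R : 'F_m)).
Proof.
have lo := l_odd5.
have two0 : (2%:R : F) != 0 by exact: two_neq0.
have [h hh] : exists h : {poly F}, forall n, (legendre (- n%:Z) l == delta)%:R * (p_div24 n)%:R = theta_comb h n :> F.
  have eN (n : nat) : (- n%:Z)%:~R = - (n%:R) :> F by rewrite rmorphN /= -pmulrn.
  case: dP => ->.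
    have [h hh] := theta_rep0 l_pr l_ge5; exists h => n; rewrite -hh legendreE leg_eq0 eN oppr_eq0.
    case: (eqVneq (n%:R : F) 0) => [->|n0]; last by rewrite Fp_fermat // subrr.
    rewrite expr0n (_ : l.-1 == 0%N = false) ?subr0 //; by apply/eqP; have := l_ge5; lia.
  have [h hh] := theta_rep1 l_pr l_ge5; exists h => n; rewrite -hh legendreE eN; congr (_ * _).
  rewrite -(euler_criterion l_pr lo).
  case: (eqVneq (n%:R : F) 0) => [->|n0].
    rewrite oppr0 leg0 expr0n (_ : l.-1 == 0%N = false) ?subrr ?mulr0 //; by apply/eqP; have := l_ge5; lia.
  have n0' : - (n%:R : F) != 0 by rewrite oppr_eq0.
  rewrite Fp_fermat //; case: (leg_vals n0') => -> /=; first by rewrite subrr mulr0.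
  by rewrite mulrN1z opprK -[1 + 1]/(2%:R) mulVf.
have [r [k [Psi [ro r2 k13 [Pper Psgn Pws]]]]] := lattice_rep l_pr l_ge5 h.
exists (fun n => theta_comb h n); split.
  move=> n; rewrite -hh mulf_eq0 negb_or; congr (_ && _); last by rewrite (pnat_eq0 l_pr).
  by case: (_ == delta); rewrite ?oner_eq0 ?eqxx.
have [Y [tau [_ t]]] := hecke_type k13 ro l_pr lo Pper Psgn.
exists Y, tau => m n1 n2; rewrite !Pws; exact: t.
Qed.

(** The class is t = 24 beta - 1: if n = 24 M - 1 is congruent to t modulo l Q, then M is congruent
    to beta because 24 is invertible, and -t = 1 - 24 beta has symbol [delta]. *)
Lemma in_S_vanish (a : nat -> F) :
  (forall n, (a n != 0) = (legendre (- n%:Z) l == delta) && ~~ (l %| p_div24 n)%N) ->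
  forall Q, in_S l delta Q -> [/\ prime Q, (5 <= Q)%N, Q <> l &
  exists2 t : nat, leg (- (t%:R) : F) = delta & forall n : nat, n = t %[mod l * Q] -> a n = 0].
Proof.
move=> aE Q [pQ Q5 Ql [beta [lb hb]]]; split=> //.
have lQ0 : (l * Q)%N%:Z != 0 by rewrite PoszM mulf_neq0 //; have := prime_gt0 l_pr; have := prime_gt0 pQ; lia.
pose t := absz ((24 * beta - 1) %% (l * Q)%N%:Z)%Z.
have tE : t%:Z = ((24 * beta - 1) %% (l * Q)%N%:Z)%Z by rewrite /t gez0_abs // modz_ge0.
have tb : ((l * Q)%N%:Z %| 24 * beta - 1 - t%:Z)%Z by rewrite tE -eqz_mod_dvd modz_mod.
exists t.
  rewrite -lb legendreE; congr leg; apply/eqP; rewrite -subr_eq0.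
  have -> : - (t%:R : F) - (1 - 24 * beta)%:~R = (24 * beta - 1 - t%:Z)%:~R by rewrite !rmorphB /= -!pmulrn; ring.
  rewrite (pint_eq0 l_pr); move: tb; rewrite dvdzE /=; apply: dvdn_trans; exact: dvdn_mulr.
move=> n nt; apply/eqP/negPn; rewrite aE negb_and negbK; apply/orP; right.
rewrite /p_div24; case: ifP => // /dvdnP [M nM]; rewrite nM mulnK //.
have dM : ((l * Q)%N%:Z %| M%:Z - beta)%Z.
  have c24 : coprimez (l * Q)%N%:Z 24.
    have c : coprime (l * Q) 24 by rewrite coprimeMl !coprime24.
    by rewrite coprimezE; exact: c.
  have : ((l * Q)%N%:Z %| 24 * (M%:Z - beta))%Z.
    have -> : 24 * (M%:Z - beta) = (n%:Z - t%:Z) - (24 * beta - 1 - t%:Z) by have -> : n%:Z = M%:Z * 24 - 1; [move: nM; clear; lia|ring].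
    rewrite rpredB //; rewrite -eqz_mod_dvd; apply/eqP; rewrite !modz_nat nt //.
  by rewrite Gauss_dvdzr.
have [c hc] := dvdzP dM.
have := hb c; have -> : Posz l * Posz Q * c + beta = M by rewrite -PoszM mulrC -hc subrK.
by [].
Qed.
End Coef.
End PartitionCoefficients.

(** * Sparse support, or density zero of S *)

Module Dichotomy.
Import structures.
Import all_boot all_order all_algebra all_fingroup all_solvable all_field.
Import boolp reals.
Import zify ring lra.
Import LegendreSymbol QuadraticReciprocity JacobiSymbol ArithmeticFunctions Mertens ResidueOperator DirichletTheorem SecondMoment.
Import Order.TTheory GRing.Theory Num.Theory.
Local Open Scope ring_scope.

Lemma crt m1 m2 c1 c2 : coprime m1 m2 -> coprime c1 m1 -> coprime c2 m2 ->
  exists c, [/\ coprime c (m1 * m2), c = c1 %[mod m1] & c = c2 %[mod m2]].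
Proof.
move=> c12 h1 h2; exists (chinese m1 m2 c1 c2).
have e1 := chinese_modl c12 c1 c2; have e2 := chinese_modr c12 c1 c2.
by split=> //; rewrite coprimeMr -(coprime_modl _ m1) e1 coprime_modl h1 -(coprime_modl _ m2) e2 coprime_modl.
Qed.
Lemma crt_eq m1 m2 a b : coprime m1 m2 -> a = b %[mod m1] -> a = b %[mod m2] -> a = b %[mod m1 * m2].
Proof. by move=> c h1 h2; apply/eqP; rewrite chinese_remainder // h1 h2 !eqxx. Qed.
Lemma mod_dvd d m a b : (d %| m)%N -> a = b %[mod m] -> a = b %[mod d].
Proof. by move=> dm h; rewrite -(modn_dvdm a dm) h modn_dvdm. Qed.

Lemma congr_mull d x y z : x = y %[mod d] -> (z * x = z * y %[mod d])%N.
Proof. by move=> h; rewrite -modnMmr h modnMmr. Qed.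

Lemma sqrt_class p x t : prime p -> odd p -> ~~ (p %| x)%N -> legn p x = legn p t ->
  exists2 c, coprime c p & (c ^ 2 * x)%N = t %[mod p].
Proof.
move=> pp op px e; have x0 : (x%:R : 'F_p) != 0 by rewrite pnat_eq0.
have t0 : (t%:R : 'F_p) != 0 by rewrite -leg_eq0 -/(legn p t) -e legn_eq0.
have : leg ((x%:R : 'F_p) * t%:R) = 1 by rewrite legM // -/(legn p x) -/(legn p t) -e leg_leg.
rewrite /leg mulf_eq0 (negPf x0) (negPf t0) /=; case: ifP => // /existsP [s /eqP hs] _.
pose c : 'F_p := s / x%:R.
have cE : c ^+ 2 * x%:R = t%:R by rewrite /c expr_div_n hs expr2; field.
have c0 : c != 0 by apply: contraNneq t0 => h; rewrite -cE h expr0n mul0r.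
exists (val c).
  by rewrite coprime_sym prime_coprime // -(pnat_eq0 pp) natr_Zp.
have /(congr1 (fun z : 'F_p => nat_of_ord z)) : ((val c ^ 2 * x)%N%:R : 'F_p) = t%:R by rewrite natrM natrX natr_Zp.
by rewrite !val_Fp_nat.
Qed.

Lemma sum_count_fibres (T : finType) (col : nat -> T) (s : seq nat) :
  (\sum_(c : T) count (fun x => col x == c) s)%N = size s.
Proof.
elim: s => [|x s IH]; first by rewrite big1.
rewrite /= big_split /= IH (bigD1 (col x)) //= eqxx big1 ?addn0 // => c.
by rewrite eq_sym => /negPf ->.
Qed.

Lemma pigeonhole (T : finType) (col : nat -> T) (R : nat) (s : seq nat) : (#|T| * R < size s)%N ->
  exists c, (R <= size [seq x <- s | col x == c])%N.
Proof.
move=> hs; apply: contrapT => ne; move: hs; rewrite ltnNge => /negP; apply.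
rewrite -(sum_count_fibres col) -sum_nat_const; apply: leq_sum => c _.
by rewrite -size_filter leqNgt; apply/negP => h; apply: ne; exists c; apply: ltnW.
Qed.

Lemma jacX p e k : prime p -> jac (p ^ e) k = legn p k ^+ e.
Proof.
move=> pp; elim: e => [|e IH]; first by rewrite expn0 jac1 expr0.
by rewrite expnS jac_muln ?expn_gt0 ?(prime_gt0 pp) // jac_prime // IH exprS.
Qed.

Lemma jac_one n : odd n -> jac n 1 = 1.
Proof.
move=> on; have n0 := odd_gt0 on; have := jac_vals 1 n0; rewrite coprime1n => -[] // h.
by have := jacM 1 1 on; rewrite muln1 h.
Qed.

Lemma prime5_odd p : prime p -> (5 <= p)%N -> odd p.
Proof. by move=> pp p5; case: (even_prime pp) => // h; rewrite h in p5. Qed.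

Lemma prime_ndvd_gt p n : (0 < n < p)%N -> ~~ (p %| n)%N.
Proof. by move=> /andP [n0 np]; apply/negP => /(dvdn_leq n0); rewrite leqNgt np. Qed.

Lemma sum_lt N n m : (N + n + 5 < m)%N -> [/\ (5 <= m)%N, (N < m)%N & (n < m)%N].
Proof. by move=> h; split; lia. Qed.

Lemma coprime_primes m n : (0 < m)%N -> (forall p, prime p -> (p %| m)%N -> (p %| n)%N -> False) -> coprime m n.
Proof.
move=> m0 h; case: (eqVneq (gcdn m n) 1%N) => [/eqP //|g1].
have g2 : (1 < gcdn m n)%N by rewrite ltn_neqAle eq_sym g1 gcdn_gt0 m0.
by case: (h _ (pdiv_prime g2)); apply: dvdn_trans (pdiv_dvd _) _; rewrite ?dvdn_gcdl ?dvdn_gcdr.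
Qed.

Lemma many_primes n : exists N, forall X, (N <= X)%N -> (n <= count prime (iota 0 X.+1))%N.
Proof.
elim: n => [|n [N hN]]; first by exists 0%N.
have [p Np pp] := prime_above N; exists p => X pX.
have -> : iota 0 X.+1 = iota 0 N.+1 ++ iota N.+1 (X - N) by rewrite -iotaD; congr (iota _ _); lia.
rewrite count_cat -addn1 leq_add ?hN // -has_count; apply/hasP; exists p => //.
by rewrite mem_iota; lia.
Qed.

Lemma nat_sqrt X : exists q, (q ^ 2 <= X < q.+1 ^ 2)%N.
Proof.
elim: X => [|X [q /andP [h1 h2]]]; first by exists 0%N.
case: (ltnP X.+1 (q.+1 ^ 2)%N) => h; first by exists q; rewrite h andbT (leq_trans h1).
by exists q.+1; rewrite h; apply: leq_ltn_trans h2 _; rewrite ltn_exp2r.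
Qed.

(** The pair (c, k) determines n, and k^2 = n c with n <= X and c <= B leaves fewer than (B + 1)(q +
    1) values of k. *)
Lemma square_class_count (P : pred nat) B X q :
  (forall n, P n -> exists c k, (0 < c <= B)%N /\ (n * c)%N = (k ^ 2)%N) -> (X < q.+1 ^ 2)%N ->
  (count P (iota 1 X) <= B * (B.+1 * q.+1))%N.
Proof.
move=> hP hq; have [Z ZE] : exists Z, (B.+1 * q.+1)%N = Z by exists (B.+1 * q.+1)%N.
pose s := [seq (k ^ 2 %/ c)%N | c <- iota 1 B, k <- iota 0 Z].
rewrite ZE; have -> : (B * Z = size s)%N by rewrite size_allpairs !size_iota.
rewrite -size_filter; apply: uniq_leq_size; first by rewrite filter_uniq ?iota_uniq.
move=> n; rewrite mem_filter mem_iota => /andP [/hP [c [k [/andP [c0 cB] e]]] /andP [n0 nX]].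
apply/allpairsP; exists (c, k); split=> /=; [by rewrite mem_iota c0 add1n ltnS | | by rewrite -e mulnK].
rewrite mem_iota add0n /= -(@ltn_exp2r k _ 2) // -e -ZE (expnMn B.+1 q.+1 2).
apply: (@leq_ltn_trans (X * B.+1 ^ 2)%N).
  by apply: leq_mul => //; apply: leq_trans cB _; rewrite ltnW // expnS expn1 leq_pmulr.
by rewrite mulnC ltn_pmul2l ?expn_gt0.
Qed.

Section Deduction.
Variables (RR : realType) (l : nat) (delta : int).
Hypotheses (l_pr : prime l) (l_ge5 : (5 <= l)%N).
Local Notation F := 'F_l.
Variables (a : nat -> F) (Y : finType) (tau : nat -> Y) (S : nat -> Prop).
Hypothesis a24 : forall n, a n != 0 -> (24 %| n.+1)%N.
Hypothesis aleg : forall n, a n != 0 -> leg (- (n%:R) : F) = delta.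
Hypothesis hecke : forall m n1 n2, prime m -> (5 <= m)%N -> m != l -> ~~ (m %| n1)%N -> ~~ (m %| n2)%N -> tau n1 = tau n2 ->
    a n1 != 0 -> a (m ^ 2 * n1)%N = a (m ^ 2 * n2)%N -> legn m n1 = legn m n2.
Hypothesis SP : forall Q, S Q -> [/\ prime Q, (5 <= Q)%N, Q <> l &
  exists2 t : nat, leg (- (t%:R) : F) = delta & forall n : nat, n = t %[mod l * Q] -> a n = 0].

Let lo : odd l. Proof. exact: prime5_odd. Qed.

Lemma class_l x t : leg (- (x%:R) : F) = delta -> leg (- (t%:R) : F) = delta ->
  exists2 c, coprime c l & (c ^ 2 * x)%N = t %[mod l].
Proof.
have m1 : leg (-1 : F) != 0 by rewrite leg_eq0 oppr_eq0 oner_eq0.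
have lN (y : nat) : leg (- (y%:R) : F) = leg (-1 : F) * legn l y by rewrite /legn -legM // mulN1r.
move=> hx ht; case: (boolP (l %| x)%N) => lx.
  have d0 : delta = 0 by rewrite -hx lN; move: lx; rewrite -(legn_eq0 x l_pr) => /eqP ->; rewrite mulr0.
  have lt : (l %| t)%N.
    by rewrite -(legn_eq0 t l_pr); move/eqP: ht; rewrite lN d0 mulf_eq0 (negPf m1).
  by exists 1%N; rewrite ?coprime1n // exp1n mul1n (eqP lx) (eqP lt).
by apply: sqrt_class => //; apply: (mulfI m1); rewrite -!lN hx ht.
Qed.

Lemma supp_gt0 n : a n != 0 -> (0 < n)%N.
Proof. by move=> /a24; case: n. Qed.

(** Bounded c means that n lies in one of finitely many square classes. *)
Definition sparse := exists B, forall n, a n != 0 -> exists c k, (0 < c <= B)%N /\ (n * c)%N = (k ^ 2)%N.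

(** Multiplying by l is included so that the cofactor of the l-part of x y is never a square. *)
Definition indep x y := forall k, (x * y)%N <> (k ^ 2)%N /\ (l * (x * y))%N <> (k ^ 2)%N.

Lemma greedy m : ~ sparse -> exists s : seq nat, [/\ size s = m, uniq s,
  forall x, x \in s -> a x != 0 & forall x y, x \in s -> y \in s -> x != y -> indep x y].
Proof.
move=> ns; elim: m => [|m [s [ss us sa si]]]; first by exists [::].
(* B is at least l x for every x in s, so an n that avoids the square classes of all c <= B is
   independent of every member of s. *)
pose B := (l * sumn s)%N.
have [n [an hn]] : exists n, a n != 0 /\ forall c k, (0 < c <= B)%N -> (n * c)%N <> (k ^ 2)%N.
  apply: contrapT => ne; apply: ns; exists B => n an; apply: contrapT => ne2; apply: ne.
  by exists n; split=> // c k hc e; apply: ne2; exists c, k.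
have le x : x \in s -> (0 < x)%N /\ (x <= sumn s)%N.
  move=> xs; split; first exact: supp_gt0 (sa _ xs).
  by rewrite sumnE (big_rem x) //= leq_addr.
have ind x : x \in s -> indep n x.
  move=> /le [x0 xs] k; split.
    by apply: hn; rewrite x0 /B /=; apply: leq_trans xs _; rewrite leq_pmull ?(prime_gt0 l_pr).
  by rewrite mulnCA; apply: hn; rewrite muln_gt0 (prime_gt0 l_pr) x0 /B leq_pmul2l ?(prime_gt0 l_pr).
have nis : n \notin s by apply/negP => /ind /(_ n) [h _]; apply: h; rewrite expnS expn1.
exists (n :: s); split; rewrite /= ?ss ?nis //.
  by move=> x; rewrite inE => /orP [/eqP ->|/sa].
move=> x y; rewrite !inE => /orP [/eqP ->|xs] /orP [/eqP ->|ys]; rewrite ?eqxx // => xy.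
- exact: ind.
- by move=> k; rewrite (mulnC x); apply: ind.
- exact: si.
Qed.

Lemma selection R : ~ sparse -> exists nn : 'I_R -> nat, [/\ forall i, a (nn i) != 0,
  forall i j, tau (nn i) = tau (nn j), forall i j, nn i = nn j %[mod l] & forall i j, i != j -> indep (nn i) (nn j)].
Proof.
have l0 := prime_gt0 l_pr.
move=> ns; pose T := (Y * 'I_l)%type; pose col n : T := (tau n, Ordinal (ltn_pmod n l0)).
have [s [ss us sa si]] := greedy (#|{: T}| * R).+1 ns.
have [c hc] : exists c, (R <= size [seq x <- s | col x == c])%N by apply: pigeonhole; rewrite ss.
set s' := [seq x <- s | col x == c] in hc.
have ms (i : 'I_R) : nth 0%N s' i \in s' by apply: mem_nth; apply: leq_trans hc.
have us' : uniq s' by rewrite filter_uniq.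
exists (fun i : 'I_R => nth 0%N s' i); split.
- by move=> i; apply: sa; have := ms i; rewrite mem_filter => /andP [].
- move=> i j; have := ms i; have := ms j; rewrite !mem_filter => /andP [/eqP + _] /andP [/eqP + _].
  by move=> <- /(congr1 fst).
- move=> i j; have := ms i; have := ms j; rewrite !mem_filter => /andP [/eqP + _] /andP [/eqP + _].
  by move=> <- /(congr1 (fun z => nat_of_ord (snd z))).
- move=> i j ij; have := ms i; have := ms j; rewrite !mem_filter => /andP [_ js] /andP [_ is_].
  by apply: si => //; rewrite nth_uniq // (leq_trans _ hc).
Qed.

Section Family.
Variables (R : nat) (nn : 'I_R -> nat).
Hypothesis nna : forall i, a (nn i) != 0.
Hypothesis nntau : forall i j, tau (nn i) = tau (nn j).
Hypothesis nnl : forall i j, nn i = nn j %[mod l].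
Hypothesis nni : forall i j, i != j -> indep (nn i) (nn j).

Let D := (\sum_i nn i + l)%N.

Lemma nn_le i : (nn i <= D)%N.
Proof. by rewrite /D (bigD1 i) //= -addnA leq_addr. Qed.
Lemma nn_gt0 i : (0 < nn i)%N. Proof. exact: supp_gt0. Qed.
Lemma nn_mod4 i : (nn i %% 4 = 3)%N.
Proof. by have := a24 (nna i); move: (nn i) => n; lia. Qed.
Lemma nn_odd i : odd (nn i).
Proof. by have := nn_mod4 i; move: (nn i) => n; lia. Qed.
Lemma nn_ndvd p i : (D < p)%N -> ~~ (p %| nn i)%N.
Proof. by move=> Dp; apply: prime_ndvd_gt; rewrite nn_gt0 (leq_ltn_trans (nn_le i)). Qed.

(* The [l]-part of [nn i * nn j] contributes a factor fixed by [c]; the cofactor is not a square, so its Jacobi symbol takes both signs. *)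
Lemma separating_prime i j A c N : i != j -> (0 < A)%N -> (l %| A)%N ->
  (forall p, prime p -> (p %| A)%N -> p = l \/ (D < p)%N) -> coprime c A ->
  exists m, [/\ prime m, (N < m)%N, m = c %[mod A] & legn m (nn i) <> legn m (nn j)].
Proof.
move=> ij A0 lA hA cA; have l0 := prime_gt0 l_pr.
pose n := (nn i * nn j)%N; have n0 : (0 < n)%N by rewrite muln_gt0 !nn_gt0.
have on : odd n by rewrite /n oddM !nn_odd.
(* Both factors are 3 modulo 4, so n is 1 modulo 4 and reciprocity with m has no sign. *)
have n4 : ~~ odd n./2.
  have : (n %% 4 = 1)%N by rewrite /n -modnMm !nn_mod4.
  by move: (n) => z; lia.
have [ns cns nE] := pfactor_coprime l_pr n0; set e := logn l n in nE.
have ons : odd ns by move: on; rewrite nE oddM => /andP [].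
have ns0 := odd_gt0 ons.
have nsq k : ns <> (k ^ 2)%N.
  move=> nsk; have [h1 h2] := nni ij (k * l ^ (uphalf e))%N; rewrite -/n in h1 h2.
  have ee := odd_double_half e; have ue := uphalf_half e.
  case oe : (odd e) in ee ue.
    by apply: h2; rewrite nE nsk ue expnMn -expnM mulnCA -expnS; congr (_ * l ^ _)%N; lia.
  by apply: h1; rewrite nE nsk ue expnMn -expnM; congr (_ * l ^ _)%N; lia.
have cA' : coprime A ns.
  apply: coprime_primes => // p pp pA pn; case: (hA _ pp pA) => [pl|Dp].
    by move: cns; rewrite -pl prime_coprime // pn.
  have : (p %| nn i * nn j)%N by rewrite -/n nE dvdn_mulr.
  by rewrite Euclid_dvdM // !(negPf (nn_ndvd _ Dp)).
have cl : ~~ (l %| c)%N.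
  rewrite -prime_coprime // coprime_sym; exact: coprime_dvdr lA cA.
have [v cv hv] : exists2 v, coprime v ns & legn l c ^+ e * jac ns v = -1.
  have : legn l c ^+ e = 1 \/ legn l c ^+ e = -1.
    case: (legn_sgn l_pr cl) => ->; first by left; rewrite expr1n.
    by rewrite -signr_odd; case: odd; [right|left].
  case=> ->; last by exists 1%N; rewrite ?coprime1n // jac_one.
  by have [u cu hu] := jac_neg ons nsq; exists u; rewrite ?mul1r.
have [d [cd dA dn]] := crt cA' cA cv.
have M1 : (1 < A * ns)%N.
  by rewrite (@leq_trans A) ?leq_pmulr //; apply: leq_trans (dvdn_leq A0 lA); apply: leq_trans l_ge5.
have [m [pm Nm mE]] := @dirichlet RR (A * ns) d (N + n + 5) M1 cd.
have mA : m = c %[mod A] by rewrite (mod_dvd (dvdn_mulr ns (dvdnn A)) mE).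
have mn : m = v %[mod ns] by rewrite (mod_dvd (dvdn_mull A (dvdnn ns)) mE).
have [m5 mN mgtn] := sum_lt Nm.
have om : odd m by apply: prime5_odd.
exists m; split=> //.
have : legn m n = -1.
  rewrite jac_reciprocity //; last by apply: prime_ndvd_gt; rewrite n0.
  rewrite -signr_odd oddM (negPf n4) andbF mul1r nE jac_muln ?expn_gt0 ?l0 // jacX //.
  by rewrite (jac_mod mn) (legn_mod l_pr (mod_dvd lA mA)) mulrC.
rewrite /n legnM // => h e'; move: h; rewrite e'; move=> h; have := sqr_ge0 (legn m (nn j)); by rewrite expr2 h.
Qed.

(** The bound |Y| + 1 covers both sources of regular primes: at most |Y| outliers when Q | t, at
    most one otherwise. *)
Definition regular Q := exists (G : {set 'I_R}) (s : int), [/\ (#|G| <= #|Y|.+1)%N, s = 1 \/ s = -1 &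
  forall i, i \notin G -> legn Q (nn i) = s].

(** Two indices are demanded so that [exceptional_unique] can choose one different from a given
    index. *)
Definition exceptional Q t := [/\ leg (- (t%:R) : F) = delta, forall n : nat, n = t %[mod l * Q] -> a n = 0, ~~ (Q %| t)%N &
  exists i j, [/\ i != j, legn Q (nn i) = legn Q t & legn Q (nn j) = legn Q t]].

(** The square factor u^2 leaves the symbols at m unchanged; u = Q serves classes t divisible by Q,
    and u = 1 serves exceptional primes. *)
Lemma vanishing_separates i j m u : prime m -> (D + u + 5 < m)%N -> tau (u ^ 2 * nn i) = tau (u ^ 2 * nn j) -> (0 < u)%N ->
  a (u ^ 2 * nn i)%N != 0 ->
  a (m ^ 2 * (u ^ 2 * nn i))%N = 0 -> a (m ^ 2 * (u ^ 2 * nn j))%N = 0 -> legn m (nn i) = legn m (nn j).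
Proof.
move=> pm Dm te u0 ai z1 z2.
have [m5 mD mu] := sum_lt Dm.
have om : odd m by apply: prime5_odd.
have nu : ~~ (m %| u)%N by apply: prime_ndvd_gt; rewrite u0.
have nu2 : ~~ (m %| u ^ 2)%N by rewrite Euclid_dvdX // (negPf nu).
have nd k : ~~ (m %| u ^ 2 * nn k)%N by rewrite Euclid_dvdM // (negPf nu2) /= nn_ndvd.
have : legn m (u ^ 2 * nn i) = legn m (u ^ 2 * nn j).
  apply: hecke => //; rewrite ?z1 ?z2 //.
  by apply/eqP => h; move: mD; rewrite h /D ltnNge leq_addl.
have z : legn m (u ^ 2) != 0 by rewrite legn_eq0.
rewrite (legnM (u ^ 2)%N (nn i) pm om) (legnM (u ^ 2)%N (nn j) pm om) => h; apply: (mulfI z); exact: h.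
Qed.

(** If Q | t, the [tau] of Q^2 n_i are distinct over the i with a(Q^2 n_i) <> 0: two equal ones
    would be separated by a prime m for which both m^2 Q^2 n_i and m^2 Q^2 n_j fall into the class
    t. So at most |Y| indices are lost, and for the others the relation at the prime Q itself
    equates the symbols. If Q does not divide t, the question is how many n_i have the symbol of
    t. *)
Lemma regular_or_exceptional Q : S Q -> (D < Q)%N -> regular Q \/ exists t, exceptional Q t.
Proof.
move=> /SP [pQ Q5 Ql [t lt zt]] DQ.
have Q0 := prime_gt0 pQ; have oQ := prime5_odd pQ Q5.
have Qll : Q != l by apply/eqP.
have clQ : coprime l Q by rewrite prime_coprime // dvdn_prime2 // eq_sym.
case: (boolP (Q %| t)%N) => Qt.
  left; pose G := [set i | a (Q ^ 2 * nn i)%N != 0].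
  have inj : {in G &, injective (fun i => tau (Q ^ 2 * nn i))}.
    move=> i j; rewrite !inE => ai aj te; apply/eqP; apply: contraT => ij.
    have [c cl cE] := class_l (aleg ai) lt.
    have hp p : prime p -> (p %| l)%N -> p = l \/ (D < p)%N.
      by move=> pp; rewrite dvdn_prime2 // => /eqP; left.
    have [m [pm Dm mc ne]] := @separating_prime i j l c (D + Q + 5) ij (prime_gt0 l_pr) (dvdnn l) hp cl.
    have van k : a (m ^ 2 * (Q ^ 2 * nn k))%N = 0.
      apply: zt; apply: crt_eq => //.
        rewrite -cE -modnMm -modnXm mc modnXm modnMm.
        by do 2 apply: congr_mull; apply: nnl.
      have d : (Q %| m ^ 2 * (Q ^ 2 * nn k))%N by rewrite dvdn_mull // dvdn_mulr // dvdn_exp.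
      by rewrite (eqP d) (eqP Qt).
    by case: ne; apply: (@vanishing_separates i j m Q).
  have cG : (#|G| <= #|Y|)%N by apply: leq_card_in inj.
  have eqG i j : i \notin G -> j \notin G -> legn Q (nn i) = legn Q (nn j).
    rewrite !inE !negbK => /eqP zi /eqP zj; apply: hecke; rewrite ?nn_ndvd ?zi ?zj //.
  exists G; case: (pickP [pred i | i \notin G]) => [i /= iG|h].
    exists (legn Q (nn i)); split; [exact: leqW | by apply: legn_sgn; rewrite // nn_ndvd | by move=> j jG; apply: eqG].
  by exists 1; split; [exact: leqW | left | move=> i iG; have := h i; rewrite /= iG].
pose G := [set i | legn Q (nn i) == legn Q t].
case: (leqP #|G| 1) => G1; last first.
  right; exists t; split=> //; have /card_gt1P [i [j [iG jG ij]]] := G1.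
  by exists i, j; move: iG jG; rewrite !inE => /eqP ? /eqP ?; split.
left; exists G, (- legn Q t); split; first exact: leq_trans G1 _.
  by case: (legn_sgn pQ Qt) => ->; [right|left].
move=> i; rewrite inE.
by case: (legn_sgn pQ Qt) => ->; case: (legn_sgn pQ (nn_ndvd i DQ)) => ->.
Qed.

(* A prime [m] with [m^2 n_i = t] modulo [l Q] and [m^2 n_j = t'] modulo [l Q'] at once makes both coefficients vanish. *)
Lemma exceptional_unique Q Q' t t' : S Q -> S Q' -> (D < Q)%N -> (D < Q')%N ->
  exceptional Q t -> exceptional Q' t' -> t = t' %[mod l] -> Q = Q'.
Proof.
move=> /SP [pQ Q5 Ql _] /SP [pQ' Q5' Ql' _] DQ DQ' [lt zt Qt [i [_ [_ hi _]]]] [lt' zt' Qt' [j1 [j2 [j12 hj1 hj2]]]] tt.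
apply/eqP; apply: contraT => QQ.
have [j [ij hj]] : exists j, i != j /\ legn Q' (nn j) = legn Q' t'.
  by case: (eqVneq i j1) => [e|]; [exists j2; rewrite e | exists j1].
have cp p q : prime p -> prime q -> p != q -> coprime p q by move=> pp pq pne; rewrite prime_coprime // dvdn_prime2.
have clQ : coprime l Q by apply: cp => //; rewrite eq_sym; apply/eqP.
have clQ' : coprime l Q' by apply: cp => //; rewrite eq_sym; apply/eqP.
have cQQ : coprime Q Q' by apply: cp.
have [c1 h1 e1] := class_l (aleg (nna i)) lt.
have [c2 h2 e2] := sqrt_class pQ (prime5_odd pQ Q5) (nn_ndvd i DQ) hi.
have [c3 h3 e3] := sqrt_class pQ' (prime5_odd pQ' Q5') (nn_ndvd j DQ') hj.
have [c4 [h4 e41 e42]] := crt clQ h1 h2.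
have cc : coprime (l * Q) Q' by rewrite coprimeMl clQ' cQQ.
have [c [hc ec4 ec3]] := crt cc h4 h3.
have lA : (l %| l * Q * Q')%N by rewrite -mulnA dvdn_mulr.
have QA : (Q %| l * Q * Q')%N by rewrite mulnAC dvdn_mull.
have QA' : (Q' %| l * Q * Q')%N by rewrite dvdn_mull.
have A0 : (0 < l * Q * Q')%N by rewrite !muln_gt0 !prime_gt0.
have hA p : prime p -> (p %| l * Q * Q')%N -> p = l \/ (D < p)%N.
  move=> pp; rewrite !Euclid_dvdM // !dvdn_prime2 // => /orP [/orP [/eqP ->|/eqP ->]|/eqP ->]; first by left.
    by right.
  by right.
have [m [pm Dm mc ne]] := @separating_prime i j _ c (D + 1 + 5) ij A0 lA hA hc.
have sq p x y z : m = y %[mod p] -> (y ^ 2 * x)%N = z %[mod p] -> (m ^ 2 * x)%N = z %[mod p].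
  by move=> hm <-; rewrite -modnMm -modnXm hm modnXm modnMm.
have ml : m = c1 %[mod l] by rewrite (mod_dvd lA mc) (mod_dvd (dvdn_mulr Q (dvdnn l)) ec4) e41.
have mQ : m = c2 %[mod Q] by rewrite (mod_dvd QA mc) (mod_dvd (dvdn_mull l (dvdnn Q)) ec4) e42.
have mQ' : m = c3 %[mod Q'] by rewrite (mod_dvd QA' mc) ec3.
case: ne; apply: (@vanishing_separates i j m 1); rewrite ?exp1n ?mul1n //.
  by apply: zt; apply: crt_eq => //; [apply: sq e1 | apply: sq e2].
apply: zt'; apply: crt_eq => //; last by apply: sq e3.
(* n_i and n_j agree modulo l, and so do t and t'; the same c1 serves both classes. *)
by rewrite -modnMmr (nnl j i) modnMmr -tt; apply: sq e1.
Qed.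

(** All n_i are 3 modulo 4, so reciprocity introduces the same sign for every i, depending on Q
    only. Each index of G lowers the sum by at most 2. *)
Lemma regular_large Q : prime Q -> odd Q -> (D < Q)%N -> regular Q ->
  ((R - 2 * #|Y|.+1) ^ 2)%N%:R <= (\sum_i (jac (nn i) Q)%:~R) ^+ 2 :> RR.
Proof.
move=> pQ oQ DQ [G [s [cG sP hG]]].
have [e [eP he]] : exists e : int, (e = 1 \/ e = -1) /\ forall i, i \notin G -> jac (nn i) Q = e.
  exists ((-1) ^+ odd Q./2 * s); split.
    by case: sP => ->; case: odd; rewrite ?expr0 ?expr1; [right|left|left|right].
  move=> i /hG; rewrite jac_reciprocity ?nn_odd ?nn_ndvd // => <-.
  have o : odd (nn i)./2 by have := nn_mod4 i; move: (nn i) => n; lia.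
  by rewrite -[X in _ * (X * _)]signr_odd oddM o andbT mulrA -expr2 sqrr_sign mul1r.
have big : (R%:Z - (2 * #|G|)%N%:Z) <= e * \sum_i jac (nn i) Q.
  have -> : R%:Z - (2 * #|G|)%N%:Z = \sum_(i < R) (1 - 2 * (i \in G)%:Z).
    rewrite big_split /= sumr_const card_ord sumrN -mulr_sumr; congr (_ - _); first by lia.
    rewrite PoszM; congr (_ * _); rewrite -sum1_card big_mkcond /= -[LHS]/(Posz _).
    by rewrite (big_morph Posz PoszD (erefl _)); apply: eq_bigr => i _; case: (i \in G).
  rewrite mulr_sumr; apply: ler_sum => i _.
  case: (boolP (i \in G)) => [_|iG]; last by rewrite he //; case: eP => ->.
  have := jac_abs Q (nn_gt0 i); move: (jac _ _) => z; case: eP => ->; lia.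
rewrite -(rmorph_sum intr) /= -rmorphXn /= (pmulrn 1 _) ler_int.
have -> : (\sum_i jac (nn i) Q) ^+ 2 = (e * \sum_i jac (nn i) Q) ^+ 2.
  by rewrite exprMn; case: eP => ->; rewrite ?sqrrN expr1n mul1r.
move: big cG; move: (e * _) #|G| (#|Y|.+1) => z g y big cG.
case: (leqP R (2 * y)) => h; first by rewrite (eqP h) exp0n // sqr_ge0.
have zz : (R - 2 * y)%N%:Z <= z by lia.
rewrite -[X in X <= _]/((R - 2 * y) ^ 2)%N%:Z (_ : ((R - 2 * y) ^ 2)%N%:Z = (R - 2 * y)%N%:Z ^+ 2) ?PoszM //.
  by rewrite ler_sqr ?nnegrE //; lia.
Qed.

(** By [exceptional_unique] the residue of t modulo l determines the irregular prime. *)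
Lemma irregular_count X : (count (fun Q => `[< S Q /\ (D < Q)%N /\ ~ regular Q >]) (iota 0 X) <= l)%N.
Proof.
set P := (fun Q => _).
have [t ht] : {t : nat -> nat & forall Q, P Q -> exceptional Q (t Q)}.
  apply: (@choice _ _ (fun Q t => P Q -> exceptional Q t)) => Q.
  case: (boolP (P Q)) => [/asboolP [SQ [DQ nr]]|_]; last by exists 0%N.
  by case: (regular_or_exceptional SQ DQ) => // -[t ht]; exists t.
have l0 := prime_gt0 l_pr.
rewrite -size_filter -(size_map (fun Q => t Q %% l)%N) -[X in (_ <= X)%N](size_iota 0 l).
apply: uniq_leq_size.
  rewrite map_inj_in_uniq ?filter_uniq ?iota_uniq // => Q Q'.
  rewrite !mem_filter => /andP [PQ _] /andP [PQ' _] e.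
  have /asboolP [SQ [DQ _]] := PQ; have /asboolP [SQ' [DQ' _]] := PQ'.
  exact: (exceptional_unique SQ SQ' DQ DQ' (ht _ PQ) (ht _ PQ') e).
by move=> z /mapP [Q _ ->]; rewrite mem_iota add0n ltn_pmod.
Qed.

Lemma ppiE X : ppi RR X = (count prime (iota 0 X.+1))%:R.
Proof.
rewrite /ppi /= add0n -sum1_count natr_sum /index_iota subSS subn0; exact: eq_bigr.
Qed.

(** The subtracted D + 1 accounts for Q <= D and l for the irregular primes; every other Q in S
    contributes at least (R - 2 (|Y| + 1))^2 to the second moment. *)
Lemma S_count : (0 < R)%N -> exists N, forall X, (N <= X)%N ->
  ((R - 2 * #|Y|.+1) ^ 2 * (count (fun Q => `[< S Q >]) (iota 0 X.+1) - (D.+1 + l)) <= 200 * R * count prime (iota 0 X.+1))%N.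
Proof.
move=> R0; have [||i j ij k|N hN] := @second_moment RR 'I_R nn.
- by rewrite card_ord.
- exact: nn_odd.
- by have [] := nni ij k.
exists N => X NX; have := hN X NX; rewrite card_ord ppiE.
pose P Q := `[< S Q /\ (D < Q)%N /\ regular Q >].
have cnt : (count (fun Q => `[< S Q >]) (iota 0 X.+1) - (D.+1 + l) <= count P (iota 1 X))%N.
  rewrite leq_subLR; have -> : count P (iota 1 X) = count P (iota 0 X.+1).
    by rewrite /= (_ : P 0%N = false) //; apply/asboolP => -[_ []].
  have h1 := irregular_count X.+1.
  have h2 : (count (fun Q => Q <= D)%N (iota 0 X.+1) <= D.+1)%N.
    rewrite -size_filter -[X in (_ <= X)%N](size_iota 0 D.+1); apply: uniq_leq_size.
      by rewrite filter_uniq ?iota_uniq.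
    by move=> z; rewrite mem_filter mem_iota => /andP [zD _]; rewrite mem_iota add0n.
  apply: (@leq_trans (count (fun Q => Q <= D)%N (iota 0 X.+1) + count (fun Q => `[< S Q /\ (D < Q)%N /\ ~ regular Q >]) (iota 0 X.+1) + count P (iota 0 X.+1))%N); last first.
    by rewrite leq_add2r; apply: leq_add.
  elim: (iota 0 X.+1) => //= Q s IH.
  suff : (`[< S Q >] <= (Q <= D)%N + `[< S Q /\ (D < Q)%N /\ ~ regular Q >] + P Q)%N by move: IH; lia.
  case: (asboolP (S Q)) => // SQ; case: (leqP Q D) => //= DQ; rewrite /P.
  case: (pselect (regular Q)) => r; first by rewrite (asboolT (conj SQ (conj DQ r))) addn1.
  have -> : `[< S Q /\ true /\ ~ regular Q >] by apply/asboolP.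
  by rewrite add0n add1n.
move=> hle; apply: leq_trans (_ : ((R - 2 * #|Y|.+1) ^ 2 * count P (iota 1 X) <= _)%N); first by rewrite leq_mul2l cnt orbT.
have e : (200 * R * count prime (iota 0 X.+1))%N%:R = 200 * R%:R * (count prime (iota 0 X.+1))%:R :> RR by rewrite !natrM.
rewrite -(ler_nat RR) e; apply: le_trans hle.
rewrite -sum1_count big_distrr /= natr_sum /index_iota subSS subn0.
rewrite big_mkcond [leRHS]big_mkcond /=; apply: ler_sum => Q _.
rewrite muln1 /P; case: (asboolP (S Q /\ (D < Q)%N /\ regular Q)) => [[SQ [DQ r]]|_].
  by have [pQ Q5 _ _] := SP SQ; rewrite pQ; apply: regular_large => //; apply: prime5_odd.
by case: ifP => // _; apply: sqr_ge0.
Qed.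
End Family.

Lemma sparse_or_density0 : sparse \/ forall k, exists N, forall X, (N <= X)%N ->
  (k * count (fun Q => `[< S Q >]) (iota 0 X.+1) <= count prime (iota 0 X.+1))%N.
Proof.
case: (pselect sparse) => ns; [by left | right=> k].
(* R is W + y so that R - y = W, and W is large enough for W^2 >= 400 (k + 1) R. Then 2 (k + 1)(#S -
   E) <= pi(X), and for large X also 2 (k + 1) E <= pi(X). *)
pose y := (2 * #|Y|.+1)%N; pose W := (400 * k.+1 * y.+1)%N; pose R := (W + y)%N.
have [nn [h1 h2 h3 h4]] := selection R ns.
have R0 : (0 < R)%N by rewrite /R /W; lia.
have [N1 hN1] := S_count h1 h2 h3 h4 R0.
set E := (_.+1 + l)%N in hN1.
have [N2 hN2] := many_primes (2 * k.+1 * E).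
exists (N1 + N2)%N => X NX.
have := hN1 X (leq_trans (leq_addr _ _) NX); have := hN2 X (leq_trans (leq_addl _ _) NX).
rewrite (_ : R - 2 * #|Y|.+1 = W)%N; last by rewrite /R addnK.
have WR : (400 * k.+1 * R <= W ^ 2)%N.
  have -> : (W ^ 2 = 400 * k.+1 * (y.+1 * W))%N by rewrite expnS expn1 {1}/W mulnA.
  rewrite leq_mul2l; apply/orP; right; rewrite /R mulSn leq_add2l.
  by rewrite leq_pmulr // /W !muln_gt0.
move: (count _ _) (count _ _) => cS cP hE hW.
have : (400 * k.+1 * R * (cS - E) <= 200 * R * cP)%N by apply: leq_trans hW; rewrite leq_mul2r WR orbT.
have -> : (400 * k.+1 * R * (cS - E) = 200 * R * (2 * k.+1 * (cS - E)))%N by lia.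
rewrite leq_pmul2l ?muln_gt0 ?R0 // => h.
have : (2 * k.+1 * cS <= 2 * k.+1 * (cS - E) + 2 * k.+1 * E)%N by rewrite -mulnDr leq_mul2l; apply/orP; right; lia.
move=> h'; have : (2 * k.+1 * cS <= 2 * cP)%N by lia.
rewrite -mulnA leq_pmul2l // mulSn; lia.
Qed.
End Deduction.
End Dichotomy.

(** * Translation into the real-valued statement *)

Import structures.
Import all_boot all_order all_algebra all_fingroup all_solvable all_field.
Import boolp reals Rstruct.
Import zify.
Import Defs.
Import LegendreSymbol QuadraticReciprocity JacobiSymbol PartitionCoefficients Dichotomy.
Import Reals Lra.
Import Order.TTheory GRing.Theory Num.Theory.

Lemma decPE (P : Prop) : decP P = `[< P >].
Proof.
rewrite /decP; case: (ClassicalEpsilon.excluded_middle_informative P) => h; first by rewrite asboolT.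
by rewrite asboolF.
Qed.

Lemma INR_leq m n : (m <= n)%N -> (INR m <= INR n)%R.
Proof. by move=> h; apply: le_INR; apply/ssrnat.leP. Qed.

Lemma count_sqrt_log (f : nat -> nat) B : (forall X q, (X < expn q.+1 2)%N -> (f X <= B * q.+1)%N) ->
  exists C : R, (0 < C)%R /\ forall X : nat, (2 <= X)%N -> (INR (f X) <= C * sqrt (INR X) * ln (INR X))%R.
Proof.
(* From q + 1 <= 2q, q <= sqrt X and ln X >= 1/2 one gets 4 B; adding 1 keeps the constant positive
   when B = 0. *)
move=> hf; exists (4 * INR B + 1)%R; have B0 := pos_INR B; split; first by Lra.lra.
move=> X X2; have [q /andP [q1 q2]] := nat_sqrt X.
have q0 : (0 < q)%N by case: q q2 q1 => //; rewrite exp1n => h; have := leq_trans X2 (ltnW h).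
have X2R : (2 <= INR X)%R by have := INR_leq X2; rewrite /= => h; Lra.lra.
have sq : (INR q <= sqrt (INR X))%R.
  rewrite -(sqrt_square (INR q)); last exact: pos_INR.
  apply: sqrt_le_1_alt; rewrite -mult_INR; apply: INR_leq; by rewrite multE mulnn.
have lnX : (/ 2 <= ln (INR X))%R.
  case: (Rle_lt_or_eq_dec _ _ X2R) => [h|<-]; last by have := ln_lt_2; Lra.lra.
  by have := ln_increasing 2 _ (Rlt_0_2) h; have := ln_lt_2; Lra.lra.
have h1 : (INR (f X) <= INR B * (2 * INR q))%R.
  have -> : (2 * INR q)%R = INR (2 * q) by rewrite -multE mult_INR.
  rewrite -mult_INR multE; apply: INR_leq; apply: leq_trans (hf X q q2) _.
  by rewrite leq_mul2l; apply/orP; right; lia.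
have q0R := pos_INR q.
apply: (Rle_trans _ _ _ h1).
apply: (Rle_trans _ (INR B * (2 * sqrt (INR X)))); first by apply: Rmult_le_compat_l => //; Lra.lra.
have s0 := sqrt_pos (INR X).
apply: (Rle_trans _ ((4 * INR B + 1) * sqrt (INR X) * / 2)); first by Lra.nra.
by apply: Rmult_le_compat_l => //; Lra.nra.
Qed.

Lemma ratio_cv0 (f g : nat -> nat) : (forall X, (f X <= g X)%N) ->
  (forall k, exists N, forall X, (N <= X)%N -> (k * f X <= g X)%N) ->
  Un_cv (fun X : nat => (INR (f X) / INR (g X))%R) 0%R.
Proof.
move=> fg h eps e0; have [k hk] := INR_archimed _ 1 e0.
have [N hN] := h k; exists N => X /ssrnat.leP NX.
have f0 := pos_INR (f X); have g0 := pos_INR (g X).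
have hX : (INR k * INR (f X) <= INR (g X))%R by rewrite -mult_INR multE; apply: INR_leq; apply: hN.
rewrite /R_dist Rminus_0_r.
(* When f X = 0 the quotient is 0 even if g X = 0; otherwise g X >= f X makes the denominator
   positive. *)
case: (Req_dec (INR (f X)) 0) => [->|fn]; first by rewrite /Rdiv Rmult_0_l Rabs_R0.
have g1 : (0 < INR (g X))%R by have := INR_leq (fg X); Lra.lra.
rewrite Rabs_pos_eq; last by apply: Rmult_le_pos => //; apply: Rlt_le; apply: Rinv_0_lt_compat.
apply: (Rmult_lt_reg_r (INR (g X))) => //.
rewrite /Rdiv Rmult_assoc Rinv_l; last by Lra.lra.
by Lra.nra.
Qed.

Theorem theorem1p1 (l : nat) (delta : int) :
  prime l -> (5 <= l)%N -> (delta = 0 \/ delta = -1)%ring ->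
  Un_cv (fun X : nat => (INR (count_S l delta X) / INR (prime_pi X))%R) 0%R
  \/
  (exists C : R, (0 < C)%R /\
     forall X : nat, (2 <= X)%N ->
       (INR (count_np l delta X) <= C * sqrt (INR X) * ln (INR X))%R).
Proof.
move=> l_pr l_ge5 dP.
have [a [aE [Y [tau hecke]]]] := coef_exists l_pr l_ge5 dP.
have a24 n : (a n != 0)%ring -> (24 %| n.+1)%N.
  by rewrite aE => /andP [_]; rewrite /p_div24; case: ifP => // _; rewrite dvdn0.
have aleg n : (a n != 0)%ring -> (leg (- (n%:R) : 'F_l) = delta)%ring.
  rewrite aE => /andP [/eqP <- _]; rewrite legendreE //.
  by rewrite rmorphN /= -pmulrn.
have [[B hB]|h] := sparse_or_density0 (R : realType) l_pr l_ge5 a24 aleg hecke (in_S_vanish l_pr l_ge5 dP aE).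
  right; apply: (@count_sqrt_log _ (B * B.+1)%N) => X q hq; rewrite -mulnA.
  by apply: square_class_count => // n hn; apply: hB; rewrite aE.
left; apply: ratio_cv0 => [X|k].
  by apply: sub_count => Q; rewrite decPE => /asboolP [].
have [N hN] := h k; exists N => X /hN; rewrite /count_S /prime_pi.
by rewrite (eq_count (fun Q => decPE _)).
Qed.
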